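(* Let $f\not\equiv0$ be an entire function of exponential type of class A. Then for every $\varepsilon>0$ there exists an entire function $g\not\equiv0$ of exponential type having only real zeros such that the product $fg$ is an entire function of exponential type whose indicator diagram lies inside a vertical strip of width at most $\varepsilon$.
   Context: An entire function $f\not\equiv0$ of exponential type ($|f(z)|\le Ce^{C|z|}$) with zeros ${\tt z}_1,{\tt z}_2,\dots$ (repeated according to multiplicity) is of class A if $\sum_{{\tt z}_k\ne0}\bigl|\operatorname{Im}\frac1{{\tt z}_k}\bigr|<+\infty$. The indicator of an entire function $F\not\equiv0$ of exponential type is $h_F(\theta)=\limsup_{r\to+\infty}\frac{\log|F(re^{i\theta})|}{r}$; its indicator diagram is the convex compact set in $\mathbb C$ with support function $h_F$, i.e. $h_F(\theta)=\max\{\operatorname{Re}(ze^{-i\theta}):z\text{ in the diagram}\}$. A vertical strip of width $w$ is a set $\{z:c\le\operatorname{Re}z\le c+w\}$ with $c\in\mathbb R$. *)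

(* Defs.v *)
From HB Require Import structures.
From mathcomp Require Import all_boot all_order all_algebra.
From mathcomp Require Import complex.
From mathcomp Require Import all_classical all_reals all_analysis.

Set Implicit Arguments.
Unset Strict Implicit.
Unset Printing Implicit Defensive.

Import Order.TTheory GRing.Theory Num.Theory.
Import numFieldNormedType.Exports.

Local Open Scope classical_set_scope.
Local Open Scope ring_scope.
Local Open Scope complex_scope.

Section entire_functions.
Variable R : realType.
Implicit Types (f g F h : R[i] -> R[i]) (z w : R[i]) (K : set R[i]).

(* The absolute value of [R[i]] is [R[i]]-valued; this is its real value. *)
Definition cabs z : R := complex.Re `|z|.

Definition cis (theta : R) : R[i] := cos theta +i* sin theta.

(* Differentiability is over the field [R[i]], i.e. complex. *)
Definition entire f : Prop := forall z, derivable (f : R[i]^o -> R[i]^o) z 1.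

Definition not_identically_zero f : Prop := exists z, f z != 0.

Definition exponential_type f : Prop :=
  exists C : R, forall z, cabs (f z) <= C * expR (C * cabs z).

Definition is_zero_order f z (n : nat) : Prop :=
  exists h, [/\ entire h, h z != 0 & forall w, f w = (w - z) ^+ n * h w].

(* For an entire [f] that is not identically zero, [is_zero_order f z] holds
   for exactly one [n]; the default value 0 is then irrelevant. *)
Definition zero_mult f z : nat := xget 0%N [set n | is_zero_order f z n].

(* Each zero contributes once with weight its multiplicity, which is the sum
   over an enumeration of the zeros repeated according to multiplicity. *)
Definition class_A f : Prop :=
  (\esum_(z in [set z | (f z = 0 /\ z != 0)%R])
     ((zero_mult f z)%:R * `|complex.Im z^-1|)%:E < +oo)%E.

Definition only_real_zeros f : Prop := forall z, f z = 0 -> complex.Im z = 0.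

(* [lne 0 = -oo], so the zeros of [F] on the ray do not contribute. *)
Definition indicator_fun F (theta : R) : \bar R :=
  limf_esup (fun r : R => lne (cabs (F (r%:C * cis theta)))%:E * (r^-1)%:E)%E
    (pinfty_nbhs R).

(* The scalars in [convex_set] are the [t : R[i]] with [0 <= t <= 1]; in the
   partial order of [R[i]] these are the real numbers of the unit interval. *)
Definition is_indicator_diagram F K : Prop :=
  [/\ convex_set (K : set (convex_lmodType R[i]^o)), compact (K : set R[i]^o) &
     forall theta : R,
      (exists2 z, K z & indicator_fun F theta =
                        (complex.Re (z * cis (- theta)))%:E) /\
      (forall z, K z ->
        ((complex.Re (z * cis (- theta)))%:E <= indicator_fun F theta)%E)].

Definition vertical_strip (c w : R) : set R[i] :=
  [set z | c <= complex.Re z <= c + w].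

End entire_functions.

(* Main.v *)
(* Let w run through the zeros of f, put a = 1/w and b = Re a, and let h be the canonical product
   of the real points -1/b. On the real axis the exponential factors of f h cancel and the pair of
   factors of w has modulus |1 - x a| |1 + x b|. As sum |Im a| converges, the zeros with
   |Im a| > d |b| contribute exp(o(x)); for the others the pair is at most |1 - z^2 b^2| at
   z = x (1 + i d). The sum of these logarithms is compensated by a product of the functions
   1 - (z / s)^2, s running through the half-integers with bounded multiplicities m(s). To find
   m, the unit mass at 1/|b| is smeared over many dyadic scales around it, which changes the
   logarithm at z by little, and m is a large constant minus the smeared density, rounded: the
   constant costs only O(d x), since prod (1 - (z / s)^2) = cos (pi z) is of size exp(pi d x).
   Hence F = f g satisfies |F(x)| <= A exp(c x + eps |x|) for all real x. By Phragmen-Lindelof the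
   growth rate of F along rays is trigonometrically convex, so it is the support function of the
   indicator diagram; its values at the angles 0 and pi give the vertical strip. *)
Require Import Defs.
From HB Require Import structures.
From mathcomp Require Import all_boot all_order all_algebra.
From mathcomp Require Import complex.
From mathcomp Require Import all_classical all_reals all_analysis.
From mathcomp Require Import ring lra zify.
Import Order.TTheory GRing.Theory Num.Theory.
Import numFieldNormedType.Exports.
Local Open Scope classical_set_scope.
Local Open Scope ring_scope.
Local Open Scope complex_scope.
Set Implicit Arguments.
Unset Strict Implicit.
Unset Printing Implicit Defensive.
Local Notation Re := complex.Re.
Local Notation Im := complex.Im.

(** * Complex moduli and derivatives *)

(** Multiplicities cannot be negative, so the excess growth of f h is not divided out but levelled:
    zeros are added where f h has few, until the total density is almost constant, and a constant
    density costs little near the real axis. This needs a density bounded at every point, whereas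
    the zeros of f are bounded only on average up to a given radius; smearing supplies the local
    bound. Smearing over one scale would change each logarithm by O(1), hence the sum over the O(x)
    relevant zeros by O(x). Averaging over [E] scales divides this by [E]. The rotation keeps z at
    distance at least d x >= 1 from every real point, so that no logarithm is singular. The
    parameters are fixed in the order: cutoff [B] for distant zeros, number [E] of scales, density
    [M0] of size 2^E, slope [d] small against 1 / M0. This is not circular because the smearing
    error [level_const / E] and the error of the distant zeros are independent of [d]; only errors
    of size sqrt x involve 1 / d. *)

Section modulus.
Variable R : realType.
Implicit Types z w : R[i].

Lemma normcE' z : `|z| = (cabs z)%:C.
Proof. by rewrite /cabs normc_def. Qed.

Lemma cabsE z : cabs z = Num.sqrt (Re z ^+ 2 + Im z ^+ 2).
Proof. by rewrite /cabs normc_def. Qed.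

Lemma cabs_ge0 z : 0 <= cabs z.
Proof. by rewrite cabsE sqrtr_ge0. Qed.

Lemma sqr_cabs z : cabs z ^+ 2 = Re z ^+ 2 + Im z ^+ 2.
Proof. by rewrite cabsE sqr_sqrtr// addr_ge0// sqr_ge0. Qed.

Lemma cabsM z w : cabs (z * w) = cabs z * cabs w.
Proof. by apply: complexI; rewrite rmorphM/= -!normcE' normrM. Qed.

Lemma cabsD z w : cabs (z + w) <= cabs z + cabs w.
Proof. by rewrite -lecR rmorphD/= -!normcE' ler_normD. Qed.

Lemma cabsN z : cabs (- z) = cabs z.
Proof. by apply: complexI; rewrite -!normcE' normrN. Qed.

Lemma cabsB z w : cabs (z - w) <= cabs z + cabs w.
Proof. by rewrite -(cabsN w) cabsD. Qed.

Lemma cabsBC z w : cabs (z - w) = cabs (w - z).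
Proof. by rewrite -cabsN opprB. Qed.

Lemma cabs0 : cabs (0 : R[i]) = 0.
Proof. by apply: complexI; rewrite -!normcE' normr0. Qed.

Lemma cabs1 : cabs (1 : R[i]) = 1.
Proof. by apply: complexI; rewrite -!normcE' normr1. Qed.

Lemma cabs_eq0 z : (cabs z == 0) = (z == 0).
Proof. by rewrite -(inj_eq (@complexI R)) -normcE' normr_eq0. Qed.

Lemma cabs_gt0 z : (0 < cabs z) = (z != 0).
Proof. by rewrite lt0r cabs_ge0 andbT cabs_eq0. Qed.

Lemma cabsV z : cabs z^-1 = (cabs z)^-1.
Proof. by apply: complexI; rewrite fmorphV/= -!normcE' normfV. Qed.

Lemma cabsX z n : cabs (z ^+ n) = cabs z ^+ n.
Proof. by apply: complexI; rewrite rmorphXn/= -!normcE' normrX. Qed.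

Lemma cabs_real (x : R) : cabs x%:C = `|x|.
Proof. by rewrite cabsE/= expr0n/= addr0 sqrtr_sqr. Qed.

Lemma cabs_i (x y : R) : cabs (x +i* y) = Num.sqrt (x ^+ 2 + y ^+ 2).
Proof. by rewrite cabsE. Qed.

Lemma Re_le_cabs z : `|Re z| <= cabs z.
Proof.
by rewrite -ler_sqr ?nnegrE ?cabs_ge0// sqr_cabs real_normK ?num_real// lerDl sqr_ge0.
Qed.

Lemma Im_le_cabs z : `|Im z| <= cabs z.
Proof.
by rewrite -ler_sqr ?nnegrE ?cabs_ge0// sqr_cabs real_normK ?num_real// lerDr sqr_ge0.
Qed.

Lemma ReD z w : Re (z + w) = Re z + Re w. Proof. by case: z; case: w. Qed.
Lemma ImD z w : Im (z + w) = Im z + Im w. Proof. by case: z; case: w. Qed.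
Lemma ReN z : Re (- z) = - Re z. Proof. by case: z. Qed.
Lemma ImN z : Im (- z) = - Im z. Proof. by case: z. Qed.
Lemma ReM z w : Re (z * w) = Re z * Re w - Im z * Im w.
Proof. by case: z; case: w. Qed.
Lemma ImM z w : Im (z * w) = Re z * Im w + Im z * Re w.
Proof. by case: z => a b; case: w => c d /=. Qed.
Lemma Re_realM (x : R) z : Re (x%:C * z) = x * Re z.
Proof. by rewrite ReM/= mul0r subr0. Qed.
Lemma Im_realM (x : R) z : Im (x%:C * z) = x * Im z.
Proof. by rewrite ImM/= mul0r addr0. Qed.
Lemma complex_ext z w : Re z = Re w -> Im z = Im w -> z = w.
Proof. by case: z; case: w => a b c d /= -> ->. Qed.
Lemma Re_sum (I : Type) (s : seq I) (P : pred I) (F : I -> R[i]) :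
  Re (\sum_(i <- s | P i) F i) = \sum_(i <- s | P i) Re (F i).
Proof. exact: (big_morph _ ReD). Qed.

Lemma cabs_le_sum z : cabs z <= `|Re z| + `|Im z|.
Proof.
rewrite -ler_sqr ?nnegrE ?cabs_ge0 ?addr_ge0// sqr_cabs.
rewrite -(real_normK (num_real (Re z))) -(real_normK (num_real (Im z))).
have := mulr_ge0 (normr_ge0 (Re z)) (normr_ge0 (Im z)); nra.
Qed.

Lemma cabs_sub_ge z w : cabs z - cabs w <= cabs (z - w).
Proof. by rewrite lerBlDr (le_trans _ (cabsD _ _))// subrK. Qed.

Lemma cabs_sum (I : Type) (s : seq I) (P : pred I) (F : I -> R[i]) :
  cabs (\sum_(i <- s | P i) F i) <= \sum_(i <- s | P i) cabs (F i).
Proof.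
elim/big_rec2: _ => [|i y x _ h]; first by rewrite cabs0.
by rewrite (le_trans (cabsD _ _))// lerD2l.
Qed.

Lemma cabs_prod (I : Type) (s : seq I) (P : pred I) (F : I -> R[i]) :
  cabs (\prod_(i <- s | P i) F i) = \prod_(i <- s | P i) cabs (F i).
Proof. by apply: (big_morph _ cabsM cabs1). Qed.

Lemma cabs_cis t : cabs (cis t : R[i]) = 1.
Proof. by rewrite cabs_i cos2Dsin2 sqrtr1. Qed.

Lemma cis0 : cis 0 = 1 :> R[i].
Proof. by rewrite /cis cos0 sin0. Qed.

Lemma cisD s t : cis (s + t) = cis s * cis t :> R[i].
Proof. by rewrite /cis sinD cosD; apply/eqP; rewrite eq_complex/= eqxx/= addrC. Qed.

Lemma cisN t : cis (- t) = (cis t)^-1 :> R[i].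
Proof.
apply: (mulfI (x := cis t)); first by rewrite -cabs_gt0 cabs_cis ltr01.
by rewrite -cisD subrr cis0 divff// -cabs_gt0 cabs_cis ltr01.
Qed.

Lemma cis_neq0 t : cis t != 0 :> R[i].
Proof. by rewrite -cabs_gt0 cabs_cis. Qed.

Lemma cis2pi : cis (pi *+ 2) = 1 :> R[i].
Proof. by rewrite /cis cos2pi sin2pi. Qed.

Lemma real_complexM (x y : R) : (x * y)%:C = x%:C * y%:C :> R[i].
Proof. exact: rmorphM. Qed.
Lemma real_complexD (x y : R) : (x + y)%:C = x%:C + y%:C :> R[i].
Proof. exact: rmorphD. Qed.
Lemma real_complexB (x y : R) : (x - y)%:C = x%:C - y%:C :> R[i].
Proof. exact: rmorphB. Qed.
Lemma real_complexN (x : R) : (- x)%:C = - x%:C :> R[i].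
Proof. exact: rmorphN. Qed.

Lemma cabs_pmul (r : R) z : 0 <= r -> cabs (r%:C * z) = r * cabs z.
Proof. by move=> r0; rewrite cabsM cabs_real ger0_norm. Qed.

End modulus.

(** * Passing from local to global on an interval *)

Section cousin.
Variable R : realType.

(** Cousin's lemma: the supremum of the points [x] with [P a x] is reached, and it is passed by the
    local hypothesis there unless it equals [b]. It takes the place of subdivision and compactness
    arguments below. *)
Lemma cousin (P : R -> R -> Prop) (a b : R) :
  (forall x y z, x <= y -> y <= z -> P x y -> P y z -> P x z) ->
  (forall x, a <= x <= b -> exists2 d, 0 < d &
     forall u v, a <= u -> u <= x -> x <= v -> v <= b -> v - u <= d -> P u v) ->
  a <= b -> P a b.
Proof.
move=> Padd Ploc ab.
pose S := [set x | a <= x <= b /\ P a x].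
have Sa : S a.
  split; first by rewrite lexx ab.
  have [|d d0 h] := Ploc a; first by rewrite lexx ab.
  by apply: h => //; rewrite subrr ltW.
have Sb : has_sup S.
  by split; [exists a|exists b => x [/andP[_]]].
have as_ : a <= sup S by apply: ub_le_sup => //; exact: Sb.2.
have sb : sup S <= b by apply: ge_sup; [exists a|move=> x [/andP[]]].
have [|d d0 h] := Ploc (sup S); first by rewrite as_ sb.
have d20 : 0 < d / 2 by rewrite divr_gt0.
have [x Sx hx] : exists2 x, S x & sup S - d / 2 < x.
  by have [x] := sup_adherent d20 Sb; exists x.
have xs : x <= sup S by apply: ub_le_sup => //; exact: Sb.2.
have [/andP[ax xb] Pax] := Sx.
pose y := Num.min b (sup S + d / 2).
have sy : sup S <= y by rewrite le_min sb lerDl ltW.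
have yb : y <= b by rewrite ge_min lexx.
have ysd : y <= sup S + d / 2 by rewrite ge_min lexx orbT.
have Pay : P a y.
  apply: (Padd _ x) => //; first exact: le_trans sy.
  by apply: h => //; lra.
have : y <= sup S by apply: ub_le_sup; [exact: Sb.2|split => //; rewrite yb (le_trans as_)].
rewrite {1}/y ge_min => /orP[bs|]; last by move=> ?; exfalso; lra.
have yE : y = b by apply/eqP; rewrite eq_le yb (le_trans bs).
by rewrite yE in Pay.
Qed.

End cousin.

Section complex_derivative.
Variable R : realType.
Implicit Types (f g : R[i] -> R[i]) (z w d : R[i]).

(** The multiplied form admits [h = 0] and avoids quotients; [entireP] links it with the
    derivability of the statement. *)
Definition cderiv f z d := forall e : R, 0 < e -> exists2 r : R, 0 < r &
  forall h, cabs h <= r -> cabs (f (z + h) - f z - h * d) <= e * cabs h.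

Definition ccont f z := forall e : R, 0 < e -> exists2 r : R, 0 < r &
  forall h, cabs h <= r -> cabs (f (z + h) - f z) <= e.

Lemma addr_eq_self (V : zmodType) (x y : V) : (x + y == x) = (y == 0).
Proof. by rewrite -{2}[x]addr0 (inj_eq (addrI x)). Qed.

(** Caratheodory's form of the derivative, as the value of a continuous factor. It reduces the
    product and chain rules to algebra and continuity. *)
Lemma cderivP f z d : cderiv f z d <->
  exists q, [/\ ccont q z, q z = d & forall h, f (z + h) = f z + h * q (z + h)].
Proof.
split=> [fd|[q [qc qz fE]] e e0].
  exists (fun w => if w == z then d else (f w - f z) / (w - z)); split.
  - move=> e e0; have [r r0 hr] := fd e e0; exists r => // h hr'.
    rewrite eqxx addr_eq_self.
    have [_|h0] := eqVneq h 0; first by rewrite subrr cabs0 ltW.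
    have -> : z + h - z = h by rewrite addrC addKr.
    rewrite -(ler_pM2r (x := cabs h)) ?cabs_gt0// -cabsM mulrBl divfK//.
    by rewrite [d * h]mulrC; exact: hr.
  - by rewrite eqxx.
  - move=> h; rewrite addr_eq_self.
    have [->|h0] := eqVneq h 0; first by rewrite addr0 mul0r addr0.
    have -> : z + h - z = h by rewrite addrC addKr.
    by rewrite [h * (_ / h)]mulrC divfK//; ring.
have [r r0 hr] := qc e e0; exists r => // h /hr hh.
by rewrite fE -qz [f z + _]addrC addrK -mulrBr cabsM mulrC ler_wpM2r// cabs_ge0.
Qed.

Lemma cderiv_cont f z d : cderiv f z d -> ccont f z.
Proof.
move=> fd e e0; have [r r0 hr] := fd _ ltr01.
have k0 : 0 < 1 + cabs d by rewrite ltr_wpDr ?cabs_ge0.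
exists (Num.min r (e / (1 + cabs d))); first by rewrite lt_min r0 divr_gt0.
move=> h; rewrite le_min => /andP[/hr hh]; rewrite ler_pdivlMr// => h2.
rewrite -[f (z + h) - f z](subrK (h * d)) (le_trans (cabsD _ _))//.
by rewrite cabsM; apply: le_trans h2; rewrite mulrDr mulr1 lerD2r -[leRHS]mul1r.
Qed.

Lemma ccont_const c z : ccont (fun=> c) z.
Proof. by move=> e e0; exists 1 => // h _; rewrite subrr cabs0 ltW. Qed.

Lemma ccont_id z : ccont id z.
Proof. by move=> e e0; exists e => // h; rewrite addrC addKr. Qed.

Lemma ccontD f g z : ccont f z -> ccont g z -> ccont (fun w => f w + g w) z.
Proof.
move=> fc gc e e0; have e2 : 0 < e / 2 by rewrite divr_gt0.
have [r r0 hr] := fc _ e2; have [s s0 hs] := gc _ e2.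
exists (Num.min r s); first by rewrite lt_min r0.
move=> h; rewrite le_min => /andP[/hr h1 /hs h2].
have -> : f (z + h) + g (z + h) - (f z + g z) =
  (f (z + h) - f z) + (g (z + h) - g z) by ring.
rewrite (le_trans (cabsD _ _))//; lra.
Qed.

Lemma ccont_bounded f z : ccont f z -> exists2 r : R, 0 < r &
  forall h, cabs h <= r -> cabs (f (z + h)) <= cabs (f z) + 1.
Proof.
move=> fc; have [r r0 hr] := fc _ ltr01; exists r => // h /hr hh.
by rewrite -[f (z + h)](subrK (f z)) (le_trans (cabsD _ _))// addrC lerD2l.
Qed.

Lemma ccontM f g z : ccont f z -> ccont g z -> ccont (fun w => f w * g w) z.
Proof.
move=> fc gc e e0.
pose K := cabs (f z) + cabs (g z) + 1.
have K0 : 0 < K by rewrite ltr_wpDl ?addr_ge0 ?cabs_ge0.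
have e2 : 0 < e / 2 / K by rewrite !divr_gt0.
have [r r0 hr] := fc _ e2; have [s s0 hs] := gc _ e2.
have [u u0 hu] := ccont_bounded fc.
exists (Num.min r (Num.min s u)); first by rewrite !lt_min r0 s0.
move=> h; rewrite !le_min => /and3P[/hr h1 /hs h2 /hu h3].
have -> : f (z + h) * g (z + h) - f z * g z =
  f (z + h) * (g (z + h) - g z) + (f (z + h) - f z) * g z by ring.
rewrite (le_trans (cabsD _ _))// !cabsM.
have a1 : cabs (f (z + h)) * cabs (g (z + h) - g z) <= e / 2.
  rewrite -[leRHS](divfK (lt0r_neq0 K0)) [leRHS]mulrC ler_pM ?cabs_ge0//.
  by rewrite (le_trans h3)// /K; have := cabs_ge0 (g z); lra.
have a2 : cabs (f (z + h) - f z) * cabs (g z) <= e / 2.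
  rewrite -[leRHS](divfK (lt0r_neq0 K0)) ler_pM ?cabs_ge0//.
  by rewrite /K; have := cabs_ge0 (f z); lra.
lra.
Qed.

Lemma ccontN f z : ccont f z -> ccont (fun w => - f w) z.
Proof.
move=> fc e e0; have [r r0 hr] := fc _ e0; exists r => // h /hr.
by rewrite -opprD cabsN.
Qed.

Lemma ccont_comp f g z : ccont f z -> ccont g (f z) -> ccont (fun w => g (f w)) z.
Proof.
move=> fc gc e e0; have [r r0 hr] := gc _ e0; have [s s0 hs] := fc _ r0.
by exists s => // h /hs/hr; rewrite [f z + _]addrC subrK.
Qed.

Lemma ccontV z : z != 0 -> ccont (fun w => w^-1) z.
Proof.
move=> z0; have z0' : 0 < cabs z by rewrite cabs_gt0.
move=> e e0.
exists (Num.min (cabs z / 2) (e * cabs z ^+ 2 / 2)).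
  by rewrite lt_min !divr_gt0// mulr_gt0// exprn_gt0.
move=> h; rewrite le_min => /andP[h1 h2].
have h3 : cabs z / 2 <= cabs (z + h).
  have := cabs_sub_ge z (- h); rewrite opprK cabsN; lra.
have zh0 : z + h != 0 by rewrite -cabs_gt0; apply: lt_le_trans h3; rewrite divr_gt0.
have -> : (z + h)^-1 - z^-1 = - h / ((z + h) * z).
  by field; rewrite ?zh0 ?z0.
rewrite cabsM cabsN cabsV cabsM ler_pdivrMr ?mulr_gt0 ?cabs_gt0//.
by rewrite (le_trans h2)// -mulrA ler_wpM2l ?(ltW e0)//; nra.
Qed.

Lemma cderiv_const c z : cderiv (fun=> c) z 0.
Proof. by apply/cderivP; exists (fun=> 0); split=> [||h]; [exact: ccont_const| |rewrite mulr0 addr0]. Qed.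

Lemma cderiv_id z : cderiv id z 1.
Proof. by apply/cderivP; exists (fun=> 1); split=> [||h]; [exact: ccont_const| |rewrite mulr1]. Qed.

Lemma cderivD f g z a b : cderiv f z a -> cderiv g z b ->
  cderiv (fun w => f w + g w) z (a + b).
Proof.
move=> /cderivP[p [pc <- fE]] /cderivP[q [qc <- gE]]; apply/cderivP.
exists (fun w => p w + q w); split=> [||h]; [exact: ccontD|by []|rewrite fE gE; ring].
Qed.

Lemma cderivM f g z a b : cderiv f z a -> cderiv g z b ->
  cderiv (fun w => f w * g w) z (a * g z + f z * b).
Proof.
move=> fa; have fc := cderiv_cont fa.
move: fa => /cderivP[p [pc <- fE]] /cderivP[q [qc <- gE]]; apply/cderivP.
exists (fun w => p w * g z + f w * q w); split=> [||h].
- apply: ccontD; apply: ccontM => //; exact: ccont_const.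
- by [].
- rewrite gE [f (z + h) in LHS]fE mulrDr; rewrite (mulrDl (f z)).
  rewrite [f (z + h) in RHS]fE; ring.
Qed.

Lemma cderivN f z a : cderiv f z a -> cderiv (fun w => - f w) z (- a).
Proof.
move=> /cderivP[p [pc <- fE]]; apply/cderivP.
exists (fun w => - p w); split=> [||h]; [exact: ccontN|by []|rewrite fE; ring].
Qed.

Lemma cderivB f g z a b : cderiv f z a -> cderiv g z b ->
  cderiv (fun w => f w - g w) z (a - b).
Proof. by move=> fa gb; apply: cderivD => //; exact: cderivN. Qed.

Lemma cderiv_comp f g z a b : cderiv f z a -> cderiv g (f z) b ->
  cderiv (fun w => g (f w)) z (b * a).
Proof.
move=> fa; have fc := cderiv_cont fa.
move: fa => /cderivP[p [pc <- fE]] /cderivP[q [qc <- gE]]; apply/cderivP.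
exists (fun w => q (f w) * p w); split=> [||h].
- by apply: ccontM => //; apply: ccont_comp.
- by [].
- by rewrite {1}fE gE -fE; ring.
Qed.

Lemma cderivV z : z != 0 -> cderiv (fun w => w^-1) z (- z ^- 2).
Proof.
move=> z0 e e0; have z0' : 0 < cabs z by rewrite cabs_gt0.
have [r r0 hr] := ccontV z0 (mulr_gt0 e0 z0').
exists (Num.min r (cabs z / 2)); first by rewrite lt_min r0 divr_gt0.
move=> h; rewrite le_min => /andP[/hr h1 h2].
have zh0 : z + h != 0.
  rewrite -cabs_gt0; have := cabs_sub_ge z (- h); rewrite opprK cabsN.
  by apply: lt_le_trans; rewrite subr_gt0 (le_lt_trans h2)// gtr_pMr// invf_lt1// ltr1n.
have -> : (z + h)^-1 - z^-1 - h * - z ^- 2 = - (h / z) * ((z + h)^-1 - z^-1).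
  by field; rewrite ?zh0 ?z0.
rewrite cabsM cabsN cabsM cabsV -mulrA [e * _]mulrC ler_wpM2l ?cabs_ge0//.
by rewrite ler_pdivrMl// mulrC.
Qed.

End complex_derivative.

(** * Integrals over an interval as increments of primitives *)

Section primitives.
Variable R : realType.
Implicit Types (gam P : R -> R[i]).

Definition rcont_on (a b : R) gam := forall t, a <= t <= b ->
  forall e : R, 0 < e -> exists2 r : R, 0 < r &
    forall s, a <= s <= b -> `|s - t| <= r -> cabs (gam s - gam t) <= e.

(** At the end points the derivative is one-sided. The increment [P b - P a] is what serves as the
    integral of [gam]. *)
Definition is_prim (a b : R) gam P := forall t, a <= t <= b ->
  forall e : R, 0 < e -> exists2 r : R, 0 < r &
    forall s, a <= s <= b -> `|s - t| <= r ->
      cabs (P s - P t - (s - t)%:C * gam t) <= e * `|s - t|.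

(** The mean value inequality, proved by adding up local estimates with Cousin's lemma. Sublinearity
    is all that the addition needs, so the modulus and the real part are treated at once. *)
Lemma prim_sublinear (N : R[i] -> R) (a b m : R) gam P :
  (forall z w, N (z + w) <= N z + N w) ->
  (forall (r : R) z, 0 <= r -> N (r%:C * z) = r * N z) ->
  (forall z, N z <= cabs z) ->
  is_prim a b gam P -> (forall t, a <= t <= b -> N (gam t) <= m) ->
  forall u v, a <= u -> u <= v -> v <= b -> N (P v - P u) <= m * (v - u).
Proof.
move=> ND NM Nc prP gm u v au uv vb; apply/ler_addgt0Pr => e e0.
(* The slope may exceed [m] by [k], which costs at most [e] over the whole interval; the 1 covers
   [u = v]. *)
pose k := e / (v - u + 1).
have vu1 : 0 < v - u + 1 by rewrite ltr_wpDl// subr_ge0.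
have k0 : 0 < k by rewrite divr_gt0.
apply: (@le_trans _ _ ((m + k) * (v - u))); last first.
  rewrite mulrDl lerD2l /k mulrAC ler_pdivrMr// ler_wpM2l ?(ltW e0)//.
  by rewrite lerDl.
pose Q x y := a <= x -> y <= b -> N (P y - P x) <= (m + k) * (y - x).
suff : Q u v by apply.
apply: (@cousin R Q) => //.
- move=> x y z xy yz h1 h2 ax zb.
  have {}h1 := h1 ax (le_trans yz zb); have {}h2 := h2 (le_trans ax xy) zb.
  have -> : P z - P x = (P z - P y) + (P y - P x) by ring.
  by rewrite (le_trans (ND _ _))//; lra.
- move=> x /andP[ux xv].
  have xab : a <= x <= b by rewrite (le_trans au)//= (le_trans xv).
  have [r r0 hr] := prP x xab k k0.
  exists r => // y z uy yx xz zv zyr ay zb.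
  have yab : a <= y <= b by rewrite ay (le_trans yx)// (le_trans xz).
  have zab : a <= z <= b by rewrite zb andbT (le_trans ay)// (le_trans yx).
  have h1 : `|z - x| <= r by rewrite ger0_norm ?subr_ge0//; lra.
  have h2 : `|y - x| <= r by rewrite ler0_norm ?subr_le0//; lra.
  have := hr z zab h1; have := hr y yab h2.
  rewrite ler0_norm ?subr_le0// ger0_norm ?subr_ge0// => h3 h4.
  have -> : P z - P y = (z - y)%:C * gam x + (P z - P x - (z - x)%:C * gam x) +
      - (P y - P x - (y - x)%:C * gam x).
    by rewrite !real_complexB; ring.
  rewrite (le_trans (ND _ _))//.
  have h5 := le_trans (Nc (- (P y - P x - (y - x)%:C * gam x))) (lexx _).
  rewrite cabsN in h5.
  have h6 := ND ((z - y)%:C * gam x) (P z - P x - (z - x)%:C * gam x).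
  have h7 := Nc (P z - P x - (z - x)%:C * gam x).
  rewrite NM ?subr_ge0 ?(le_trans yx)// in h6.
  have h8 : (z - y) * N (gam x) <= (z - y) * m.
    by rewrite ler_wpM2l ?gm// subr_ge0 (le_trans yx).
  nra.
Qed.

Lemma prim_bound (a b m : R) gam P :
  is_prim a b gam P -> (forall t, a <= t <= b -> cabs (gam t) <= m) ->
  forall u v, a <= u -> u <= v -> v <= b -> cabs (P v - P u) <= m * (v - u).
Proof.
move=> h1 h2; apply: (prim_sublinear (N := @cabs R) _ _ _ h1 h2) => //; first exact: cabsD.
by move=> r z r0; rewrite cabs_pmul.
Qed.

Lemma prim_Re_bound (a b m : R) gam P :
  is_prim a b gam P -> (forall t, a <= t <= b -> Re (gam t) <= m) ->
  forall u v, a <= u -> u <= v -> v <= b -> Re (P v - P u) <= m * (v - u).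
Proof.
move=> h1 h2; apply: (prim_sublinear (N := @complex.Re R) _ _ _ h1 h2) => //.
- by move=> z w; rewrite ReD.
- by move=> r z r0; rewrite Re_realM.
- by move=> z; apply: le_trans (ler_norm _) (Re_le_cabs _).
Qed.

Lemma primD a b gam gam' P P' : is_prim a b gam P -> is_prim a b gam' P' ->
  is_prim a b (fun t => gam t + gam' t) (fun t => P t + P' t).
Proof.
move=> h h' t tab e e0; have e2 : 0 < e / 2 by rewrite divr_gt0.
have [r r0 hr] := h t tab _ e2; have [r' r'0 hr'] := h' t tab _ e2.
exists (Num.min r r'); first by rewrite lt_min r0.
move=> s sab; rewrite le_min => /andP[/(hr s sab) h1 /(hr' s sab) h2].
have -> : P s + P' s - (P t + P' t) - (s - t)%:C * (gam t + gam' t) =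
  (P s - P t - (s - t)%:C * gam t) + (P' s - P' t - (s - t)%:C * gam' t) by ring.
rewrite (le_trans (cabsD _ _))//; lra.
Qed.

Lemma primZ a b gam P c : is_prim a b gam P ->
  is_prim a b (fun t => c * gam t) (fun t => c * P t).
Proof.
move=> h t tab e e0; have k0 : 0 < e / (cabs c + 1) by rewrite divr_gt0// ltr_wpDl ?cabs_ge0.
have [r r0 hr] := h t tab _ k0; exists r => // s sab /(hr s sab) h1.
have -> : c * P s - c * P t - (s - t)%:C * (c * gam t) =
  c * (P s - P t - (s - t)%:C * gam t) by ring.
rewrite cabsM (le_trans (ler_wpM2l (cabs_ge0 _) h1))//.
rewrite mulrA ler_wpM2r// mulrCA ler_piMr ?(ltW e0)//.
by rewrite ler_pdivrMr ?ltr_wpDl ?cabs_ge0// mul1r lerDl.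
Qed.

Lemma primB a b gam gam' P P' : is_prim a b gam P -> is_prim a b gam' P' ->
  is_prim a b (fun t => gam t - gam' t) (fun t => P t - P' t).
Proof.
move=> h /(primZ (-1)) h'; have := primD h h'.
by under eq_fun do rewrite mulN1r; under [X in is_prim _ _ _ X]eq_fun do rewrite mulN1r.
Qed.

Lemma prim_line a b (A D : R[i] -> R[i]) z0 v :
  (forall s : R, a <= s <= b -> cderiv A (z0 + s%:C * v) (D (z0 + s%:C * v))) ->
  is_prim a b (fun s => v * D (z0 + s%:C * v)) (fun s => A (z0 + s%:C * v)).
Proof.
move=> Ad t tab e e0.
have k0 : 0 < cabs v + 1 by rewrite ltr_wpDl ?cabs_ge0.
have ek0 : 0 < e / (cabs v + 1) by rewrite divr_gt0.
have [r r0 hr] := Ad t tab _ ek0; exists (r / (cabs v + 1)); first by rewrite divr_gt0.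
move=> s sab; rewrite ler_pdivlMr// => h1.
have hv : cabs ((s - t)%:C * v) <= `|s - t| * (cabs v + 1).
  by rewrite cabsM cabs_real ler_wpM2l// lerDl.
have := hr _ (le_trans hv h1).
have -> : z0 + t%:C * v + (s - t)%:C * v = z0 + s%:C * v by rewrite real_complexB; ring.
rewrite -[_ * v * D _]mulrA => /le_trans; apply.
apply: le_trans (ler_wpM2l (ltW ek0) hv) _.
by rewrite mulrCA mulrC divfK ?lt0r_neq0// mulrC.
Qed.

Lemma prim_real (a b : R) (f : R -> R) : (forall x, {for x, continuous f}) ->
  exists F : R -> R, forall t, a <= t <= b -> is_derive t 1 F (f t).
Proof.
move=> fc; have [ab|ba] := leP a b; last first.
  by exists f => t /andP[h1 h2]; move: (lt_le_trans ba (le_trans h1 h2)); rewrite ltxx.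
pose mu := @lebesgue_measure R.
exists (fun x => \int[mu]_(t in `[(a - 1)%R, x]) f t)%R => t /andP[ta tb].
(* The interval is enlarged so that [a] and [b] become interior points for the fundamental
   theorem. *)
have fi : mu.-integrable `[a - 1, b + 1] (EFin \o f).
  apply: continuous_compact_integrable; first exact: segment_compact.
  by apply: continuous_subspaceT => x; exact: fc.
have tb1 : t < b + 1 by rewrite (le_lt_trans tb)// ltrDl.
have at1 : a - 1 < t by rewrite ltrBlDr (le_lt_trans ta)// ltrDl.
have [h1 h2] := continuous_FTC1_closed tb1 fi at1 (fc t).
by apply: DeriveDef; [exact: h1|rewrite -derive1E; exact: h2].
Qed.

Lemma is_derive_eps (F : R -> R) (t d : R) : is_derive t 1 F d ->
  forall e : R, 0 < e -> exists2 r : R, 0 < r &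
  forall h, `|h| <= r -> `|F (t + h) - F t - h * d| <= e * `|h|.
Proof.
move=> [Fd <-] e e0.
have /cvgrPdist_le/(_ e e0)/nbhs_ballP[r /= r0 hr] := Fd.
exists (r / 2); first by rewrite divr_gt0.
move=> h hh; have [->|h0] := eqVneq h 0.
  by rewrite addr0 subrr mul0r subr0 normr0 mulr0.
have /(_ _ h0) := hr h.
rewrite /ball/= sub0r normrN => /(_ (le_lt_trans hh _)).
rewrite ltr_pdivrMr// ltr_pMr// ltr1n => /(_ isT).
rewrite -[_ - h * _]opprB normrN => hh'.
have -> : h * 'D_1 F t - (F (t + h) - F t) =
   h * ('D_1 F t - h^-1 *: (F (h *: 1 + t) - F t)).
  by rewrite mulrBr /GRing.scale/= mulVKf// mulr1 [h + t]addrC.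
by rewrite normrM mulrC ler_wpM2r.
Qed.

Lemma max_lip (a u v : R) : `|Num.max a u - Num.max a v| <= `|u - v|.
Proof.
have h1 := ler_norm (u - v); have := ler_norm (v - u); rewrite distrC => h2.
by have [?|?] := leP a u; have [?|?] := leP a v; rewrite ler_norml; lra.
Qed.

Lemma min_lip (a u v : R) : `|Num.min a u - Num.min a v| <= `|u - v|.
Proof.
have h1 := ler_norm (u - v); have := ler_norm (v - u); rewrite distrC => h2.
by have [?|?] := leP a u; have [?|?] := leP a v; rewrite ler_norml; lra.
Qed.

Lemma prim_exists (a b : R) gam : a <= b -> rcont_on a b gam ->
  exists P, is_prim a b gam P.
Proof.
(* Clamping to [[a, b]] extends [gam] continuously to the whole line, where its real and imaginary
   parts have primitives. *)
move=> ab gc; pose cl (x : R) := Num.max a (Num.min b x).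
have clab x : a <= cl x <= b.
  by rewrite /cl le_max lexx/= ge_max ab/= ge_min lexx.
have cle x : a <= x <= b -> cl x = x.
  by move=> /andP[ax xb]; rewrite /cl min_r// max_r.
have clip x y : `|cl x - cl y| <= `|x - y| by exact: le_trans (max_lip _ _ _) (min_lip _ _ _).
have cont (q : R[i] -> R) : (forall z, `|q z| <= cabs z) ->
    (forall z w, q (z - w) = q z - q w) ->
    forall x, {for x, continuous (fun t => q (gam (cl t)))}.
  move=> qc qB x; apply/cvgrPdist_le => e e0.
  have [r r0 hr] := gc _ (clab x) e e0.
  apply/nbhs_ballP; exists r => // y /=; rewrite /ball/= => xy.
  rewrite -qB (le_trans (qc _))// cabsBC hr//.
  by rewrite (le_trans (clip _ _))// distrC ltW.
have Rc := @Re_le_cabs R; have Ic := @Im_le_cabs R.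
have [F hF] := @prim_real a b _ (cont (@complex.Re R) Rc (fun z w => etrans (ReD _ _) (congr1 _ (ReN w)))).
have [G hG] := @prim_real a b _ (cont (@complex.Im R) Ic (fun z w => etrans (ImD _ _) (congr1 _ (ImN w)))).
exists (fun t => F t +i* G t) => t tab e e0.
have e2 : 0 < e / 2 by rewrite divr_gt0.
have [r r0 hr] := is_derive_eps (hF t tab) e2.
have [s s0 hs] := is_derive_eps (hG t tab) e2.
exists (Num.min r s); first by rewrite lt_min r0.
move=> x xab; rewrite le_min => /andP[/hr h1 /hs h2].
move: h1 h2; rewrite [t + _]addrC subrK cle// => h1 h2.
rewrite (le_trans (cabs_le_sum _))// ReD ReN ImD ImN Re_realM Im_realM/=.
lra.
Qed.

End primitives.

(** * The Cauchy formula *)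

Section goursat.
Variable R : realType.

Lemma nested_point (l u : nat -> R) :
  (forall n, l n <= l n.+1) -> (forall n, u n.+1 <= u n) -> (forall n, l n <= u n) ->
  exists p, forall n, l n <= p <= u n.
Proof.
move=> li ui lu.
have lm : {homo l : m n / (m <= n)%N >-> m <= n} by apply: homo_leq => //; exact: le_trans.
have um : {homo u : m n / (m <= n)%N >-> n <= m}.
  by apply: homo_leq => // y x z h1 h2; exact: le_trans h2 h1.
have lun m n : l m <= u n.
  rewrite (le_trans (lm _ (maxn m n) (leq_maxl _ _)))// (le_trans (lu _))//.
  exact: um (leq_maxr _ _).
have sl : has_sup [set l n | n in setT].
  by split; [exists (l 0%N), 0%N|exists (u 0%N) => _ [n _ <-]].
exists (sup [set l n | n in setT]) => n; apply/andP; split.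
  by apply: ub_le_sup; [exact: sl.2|exists n].
by apply: ge_sup; [exact: sl.1|move=> _ [m _ <-]].
Qed.

Variables (phi : R[i] -> R[i]) (a b c d : R).
Variables (hp vp : R -> R -> R[i]).
Hypothesis ab : a <= b.
Hypothesis cd : c <= d.
Hypothesis hpP : forall y, c <= y <= d -> is_prim a b (fun x => phi (x +i* y)) (hp y).
Hypothesis vpP : forall x, a <= x <= b -> is_prim c d (fun y => phi (x +i* y)) (vp x).
Hypothesis phiD : forall x y, a <= x <= b -> c <= y <= d ->
  exists D, cderiv phi (x +i* y) D.

(** The counterclockwise boundary integral of [phi]: bottom, right, top, left. The factor ['i] is dz
    / dy on the vertical edges. *)
Let bnd (x0 x1 y0 y1 : R) : R[i] :=
  (hp y0 x1 - hp y0 x0) + 'i * (vp x1 y1 - vp x1 y0)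
  - (hp y1 x1 - hp y1 x0) - 'i * (vp x0 y1 - vp x0 y0).

Lemma cabs_imag : cabs ('i : R[i]) = 1.
Proof. by rewrite cabs_i expr0n/= add0r expr1n sqrtr1. Qed.

(* The edge integrals of the affine part of [phi] at [p] are differences of the
   values of [A] at the corners and cancel around the rectangle. *)
Let bnd_local (px py e : R) : a <= px <= b -> c <= py <= d -> 0 < e ->
  exists2 r : R, 0 < r & forall x0 x1 y0 y1,
    a <= x0 -> x0 <= px -> px <= x1 -> x1 <= b ->
    c <= y0 -> y0 <= py -> py <= y1 -> y1 <= d ->
    (x1 - x0) + (y1 - y0) <= r ->
    cabs (bnd x0 x1 y0 y1) <= e * ((x1 - x0) + (y1 - y0)) ^+ 2.
Proof.
move=> pxab pycd e0; have [D] := phiD pxab pycd.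
set p := px +i* py => phiD'.
have e2 : 0 < e / 2 by rewrite divr_gt0.
have [r r0 hr] := phiD' _ e2.
exists r => // x0 x1 y0 y1 ax0 x0p px1 x1b cy0 y0p py1 y1d small.
set L := (x1 - x0) + (y1 - y0) in small *.
pose A z := phi p * (z - p) + D * ((z - p) * (z - p)) / 2.
pose A' z := phi p + D * (z - p).
have Ad z : cderiv A z (A' z).
  have d1 : cderiv (fun w => w - p) z 1.
    by have := cderivB (cderiv_id z) (cderiv_const p z); rewrite subr0.
  have := cderivD (cderivM (cderiv_const (phi p) z) d1)
    (cderivM (cderivM (cderiv_const D z) (cderivM d1 d1)) (cderiv_const 2^-1 z)).
  rewrite !mul0r !add0r !mulr0 !addr0 !mulr1 !mul1r.
  suff -> : phi p + D * (z - p + (z - p)) / 2 = A' z by [].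
  by rewrite /A'; field.
have rem x y : x0 <= x <= x1 -> y0 <= y <= y1 ->
    cabs (phi (x +i* y) - A' (x +i* y)) <= e / 2 * L.
  move=> /andP[h1 h2] /andP[h3 h4].
  have hL : cabs (x +i* y - p) <= L.
    apply: (le_trans (cabs_le_sum _)); rewrite /= /L lerD// ler_norml; apply/andP; split; lra.
  have := hr _ (le_trans hL small); rewrite [p + _]addrC subrK => h5.
  have -> : phi (x +i* y) - A' (x +i* y) = phi (x +i* y) - phi p - (x +i* y - p) * D.
    by rewrite /A'; ring.
  by rewrite (le_trans h5)// ler_wpM2l// ltW.
have horE (x y : R) : (0 +i* y) + x%:C * 1 = x +i* y.
  by rewrite mulr1; apply: complex_ext; rewrite /= ?add0r ?addr0.
have verE (x y : R) : x%:C + y%:C * 'i = x +i* y.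
  by apply: complex_ext; rewrite /= !(mulr0, mul0r, addr0, add0r, mulr1, subr0).
have hor y : y0 <= y <= y1 ->
    cabs ((hp y x1 - hp y x0) - (A (x1 +i* y) - A (x0 +i* y))) <= e / 2 * L * (x1 - x0).
  move=> yy; have ycd : c <= y <= d by move: yy => /andP[? ?]; apply/andP; split; lra.
  have := primB (hpP ycd) (@prim_line _ a b A A' (0 +i* y) 1 (fun s _ => Ad _)).
  under eq_fun do rewrite mul1r horE; under [X in is_prim _ _ _ X]eq_fun do rewrite horE.
  move=> pr.
  have -> : hp y x1 - hp y x0 - (A (x1 +i* y) - A (x0 +i* y)) =
    (hp y x1 - A (x1 +i* y)) - (hp y x0 - A (x0 +i* y)) by ring.
  have pr' : is_prim x0 x1 (fun x => phi (x +i* y) - A' (x +i* y))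
     (fun x => hp y x - A (x +i* y)).
    move=> t tx ee ee0; have tab : a <= t <= b by move: tx => /andP[? ?]; apply/andP; split; lra.
    have [s s0 hs] := pr t tab ee ee0; exists s => // q qx; apply: hs.
    by move: qx => /andP[? ?]; apply/andP; split; lra.
  by apply: (prim_bound pr' (fun x xx => rem x y xx yy)) => //; lra.
have ver x : x0 <= x <= x1 ->
    cabs ('i * (vp x y1 - vp x y0) - (A (x +i* y1) - A (x +i* y0))) <= e / 2 * L * (y1 - y0).
  move=> xx; have xab : a <= x <= b by move: xx => /andP[? ?]; apply/andP; split; lra.
  have := primB (primZ 'i (vpP xab)) (@prim_line _ c d A A' x%:C 'i (fun s _ => Ad _)).
  under eq_fun do rewrite verE -mulrBr; under [X in is_prim _ _ _ X]eq_fun do rewrite verE.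
  move=> pr.
  have -> : 'i * (vp x y1 - vp x y0) - (A (x +i* y1) - A (x +i* y0)) =
    ('i * vp x y1 - A (x +i* y1)) - ('i * vp x y0 - A (x +i* y0)) by ring.
  have pr' : is_prim y0 y1 (fun y => 'i * (phi (x +i* y) - A' (x +i* y)))
     (fun y => 'i * vp x y - A (x +i* y)).
    move=> t tx ee ee0; have tcd : c <= t <= d by move: tx => /andP[? ?]; apply/andP; split; lra.
    have [s s0 hs] := pr t tcd ee ee0; exists s => // q qx; apply: hs.
    by move: qx => /andP[? ?]; apply/andP; split; lra.
  apply: (prim_bound pr') => //; try lra.
  by move=> t tt; rewrite cabsM cabs_imag mul1r rem.
have x0x : x0 <= x0 <= x1 by rewrite lexx (le_trans x0p).
have x1x : x0 <= x1 <= x1 by rewrite lexx (le_trans x0p).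
have y0y : y0 <= y0 <= y1 by rewrite lexx (le_trans y0p).
have y1y : y0 <= y1 <= y1 by rewrite lexx (le_trans y0p).
have h1 := hor _ y0y; have h2 := hor _ y1y; have h3 := ver _ x0x; have h4 := ver _ x1x.
set u1 := _ - _ in h1; set u2 := _ - _ in h2; set u3 := _ - _ in h3; set u4 := _ - _ in h4.
have -> : bnd x0 x1 y0 y1 = (u1 + u4) - (u2 + u3).
  by rewrite /bnd /u1 /u2 /u3 /u4; ring.
have := cabsB (u1 + u4) (u2 + u3); have := cabsD u1 u4; have := cabsD u2 u3.
move=> t1 t2 t3; apply: (le_trans t3).
have -> : e * L ^+ 2 = e / 2 * L * (x1 - x0) * 2 + e / 2 * L * (y1 - y0) * 2.
  by rewrite /L; field.
lra.
Qed.

(** If the integral had modulus K > 0, quartering would give nested rectangles with integrals at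
    least K / 4^n. At their common point [bnd_local], with error factor [K / 2 / (L ^+ 2 + 1)] and
    half-perimeter L / 2^n, bounds them by less than K / 2 / 4^n. *)
Lemma goursat : bnd a b c d = 0.
Proof.
apply/eqP; rewrite -cabs_eq0; apply/negPn/negP => K0.
set K := cabs (bnd a b c d) in K0.
have {}K0 : 0 < K by rewrite lt0r K0 cabs_ge0.
pose W (n : nat) := (b - a) / 2 ^+ n; pose H (n : nat) := (d - c) / 2 ^+ n.
have W0 n : 0 <= W n by rewrite divr_ge0 ?subr_ge0// exprn_ge0.
have H0 n : 0 <= H n by rewrite divr_ge0 ?subr_ge0// exprn_ge0.
have WS n : W n = W n.+1 + W n.+1.
  by rewrite /W exprS; field; rewrite expf_neq0.
have HS n : H n = H n.+1 + H n.+1.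
  by rewrite /H exprS; field; rewrite expf_neq0.
pose bad n (p : R * R) := [/\ a <= p.1, p.1 + W n <= b, c <= p.2, p.2 + H n <= d &
  K <= 4 ^+ n * cabs (bnd p.1 (p.1 + W n) p.2 (p.2 + H n))].
(* The pair carries the level and the lower left corner; [bad] is a premise rather than part of the
   type so that [choice] applies. *)
have step (q : nat * (R * R)) : exists p' : R * R, bad q.1 q.2 ->
    bad q.1.+1 p' /\ [/\ q.2.1 <= p'.1, p'.1 + W q.1.+1 <= q.2.1 + W q.1,
       q.2.2 <= p'.2 & p'.2 + H q.1.+1 <= q.2.2 + H q.1].
  case: q => n [x y] /=.
  have [[/= ax xb cy yd KB]|nb] := pselect (bad n (x, y)); last by exists (0, 0) => /nb.
  have w0 := W0 n.+1; have h0 := H0 n.+1.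
  move: xb yd KB; rewrite /= (WS n) (HS n); set w := W n.+1 in w0 *; set h := H n.+1 in h0 *.
  move=> xb yd KB.
  have split4 : bnd x (x + (w + w)) y (y + (h + h)) =
     (bnd x (x + w) y (y + h) + bnd (x + w) (x + w + w) y (y + h)) +
     (bnd x (x + w) (y + h) (y + h + h) + bnd (x + w) (x + w + w) (y + h) (y + h + h)).
    by rewrite /bnd !addrA; ring.
  have [|h1] := leP K (4 ^+ n.+1 * cabs (bnd x (x + w) y (y + h))).
    by exists (x, y) => _; split; split => //=; rewrite -?/w -?/h; lra.
  have [|h2] := leP K (4 ^+ n.+1 * cabs (bnd (x + w) (x + w + w) y (y + h))).
    by exists (x + w, y) => _; split; split => //=; rewrite -?/w -?/h; lra.
  have [|h3] := leP K (4 ^+ n.+1 * cabs (bnd x (x + w) (y + h) (y + h + h))).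
    by exists (x, y + h) => _; split; split => //=; rewrite -?/w -?/h; lra.
  have [|h4] := leP K (4 ^+ n.+1 * cabs (bnd (x + w) (x + w + w) (y + h) (y + h + h))).
    by exists (x + w, y + h) => _; split; split => //=; rewrite -?/w -?/h; lra.
  exfalso; move: KB; rewrite split4 leNgt => /negP; apply.
  have p4 : 0 < 4 ^+ n :> R by rewrite exprn_gt0.
  rewrite !exprS in h1 h2 h3 h4.
  apply: (le_lt_trans (ler_wpM2l (ltW p4) (le_trans (cabsD _ _) (lerD (cabsD _ _) (cabsD _ _))))).
  lra.
have [f hf] := choice step.
pose s := fix s n : R * R := if n is m.+1 then f (m, s m) else (a, c).
have sbad n : bad n (s n).
  elim: n => [|n ih]; last by have [] := hf (n, s n) ih.
  by rewrite /bad /= /W /H !expr0 !divr1 !(addrC _ (_ - _)) !subrK !mul1r.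
have sinc n := (hf (n, s n) (sbad n)).2.
have [px pxP] : exists p, forall n, (s n).1 <= p <= (s n).1 + W n.
  by apply: nested_point => n; [have [] := sinc n|have [] := sinc n|rewrite lerDl].
have [py pyP] : exists p, forall n, (s n).2 <= p <= (s n).2 + H n.
  by apply: nested_point => n; [have [] := sinc n|have [] := sinc n|rewrite lerDl].
have pxab : a <= px <= b.
  have /andP[h1 h2] := pxP 0%N; have [h3 h4 _ _ _] := sbad 0%N.
  by rewrite (le_trans h3)// (le_trans h2).
have pycd : c <= py <= d.
  have /andP[h1 h2] := pyP 0%N; have [_ _ h3 h4 _] := sbad 0%N.
  by rewrite (le_trans h3)// (le_trans h2).
pose L := (b - a) + (d - c).
have L0 : 0 <= L by rewrite addr_ge0 ?subr_ge0.
have e0 : 0 < K / 2 / (L ^+ 2 + 1) by rewrite !divr_gt0// ltr_wpDl ?sqr_ge0.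
have [r r0 hr] := bnd_local pxab pycd e0.
have [n hn] : exists n, L / 2 ^+ n <= r.
  exists (Num.truncn (L / r)).+1; rewrite ler_pdivrMr ?exprn_gt0// mulrC -ler_pdivrMr//.
  rewrite (le_trans (ltW (truncnS_gt _)))// -natrX ler_nat ltnW// ltn_expl//.
have [ax xb cy yd KB] := sbad n.
have /andP[x1 x2] := pxP n; have /andP[y1 y2] := pyP n.
have LE : W n + H n = L / 2 ^+ n by rewrite /W /H -mulrDl.
have := hr _ _ _ _ ax x1 x2 xb cy y1 y2 yd.
have sE (x w : R) : x + w - x = w by rewrite addrC addKr.
rewrite !sE LE => /(_ hn) h.
have : K <= 4 ^+ n * (K / 2 / (L ^+ 2 + 1) * (L / 2 ^+ n) ^+ 2).
  by rewrite (le_trans KB)// ler_wpM2l// exprn_ge0.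
have -> : 4 ^+ n * (K / 2 / (L ^+ 2 + 1) * (L / 2 ^+ n) ^+ 2) =
   (K / 2) * (L ^+ 2 / (L ^+ 2 + 1)).
  have -> : 4 = 2 ^+ 2 :> R by rewrite -natrX.
  rewrite -exprM mulnC exprM; field.
  by rewrite expf_neq0//= lt0r_neq0// ltr_wpDl ?sqr_ge0.
have : L ^+ 2 / (L ^+ 2 + 1) <= 1.
  by rewrite ler_pdivrMr ?mul1r ?lerDl// ltr_wpDl ?sqr_ge0.
nra.
Qed.

End goursat.

Section complex_differentiability.
Variable R : realType.
Implicit Types (f g : R[i] -> R[i]) (z w : R[i]).

Definition cdiff f z := exists d, cderiv f z d.

Lemma cdiff_const c z : cdiff (fun=> c) z. Proof. by exists 0; exact: cderiv_const. Qed.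
Lemma cdiff_id z : cdiff id z. Proof. by exists 1; exact: cderiv_id. Qed.
Lemma cdiffD f g z : cdiff f z -> cdiff g z -> cdiff (fun w => f w + g w) z.
Proof. by move=> [a fa] [b gb]; exists (a + b); exact: cderivD. Qed.
Lemma cdiffN f z : cdiff f z -> cdiff (fun w => - f w) z.
Proof. by move=> [a fa]; exists (- a); exact: cderivN. Qed.
Lemma cdiffB f g z : cdiff f z -> cdiff g z -> cdiff (fun w => f w - g w) z.
Proof. by move=> [a fa] [b gb]; exists (a - b); exact: cderivB. Qed.
Lemma cdiffM f g z : cdiff f z -> cdiff g z -> cdiff (fun w => f w * g w) z.
Proof. by move=> [a fa] [b gb]; exists (a * g z + f z * b); exact: cderivM. Qed.
Lemma cdiff_comp f g z : cdiff f z -> cdiff g (f z) -> cdiff (fun w => g (f w)) z.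
Proof. by move=> [a fa] [b gb]; exists (b * a); exact: cderiv_comp. Qed.
Lemma cdiffV f z : f z != 0 -> cdiff f z -> cdiff (fun w => (f w)^-1) z.
Proof.
by move=> f0 fd; apply: (cdiff_comp (g := fun w => w^-1)) => //; exists (- (f z) ^- 2); exact: cderivV.
Qed.
Lemma cdiffX f n z : cdiff f z -> cdiff (fun w => f w ^+ n) z.
Proof.
move=> fd; elim: n => [|n ih]; first exact: cdiff_const.
by under eq_fun do rewrite exprS; exact: cdiffM.
Qed.
Lemma cdiff_prod (I : Type) (s : seq I) (F : I -> R[i] -> R[i]) z :
  (forall i, cdiff (F i) z) -> cdiff (fun w => \prod_(i <- s) F i w) z.
Proof.
move=> h; elim: s => [|i s ih]; first by under eq_fun do rewrite big_nil; exact: cdiff_const.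
by under eq_fun do rewrite big_cons; exact: cdiffM.
Qed.
Lemma cdiff_sum (I : Type) (s : seq I) (F : I -> R[i] -> R[i]) z :
  (forall i, cdiff (F i) z) -> cdiff (fun w => \sum_(i <- s) F i w) z.
Proof.
move=> h; elim: s => [|i s ih]; first by under eq_fun do rewrite big_nil; exact: cdiff_const.
by under eq_fun do rewrite big_cons; exact: cdiffD.
Qed.
Lemma cdiff_cont f z : cdiff f z -> ccont f z.
Proof. by move=> [d /cderiv_cont]. Qed.

Definition cexp z : R[i] := (expR (Re z))%:C * cis (Im z).

Lemma cexp0 : cexp 0 = 1.
Proof. by rewrite /cexp/= expR0 cis0 mulr1. Qed.

Lemma cexpD z w : cexp (z + w) = cexp z * cexp w.
Proof. by rewrite /cexp ReD ImD expRD cisD real_complexM; ring. Qed.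

Lemma cabs_cexp z : cabs (cexp z) = expR (Re z).
Proof. by rewrite /cexp cabs_pmul ?expR_ge0// cabs_cis mulr1. Qed.

Lemma cexp_neq0 z : cexp z != 0.
Proof. by rewrite -cabs_gt0 cabs_cexp expR_gt0. Qed.

Lemma cexpN z : cexp (- z) = (cexp z)^-1.
Proof. by apply: (mulfI (cexp_neq0 z)); rewrite -cexpD subrr cexp0 divff ?cexp_neq0. Qed.

Lemma cexpE (x y : R) : cexp (x +i* y) = (expR x)%:C * cis y.
Proof. by []. Qed.

Lemma cexp_deriv0 : cderiv cexp 0 1.
Proof.
(* The three error terms below add up to [6 * k * cabs h], so a tenth of [e] is enough. *)
move=> e e0; have k0 : 0 < Num.min 1 (e / 10) by rewrite lt_min ltr01 divr_gt0.
set k := Num.min 1 (e / 10) in k0.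
have k1 : k <= 1 by rewrite ge_min lexx.
have ke : k <= e / 10 by rewrite ge_min lexx orbT.
clearbody k.
have [r r0 hr] := is_derive_eps (is_derive_expR (0 : R)) k0.
have [s s0 hs] := is_derive_eps (is_derive_cos (0 : R)) k0.
have [u u0 hu] := is_derive_eps (is_derive_sin (0 : R)) k0.
exists (Num.min k (Num.min r (Num.min s u))); first by rewrite !lt_min k0 r0 s0.
move=> h; rewrite !le_min => /and4P[hk h1 h2 h3].
have [Rh Ih] := (Re_le_cabs h, Im_le_cabs h).
move: (hr (Re h)) (hs (Im h)) (hu (Im h)); rewrite !add0r expR0 cos0 sin0 oppr0 !mulr0 !mulr1 !subr0.
move=> /(_ (le_trans Rh h1)) a1 /(_ (le_trans Ih h2)) a2 /(_ (le_trans Ih h3)) a3.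
rewrite cexp0 /cexp.
set x := Re h in Rh a1 *; set y := Im h in Ih a2 a3 *.
have -> : (expR x)%:C * cis y - 1 - h =
  (expR x - 1 - x)%:C * cis y + (1 + x)%:C * (cis y - 1 - 0 +i* y) + (x%:C * (0 +i* y)).
  rewrite /x /y; case: (h) => p q /=.
  by apply: complex_ext; rewrite /= !(mulr0, mul0r, addr0, add0r, subr0, oppr0); ring.
have c1 : cabs (cis y - 1 - 0 +i* y) <= 2 * k * cabs h.
  apply: (le_trans (cabs_le_sum _)) => /=; rewrite ?(oppr0, addr0, subr0) in a3 *.
  have := ler_wpM2l (ltW k0) Ih; lra.
have c2 : cabs (0 +i* y : R[i]) <= cabs h.
  by rewrite cabs_i expr0n/= add0r sqrtr_sqr.
rewrite (le_trans (cabsD _ _))// cabsM cabs_real.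
have t1 := cabsD ((expR x - 1 - x)%:C * cis y) ((1 + x)%:C * (cis y - 1 - 0 +i* y)).
rewrite !cabsM !cabs_real cabs_cis mulr1 in t1.
have t2 : `|1 + x| <= 2 by rewrite (le_trans (ler_normD _ _))// normr1; lra.
have t3 : `|1 + x| * cabs (cis y - 1 - 0 +i* y) <= 2 * (2 * k * cabs h).
  by apply: ler_pM => //; exact: cabs_ge0.
have t4 : `|x| * cabs (0 +i* y : R[i]) <= k * cabs h.
  by apply: ler_pM => //; [exact: cabs_ge0|lra].
have t5 := ler_wpM2l (ltW k0) Rh.
have t6 := ler_wpM2r (cabs_ge0 h) ke.
have t7 := mulr_ge0 (ltW e0) (cabs_ge0 h).
lra.
Qed.

Lemma cderiv_cexp z : cderiv cexp z (cexp z).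
Proof.
move=> e e0; have k0 : 0 < e / cabs (cexp z) by rewrite divr_gt0// cabs_cexp expR_gt0.
have [r r0 hr] := cexp_deriv0 k0; exists r => // h /hr; rewrite cexp0 add0r mulr1 => h1.
rewrite cexpD.
have -> : cexp z * cexp h - cexp z - h * cexp z = cexp z * (cexp h - 1 - h) by ring.
rewrite cabsM mulrC -ler_pdivlMr ?(le_trans h1) 1?mulrAC//.
by rewrite cabs_cexp expR_gt0.
Qed.

Lemma cdiff_cexp z : cdiff cexp z.
Proof. by exists (cexp z); exact: cderiv_cexp. Qed.

End complex_differentiability.

(** * Means over circles and their independence of the radius *)

Section averages.
Variable R : realType.
Implicit Types (gam : R -> R[i]) (F f : R[i] -> R[i]) (z w : R[i]).

Local Notation tau := (pi *+ 2 : R).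

Lemma tau_gt0 : 0 < tau.
Proof. by rewrite mulrn_wgt0// pi_gt0. Qed.

(** The mean over one period. By [avgE] the choice of the primitive does not matter, and continuous
    functions have one; the default concerns only functions without primitive. *)
Definition avg gam : R[i] :=
  let P := xget (fun=> 0) [set P | is_prim 0 tau gam P] in
  (tau^-1)%:C * (P tau - P 0).

Lemma avgE gam P : is_prim 0 tau gam P -> avg gam = (tau^-1)%:C * (P tau - P 0).
Proof.
move=> prP; rewrite /avg; case: xgetP => [Q _ prQ|/(_ P)//].
have pr := primB prQ prP.
have z0 t : 0 <= t <= tau -> cabs (gam t - gam t) <= 0 by rewrite subrr cabs0.
have := prim_bound pr z0 (lexx _) (ltW tau_gt0) (lexx _).
rewrite mul0r => h; have /eqP : cabs (Q tau - P tau - (Q 0 - P 0)) == 0.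
  by rewrite eq_le h cabs_ge0.
move=> /eqP; rewrite cabs_eq0 => /eqP h0; congr (_ * _).
by apply/eqP; rewrite -subr_eq0 -[X in _ == X]h0; apply/eqP; ring.
Qed.

Definition rc gam := rcont_on 0 tau gam.

Lemma rcP gam : rc gam -> exists P, is_prim 0 tau gam P.
Proof. by apply: prim_exists; exact: ltW tau_gt0. Qed.

Lemma avgD gam gam' : rc gam -> rc gam' -> avg (fun t => gam t + gam' t) = avg gam + avg gam'.
Proof.
move=> /rcP[P prP] /rcP[Q prQ]; rewrite (avgE (primD prP prQ)) (avgE prP) (avgE prQ); ring.
Qed.

Lemma avgZ gam c : rc gam -> avg (fun t => c * gam t) = c * avg gam.
Proof. by move=> /rcP[P prP]; rewrite (avgE (primZ c prP)) (avgE prP); ring. Qed.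

Lemma avgB gam gam' : rc gam -> rc gam' -> avg (fun t => gam t - gam' t) = avg gam - avg gam'.
Proof.
move=> /rcP[P prP] /rcP[Q prQ]; rewrite (avgE (primB prP prQ)) (avgE prP) (avgE prQ); ring.
Qed.

Lemma avg_cst c : avg (fun=> c) = c.
Proof.
have pr : is_prim 0 tau (fun=> c) (fun t => t%:C * c).
  move=> t _ e e0; exists 1 => // s _ _.
  by rewrite -mulrBl -real_complexB subrr cabs0 mulr_ge0// ltW.
rewrite (avgE pr) mul0r subr0 mulrA -real_complexM mulVf ?mul1r//.
exact: lt0r_neq0 tau_gt0.
Qed.

Lemma avg_bound gam m : rc gam -> (forall t, 0 <= t <= tau -> cabs (gam t) <= m) ->
  cabs (avg gam) <= m.
Proof.
move=> /rcP[P prP] gm; rewrite (avgE prP) cabs_pmul ?invr_ge0 ?(ltW tau_gt0)//.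
rewrite mulrC ler_pdivrMr ?tau_gt0//.
by have := prim_bound prP gm (lexx _) (ltW tau_gt0) (lexx _); rewrite subr0.
Qed.

Lemma avg_Re_bound gam m : rc gam -> (forall t, 0 <= t <= tau -> Re (gam t) <= m) ->
  Re (avg gam) <= m.
Proof.
move=> /rcP[P prP] gm; rewrite (avgE prP) Re_realM.
rewrite mulrC ler_pdivrMr ?tau_gt0//.
by have := prim_Re_bound prP gm (lexx _) (ltW tau_gt0) (lexx _); rewrite subr0.
Qed.

Lemma rc_cst c : rc (fun=> c).
Proof. by move=> t _ e e0; exists 1 => // s _ _; rewrite subrr cabs0 ltW. Qed.

Lemma rcont_on_line F a b z0 v :
  (forall t, a <= t <= b -> ccont F (z0 + t%:C * v)) ->
  rcont_on a b (fun t => F (z0 + t%:C * v)).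
Proof.
move=> Fc t tab e e0; have [r r0 hr] := Fc t tab e e0.
have k0 : 0 < cabs v + 1 by rewrite ltr_wpDl ?cabs_ge0.
exists (r / (cabs v + 1)); first by rewrite divr_gt0.
move=> s sab; rewrite ler_pdivlMr// => h.
have -> : z0 + s%:C * v = z0 + t%:C * v + (s - t)%:C * v by rewrite real_complexB; ring.
by apply: hr; rewrite cabsM cabs_real (le_trans _ h)// ler_wpM2l// lerDl.
Qed.

Definition circ F (r : R) := avg (fun t => F (r%:C * cis t)).

Lemma rc_circ F r : (forall z, cabs z = `|r| -> ccont F z) -> rc (fun t => F (r%:C * cis t)).
Proof.
move=> Fc t _ e e0.
have [s s0 hs] := Fc (r%:C * cis t) (etrans (cabsM _ _) (etrans (congr2 _ (cabs_real _) (cabs_cis _)) (mulr1 _))) _ e0.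
have k0 : 0 < s / (`|r| + 1) by rewrite divr_gt0// ltr_wpDl.
have [u u0 hu] := cderiv_cont (cderiv_cexp ('i * t%:C)) k0.
exists u => // q _ qt.
have cE (x : R) : cis x = cexp ('i * x%:C).
  by rewrite /cexp/= !(mulr0, mul0r, mul1r, addr0, add0r, subr0) oppr0 expR0 rmorph1 mul1r.
have := hu ('i * (q - t)%:C); rewrite cabsM cabs_imag mul1r cabs_real => /(_ qt).
have -> : 'i * t%:C + 'i * (q - t)%:C = 'i * q%:C :> R[i] by rewrite real_complexB; ring.
rewrite -!cE => h; have -> : r%:C * cis q = r%:C * cis t + r%:C * (cis q - cis t) by ring.
apply: hs; rewrite cabsM cabs_real (le_trans (ler_wpM2l _ h))// mulrCA ler_piMr ?(ltW s0)//.
by rewrite ler_pdivrMr ?mul1r ?lerDl// ltr_wpDl.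
Qed.

(** In the coordinate log z the annulus becomes a rectangle of height 2 pi. In Goursat's lemma the
    two horizontal edges cancel by periodicity, and the vertical edges are the two means. *)
Lemma circ_const F r1 r2 : 0 < r1 -> r1 <= r2 ->
  (forall z, r1 <= cabs z <= r2 -> cdiff F z) -> circ F r1 = circ F r2.
Proof.
move=> r1_gt0 r12 Fd; have r2_gt0 := lt_le_trans r1_gt0 r12.
pose phi z := F (cexp z).
set a := ln r1; set b := ln r2.
have ab : a <= b by rewrite ler_ln.
have cab x y : a <= x <= b -> r1 <= cabs (cexp (x +i* y)) <= r2.
  move=> /andP[ax xb]; rewrite cabs_cexp/= -[r1]lnK// -[r2]lnK// !ler_expR.
  by rewrite ax.
have r1E : r1 = expR a by rewrite lnK.
have r2E : r2 = expR b by rewrite lnK.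
clearbody a b.
have phiD x y : a <= x <= b -> cdiff phi (x +i* y).
  by move=> xab; apply: (@cdiff_comp R (@cexp R) F); [exact: cdiff_cexp|apply: Fd; exact: cab].
pose hp y := xget (fun=> 0) [set P | is_prim a b (fun x => phi (x +i* y)) P].
pose vp x := xget (fun=> 0) [set P | is_prim 0 tau (fun y => phi (x +i* y)) P].
have hpP y : 0 <= y <= tau -> is_prim a b (fun x => phi (x +i* y)) (hp y).
  move=> _; have [P prP] : exists P, is_prim a b (fun x => phi (x +i* y)) P.
    apply: prim_exists => //.
    have E (x : R) : x +i* y = (0 +i* y) + x%:C * 1.
      by rewrite mulr1; apply: complex_ext; rewrite /= ?add0r ?addr0.
    under eq_fun do rewrite E; apply: (@rcont_on_line phi).
    by move=> t tab; rewrite -E; apply: cdiff_cont; exact: phiD.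
  by rewrite /hp; case: xgetP => [//|/(_ P)].
have vpP x : a <= x <= b -> is_prim 0 tau (fun y => phi (x +i* y)) (vp x).
  move=> xab; have [P prP] : exists P, is_prim 0 tau (fun y => phi (x +i* y)) P.
    apply: prim_exists; first exact: ltW tau_gt0.
    have E (y : R) : x +i* y = x%:C + y%:C * 'i.
      by apply: complex_ext; rewrite /= !(mulr0, mul0r, addr0, add0r, mulr1, subr0).
    under eq_fun do rewrite E; apply: (@rcont_on_line phi).
    by move=> t tab; rewrite -E; apply: cdiff_cont; exact: phiD.
  by rewrite /vp; case: xgetP => [//|/(_ P)].
have := goursat ab (ltW tau_gt0) hpP vpP (fun x y xab _ => phiD x y xab).
have -> : hp tau = hp 0.
  rewrite /hp; congr (xget _ _); apply: funext => P; congr (is_prim _ _ _ _).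
  by apply: funext => x; rewrite /phi !cexpE cis2pi cis0.
have vE x : a <= x <= b -> circ F (expR x) = (tau^-1)%:C * (vp x tau - vp x 0).
  by move=> xab; rewrite /circ; apply: avgE; exact: vpP.
have aab : a <= a <= b by rewrite lexx.
have bab : a <= b <= b by rewrite lexx ab.
rewrite r1E r2E (vE a aab) (vE b bab).
have E (X u v : R[i]) : X + v - X - u = v - u by ring.
have i0 : 'i != 0 :> R[i] by rewrite -cabs_gt0 cabs_imag.
by rewrite E -mulrBr => /eqP; rewrite mulf_eq0 (negPf i0) subr_eq0 => /eqP ->.
Qed.

(** Continuity at the points of the circle is made uniform in the angle by Cousin's lemma. The
    radius 0 is included, which links the means to the value at the centre. *)
Lemma circ_cont F rho r0 : (forall z, cabs z <= rho -> ccont F z) -> 0 <= r0 <= rho ->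
  forall e : R, 0 < e -> exists2 del : R, 0 < del &
    forall r, 0 <= r <= rho -> `|r - r0| <= del -> cabs (circ F r - circ F r0) <= e.
Proof.
move=> Fc /andP[r00 r0rho] e e0.
have cabsr r t : 0 <= r -> cabs (r%:C * cis t : R[i]) = r.
  by move=> ?; rewrite cabs_pmul// cabs_cis mulr1.
have rcr r : 0 <= r <= rho -> rc (fun t => F (r%:C * cis t)).
  by move=> /andP[? ?]; apply: rc_circ => z zr; apply: Fc; rewrite zr ger0_norm.
pose Q (s t : R) := exists2 del : R, 0 < del & forall r x, 0 <= r -> `|r - r0| <= del ->
  s <= x <= t -> cabs (F (r%:C * cis x) - F (r0%:C * cis x)) <= e.
have [del del0 hdel] : Q 0 tau.
  apply: (@cousin R Q); last exact: ltW tau_gt0.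
    move=> x y z xy yz [d1 d10 h1] [d2 d20 h2].
    exists (Num.min d1 d2); first by rewrite lt_min d10.
    move=> r u r_ge0; rewrite le_min => /andP[k1 k2] /andP[xu uz].
    by have [uy|yu] := leP u y; [apply: h1 => //; rewrite xu|apply: h2 => //; rewrite uz ltW].
  move=> t _; have e2 : 0 < e / 2 by rewrite divr_gt0.
  have [s s0 hs] := Fc (r0%:C * cis t) (eq_ind_r (fun u => u <= rho) r0rho (cabsr r0 t r00)) _ e2.
  have k0 : 0 < s / 2 / (r0 + 1) by rewrite !divr_gt0// ltr_wpDl.
  have [u u0 hu] := cderiv_cont (cderiv_cexp ('i * t%:C)) k0.
  have cE (x : R) : cis x = cexp ('i * x%:C).
    by rewrite /cexp/= !(mulr0, mul0r, mul1r, addr0, add0r, subr0) oppr0 expR0 rmorph1 mul1r.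
  exists u => // p q _ pt tq _ pqu; exists (s / 2); first by rewrite divr_gt0.
  move=> r x r_ge0 rr0 /andP[px xq].
  have xt : `|x - t| <= u by rewrite ler_norml; apply/andP; split; lra.
  have := hu ('i * (x - t)%:C); rewrite cabsM cabs_imag mul1r cabs_real => /(_ xt).
  have -> : 'i * t%:C + 'i * (x - t)%:C = 'i * x%:C :> R[i] by rewrite real_complexB; ring.
  rewrite -!cE => h.
  have h2 : cabs (r0%:C * (cis x - cis t)) <= s / 2.
    rewrite cabs_pmul// (le_trans (ler_wpM2l r00 h))// mulrCA ler_piMr ?divr_ge0 ?(ltW s0)//.
    by rewrite ler_pdivrMr ?mul1r ?lerDl// ltr_wpDl.
  have E1 : F (r0%:C * cis x) = F (r0%:C * cis t + r0%:C * (cis x - cis t)) by congr F; ring.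
  have E2 : F (r%:C * cis x) =
      F (r0%:C * cis t + ((r - r0)%:C * cis x + r0%:C * (cis x - cis t))).
    by congr F; rewrite real_complexB; ring.
  have k1 := hs (r0%:C * (cis x - cis t)); rewrite -E1 in k1.
  have k2 := hs ((r - r0)%:C * cis x + r0%:C * (cis x - cis t)); rewrite -E2 in k2.
  have -> : F (r%:C * cis x) - F (r0%:C * cis x) =
    (F (r%:C * cis x) - F (r0%:C * cis t)) - (F (r0%:C * cis x) - F (r0%:C * cis t)) by ring.
  apply: (le_trans (cabsB _ _)).
  have := k1 (le_trans h2 _); have := k2 (le_trans (cabsD _ _) _).
  rewrite cabsM cabs_real cabs_cis mulr1; have := (lerD rr0 h2).
  by rewrite -splitr => hh /(_ hh) l1 /(_ _) l2; have {}l2 : _ <= e / 2 := l2 ltac:(lra); lra.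
exists del => // r rr hr.
rewrite /circ -avgB; [|exact: rcr|by apply: rcr; rewrite r00].
apply: avg_bound => [|t tt]; last by apply: hdel => //; case/andP: rr.
have := rcr _ rr => c1; have c2 : rc (fun t => F (r0%:C * cis t)) by apply: rcr; rewrite r00.
move=> t tt k k0; have k2 : 0 < k / 2 by rewrite divr_gt0.
have [s s0 hs] := c1 t tt _ k2; have [u u0 hu] := c2 t tt _ k2.
exists (Num.min s u); first by rewrite lt_min s0.
move=> x xx; rewrite le_min => /andP[/(hs _ xx) h1 /(hu _ xx) h2].
set A := F _ in h1 *; set B := F _ in h1 *; set C := F _ in h2 *; set D := F _ in h2 *.
have -> : A - C - (B - D) = (A - B) - (C - D) by ring.
rewrite (le_trans (cabsB _ _))//; lra.
Qed.

Lemma circ0 F : circ F 0 = F 0.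
Proof. by rewrite /circ; under eq_fun do rewrite mul0r; rewrite avg_cst. Qed.

(** The mean is constant for radii below [s] and for radii above it, and continuity in the radius
    joins both ranges with the centre. The exceptional circle is there for the difference quotient
    in Cauchy's formula, which is merely continuous at one point. *)
Lemma circ_mean F rho s : 0 <= s -> s < rho -> (forall z, cabs z <= rho -> ccont F z) ->
  (forall z, cabs z <= rho -> cabs z != s -> cdiff F z) -> circ F rho = F 0.
Proof.
move=> s0 srho Fc Fd; have rho0 := le_lt_trans s0 srho.
apply/eqP; rewrite -subr_eq0 -cabs_eq0 eq_le cabs_ge0 andbT; apply/ler_addgt0Pr => e e0.
rewrite add0r; have e3 : 0 < e / 3 by rewrite divr_gt0.
have [d d0 hd] := circ_cont Fc (introT andP (conj (lexx 0) (ltW rho0))) e3.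
have [d' d'0 hd'] := circ_cont Fc (introT andP (conj s0 (ltW srho))) e3.
have outer r : s < r -> r <= rho -> circ F r = circ F rho.
  move=> sr rrho; apply: circ_const => //; first exact: le_lt_trans sr.
  by move=> z /andP[z1 z2]; apply: Fd => //; rewrite gt_eqF// (lt_le_trans sr).
pose r2 := Num.min rho (s + d').
have sr2 : s < r2 by rewrite lt_min srho ltrDl.
have r2rho : r2 <= rho by rewrite ge_min lexx.
have r2d : r2 <= s + d' by rewrite ge_min lexx orbT.
have k2 : cabs (circ F rho - circ F s) <= e / 3.
  rewrite -(outer r2)//; apply: hd'; first by rewrite r2rho andbT; lra.
  by rewrite ger0_norm; lra.
have k1 : cabs (circ F s - circ F 0) <= e / 3 + e / 3.
  have [->|sn0] := eqVneq s 0; first by rewrite subrr cabs0; lra.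
  have sp : 0 < s by rewrite lt0r sn0.
  pose r := Num.min d (s / 2); pose r1 := Num.max r (s - d').
  have r0 : 0 < r by rewrite lt_min d0 divr_gt0.
  have rd : r <= d by rewrite ge_min lexx.
  have rs : r <= s / 2 by rewrite ge_min lexx orbT.
  have r1s : r1 < s by rewrite gt_max; apply/andP; split; lra.
  have rr1 : r <= r1 by rewrite le_max lexx.
  have r1d : s - d' <= r1 by rewrite le_max lexx orbT.
  have E : circ F r = circ F r1.
    apply: circ_const => // z /andP[z1 z2]; apply: Fd; first by lra.
    by rewrite lt_eqF// (le_lt_trans z2).
  have h1 : cabs (circ F r - circ F 0) <= e / 3.
    by apply: hd; [apply/andP; split; lra|rewrite subr0 ger0_norm// ltW].
  have h2 : cabs (circ F r1 - circ F s) <= e / 3.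
    by apply: hd'; [apply/andP; split; lra|rewrite ler0_norm; lra].
  have -> : circ F s - circ F 0 = (circ F r - circ F 0) - (circ F r1 - circ F s).
    by rewrite E; ring.
  by rewrite (le_trans (cabsB _ _))// lerD.
rewrite -(circ0 F).
have -> : circ F rho - circ F 0 = (circ F rho - circ F s) + (circ F s - circ F 0) by ring.
rewrite (le_trans (cabsD _ _))//; lra.
Qed.

End averages.

(** * Cauchy's formula on circles and the Taylor expansion *)

Section cauchy.
Variable R : realType.
Implicit Types (gam : R -> R[i]) (F G f g : R[i] -> R[i]) (z w : R[i]).

Local Notation tau := (pi *+ 2 : R).

Lemma cabs_circle (r t : R) : 0 <= r -> cabs (r%:C * cis t : R[i]) = r.
Proof. by move=> r0; rewrite cabs_pmul// cabs_cis mulr1. Qed.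

Lemma circ_ext F G (r : R) : 0 <= r -> (forall z, cabs z = r -> F z = G z) ->
  circ F r = circ G r.
Proof.
move=> r0 FG; rewrite /circ; congr (avg _); apply: funext => t.
by apply: FG; rewrite cabs_circle.
Qed.

Definition diff_on_circle F (r : R) := forall z, cabs z = r -> cdiff F z.

Lemma rc_diff F (r : R) : 0 <= r -> diff_on_circle F r -> rc (fun t => F (r%:C * cis t)).
Proof.
by move=> r0 Fd; apply: rc_circ => z; rewrite ger0_norm// => /Fd/cdiff_cont.
Qed.

Lemma circD F G (r : R) : 0 <= r -> diff_on_circle F r -> diff_on_circle G r ->
  circ (fun z => F z + G z) r = circ F r + circ G r.
Proof. by move=> r0 Fd Gd; rewrite /circ avgD//; exact: rc_diff. Qed.

Lemma circB F G (r : R) : 0 <= r -> diff_on_circle F r -> diff_on_circle G r ->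
  circ (fun z => F z - G z) r = circ F r - circ G r.
Proof. by move=> r0 Fd Gd; rewrite /circ avgB//; exact: rc_diff. Qed.

Lemma circZ F c (r : R) : 0 <= r -> diff_on_circle F r ->
  circ (fun z => c * F z) r = c * circ F r.
Proof. by move=> r0 Fd; rewrite /circ avgZ//; exact: rc_diff. Qed.

Lemma circ_cst c (r : R) : circ (fun=> c) r = c.
Proof. by rewrite /circ avg_cst. Qed.

Lemma circ_sum (r : R) (n : nat) (h : nat -> R[i] -> R[i]) : 0 <= r ->
  (forall i, diff_on_circle (h i) r) ->
  circ (fun z => \sum_(i < n) h i z) r = \sum_(i < n) circ (h i) r.
Proof.
move=> r0 hd; elim: n => [|n ih].
  by under eq_fun do rewrite big_ord0; rewrite big_ord0 circ_cst.
under eq_fun do rewrite big_ord_recr/=; rewrite circD//.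
- by rewrite big_ord_recr/= ih.
- by move=> z zr; apply: (@cdiff_sum R _ _ (fun i : 'I_n => h i)) => i; exact: hd.
Qed.

Lemma circ_bound F (r m : R) : 0 <= r -> diff_on_circle F r ->
  (forall t, 0 <= t <= tau -> cabs (F (r%:C * cis t)) <= m) -> cabs (circ F r) <= m.
Proof. by move=> r0 Fd Fm; apply: avg_bound => //; exact: rc_diff. Qed.

Lemma circle_neq (r : R) z w : cabs z < r -> cabs w = r -> w - z != 0.
Proof.
by move=> zr wr; rewrite subr_eq0; apply: contraTneq zr => <-; rewrite wr ltxx.
Qed.

(** The mean does not change when the radius grows, and the integrand tends to 1 at infinity. *)
Lemma circ_kernel (r : R) z : cabs z < r -> circ (fun w => w / (w - z)) r = 1.
Proof.
move=> zr; have r0 : 0 < r by rewrite (le_lt_trans (cabs_ge0 z)).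
have kd w : cabs z < cabs w -> cdiff (fun w => w / (w - z)) w.
  move=> zw; apply: cdiffM; first exact: cdiff_id.
  apply: cdiffV; first exact: circle_neq zw _.
  by apply: cdiffB; [exact: cdiff_id|exact: cdiff_const].
apply/eqP; rewrite -subr_eq0 -cabs_eq0 eq_le cabs_ge0 andbT; apply/ler_addgt0Pr => e e0.
rewrite add0r.
(* On this radius the deviation from 1, at most [cabs z / (s - cabs z)], is below [e]. *)
pose s := Num.max r (cabs z + cabs z / e).
have rs : r <= s by rewrite le_max lexx.
have s1 : cabs z + cabs z / e <= s by rewrite le_max lexx orbT.
have s0 := lt_le_trans r0 rs.
rewrite (circ_const r0 rs); last first.
  by move=> w /andP[rw _]; apply: kd; exact: lt_le_trans rw.
have kds : diff_on_circle (fun w => w / (w - z)) s.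
  by move=> w ws; apply: kd; rewrite ws (lt_le_trans zr).
rewrite -(circ_cst 1 s) -circB ?(ltW s0)//; last by move=> w _; exact: cdiff_const.
apply: circ_bound; first exact: ltW.
  by move=> w ws; apply: cdiffB; [exact: kds|exact: cdiff_const].
move=> t _; set w := _%:C * _; have ws : cabs w = s by rewrite cabs_circle// ltW.
have wz : w - z != 0 by apply: circle_neq ws; rewrite (lt_le_trans zr).
have -> : w / (w - z) - 1 = z / (w - z) by field.
rewrite cabsM cabsV ler_pdivrMr ?cabs_gt0//.
have := cabs_sub_ge w z; rewrite ws => h.
apply: le_trans (ler_wpM2l (ltW e0) h).
rewrite mulrC -ler_pdivrMr//; lra.
Qed.

(** With the difference quotient [q] at [z], the integrand is [w * q w] plus [f z] times the kernel.
    The first has mean 0, its value at the centre, by [circ_mean] with the exceptional circle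
    through [z]. *)
Lemma cauchy_formula f (r : R) z : (forall w, cabs w <= r -> cdiff f w) -> cabs z < r ->
  circ (fun w => f w * (w / (w - z))) r = f z.
Proof.
move=> fd zr; have r0 : 0 < r by rewrite (le_lt_trans (cabs_ge0 z)).
have [D /cderivP[q [qc qz qE]]] := fd z (ltW zr).
have qE' w : f w = f z + (w - z) * q w.
  by have := qE (w - z); rewrite [z + _]addrC subrK.
have qd w : cabs w <= r -> w != z -> cdiff q w.
  move=> wr wz; have wz0 : w - z != 0 by rewrite subr_eq0.
  have d1 : cdiff (fun u => (f u - f z) / (u - z)) w.
    apply: cdiffM; first by apply: cdiffB; [exact: fd|exact: cdiff_const].
    by apply: cdiffV => //; apply: cdiffB; [exact: cdiff_id|exact: cdiff_const].
  case: d1 => d d1; exists d => e e0; have [s s0 hs] := d1 e e0.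
  have wz0' : 0 < cabs (w - z) by rewrite cabs_gt0.
  exists (Num.min s (cabs (w - z) / 2)); first by rewrite lt_min s0 divr_gt0.
  move=> h; rewrite le_min => /andP[/hs h1 h2]; move: h1.
  have -> : (f (w + h) - f z) / (w + h - z) = q (w + h).
    rewrite qE' [f z + _]addrC addrK mulrAC divff ?mul1r// -cabs_gt0.
    have -> : w + h - z = (w - z) - (- h) by ring.
    have := cabs_sub_ge (w - z) (- h); rewrite cabsN; lra.
  have -> // : (f w - f z) / (w - z) = q w.
  by rewrite [f w]qE' [f z + _]addrC addrK mulrAC divff ?mul1r.
have qcont w : cabs w <= r -> ccont q w.
  by move=> wr; have [->//|wz] := eqVneq w z; apply: cdiff_cont; exact: qd.
have m0 : circ (fun w => w * q w) r = 0.
  rewrite (@circ_mean _ (fun w => w * q w) r (cabs z)) ?cabs_ge0 ?mul0r//.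
    by move=> w wr; apply: ccontM; [exact: ccont_id|exact: qcont].
  move=> w wr wz; apply: cdiffM; [exact: cdiff_id|apply: qd => //].
  by apply: contraNneq wz => ->.
have kd : diff_on_circle (fun w => w / (w - z)) r.
  move=> w wr; apply: cdiffM; first exact: cdiff_id.
  apply: cdiffV; first exact: circle_neq wr.
  by apply: cdiffB; [exact: cdiff_id|exact: cdiff_const].
transitivity (circ (fun w => w * q w + f z * (w / (w - z))) r).
  apply: circ_ext; first exact: ltW.
  move=> w wr; rewrite {1}qE'; have wz := circle_neq zr wr.
  by field.
rewrite circD ?(ltW r0)//.
- by rewrite m0 add0r circZ ?(ltW r0)// circ_kernel// mulr1.
- move=> w wr; apply: cdiffM; [exact: cdiff_id|apply: qd; rewrite ?wr//].
  by rewrite -subr_eq0 (circle_neq zr).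
- by move=> w wr; apply: cdiffM; [exact: cdiff_const|exact: kd].
Qed.

Definition tcoef f (r : R) (n : nat) := circ (fun w => f w * w ^- n) r.

Lemma diff_tcoef f (r : R) n : 0 < r -> (forall w, cabs w <= r -> cdiff f w) ->
  diff_on_circle (fun w => f w * w ^- n) r.
Proof.
move=> r0 fd w wr; apply: cdiffM; first by apply: fd; rewrite wr.
by apply: cdiffV; [rewrite expf_neq0// -cabs_gt0 wr|apply: cdiffX; exact: cdiff_id].
Qed.

Lemma tcoef_bound f (r M : R) n : 0 < r -> (forall w, cabs w <= r -> cdiff f w) ->
  (forall t, 0 <= t <= tau -> cabs (f (r%:C * cis t)) <= M) -> cabs (tcoef f r n) <= M / r ^+ n.
Proof.
move=> r0 fd fM; apply: circ_bound; [exact: ltW|exact: diff_tcoef|].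
move=> t tt; rewrite cabsM cabsV cabsX cabs_circle ?(ltW r0)//.
by rewrite ler_wpM2r ?fM// invr_ge0 exprn_ge0// ltW.
Qed.

(** Subtracting N terms of the geometric series from the Cauchy kernel multiplies it by (z /
    w)^N. *)
Lemma taylor f (r M : R) N z : 0 < r -> (forall w, cabs w <= r -> cdiff f w) ->
  (forall t, 0 <= t <= tau -> cabs (f (r%:C * cis t)) <= M) -> cabs z < r ->
  cabs (f z - \sum_(n < N) tcoef f r n * z ^+ n) <=
  M * ((cabs z / r) ^+ N / (1 - cabs z / r)).
Proof.
move=> r0 fd fM zr; rewrite -(cauchy_formula fd zr).
have r_ge0 := ltW r0.
have td n : diff_on_circle (fun w => z ^+ n * (f w * w ^- n)) r.
  by move=> w wr; apply: cdiffM; [exact: cdiff_const|exact: (diff_tcoef n r0 fd)].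
have -> : \sum_(n < N) tcoef f r n * z ^+ n =
    circ (fun w => \sum_(n < N) z ^+ n * (f w * w ^- n)) r.
  rewrite (circ_sum _ r_ge0 td); apply: eq_bigr => n _.
  by rewrite (circZ _ r_ge0 (diff_tcoef n r0 fd)) mulrC.
have kd : diff_on_circle (fun w => f w * (w / (w - z))) r.
  move=> w wr; apply: cdiffM; first by apply: fd; rewrite wr.
  apply: cdiffM; first exact: cdiff_id.
  apply: cdiffV; first exact: circle_neq wr.
  by apply: cdiffB; [exact: cdiff_id|exact: cdiff_const].
have sd : diff_on_circle (fun w => \sum_(n < N) z ^+ n * (f w * w ^- n)) r.
  by move=> w wr; apply: (@cdiff_sum R _ _ (fun (n : 'I_N) w => z ^+ n * (f w * w ^- n))) => n; exact: td.
rewrite -circB//; apply: circ_bound => //.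
  by move=> w wr; apply: cdiffB; [exact: kd|exact: sd].
move=> t tt; have := fM t tt; set w := _%:C * _ => fw.
have wr : cabs w = r by rewrite cabs_circle.
have w0 : w != 0 by rewrite -cabs_gt0 wr.
have wz := circle_neq zr wr.
clearbody w.
have -> : f w * (w / (w - z)) - \sum_(n < N) z ^+ n * (f w * w ^- n) =
   f w * ((z / w) ^+ N * (w / (w - z))).
  elim: N {td sd} => [|N ih]; first by rewrite big_ord0 subr0 expr0 mul1r.
  rewrite big_ord_recr/= opprD addrA ih exprS expr_div_n; field.
  by rewrite wz w0 expf_neq0.
rewrite cabsM ler_pM ?cabs_ge0// cabsM cabsX !cabsM !cabsV wr ler_wpM2l//.
  by rewrite exprn_ge0// divr_ge0// cabs_ge0.
rewrite ler_pdivrMr ?cabs_gt0// ler_pdivlMl; last first.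
  by rewrite subr_gt0 ltr_pdivrMr// mul1r.
by rewrite mulrBl mul1r divfK ?lt0r_neq0//; have := cabs_sub_ge w z; rewrite wr.
Qed.

Lemma rc_bounded gam : rc gam -> exists2 M : R, 0 <= M & forall t, 0 <= t <= tau -> cabs (gam t) <= M.
Proof.
move=> gc; pose Q (s t : R) := 0 <= s -> t <= tau -> exists2 M : R, 0 <= M &
  forall x, s <= x <= t -> cabs (gam x) <= M.
have : Q 0 tau.
  apply: (@cousin R Q); last exact: ltW (tau_gt0 R).
    move=> x y z xy yz h1 h2 x0 zt.
    have [M1 M10 k1] := h1 x0 (le_trans yz zt); have [M2 M20 k2] := h2 (le_trans x0 xy) zt.
    exists (Num.max M1 M2); first by rewrite le_max M10.
    move=> u /andP[xu uz]; rewrite le_max.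
    by have [uy|yu] := leP u y; [rewrite k1// xu|rewrite k2 ?orbT// uz ltW].
  move=> x x0t; have [r r0 hr] := gc x x0t _ ltr01.
  exists r => // u v _ ux xv _ vur u0 vt; exists (cabs (gam x) + 1); first by rewrite addr_ge0 ?cabs_ge0.
  move=> s /andP[us sv]; rewrite -[gam s](subrK (gam x)) (le_trans (cabsD _ _))// addrC lerD2l.
  apply: hr; first by rewrite (le_trans u0)//= (le_trans sv).
  by rewrite ler_norml; apply/andP; split; lra.
by apply => //.
Qed.

(** Cauchy's formula, the case N = 0 of [taylor], reduces the disc to a larger circle, where a
    continuous function of the angle is bounded. *)
Lemma disc_bounded f (r r' : R) : 0 < r -> r < r' -> (forall w, cabs w <= r' -> cdiff f w) ->
  exists2 M : R, 0 < M & forall w, cabs w <= r -> cabs (f w) <= M.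
Proof.
move=> r0 rr' fd; have r'0 := lt_trans r0 rr'.
have fdc : diff_on_circle f r' by move=> w wr; apply: fd; rewrite wr.
have [M M0 hM] := rc_bounded (rc_diff (ltW r'0) fdc).
have k0 : 0 < 1 - r / r' by rewrite subr_gt0 ltr_pdivrMr// mul1r.
exists (M / (1 - r / r') + 1); first by rewrite ltr_wpDl// divr_ge0// ltW.
move=> w wr; have := taylor 0 r'0 fd hM (le_lt_trans wr rr').
rewrite big_ord0 subr0 expr0 mul1r => /le_trans; apply.
apply: (@le_trans _ _ (M / (1 - r / r'))); last by rewrite lerDl.
rewrite ler_wpM2l// lef_pV2 ?posrE//.
  by rewrite lerB// ler_pM2r// invr_gt0.
by rewrite subr_gt0 ltr_pdivrMr// mul1r (le_lt_trans wr).
Qed.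

End cauchy.

(** * Entire functions: limits, division by zeros, derivatives *)

Section holomorphic.
Variable R : realType.
Implicit Types (f g q : R[i] -> R[i]) (z w c : R[i]).

Definition ent f := forall z, cdiff f z.

Lemma ent_bounded f (r : R) : ent f -> exists2 M : R, 0 < M & forall w, cabs w <= r -> cabs (f w) <= M.
Proof.
move=> fe; have m0 : 0 < Num.max 1 r by rewrite lt_max ltr01.
have [|M M0 hM] := @disc_bounded _ f (Num.max 1 r) (Num.max 1 r + 1) m0 _ (fun w _ => fe w).
  by rewrite ltrDl.
by exists M => // w wr; apply: hM; rewrite le_max wr orbT.
Qed.

Lemma cderiv_shift f c z d : cderiv f (c + z) d <-> cderiv (fun w => f (c + w)) z d.
Proof. by split=> h e /h [r r0 hr]; exists r => // u /hr; rewrite addrA. Qed.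

Lemma cdiff_shift f c z : cdiff f (c + z) -> cdiff (fun w => f (c + w)) z.
Proof. by move=> [d /cderiv_shift]; exists d. Qed.

Lemma ent_shift f c : ent f -> ent (fun w => f (c + w)).
Proof. by move=> fe z; apply: cdiff_shift. Qed.

Lemma cderiv_unique f z a b : cderiv f z a -> cderiv f z b -> a = b.
Proof.
move=> fa fb; apply/eqP; rewrite -subr_eq0 -cabs_eq0 eq_le cabs_ge0 andbT.
apply/ler_addgt0Pr => e e0; rewrite add0r; have e2 : 0 < e / 2 by rewrite divr_gt0.
have [r r0 hr] := fa _ e2; have [s s0 hs] := fb _ e2.
set t := Num.min r s; have t0 : 0 < t by rewrite lt_min r0.
have tt : cabs (t%:C : R[i]) = t by rewrite cabs_real gtr0_norm.
have := hr t%:C; have := hs t%:C; rewrite tt !ge_min !lexx orbT => /(_ isT) h1 /(_ isT) h2.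
rewrite -(ler_pM2l t0) -[X in X * cabs _]tt -cabsM.
have -> : t%:C * (a - b) = (f (z + t%:C) - f z - t%:C * b) - (f (z + t%:C) - f z - t%:C * a) by ring.
rewrite (le_trans (cabsB _ _))//; lra.
Qed.

(** The constants depend on [r] and [M] only; this uniformity is what makes a sequence of functions
    tractable in [limit_cderiv]. *)
Lemma taylor1 f c (r M : R) : 0 < r -> (forall w, cabs w <= r -> cdiff f (c + w)) ->
  (forall w, cabs w <= r -> cabs (f (c + w)) <= M) ->
  exists d, [/\ cderiv f c d, cabs d <= M / r &
    forall h, cabs h <= r / 2 -> cabs (f (c + h) - f c - h * d) <= 2 * M / r ^+ 2 * cabs h ^+ 2].
Proof.
move=> r0 fd fM.
have gd w : cabs w <= r -> cdiff (fun w => f (c + w)) w by move=> wr; apply: cdiff_shift; exact: fd.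
have gM t : 0 <= t <= pi *+ 2 -> cabs (f (c + r%:C * cis t)) <= M.
  by move=> _; apply: fM; rewrite cabs_circle// ltW.
have M0 : 0 <= M by rewrite (le_trans (cabs_ge0 _) (fM 0 _))// cabs0 ltW.
set d := tcoef (fun w => f (c + w)) r 1.
have est h : cabs h <= r / 2 -> cabs (f (c + h) - f c - h * d) <= 2 * M / r ^+ 2 * cabs h ^+ 2.
  move=> hr; have hr' : cabs h < r by lra.
  have a0 : tcoef (fun w => f (c + w)) r 0 = f c.
    apply/eqP; rewrite eq_sym -subr_eq0 -cabs_eq0 eq_le cabs_ge0 andbT.
    have := taylor 1 r0 gd gM (eq_ind_r (fun x => x < r) r0 (cabs0 R)).
    by rewrite big_ord1 cabs0 mul0r !expr0n/= !(mul0r, mulr0, mulr1, addr0).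
  have := taylor 2 r0 gd gM hr'.
  rewrite !big_ord_recr big_ord0/= add0r a0 expr0 mulr1 expr1 -/d opprD addrA [d * h]mulrC.
  move=> /le_trans; apply.
  have -> : 2 * M / r ^+ 2 * cabs h ^+ 2 = M * ((cabs h / r) ^+ 2 * 2).
    by rewrite expr_div_n; field; rewrite lt0r_neq0.
  rewrite ler_wpM2l// ler_wpM2l ?exprn_ge0 ?divr_ge0 ?cabs_ge0 ?(ltW r0)//.
  have k : cabs h / r <= 2^-1 by rewrite ler_pdivrMr// mulrC.
  rewrite -[leRHS]invrK lef_pV2 ?posrE ?invr_gt0//; lra.
exists d; split => //; last by have := tcoef_bound 1 r0 gd gM; rewrite expr1.
move=> e e0; have k0 : 0 < 2 * M / r ^+ 2 + 1.
  by rewrite ltr_wpDl// divr_ge0 ?mulr_ge0 ?exprn_ge0 ?(ltW r0)//.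
exists (Num.min (r / 2) (e / (2 * M / r ^+ 2 + 1))); first by rewrite lt_min !divr_gt0.
move=> h; rewrite le_min => /andP[/est h1]; rewrite ler_pdivlMr// => h2.
rewrite (le_trans h1)// expr2 mulrA ler_wpM2r ?cabs_ge0// mulrC (le_trans _ h2)//.
by rewrite ler_wpM2l ?cabs_ge0// lerDl.
Qed.

Definition ccvg (s : nat -> R[i]) l := forall e : R, 0 < e ->
  exists N0, forall N, (N0 <= N)%N -> cabs (s N - l) <= e.

Lemma ccvg_complete (s : nat -> R[i]) :
  (forall e : R, 0 < e -> exists N0, forall m n, (N0 <= m)%N -> (N0 <= n)%N -> cabs (s m - s n) <= e) ->
  exists l, ccvg s l.
Proof.
move=> cs.
have real (q : R[i] -> R) : (forall z, `|q z| <= cabs z) ->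
    (forall z w, q (z - w) = q z - q w) -> exists l : R, forall e : R, 0 < e ->
    exists N0, forall N, (N0 <= N)%N -> `|q (s N) - l| <= e.
  move=> qc qB; pose u := (fun n => q (s n)) : R^nat.
  have : cvg (u @ \oo).
    apply/cauchy_cvgP/cauchy_exP => e e0.
    have e2 : 0 < e / 2 by rewrite divr_gt0.
    have [N0 hN0] := cs _ e2; exists (u N0); exists N0 => // n /= Nn.
    rewrite /ball/= /u -qB (le_lt_trans (qc _))//.
    by rewrite (le_lt_trans (hN0 _ _ _ _))// ltr_pdivrMr// ltr_pMr// ltr1n.
  move=> /cvg_ex[l /cvgrPdist_le ul]; exists l => e e0.
  have [N0 _ hN0] := ul e e0; exists N0 => N NN.
  by rewrite distrC; exact: hN0.
have [a ha] := real (@complex.Re R) (@Re_le_cabs R) (fun z w => etrans (ReD _ _) (congr1 _ (ReN w))).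
have [b hb] := real (@complex.Im R) (@Im_le_cabs R) (fun z w => etrans (ImD _ _) (congr1 _ (ImN w))).
exists (a +i* b) => e e0; have e2 : 0 < e / 2 by rewrite divr_gt0.
have [N1 h1] := ha _ e2; have [N2 h2] := hb _ e2.
exists (maxn N1 N2) => N; rewrite geq_max => /andP[/h1 k1 /h2 k2].
by rewrite (le_trans (cabs_le_sum _))// ReD ReN ImD ImN/=; lra.
Qed.

(** Weierstrass' theorem. By the Cauchy estimates all [F N] share one quadratic remainder, so their
    derivatives at [c] are compared through the difference quotients of a single small step, where
    the values converge. *)
Lemma limit_cderiv (F : nat -> R[i] -> R[i]) f c (r M : R) : 0 < r ->
  (forall N w, cabs w <= r -> cdiff (F N) (c + w)) ->
  (forall N w, cabs w <= r -> cabs (F N (c + w)) <= M) ->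
  (forall w, cabs w <= r -> ccvg (fun N => F N (c + w)) (f (c + w))) ->
  exists2 d, cderiv f c d & forall a, (forall N, cderiv (F N) c (a N)) -> ccvg a d.
Proof.
move=> r0 Fd FM Fl.
have M0 : 0 <= M by rewrite (le_trans (cabs_ge0 _) (FM 0%N 0 _))// cabs0 ltW.
have [a ha] := choice (fun N => taylor1 r0 (Fd N) (FM N)).
set K := 2 * M / r ^+ 2 in ha.
have K0 : 0 <= K by rewrite divr_ge0 ?mulr_ge0 ?exprn_ge0 ?(ltW r0)//.
have F0 : ccvg (fun N => F N c) (f c).
  by have := Fl 0; rewrite addr0 cabs0; apply; exact: ltW.
have [d hd] : exists d, ccvg a d.
  apply: ccvg_complete => e e0.
  (* Each remainder is then at most e t / 4. Together with four errors e t / 8 of the values at [c]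
     and [c + t] this gives e t. *)
  pose t := Num.min (r / 2) (e / 4 / (K + 1)).
  have K1 : 0 < K + 1 by rewrite ltr_wpDl.
  have t0 : 0 < t by rewrite lt_min !divr_gt0.
  have tr : t <= r / 2 by rewrite ge_min lexx.
  have tK : K * t <= e / 4.
    have : t <= e / 4 / (K + 1) by rewrite ge_min lexx orbT.
    by rewrite ler_pdivlMr//; nra.
  have tc : cabs (t%:C : R[i]) = t by rewrite cabs_real gtr0_norm.
  have te : 0 < e * t / 8 by rewrite divr_gt0 ?mulr_gt0.
  have [N1 h1] := F0 _ te; have [|N2 h2] := Fl t%:C _ _ te; first by rewrite tc; lra.
  exists (maxn N1 N2) => m n; rewrite !geq_max => /andP[m1 m2] /andP[n1 n2].
  rewrite -(ler_pM2r t0) -{1}tc -cabsM.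
  have [_ _ em] := ha m; have [_ _ en] := ha n.
  have {}em := em t%:C; have {}en := en t%:C; rewrite tc in em en.
  have {}em := em tr; have {}en := en tr.
  have -> : (a m - a n) * t%:C =
    ((F m (c + t%:C) - f (c + t%:C)) - (F m c - f c) - (F m (c + t%:C) - F m c - t%:C * a m))
    - ((F n (c + t%:C) - f (c + t%:C)) - (F n c - f c) - (F n (c + t%:C) - F n c - t%:C * a n)) by ring.
  have tri (x y z : R[i]) (b1 b2 b3 : R) : cabs x <= b1 -> cabs y <= b2 -> cabs z <= b3 ->
      cabs (x - y - z) <= b1 + b2 + b3.
    by move=> ? ? ?; rewrite (le_trans (cabsB _ _))// lerD// (le_trans (cabsB _ _))// lerD.
  rewrite (le_trans (cabsB _ _))//.
  have := tri _ _ _ _ _ _ (h2 _ m2) (h1 _ m1) em.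
  have := tri _ _ _ _ _ _ (h2 _ n2) (h1 _ n1) en.
  have : K * t ^+ 2 <= e / 4 * t by rewrite expr2 mulrA ler_wpM2r// ltW.
  lra.
have est h : cabs h <= r / 2 -> cabs (f (c + h) - f c - h * d) <= K * cabs h ^+ 2.
  move=> hr; have hr' : cabs h <= r by lra.
  apply/ler_addgt0Pr => e e0.
  pose k := e / (2 + cabs h).
  have c2 : 0 < 2 + cabs h by rewrite ltr_wpDr ?cabs_ge0.
  have k0 : 0 < k by rewrite divr_gt0.
  have [N1 h1] := F0 _ k0; have [N2 h2] := Fl h hr' _ k0; have [N3 h3] := hd _ k0.
  pose N := maxn N1 (maxn N2 N3).
  have {}h1 := h1 N (leq_maxl _ _).
  have {}h2 := h2 N (leq_trans (leq_maxl _ _) (leq_maxr _ _)).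
  have {}h3 := h3 N (leq_trans (leq_maxr _ _) (leq_maxr _ _)).
  have [_ _ /(_ h hr) h4] := ha N.
  have -> : f (c + h) - f c - h * d = (F N (c + h) - F N c - h * a N)
    - ((F N (c + h) - f (c + h)) - (F N c - f c) - h * (a N - d)) by ring.
  rewrite (le_trans (cabsB _ _))// lerD//.
  have -> : e = k + k + cabs h * k by rewrite /k; field; rewrite lt0r_neq0.
  rewrite (le_trans (cabsB _ _))// lerD// ?(le_trans (cabsB _ _))// ?lerD//.
  by rewrite cabsM ler_wpM2l ?cabs_ge0.
exists d; last first.
  by move=> b hb; have -> // : b = a; apply: funext => N; apply: cderiv_unique (hb N) _; have [] := ha N.
move=> e e0; have K1 : 0 < K + 1 by rewrite ltr_wpDl.
exists (Num.min (r / 2) (e / (K + 1))); first by rewrite lt_min !divr_gt0.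
move=> h; rewrite le_min => /andP[/est h1]; rewrite ler_pdivlMr// => h2.
rewrite (le_trans h1)// expr2 mulrA ler_wpM2r ?cabs_ge0// mulrC (le_trans _ h2)//.
by rewrite ler_wpM2l ?cabs_ge0// lerDl.
Qed.

Lemma ent_limit (F : nat -> R[i] -> R[i]) f : (forall N, ent (F N)) ->
  (forall r : R, exists M : R, forall N w, cabs w <= r -> cabs (F N w) <= M) ->
  (forall w, ccvg (fun N => F N w) (f w)) -> ent f.
Proof.
move=> Fe Fb Fl c; have [M hM] := Fb (cabs c + 1).
have [] := @limit_cderiv F f c 1 M ltr01 (fun N w _ => Fe N _) _ (fun w _ => Fl _).
  by move=> N w w1; apply: hM; rewrite (le_trans (cabsD _ _))// lerD2l.
by move=> d fd _; exists d.
Qed.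

Lemma cdiff_local f g z : (exists2 r : R, 0 < r & forall h, cabs h <= r -> f (z + h) = g (z + h)) ->
  cdiff g z -> cdiff f z.
Proof.
move=> [r r0 fg] [d gd]; exists d => e e0; have [s s0 hs] := gd e e0.
exists (Num.min r s); first by rewrite lt_min r0.
move=> h; rewrite le_min => /andP[/fg -> /hs].
by have := fg 0; rewrite addr0 cabs0 => -> //; exact: ltW.
Qed.

(** The removable singularity: at [w] the quotient takes the Taylor coefficient [a 1], and the
    expansion with three terms shows that its derivative there is [a 2]. *)
Lemma ent_division f w : ent f -> f w = 0 ->
  exists2 q, ent q & forall z, f z = (z - w) * q z.
Proof.
move=> fe fw.
have [M M0 hM] := ent_bounded 1 (ent_shift w fe).
have gd u : cabs u <= 1 -> cdiff (fun u => f (w + u)) u by move=> _; exact: ent_shift.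
have gM t : 0 <= t <= pi *+ 2 -> cabs (f (w + 1%:C * cis t)) <= M.
  by move=> _; apply: hM; rewrite cabs_circle.
set a := tcoef (fun u => f (w + u)) 1.
have a0 : a 0%N = 0.
  apply/eqP; rewrite -cabs_eq0 eq_le cabs_ge0 andbT.
  have := taylor 1 ltr01 gd gM (eq_ind_r (fun x => x < 1) ltr01 (cabs0 R)).
  by rewrite big_ord1 cabs0 mul0r !expr0n/= !(mul0r, mulr0, mulr1, addr0) fw sub0r cabsN.
pose q z := if z == w then a 1%N else f z / (z - w).
have qE z : f z = (z - w) * q z.
  rewrite /q; case: eqVneq => [->|zw]; first by rewrite subrr mul0r.
  by rewrite mulrC divfK// subr_eq0.
exists q => // z; have [->|zw] := eqVneq z w; last first.
  apply: (@cdiff_local _ (fun u => f u / (u - w))).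
    have zw0 : 0 < cabs (z - w) by rewrite cabs_gt0 subr_eq0.
    exists (cabs (z - w) / 2) => [|h hh]; first by rewrite divr_gt0.
    rewrite /q ifN// -subr_eq0 -cabs_gt0.
    have -> : z + h - w = (z - w) - (- h) by ring.
    have := cabs_sub_ge (z - w) (- h); rewrite cabsN; lra.
  apply: cdiffM; first exact: fe.
  apply: cdiffV; first by rewrite subr_eq0.
  by apply: cdiffB; [exact: cdiff_id|exact: cdiff_const].
exists (a 2%N) => e e0.
(* The remainder after three terms is at most 2 M |h|^3; after division by h it must stay below e
   |h|. *)
exists (Num.min 2^-1 (e / (2 * M))); first by rewrite lt_min invr_gt0 ltr0n divr_gt0// mulr_gt0.
move=> h; rewrite le_min => /andP[h1 h2].
have [->|h0] := eqVneq h 0; first by rewrite addr0 subrr mul0r subr0 cabs0 mulr0.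
have hp : 0 < cabs h by rewrite cabs_gt0.
have -> : q w = a 1%N by rewrite /q eqxx.
rewrite /q ifN ?addr_eq_self// -(ler_pM2r hp) -cabsM.
have -> : (f (w + h) / (w + h - w) - a 1%N - h * a 2%N) * h =
   f (w + h) - (0 + 0 * h ^+ 0 + a 1%N * h ^+ 1 + a 2%N * h ^+ 2).
  have -> : w + h - w = h by ring.
  by field.
have h1' : cabs h < 1 by rewrite (le_lt_trans h1)// invf_lt1// ltr1n.
have := taylor 3 ltr01 gd gM h1'; rewrite !big_ord_recr big_ord0/= -/a a0 => /le_trans; apply.
rewrite divr1 exprS expr2.
have hh : (1 - cabs h)^-1 <= 2.
  by rewrite -[leRHS]invrK lef_pV2 ?posrE ?invr_gt0//; lra.
move: h2; rewrite ler_pdivlMr ?mulr_gt0// => h2.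
have k : cabs h * cabs h * (cabs h / (1 - cabs h) * M) <= cabs h * cabs h * e.
  rewrite ler_wpM2l ?mulr_ge0 ?cabs_ge0//.
  have : cabs h / (1 - cabs h) <= cabs h * 2 by rewrite ler_wpM2l// ltW.
  nra.
nra.
Qed.

(** Dividing twice at [c] gives f(z) = f(c) + (z - c) q(c) + (z - c)^2 r(z). In the derivative of
    this expression r' occurs with the factor (z - c)^2, so its boundedness near [c] suffices for a
    second derivative. *)
Lemma ent_deriv f : ent f -> exists2 f', ent f' & forall z, cderiv f z (f' z).
Proof.
move=> fe; have [f' hf'] := choice fe; exists f' => // c.
have [q qe qE] : exists2 q, ent q & forall z, f z - f c = (z - c) * q z.
  apply: (@ent_division (fun z => f z - f c)); last by rewrite subrr.
  by move=> z; apply: cdiffB; [exact: fe|exact: cdiff_const].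
have [r re rE] : exists2 q', ent q' & forall z, q z - q c = (z - c) * q' z.
  apply: (@ent_division (fun z => q z - q c)); last by rewrite subrr.
  by move=> z; apply: cdiffB; [exact: qe|exact: cdiff_const].
have [r' hr'] := choice re.
have fE z : f z = f c + (z - c) * q c + (z - c) * (z - c) * r z.
  by rewrite -[f z](subrK (f c)) qE -[q z](subrK (q c)) rE; ring.
have f'E z : f' z = q c + (z - c) * (2 * r z + (z - c) * r' z).
  apply: (cderiv_unique (hf' z)).
  have d1 : cderiv (fun w => w - c) z 1.
    by have := cderivB (cderiv_id z) (cderiv_const c z); rewrite subr0.
  have := cderivD (cderivD (cderiv_const (f c) z) (cderivM d1 (cderiv_const (q c) z)))
     (cderivM (cderivM d1 d1) (hr' z)).
  under eq_fun do rewrite -fE.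
  have -> // : 0 + (1 * q c + (z - c) * 0) + ((1 * (z - c) + (z - c) * 1) * r z + (z - c) * (z - c) * r' z)
    = q c + (z - c) * (2 * r z + (z - c) * r' z) by ring.
have [M M0 hM] := ent_bounded 2 (ent_shift c re).
have r'M h : cabs h <= 1 -> cabs (r' (c + h)) <= M.
  move=> h1; have [|d [rd dM _]] := @taylor1 r (c + h) 1 M ltr01 (fun w _ => re _) _.
    move=> w w1; rewrite -addrA; apply: hM; rewrite (le_trans (cabsD _ _))//; lra.
  by rewrite (cderiv_unique (hr' (c + h)) rd); rewrite divr1 in dM.
exists (2 * r c); apply/cderivP; exists (fun w => 2 * r w + (w - c) * r' w); split.
- apply: ccontD; first by apply: ccontM; [exact: ccont_const|exact: cdiff_cont].
  move=> e e0; exists (Num.min 1 (e / M)); first by rewrite lt_min ltr01 divr_gt0.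
  move=> h; rewrite le_min => /andP[/r'M h1]; rewrite ler_pdivlMr// => h2.
  rewrite subrr mul0r subr0; have -> : c + h - c = h by ring.
  by rewrite cabsM (le_trans _ h2)// ler_wpM2l ?cabs_ge0.
- by rewrite subrr mul0r addr0.
- by move=> h; rewrite !f'E subrr mul0r addr0; have -> : c + h - c = h by ring.
Qed.

End holomorphic.

(** * Logarithms of zero-free functions and the Borel-Caratheodory inequality *)

Section zero_free.
Variable R : realType.
Implicit Types (f g p : R[i] -> R[i]) (z w c : R[i]).

Local Notation tau := (pi *+ 2 : R).

Lemma pow_small (q e : R) : 0 <= q -> q < 1 -> 0 < e ->
  exists N0, forall N, (N0 <= N)%N -> q ^+ N <= e.
Proof.
move=> q0 q1 e0; have q1' : `|q| < 1 by rewrite ger0_norm.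
have /cvgrPdist_le/(_ e e0)[N0 _ h] := cvg_expr q1'.
exists N0 => N /h /=; rewrite sub0r normrN ger0_norm//.
by rewrite exprn_ge0.
Qed.

Lemma geometric_sum_le (q : R) (n : nat) : 0 <= q -> q < 1 ->
  \sum_(i < n) q ^+ i <= (1 - q)^-1.
Proof.
move=> q0 q1; have q1' : 0 < 1 - q by rewrite subr_gt0.
rewrite -[leRHS]mul1r ler_pdivlMr//; have -> : (\sum_(i < n) q ^+ i) * (1 - q) = 1 - q ^+ n.
  elim: n => [|n ih]; first by rewrite big_ord0 expr0 subrr mul0r.
  by rewrite big_ord_recr/= mulrDl ih exprS; ring.
by rewrite gerBl exprn_ge0.
Qed.

Lemma ccvg_unique (s : nat -> R[i]) a b : ccvg s a -> ccvg s b -> a = b.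
Proof.
move=> sa sb; apply/eqP; rewrite -subr_eq0 -cabs_eq0 eq_le cabs_ge0 andbT.
apply/ler_addgt0Pr => e e0; rewrite add0r; have e2 : 0 < e / 2 by rewrite divr_gt0.
have [N1 h1] := sa _ e2; have [N2 h2] := sb _ e2.
have {}h1 := h1 _ (leq_maxl N1 N2); have {}h2 := h2 _ (leq_maxr N1 N2).
set N := maxn N1 N2 in h1 h2.
have -> : a - b = (s N - b) - (s N - a) by ring.
rewrite (le_trans (cabsB _ _))//; lra.
Qed.

Lemma ccvg_cabs_le (s : nat -> R[i]) l (B : R) : ccvg s l ->
  (forall N0, exists2 N, (N0 <= N)%N & cabs (s N) <= B) -> cabs l <= B.
Proof.
move=> sl sB; apply/ler_addgt0Pr => e e0; have [N0 h] := sl _ e0.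
have [N NN sN] := sB N0; have {}h := h N NN.
have := cabs_sub_ge l (s N); rewrite cabsBC; lra.
Qed.

Lemma geometric_tail (a : nat -> R[i]) (K q : R) m n : 0 <= K -> 0 <= q -> q < 1 ->
  (forall i, cabs (a i) <= K * q ^+ i) -> (m <= n)%N ->
  cabs (\sum_(i < n) a i - \sum_(i < m) a i) <= K * (q ^+ m / (1 - q)).
Proof.
move=> K0 q0 q1 ha mn; rewrite -!(big_mkord xpredT) (big_cat_nat _ mn)//= [X in X - _]addrC addrK.
rewrite -{1}[m]add0n big_addn big_mkord.
rewrite (le_trans (cabs_sum _ _ _))//.
apply: (@le_trans _ _ (\sum_(i < n - m) K * q ^+ m * q ^+ i)).
  by apply: ler_sum => i _; rewrite (le_trans (ha _))// exprD mulrA mulrAC.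
rewrite -mulr_sumr mulrA ler_wpM2l ?geometric_sum_le//.
by rewrite mulr_ge0// exprn_ge0.
Qed.

Lemma geometric_ccvg (a : nat -> R[i]) (K q : R) : 0 <= K -> 0 <= q -> q < 1 ->
  (forall i, cabs (a i) <= K * q ^+ i) -> exists l, ccvg (fun N => \sum_(i < N) a i) l.
Proof.
move=> K0 q0 q1 ha; apply: ccvg_complete => e e0.
have q1' : 0 < 1 - q by rewrite subr_gt0.
have k0 : 0 < e / (K + 1) * (1 - q) / 2 by rewrite !(divr_gt0, mulr_gt0)// ltr_wpDl.
have [N0 h] := pow_small q0 q1 k0.
have tail n : (N0 <= n)%N -> cabs (\sum_(i < n) a i - \sum_(i < N0) a i) <= e / 2.
  move=> nN; rewrite (le_trans (geometric_tail K0 q0 q1 ha nN))//.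
  apply: (@le_trans _ _ (K * (e / (K + 1) / 2))).
    by rewrite ler_wpM2l// ler_pdivrMr// mulrAC h.
  rewrite mulrA ler_wpM2r// mulrCA ler_piMr ?(ltW e0)//.
  by rewrite ler_pdivrMr ?mul1r ?lerDl// ltr_wpDl.
exists N0 => m n /tail hm /tail hn.
set S := \sum_(i < N0) _ in hm hn.
have -> : \sum_(i < m) a i - \sum_(i < n) a i =
  (\sum_(i < m) a i - S) - (\sum_(i < n) a i - S) by ring.
rewrite (le_trans (cabsB _ _))//; lra.
Qed.

Lemma cderivX n z : cderiv (fun w => w ^+ n.+1) z (n.+1%:R * z ^+ n).
Proof.
elim: n => [|n ih]; first by rewrite expr0 mulr1; under eq_fun do rewrite expr1; exact: cderiv_id.
under eq_fun do rewrite exprS.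
have := cderivM (cderiv_id z) ih.
by have -> : 1 * z ^+ n.+1 + z * (n.+1%:R * z ^+ n) = n.+2%:R * z ^+ n.+1 by rewrite exprS -[n.+2]addn1 natrD; ring.
Qed.

Lemma cderiv_sum (I : Type) (s : seq I) (F : I -> R[i] -> R[i]) (d : I -> R[i]) z :
  (forall i, cderiv (F i) z (d i)) ->
  cderiv (fun w => \sum_(i <- s) F i w) z (\sum_(i <- s) d i).
Proof.
move=> h; elim: s => [|i s ih].
  by rewrite big_nil; under eq_fun do rewrite big_nil; exact: cderiv_const.
by rewrite big_cons; under eq_fun do rewrite big_cons; exact: (cderivD (h i) ih).
Qed.

Lemma tcoef_indep f (r s : R) n : 0 < r -> r <= s -> (forall w, cabs w <= s -> cdiff f w) ->
  tcoef f r n = tcoef f s n.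
Proof.
move=> r0 rs fd; apply: circ_const => // z /andP[rz zs].
apply: cdiffM; first exact: fd.
apply: cdiffV; last by apply: cdiffX; exact: cdiff_id.
by rewrite expf_neq0// -cabs_gt0 (lt_le_trans r0).
Qed.

(** The Taylor series is integrated term by term. Its coefficients do not depend on the radius of
    the circle, and [limit_cderiv] identifies the derivative of the limit with the sum of the
    series, which is [f]. *)
Lemma disc_primitive f (r : R) : 0 < r -> (forall w, cabs w < r -> cdiff f w) ->
  exists2 G, G 0 = 0 & forall w, cabs w < r -> cderiv G w (f w).
Proof.
move=> r0 fd; have [a aE0] : exists a, forall n, a n = tcoef f (r / 2) n by exists (tcoef f (r / 2)).
have aE s n : 0 < s -> s < r -> a n = tcoef f s n.
  move=> s0 sr; have r2 : 0 < r / 2 by rewrite divr_gt0.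
  have [h|h] := leP (r / 2) s.
    by rewrite aE0; apply: tcoef_indep => // w ws; apply: fd; rewrite (le_lt_trans ws).
  rewrite aE0 -(tcoef_indep n s0 (ltW h))// => w ws; apply: fd; rewrite (le_lt_trans ws)//.
  by rewrite ltr_pdivrMr// ltr_pMr// ltr1n.
pose b n z := a n * n.+1%:R^-1 * z ^+ n.+1.
pose S N z := \sum_(n < N) b n z.
have ball s : 0 < s -> s < r -> exists K q : R, [/\ 0 <= K, 0 <= q, q < 1 &
    forall n z, cabs z <= s -> cabs (b n z) <= K * q ^+ n].
  move=> s0 sr; pose t := (s + r) / 2.
  have st : s < t by rewrite /t; lra.
  have tr : t < r by rewrite /t; lra.
  have t0 := lt_trans s0 st.
  have fd' w : cabs w <= t -> cdiff f w by move=> wt; apply: fd; rewrite (le_lt_trans wt).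
  have fdc : diff_on_circle f t by move=> w wt; apply: fd'; rewrite wt.
  have [M M0 hM] := rc_bounded (rc_diff (ltW t0) fdc).
  exists (M * s), (s / t); split.
  - by rewrite mulr_ge0// ltW.
  - by rewrite divr_ge0// ltW.
  - by rewrite ltr_pdivrMr// mul1r.
  move=> n z zs; rewrite /b !cabsM cabsX cabsV (aE t)//.
  have c1 : cabs (n.+1%:R : R[i])^-1 <= 1.
    rewrite cabsV; have -> : (n.+1%:R : R[i]) = (n.+1%:R)%:C by rewrite rmorph_nat.
    by rewrite cabs_real normr_nat invf_le1 ?ltr0n// ler1n.
  rewrite cabsV in c1.
  have c2 := tcoef_bound n t0 fd' hM.
  have c3 : cabs z ^+ n.+1 <= s ^+ n.+1 by rewrite lerXn2r ?nnegrE ?cabs_ge0// ltW.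
  have -> : M * s * (s / t) ^+ n = M / t ^+ n * 1 * s ^+ n.+1.
    by rewrite expr_div_n exprS; field; rewrite expf_neq0// lt0r_neq0.
  apply: ler_pM => //; rewrite ?mulr_ge0 ?cabs_ge0 ?exprn_ge0 ?invr_ge0 ?cabs_ge0//.
  by apply: ler_pM => //; rewrite ?cabs_ge0 ?invr_ge0 ?cabs_ge0.
have mid z : cabs z < r -> exists2 s, 0 < s & cabs z < s /\ s < r.
  move=> zr; exists ((cabs z + r) / 2); last by split; lra.
  by have := cabs_ge0 z; lra.
have lim z : exists l, cabs z < r -> ccvg (S ^~ z) l.
  have [zr|] := ltP (cabs z) r; last by move=> _; exists 0.
  have [s s0 [zs sr]] := mid z zr; have [K [q [K0 q0 q1 hb]]] := ball s s0 sr.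
  have [l hl] := geometric_ccvg K0 q0 q1 (fun n => hb n z (ltW zs)).
  by exists l.
have [G hG] := choice lim.
exists G.
  have := hG 0; rewrite cabs0 => /(_ r0) h.
  apply: (ccvg_unique h) => e e0; exists 0%N => N _.
  rewrite /S big1 ?subrr ?cabs0 ?ltW// => i _.
  by rewrite /b expr0n/= mulr0.
move=> c cr; have [s s0 [cs sr]] := mid c cr.
have [K [q [K0 q0 q1 hb]]] := ball s s0 sr.
have u0 : 0 < s - cabs c by rewrite subr_gt0.
have inb w : cabs w <= s - cabs c -> cabs (c + w) <= s.
  by move=> h; rewrite (le_trans (cabsD _ _))//; lra.
have bd n z : cderiv (b n) z (a n * z ^+ n).
  have := cderivM (cderiv_const (a n * n.+1%:R^-1) z) (cderivX n z).
  have -> // : 0 * z ^+ n.+1 + a n * n.+1%:R^-1 * (n.+1%:R * z ^+ n) = a n * z ^+ n.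
  by rewrite mul0r add0r mulrA divfK ?pnatr_eq0.
have Sd N z : cderiv (S N) z (\sum_(n < N) a n * z ^+ n).
  by apply: (@cderiv_sum _ _ (fun n : 'I_N => b n)) => n; exact: bd.
have [|||d Gd dl] := @limit_cderiv R S G c (s - cabs c) (K / (1 - q)) u0.
- by move=> N w _; exists (\sum_(n < N) a n * (c + w) ^+ n); exact: Sd.
- move=> N w /inb ws; have := geometric_tail K0 q0 q1 (fun n => hb n (c + w) ws) (leq0n N).
  by rewrite big_ord0 subr0 expr0 mul1r.
- by move=> w /inb ws; apply: hG; rewrite (le_lt_trans ws).
suff -> : f c = d by [].
apply: ccvg_unique (dl _ (Sd ^~ c)) => e e0.
have fd' w : cabs w <= s -> cdiff f w by move=> wt; apply: fd; rewrite (le_lt_trans wt).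
have fdc : diff_on_circle f s by move=> w wt; apply: fd'; rewrite wt.
have [M M0 hM] := rc_bounded (rc_diff (ltW s0) fdc).
have qs1 : cabs c / s < 1 by rewrite ltr_pdivrMr// mul1r.
have qs0 : 0 <= cabs c / s by rewrite divr_ge0 ?cabs_ge0// ltW.
have k0 : 0 < e / (M + 1) * (1 - cabs c / s).
  by rewrite mulr_gt0 ?subr_gt0// divr_gt0// ltr_wpDl.
have [N0 hN] := pow_small qs0 qs1 k0; exists N0 => N /hN h.
rewrite cabsBC; have := taylor N s0 fd' hM cs.
under eq_bigr do rewrite -aE//.
move=> /le_trans; apply.
apply: (@le_trans _ _ (M * (e / (M + 1)))).
  by rewrite ler_wpM2l// ler_pdivrMr ?subr_gt0.
by rewrite mulrCA ler_piMr ?(ltW e0)// ler_pdivrMr ?mul1r ?lerDl// ltr_wpDl.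
Qed.

Lemma disc_constant f (r : R) : (forall w, cabs w < r -> cderiv f w 0) ->
  forall w, cabs w < r -> f w = f 0.
Proof.
move=> fd w wr; have pr : is_prim 0 1 (fun s => w * 0) (fun s => f (0 + s%:C * w)).
  apply: (@prim_line R 0 1 f (fun=> 0) 0 w) => s /andP[s0 s1].
  rewrite add0r; apply: fd; rewrite cabs_pmul// (le_lt_trans _ wr)//.
  by rewrite ler_piMl// cabs_ge0.
have := prim_bound (m := 0) pr (fun t _ => eq_ind_r (fun u => cabs u <= 0) (eq_ind_r (fun u => u <= 0) (lexx 0) (cabs0 R)) (mulr0 w)) (lexx 0) ler01 (lexx 1).
rewrite mul0r !add0r mul0r mul1r => h.
by apply/eqP; rewrite -subr_eq0 -cabs_eq0 eq_le h cabs_ge0.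
Qed.

(** [Psi] is a primitive of p' / p, and p exp(- Psi) has derivative 0. *)
Lemma zero_free_log p (r : R) : 0 < r -> ent p -> (forall w, cabs w < r -> p w != 0) ->
  exists Psi, [/\ Psi 0 = 0, forall w, cabs w < r -> cdiff Psi w &
    forall w, cabs w < r -> p w = p 0 * cexp (Psi w)].
Proof.
move=> r0 pe p0; have [p' p'e hp'] := ent_deriv pe.
have [|Psi P0 hP] := @disc_primitive (fun w => p' w / p w) r r0.
  by move=> w /p0 pw; apply: cdiffM => //; apply: cdiffV.
exists Psi; split => // [w /hP h|w wr]; first by eexists; exact: h.
have cst : forall w, cabs w < r -> cderiv (fun w => p w * cexp (- Psi w)) w 0.
  move=> u ur; have := cderivM (hp' u) (cderiv_comp (cderivN (hP u ur)) (cderiv_cexp _)).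
  have -> // : p' u * cexp (- Psi u) + p u * (cexp (- Psi u) * - (p' u / p u)) = 0.
  by field; exact: p0.
have := disc_constant cst wr; rewrite P0 oppr0 cexp0 mulr1 => <-.
by rewrite cexpN divfK// cexp_neq0.
Qed.

Lemma cabsJ z : cabs z^*%C = cabs z.
Proof. by rewrite /cabs normcJ. Qed.

Lemma conjcB z w : (z - w)^*%C = z^*%C - w^*%C.
Proof. by case: z => a b; case: w => a' b'; apply: complex_ext => //=; ring. Qed.

Lemma conjcM z w : (z * w)^*%C = z^*%C * w^*%C.
Proof. by case: z => a b; case: w => a' b'; apply: complex_ext => /=; ring. Qed.

Lemma is_prim_conj a b (gam P : R -> R[i]) : is_prim a b gam P ->
  is_prim a b (fun t => (gam t)^*%C) (fun t => (P t)^*%C).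
Proof.
move=> h t tab e e0; have [r r0 hr] := h t tab e e0; exists r => // s sab /(hr s sab).
by rewrite -[X in X <= _ -> _]cabsJ conjcB conjcB conjcM conjc_real.
Qed.

Lemma avg_conj (gam : R -> R[i]) : rc gam -> avg (fun t => (gam t)^*%C) = (avg gam)^*%C.
Proof.
move=> /rcP[P prP]; rewrite (avgE (is_prim_conj prP)) (avgE prP) conjcM conjcB.
by rewrite conjc_real.
Qed.

Lemma rc_conj (gam : R -> R[i]) : rc gam -> rc (fun t => (gam t)^*%C).
Proof.
move=> h t tab e e0; have [r r0 hr] := h t tab e e0; exists r => // s sab /(hr s sab).
by rewrite -conjcB cabsJ.
Qed.

Lemma rcD (gam gam' : R -> R[i]) : rc gam -> rc gam' -> rc (fun t => gam t + gam' t).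
Proof.
move=> h h' t tab e e0; have e2 : 0 < e / 2 by rewrite divr_gt0.
have [r r0 hr] := h t tab _ e2; have [s s0 hs] := h' t tab _ e2.
exists (Num.min r s); first by rewrite lt_min r0.
move=> u uab; rewrite le_min => /andP[/(hr u uab) h1 /(hs u uab) h2].
have -> : gam u + gam' u - (gam t + gam' t) = (gam u - gam t) + (gam' u - gam' t) by ring.
rewrite (le_trans (cabsD _ _))//; lra.
Qed.

Lemma rcN (gam : R -> R[i]) : rc gam -> rc (fun t => - gam t).
Proof.
move=> h t tab e e0; have [r r0 hr] := h t tab e e0; exists r => // s sab /(hr s sab).
by rewrite -opprD cabsN.
Qed.

Lemma unimodular_multiplier z : exists2 c, cabs c = 1 & c * z = (cabs z)%:C.
Proof.
have [->|z0] := eqVneq z 0; first by exists 1; rewrite ?cabs1// mulr0 cabs0.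
have z0' : 0 < cabs z by rewrite cabs_gt0.
exists ((cabs z)%:C / z); last by rewrite divfK.
by rewrite cabsM cabsV cabs_real gtr0_norm// divff// lt0r_neq0.
Qed.

(** No Fourier coefficient of a nonnegative function exceeds its mean. The function is 2 (A - Re f)
    on the circle, with mean 2 A because [f 0 = 0]. *)
Lemma coef_borel_caratheodory f (r A : R) n : 0 < r -> (forall w, cabs w <= r -> cdiff f w) ->
  f 0 = 0 -> (forall t, 0 <= t <= tau -> Re (f (r%:C * cis t)) <= A) ->
  cabs (tcoef f r n.+1) <= 2 * A / r ^+ n.+1.
Proof.
move=> r0 fd f0 fA; have r_ge0 := ltW r0.
have rn0 : 0 < r ^+ n.+1 by rewrite exprn_gt0.
pose z (t : R) : R[i] := r%:C * cis t.
have zr t : cabs (z t) = r by rewrite cabs_circle.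
pose k := n.+1.
have circle0 g : (forall w, cabs w <= r -> cdiff g w) ->
    avg (fun t => g (z t) * z t ^+ k) = 0 /\ rc (fun t => g (z t) * z t ^+ k).
  move=> gd; have gkd w : cabs w <= r -> cdiff (fun w => g w * w ^+ k) w.
    by move=> wr; apply: cdiffM; [exact: gd|apply: cdiffX; exact: cdiff_id].
  split; last by apply: (@rc_diff R (fun w => g w * w ^+ k)) => // w wr; apply: gkd; rewrite wr.
  have := @circ_mean R (fun w => g w * w ^+ k) r 0 (lexx _) r0
    (fun w wr => cdiff_cont (gkd w wr)) (fun w wr _ => gkd w wr).
  by rewrite expr0n/= mulr0.
have [f1 f2] := circle0 f fd; have [p1 p2] := circle0 (fun=> 1) (fun w _ => cdiff_const 1 w).
have frc : rc (fun t => f (z t)) by apply: rc_diff => // w wr; apply: fd; rewrite wr.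
have favg : avg (fun t => f (z t)) = 0.
  have := @circ_mean R f r 0 (lexx _) r0 (fun w wr => cdiff_cont (fd w wr)) (fun w wr _ => fd w wr).
  by rewrite f0.
have krc : rc (fun t => f (z t) * z t ^- k).
  by apply: (@rc_diff R (fun w => f w * w ^- k)) => //; exact: diff_tcoef.
have zJ t : (z t ^+ k)^*%C = (r ^+ k * r ^+ k)%:C * z t ^- k.
  have zk0 : z t ^+ k != 0 by rewrite expf_neq0// -cabs_gt0 zr.
  apply: (mulfI zk0); rewrite mulrCA divff// mulr1.
  by rewrite -sqr_normc normrX normcE' zr real_complexM rmorphXn/= expr2.
pose r2 := r ^+ k * r ^+ k.
have r20 : 0 < r2 by rewrite mulr_gt0.
(* [u] is real and nonnegative, and its Fourier coefficient of index [k] is that of [- f]. *)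
pose u t := (2 * A)%:C - f (z t) - (f (z t))^*%C.
have uR t : u t = (2 * (A - Re (f (z t))))%:C.
  by rewrite /u; case: (f (z t)) => [x y]; apply: complex_ext; rewrite /= ?oppr0 ?addr0; ring.
have urc : rc u.
  by apply: rcD; [apply: rcD; [exact: rc_cst|exact: rcN]|apply: rcN; exact: rc_conj].
have uavg : avg u = (2 * A)%:C.
  rewrite avgB//; [|by apply: rcD; [exact: rc_cst|exact: rcN]|exact: rc_conj].
  rewrite avgB//; last exact: rc_cst.
  by rewrite avg_conj// favg avg_cst conjc0 !subr0.
pose v t := (2 * A)%:C * (1 * z t ^+ k)^*%C - r2%:C * (f (z t) * z t ^- k) - (f (z t) * z t ^+ k)^*%C.
have rcZ (c : R[i]) (gam : R -> R[i]) : rc gam -> rc (fun t => c * gam t).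
  move=> h t tab e e0; have c0 : 0 < cabs c + 1 by rewrite ltr_wpDl ?cabs_ge0.
  have [s s0 hs] := h t tab _ (divr_gt0 e0 c0); exists s => // q qab /(hs q qab) hq.
  rewrite -mulrBr cabsM (le_trans (ler_wpM2l (cabs_ge0 c) hq))// mulrCA ler_piMr ?(ltW e0)//.
  by rewrite ler_pdivrMr// mul1r lerDl.
have vrc : rc v.
  apply: rcD; last by apply: rcN; exact: rc_conj.
  by apply: rcD; [apply: rcZ; exact: rc_conj|apply: rcN; exact: rcZ].
have vE t : v t = u t * (r2%:C * z t ^- k).
  by rewrite /v /u mul1r conjcM !zJ -/r2; ring.
have vavg : avg v = - (r2%:C * tcoef f r k).
  rewrite avgB//; [|by apply: rcD; [apply: rcZ; exact: rc_conj|apply: rcN; exact: rcZ]|exact: rc_conj].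
  rewrite avgB//; [|by apply: rcZ; exact: rc_conj|exact: rcZ].
  rewrite avg_conj// f1 conjc0 subr0 !avgZ//; last exact: rc_conj.
  by rewrite avg_conj// p1 conjc0 mulr0 sub0r.
(* A unimodular factor turns the modulus of the mean into a real part, so that the comparison with
   the mean of [u] can be made pointwise. *)
have [c c1 cE] := unimodular_multiplier (avg v).
have : Re (c * avg v - (r ^+ k)%:C * avg u) <= 0.
  rewrite -!avgZ// -avgB; [|exact: rcZ|exact: rcZ].
  apply: avg_Re_bound.
    by apply: rcD; [exact: rcZ|apply: rcN; exact: rcZ].
  move=> t tt; rewrite vE uR.
  have uge : 0 <= 2 * (A - Re (f (z t))) by rewrite mulr_ge0// subr_ge0 fA.
  have -> : c * ((2 * (A - Re (f (z t))))%:C * (r2%:C * z t ^- k)) -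
      (r ^+ k)%:C * (2 * (A - Re (f (z t))))%:C =
      (2 * (A - Re (f (z t))))%:C * (c * (r2%:C * z t ^- k) - (r ^+ k)%:C) by ring.
  rewrite Re_realM mulr_ge0_le0// ReD ReN/= subr_le0.
  rewrite (le_trans (ler_norm _))// (le_trans (Re_le_cabs _))//.
  rewrite cabsM c1 mul1r cabs_pmul ?(ltW r20)// cabsV cabsX zr /r2 mulfK//.
  exact: lt0r_neq0.
rewrite cE uavg vavg cabsN cabs_pmul ?(ltW r20)// -real_complexM -real_complexB/= subr_le0.
rewrite /r2 -mulrA ler_pM2l// => h.
by rewrite ler_pdivlMr// mulrC.
Qed.

(** The coefficients of index at least 2 form a geometric series of ratio at most 1/2, which doubles
    the constant 2 A of its leading term. The bound [M] of the modulus enters only through a Taylor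
    tail that tends to 0. *)
Lemma borel_caratheodory f (r A : R) : 0 < r -> (forall w, cabs w <= r -> cdiff f w) ->
  f 0 = 0 -> (forall t, 0 <= t <= tau -> Re (f (r%:C * cis t)) <= A) ->
  exists2 c, cabs c <= 2 * A / r & forall z, cabs z <= r / 2 ->
    cabs (f z - c * z) <= 4 * A / r ^+ 2 * cabs z ^+ 2.
Proof.
move=> r0 fd f0 fA; have cb n := coef_borel_caratheodory n r0 fd f0 fA.
exists (tcoef f r 1); first by have := cb 0%N; rewrite expr1.
move=> z zr; set q := cabs z / r.
have q0 : 0 <= q by rewrite divr_ge0 ?cabs_ge0// ltW.
have q2 : q <= 2^-1 by rewrite ler_pdivrMr// mulrC.
have q1 : q < 1 by lra.
have zr1 : cabs z < r by lra.
have fdc : diff_on_circle f r by move=> w wr; apply: fd; rewrite wr.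
have [M M0 hM] := rc_bounded (rc_diff (ltW r0) fdc).
have A0 : 0 <= A.
  by have := le_trans (cabs_ge0 _) (cb 0%N); rewrite expr1 pmulr_lge0 ?invr_gt0// pmulr_rge0.
have a0 : tcoef f r 0 = 0.
  apply/eqP; rewrite -cabs_eq0 eq_le cabs_ge0 andbT.
  have := taylor 1 r0 fd hM (eq_ind_r (fun x => x < r) r0 (cabs0 R)).
  by rewrite big_ord1 cabs0 mul0r !expr0n/= !(mul0r, mulr0, mulr1, addr0) f0 sub0r cabsN.
apply/ler_addgt0Pr => e e0.
have k0 : 0 < e / (M + 1) * (1 - q) by rewrite mulr_gt0 ?subr_gt0// divr_gt0// ltr_wpDl.
have [N0 hN] := pow_small q0 q1 k0.
have := taylor N0.+2 r0 fd hM zr1; rewrite -/q.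
rewrite !big_ord_recl/= a0 mul0r add0r expr1.
set T := \sum_(i < N0) _ => h.
have TB : cabs T <= 4 * A / r ^+ 2 * cabs z ^+ 2.
  apply: (le_trans (cabs_sum _ _ _)).
  apply: (@le_trans _ _ (\sum_(i < N0) 2 * A * q ^+ 2 * q ^+ i)).
    apply: ler_sum => i _; rewrite cabsM cabsX /= /bump/= !add1n.
    have -> : 2 * A * q ^+ 2 * q ^+ i = 2 * A / r ^+ i.+2 * cabs z ^+ i.+2.
      by rewrite -mulrA -exprD add2n /q expr_div_n; ring.
    by rewrite ler_wpM2r ?exprn_ge0 ?cabs_ge0.
  rewrite -mulr_sumr.
  have -> : 4 * A / r ^+ 2 * cabs z ^+ 2 = 2 * A * q ^+ 2 * 2.
    by rewrite /q expr_div_n; field; rewrite lt0r_neq0.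
  apply: ler_wpM2l; first by apply: mulr_ge0; [lra|exact: sqr_ge0].
  apply: (le_trans (geometric_sum_le _ q0 q1)).
  by rewrite -[leRHS]invrK lef_pV2 ?posrE ?invr_gt0//; lra.
have E : f z - tcoef f r 1 * z = (f z - (tcoef f r 1 * z + T)) + T by ring.
rewrite E (le_trans (cabsD _ _))// addrC lerD// (le_trans h)//.
apply: (@le_trans _ _ (M * (e / (M + 1)))).
  rewrite ler_wpM2l// ler_pdivrMr ?subr_gt0//; apply: hN.
  by rewrite (leq_trans (leqnSn _)).
by rewrite mulrCA ler_piMr ?(ltW e0)// ler_pdivrMr ?mul1r ?lerDl// ltr_wpDl.
Qed.

(** The Borel-Caratheodory inequality for a logarithm of [p / p 0]; [c] is the logarithmic
    derivative of [p] at 0. *)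
Lemma zero_free_bound p (r s A : R) : 0 < r -> r < s -> ent p -> 
  (forall w, cabs w < s -> p w != 0) ->
  (forall t, 0 <= t <= tau -> cabs (p (r%:C * cis t)) <= cabs (p 0) * expR A) ->
  exists c, [/\ cabs c <= 2 * A / r, cderiv p 0 (p 0 * c) & forall z, cabs z <= r / 2 ->
    cabs (p z) <= cabs (p 0) * expR (Re (c * z) + 4 * A / r ^+ 2 * cabs z ^+ 2)].
Proof.
move=> r0 rs pe pn pA; have s0 := lt_trans r0 rs.
have [Psi [P0 Pd PE]] := zero_free_log s0 pe pn.
have p00 : 0 < cabs (p 0) by rewrite cabs_gt0 pn// cabs0.
have Pd' w : cabs w <= r -> cdiff Psi w by move=> wr; apply: Pd; rewrite (le_lt_trans wr).
have PA t : 0 <= t <= tau -> Re (Psi (r%:C * cis t)) <= A.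
  move=> /pA; rewrite PE ?cabs_circle ?(ltW r0)// cabsM cabs_cexp ler_pM2l//.
  by rewrite ler_expR.
have [c cb hc] := borel_caratheodory r0 Pd' P0 PA.
have A0 : 0 <= A.
  by have := le_trans (cabs_ge0 _) cb; rewrite pmulr_lge0 ?invr_gt0// pmulr_rge0.
have K0 : 0 < 4 * A / r ^+ 2 + 1.
  by rewrite ltr_wpDl// divr_ge0 ?mulr_ge0 ?exprn_ge0 ?(ltW r0).
exists c; split => //.
  have Pc : cderiv Psi 0 c.
    move=> e e0; exists (Num.min (r / 2) (e / (4 * A / r ^+ 2 + 1))); first by rewrite lt_min !divr_gt0.
    move=> h; rewrite le_min => /andP[/hc h1]; rewrite ler_pdivlMr// => h2.
    rewrite add0r P0 subr0 mulrC (le_trans h1)// expr2 mulrA ler_wpM2r ?cabs_ge0// mulrC (le_trans _ h2)//.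
    by rewrite ler_wpM2l ?cabs_ge0// lerDl.
  have := cderivM (cderiv_const (p 0) 0) (cderiv_comp Pc (cderiv_cexp (Psi 0))).
  rewrite P0 cexp0 mul0r add0r mul1r => h e e0; have [u u0 hu] := h e e0.
  exists (Num.min u r); first by rewrite lt_min u0.
  move=> v; rewrite le_min => /andP[/hu + vr]; rewrite !add0r P0 cexp0 mulr1 -PE//.
  by rewrite (le_lt_trans vr).
move=> z zr; rewrite PE; last by lra.
rewrite cabsM cabs_cexp ler_wpM2l ?cabs_ge0// ler_expR -lerBlDl -ReN -ReD.
by rewrite (le_trans (ler_norm _))// (le_trans (Re_le_cabs _))// hc.
Qed.

Lemma disc_le_circle f (r M : R) z : 0 < r -> ent f ->
  (forall t, 0 <= t <= tau -> cabs (f (r%:C * cis t)) <= M) -> cabs z <= r / 2 ->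
  cabs (f z) <= 2 * M.
Proof.
move=> r0 fe fM zr; have zr1 : cabs z < r by lra.
have := taylor 0 r0 (fun w _ => fe w) fM zr1; rewrite big_ord0 subr0 expr0 => /le_trans; apply.
rewrite mulrC mul1r ler_wpM2r//.
  by rewrite (le_trans (cabs_ge0 _) (fM 0 _))// lexx ltW// tau_gt0.
rewrite -[leRHS]invrK lef_pV2 ?posrE ?invr_gt0//; last by rewrite subr_gt0 ltr_pdivrMr// mul1r.
have : cabs z / r <= 2^-1 by rewrite ler_pdivrMr// mulrC.
lra.
Qed.

(** Otherwise [f] is divisible by every power of z - w. On a circle of radius [r], at least twice
    the distance from [w] to [z0], the n-th quotient is at most M / r^n, so f(z0) is at most 2 M /
    2^n for all n. *)
Lemma ent_order f w : ent f -> (exists z, f z != 0) ->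
  exists n h, [/\ ent h, h w != 0 & forall z, f z = (z - w) ^+ n * h z].
Proof.
move=> fe [z0 fz0]; apply: contrapT => no; move: fz0; apply/negP; rewrite negbK.
have quo n : exists2 q, ent q & forall z, f z = (z - w) ^+ n * q z.
  elim: n => [|n [q qe qE]]; first by exists f => // z; rewrite expr0 mul1r.
  have [qw|qw] := eqVneq (q w) 0; last by exfalso; apply: no; exists n, q.
  have [q' q'e q'E] := ent_division qe qw; exists q' => // z.
  by rewrite qE q'E exprS; ring.
pose r := 2 * cabs (z0 - w) + 1.
have r0 : 0 < r by rewrite ltr_wpDl// mulr_ge0// cabs_ge0.
have [M M0 hM] := ent_bounded r (ent_shift w fe).
rewrite -cabs_eq0 eq_le cabs_ge0 andbT; apply/ler_addgt0Pr => e e0; rewrite add0r.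
have k0 : 0 < e / (2 * M) by rewrite divr_gt0// mulr_gt0.
have [n hn] := @pow_small 2^-1 _ ltac:(by rewrite invr_ge0) ltac:(by rewrite invf_lt1// ltr1n) k0.
have {}hn := hn n (leqnn n).
have [q qe qE] := quo n.
have rn0 : 0 < r ^+ n by rewrite exprn_gt0.
have qM t : 0 <= t <= tau -> cabs (q (w + r%:C * cis t)) <= M / r ^+ n.
  move=> _; rewrite ler_pdivlMr// mulrC.
  have zr : cabs (r%:C * cis t : R[i]) = r by rewrite cabs_circle// ltW.
  have := hM (r%:C * cis t); rewrite zr qE cabsM cabsX.
  have -> : w + r%:C * cis t - w = r%:C * cis t by ring.
  by rewrite zr; apply.
have z0r : cabs (z0 - w) <= r / 2 by rewrite /r; lra.
have := disc_le_circle r0 (ent_shift w qe) qM z0r; rewrite [w + _]addrC subrK => h.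
rewrite qE cabsM cabsX (le_trans (ler_wpM2l _ h)) ?exprn_ge0 ?cabs_ge0//.
have -> : cabs (z0 - w) ^+ n * (2 * (M / r ^+ n)) = (cabs (z0 - w) / r) ^+ n * (2 * M).
  by rewrite expr_div_n; field; rewrite lt0r_neq0.
rewrite -ler_pdivlMr ?mulr_gt0// (le_trans _ hn)// lerXn2r ?nnegrE ?invr_ge0//.
  by rewrite divr_ge0 ?cabs_ge0// ltW.
by rewrite ler_pdivrMr// mulrC.
Qed.

End zero_free.

(** * Zeros and the Hadamard product *)

Section zeros.
Variable R : realType.
Implicit Types (f g p : R[i] -> R[i]) (z w : R[i]) (L : seq R[i]).

Local Notation tau := (pi *+ 2 : R).

Lemma entireP f : entire f <-> ent f.
Proof.
split=> [fe z|fe z].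
  have := fe z; rewrite /derivable => /cvg_ex[/= d /cvgrPdist_le hd].
  exists d => e e0; have e0' : 0 < e%:C by rewrite ltcR.
  have /nbhs_ballP[r /= r0 hr] := hd _ e0'.
  have rE : r = (Re r)%:C by rewrite RRe_real// gtr0_real.
  have r0' : 0 < Re r by rewrite -ltcR -rE.
  exists (Re r / 2) => [|h hh]; first by rewrite divr_gt0.
  have [->|h0] := eqVneq h 0; first by rewrite addr0 subrr mul0r subr0 cabs0 mulr0.
  have := hr h; rewrite /ball/= sub0r normrN normcE' rE ltcR => /(_ _ h0).
  have hr' : cabs h < Re r by rewrite (le_lt_trans hh)// ltr_pdivrMr// ltr_pMr// ltr1n.
  move=> /(_ hr'); rewrite normcE' lecR => h1.
  have -> : f (z + h) - f z - h * d = - (h * (d - h^-1 *: (f (h *: 1 + z) - f z))).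
    by rewrite mulrBr /GRing.scale/= mulVKf// mulr1 [h + z]addrC; ring.
  by rewrite cabsN cabsM mulrC ler_wpM2r ?cabs_ge0.
have [d hd] := fe z; apply/cvg_ex; exists d; apply/cvgrPdist_le => e e0.
have eE : e = (Re e)%:C by rewrite RRe_real// gtr0_real.
have e0' : 0 < Re e by rewrite -ltcR -eE.
have [r r0 hr] := hd _ e0'.
apply/nbhs_ballP; exists r%:C => /=; first by rewrite ltcR.
move=> h /=; rewrite /ball/= sub0r normrN normcE' ltcR => hh h0.
have := hr h (ltW hh).
have -> : f (z + h) - f z - h * d = - (h * (d - h^-1 *: (f (h *: 1 + z) - f z))).
  by rewrite mulrBr /GRing.scale/= mulVKf// mulr1 [h + z]addrC; ring.
rewrite cabsN cabsM [leRHS]mulrC ler_pM2l ?cabs_gt0// => h1.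
by rewrite normcE' eE lecR.
Qed.

Definition zprod L z := \prod_(w <- L) (1 - z / w).

(** Multiplicities are handled by divisibility: a nonzero entry of [L] occurs at most as often as
    its order as a zero of [f]. The factors are 1 at 0, which keeps [p 0 = f 0]. *)
Definition cofactor_of f L p := ent p /\ forall z, f z = zprod L z * p z.

Lemma zprod_cat L L' z : zprod (L ++ L') z = zprod L z * zprod L' z.
Proof. exact: big_cat. Qed.

Lemma zprod0 L : zprod L 0 = 1.
Proof. by rewrite /zprod big1// => w _; rewrite mul0r subr0. Qed.

Lemma cderiv_factor w z : cderiv (fun u => 1 - u / w) z (- w^-1).
Proof.
have := cderivB (cderiv_const 1 z) (cderivM (cderiv_id z) (cderiv_const w^-1 z)).
by rewrite mulr0 addr0 mul1r sub0r.
Qed.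

Lemma cderiv_zprod0 L : cderiv (zprod L) 0 (- \sum_(w <- L) w^-1).
Proof.
elim: L => [|w L ih].
  have -> : zprod [::] = fun=> 1 by apply: funext => z; rewrite /zprod big_nil.
  by rewrite big_nil oppr0; exact: cderiv_const.
have -> : zprod (w :: L) = fun u => (1 - u / w) * zprod L u.
  by apply: funext => u; rewrite /zprod big_cons.
have := cderivM (cderiv_factor w 0) ih.
by rewrite zprod0 mul0r subr0 mul1r mulr1 big_cons opprD.
Qed.

Lemma ent_zprod L : ent (zprod L).
Proof.
by move=> z; apply: (@cdiff_prod R _ L (fun w z => 1 - z / w)) => w; exists (- w^-1); exact: cderiv_factor.
Qed.

Lemma cofactor_root f L p w : cofactor_of f L p -> w != 0 -> p w = 0 ->
  exists p', cofactor_of f (rcons L w) p'.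
Proof.
move=> [pe fE] w0 pw; have [q qe qE] := ent_division pe pw.
exists (fun z => - w * q z); split.
  by move=> z; apply: cdiffM; [exact: cdiff_const|exact: qe].
move=> z; rewrite fE qE -cats1 zprod_cat /zprod big_seq1 -!mulrA; congr (_ * _).
by field.
Qed.

Lemma zprod_ge L (r k : R) z : (forall w, w \in L -> 0 < cabs w <= r) -> (1 + k) * r <= cabs z ->
  0 <= k -> k ^+ size L <= cabs (zprod L z).
Proof.
move=> Lr kz k0; elim: L Lr => [|w L ih] Lr.
  by rewrite /zprod big_nil cabs1 expr0.
rewrite /zprod big_cons cabsM exprS ler_pM ?exprn_ge0//; last first.
  by apply: ih => u uL; apply: Lr; rewrite inE uL orbT.
have /andP[w0 wr] := Lr w (mem_head _ _).
rewrite cabsBC; apply: le_trans (cabs_sub_ge _ _).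
rewrite cabs1 cabsM cabsV lerBrDr ler_pdivlMr// addrC (le_trans _ kz)// ler_wpM2l//.
by rewrite addr_ge0.
Qed.

Variables (f : R[i] -> R[i]) (C : R).
Hypothesis fe : ent f.
Hypothesis f0 : f 0 != 0.
Hypothesis C0 : 0 < C.
Hypothesis fC : forall z, cabs (f z) <= C * expR (C * cabs z).

Let K := `|ln (2 * C / cabs (f 0))|.
Let Q := (K + 4 * C) / ln 3.

Let f0' : 0 < cabs (f 0). Proof. by rewrite cabs_gt0. Qed.
Let ln3 : 0 < ln 3 :> R. Proof. by rewrite ln_gt0// ltr1n. Qed.

Lemma cofactor0 L p : cofactor_of f L p -> p 0 = f 0.
Proof. by move=> [_ ->]; rewrite zprod0 mul1r. Qed.

(** A substitute for Jensen's formula: on the circle of radius 4 r each factor 1 - z / w has modulus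
    at least 3, so the n listed zeros force |f(0)| = |p(0)| <= 2 C exp(4 C r) / 3^n. *)
Lemma zero_count L p (r : R) : cofactor_of f L p -> 1 <= r ->
  (forall w, w \in L -> 0 < cabs w <= r) -> (size L)%:R <= Q * r.
Proof.
move=> hp r1 Lr; have r0 := lt_le_trans ltr01 r1; have [pe fE] := hp.
have pb t : 0 <= t <= tau -> cabs (p ((4 * r)%:C * cis t)) <= C * expR (C * (4 * r)) / 3 ^+ size L.
  move=> _; set z := _%:C * _.
  have zr : cabs z = 4 * r by rewrite cabs_circle// mulr_ge0// ltW.
  have := fC z; rewrite fE cabsM zr => h.
  rewrite ler_pdivlMr ?exprn_gt0// mulrC (le_trans _ h)// ler_wpM2r ?cabs_ge0//.
  by apply: zprod_ge Lr _ _ => //; rewrite zr; lra.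
have r40 : 0 < 4 * r by rewrite mulr_gt0.
have := disc_le_circle r40 pe pb (eq_ind_r (fun u => u <= 4 * r / 2) (divr_ge0 (ltW r40) (ler0n R 2)) (cabs0 R)).
rewrite (cofactor0 hp) mulrA ler_pdivlMr ?exprn_gt0// -ler_pdivlMl//.
have -> : (cabs (f 0))^-1 * (2 * (C * expR (C * (4 * r)))) = (2 * C / cabs (f 0)) * expR (C * (4 * r)) by ring.
have c0 : 0 < 2 * C / cabs (f 0) by rewrite divr_gt0// mulr_gt0.
rewrite -ler_ln ?posrE ?exprn_gt0 ?mulr_gt0 ?expR_gt0 ?invr_gt0//.
rewrite lnXn// lnM ?posrE ?expR_gt0// expRK /Q => h.
rewrite mulrAC ler_pdivlMr// [_ * ln 3]mulr_natl (le_trans h)//.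
have hK : ln (2 * C / cabs (f 0)) <= K * r.
  by rewrite (le_trans (ler_norm _))// ler_peMr.
lra.
Qed.

(** Zeros of the cofactor in the disc are split off one by one; [zero_count] ends the process. *)
Lemma cofactor_extend L p (r' r : R) : cofactor_of f L p -> 1 <= r -> r' <= r ->
  (forall w, w \in L -> 0 < cabs w <= r') ->
  exists L' p', [/\ cofactor_of f (L ++ L') p', forall w, cabs w <= r -> p' w != 0,
    forall w, w \in L' -> 0 < cabs w <= r & forall w, w \in L' -> p w = 0].
Proof.
move=> hp r1 r'r Lr.
have Lr' w : w \in L -> 0 < cabs w <= r.
  by move=> /Lr/andP[-> /le_trans->].
(* Here [n] bounds the number of zeros that may still be split off: at [n = 0] the list would be
   longer than [zero_count] allows. *)
suff ext n L' p' : (Num.truncn (Q * r) < n + size (L ++ L'))%N -> cofactor_of f (L ++ L') p' ->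
    (forall w, w \in L' -> 0 < cabs w <= r) ->
    exists L'' p'', [/\ cofactor_of f (L ++ L'') p'', forall w, cabs w <= r -> p'' w != 0 &
      forall w, w \in L'' -> 0 < cabs w <= r].
  have [| |//|L' [p' [h1 h2 h3]]] := ext (Num.truncn (Q * r)).+1 [::] p.
  - by rewrite addSn ltnS leq_addr.
  - by rewrite cats0.
  exists L', p'; split => // w wL'; have [p'e fE] := h1; have [pe fE'] := hp.
  have pE z : p z = zprod L' z * p' z.
    apply/eqP; rewrite -subr_eq0 -cabs_eq0.
    have : zprod L z * (p z - zprod L' z * p' z) = 0.
      by rewrite mulrBr -fE' mulrA -zprod_cat -fE subrr.
    have [zL|zL] := eqVneq (zprod L z) 0; last first.
      by move=> /eqP; rewrite mulf_eq0 (negPf zL)/= -cabs_eq0.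
    move=> _.
    (* The product over [L] cannot be cancelled at its own zeros. It is nonzero at points
       arbitrarily near [z], where [D] therefore vanishes, and continuity carries this to [z]. *)
    have [n [h [he hz hE]]] := @ent_order R (zprod L) z (ent_zprod L) (ex_intro _ 0 (eq_ind_r (fun u => u != 0) (oner_neq0 _) (zprod0 L))).
    pose D u := p u - zprod L' u * p' u.
    have De : ent D by move=> u; apply: cdiffB; [exact: pe|apply: cdiffM; [exact: ent_zprod|exact: p'e]].
    have D0 u : zprod L u * D u = 0 by rewrite /D mulrBr -fE' mulrA -zprod_cat -fE subrr.
    rewrite -/(D z) eq_le cabs_ge0 andbT; apply/ler_addgt0Pr => e e0; rewrite add0r.
    have [s s0 hs] := cdiff_cont (De z) e0.
    have ch0 : 0 < cabs (h z) / 2 by rewrite divr_gt0// cabs_gt0.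
    have [s' s'0 hs'] := cdiff_cont (he z) ch0.
    set t := Num.min s s'; have t0 : 0 < t by rewrite lt_min s0.
    have tc : cabs (t%:C : R[i]) = t by rewrite cabs_real gtr0_norm.
    have h1' := hs t%:C; rewrite tc ge_min lexx in h1'; have {}h1' := h1' isT.
    have h2' := hs' t%:C; rewrite tc ge_min lexx orbT in h2'; have {}h2' := h2' isT.
    have hzt : h (z + t%:C) != 0.
      rewrite -cabs_gt0; have := cabs_sub_ge (h z) (h (z + t%:C)); rewrite cabsBC.
      by move: h2' ch0; lra.
    have : D (z + t%:C) = 0.
      have /eqP := D0 (z + t%:C); rewrite hE !mulf_eq0 (negPf hzt) orbF expf_eq0.
      have -> : z + t%:C - z = t%:C by ring.
      by rewrite -[t%:C == 0]cabs_eq0 tc (gt_eqF t0) andbF/= => /eqP.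
    by move=> Dt; rewrite Dt sub0r cabsN in h1'.
  rewrite pE /zprod; suff -> : \prod_(w0 <- L') (1 - w / w0) = 0 by rewrite mul0r.
  rewrite (big_rem w)//= divff ?subrr ?mul0r//.
  by have /andP[] := h3 w wL'; rewrite cabs_gt0.
elim: n L' p' => [|n ih] L' p' sz hp' L'r.
  have := zero_count hp' r1; rewrite size_cat => /(_ _) h; exfalso.
  have Lall w : w \in L ++ L' -> 0 < cabs w <= r.
    by rewrite mem_cat => /orP[/Lr'|/L'r].
  have := h Lall; rewrite leNgt => /negP; apply.
  by move: sz; rewrite add0n size_cat => sz; rewrite (lt_le_trans (truncnS_gt _))// ler_nat.
have [[w [wr pw]]|no] := pselect (exists w, cabs w <= r /\ p' w = 0); last first.
  by exists L', p'; split => // w wr; apply/eqP => pw; apply: no; exists w.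
have w0 : w != 0.
  by apply: contra_eq_neq pw => ->; rewrite (cofactor0 hp').
have [q hq] := cofactor_root hp' w0 pw.
apply: (ih (rcons L' w) q).
- by rewrite -rcons_cat size_rcons addnS.
- by rewrite -rcons_cat.
- by move=> u; rewrite mem_rcons inE => /predU1P[->|/L'r//]; rewrite cabs_gt0 w0.
Qed.

(** The entries of level N + 1 are zeros of the cofactor [p N], which has none of modulus at most
    2^N; hence the lower bound on their moduli. *)
Lemma zero_sequence : exists (L : nat -> seq R[i]) (p : nat -> R[i] -> R[i]), forall N,
  [/\ cofactor_of f (flatten (mkseq L N.+1)) (p N),
    forall w, cabs w <= 2 ^+ N -> p N w != 0,
    forall w, w \in L N -> 0 < cabs w <= 2 ^+ N &
    forall w, w \in L N.+1 -> 2 ^+ N < cabs w].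
Proof.
pose ok (n : nat) (s : seq R[i] * (R[i] -> R[i])) :=
  cofactor_of f s.1 s.2 /\ forall w, w \in s.1 -> 0 < cabs w <= 2 ^+ n.
have two1 n : 1 <= 2 ^+ n :> R by rewrite exprn_ege1// ler1n.
(* Stage n starts with moduli at most 2^(n - 1). Stage 0 starts with the empty list, so the
   truncated predecessor of 0 is harmless. *)
have step (q : nat * (seq R[i] * (R[i] -> R[i]))) : exists t : seq R[i] * (R[i] -> R[i]), ok q.1.-1 q.2 ->
    [/\ cofactor_of f (q.2.1 ++ t.1) t.2, forall w, cabs w <= 2 ^+ q.1 -> t.2 w != 0,
    forall w, w \in t.1 -> 0 < cabs w <= 2 ^+ q.1 & forall w, w \in t.1 -> q.2.2 w = 0].
  have [[h1 h2]|no] := pselect (ok q.1.-1 q.2); last by exists ([::], f).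
  have le2 : 2 ^+ q.1.-1 <= 2 ^+ q.1 :> R by rewrite ler_eXn2l ?ltr1n// leq_pred.
  by have [L' [p' h]] := cofactor_extend h1 (two1 _) le2 h2; exists (L', p').
have [F hF] := choice step.
pose S := fix S n : seq R[i] * (R[i] -> R[i]) := if n is m.+1 then
  ((S m).1 ++ (F (m, S m)).1, (F (m, S m)).2) else ([::], f).
have Sok n : ok n.-1 (S n).
  elim: n => [|n ih]; first by split => //; split => // z; rewrite /zprod big_nil mul1r.
  have [h1 h2 h3 _] := hF (n, S n) ih; split => //= w; rewrite mem_cat => /orP[|/h3//].
  move=> /(proj2 ih)/andP[-> /le_trans]; apply.
  by rewrite ler_eXn2l ?ltr1n// leq_pred.
pose L n := (F (n, S n)).1; pose p n := (F (n, S n)).2.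
have SE n : (S n).1 = flatten (mkseq L n).
  elim: n => [//|n ih]; rewrite /mkseq -addn1 iotaD map_cat flatten_cat/= cats0 add0n.
  by rewrite -[map L _]/(mkseq L n) -ih addn1.
exists L, p => N; have [h1 h2 h3 h4] := hF (N, S N) (Sok N); split => //.
  have := Sok N.+1; rewrite /ok SE => -[h _]; exact: h.
have [_ _ _ h5] := hF (N.+1, S N.+1) (Sok N.+1).
move=> w /h5 pw; rewrite ltNge; apply/negP => wN.
by have := h2 w wN; rewrite [X in X != _]pw eqxx.
Qed.

(** With t = 2^N, all factors have modulus at least 1 on the circle of radius 2 t, so [p] inherits
    the bound of [f] there and, up to a factor 2, on the disc of radius t. Then [zero_free_bound]
    applies on the radius t / 2 with A = t (K + 2 C). *)
Lemma cofactor_bound L p N : cofactor_of f L p ->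
  (forall w, cabs w <= 2 ^+ N -> p w != 0) ->
  (forall w, w \in L -> 0 < cabs w <= 2 ^+ N) ->
  exists c, [/\ cabs c <= 4 * (K + 2 * C), cderiv p 0 (p 0 * c) &
   forall z, cabs z <= 2 ^+ N / 4 ->
    cabs (p z) <= cabs (f 0) * expR (Re (c * z) + 16 * (K + 2 * C) / 2 ^+ N * cabs z ^+ 2)].
Proof.
move=> hp pn Lr; have [pe fE] := hp.
set t := 2 ^+ N in pn Lr *; have t1 : 1 <= t by rewrite exprn_ege1// ler1n.
have t0 := lt_le_trans ltr01 t1.
have t20 : 0 < 2 * t by rewrite mulr_gt0.
have pb x : 0 <= x <= tau -> cabs (p ((2 * t)%:C * cis x)) <= C * expR (C * (2 * t)).
  move=> _; set z := _%:C * _.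
  have zr : cabs z = 2 * t by rewrite cabs_circle// ltW.
  have := fC z; rewrite fE cabsM zr; apply: le_trans.
  rewrite ler_peMl ?cabs_ge0//.
  by have := @zprod_ge L t 1 z Lr; rewrite expr1n zr; apply.
have K0 : 0 <= K by exact: normr_ge0.
have pr (x : R) : 0 <= x <= tau -> cabs (p ((t / 2)%:C * cis x)) <= cabs (p 0) * expR (t * (K + 2 * C)).
  move=> _; have zr : cabs ((t / 2)%:C * cis x : R[i]) <= 2 * t / 2.
    by rewrite cabs_circle; lra.
  rewrite (le_trans (disc_le_circle t20 pe pb zr))// (cofactor0 hp) mulrA.
  have c0 : 0 < 2 * C / cabs (f 0) by rewrite divr_gt0// mulr_gt0.
  have -> : 2 * C = cabs (f 0) * (2 * C / cabs (f 0)) by field; rewrite lt0r_neq0.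
  rewrite -mulrA ler_wpM2l ?cabs_ge0// -{1}(lnK c0) -expRD ler_expR.
  have hK : ln (2 * C / cabs (f 0)) <= K * t.
    by rewrite (le_trans (ler_norm _))// ler_peMr.
  have -> : cabs (f 0) * (2 * C / cabs (f 0)) = 2 * C by field; rewrite lt0r_neq0.
  lra.
have t2 : 0 < t / 2 by rewrite divr_gt0.
have t2t : t / 2 < t by lra.
have [c [c1 c2 c3]] := zero_free_bound t2 t2t pe (fun w wt => pn w (ltW wt)) pr.
exists c; split => //.
  by move: c1; have -> : 2 * (t * (K + 2 * C)) / (t / 2) = 4 * (K + 2 * C) by field; rewrite lt0r_neq0.
move=> z zt; have := c3 z; rewrite (cofactor0 hp).
have -> : 4 * (t * (K + 2 * C)) / (t / 2) ^+ 2 = 16 * (K + 2 * C) / t by field; rewrite lt0r_neq0.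
by apply; lra.
Qed.

Definition efactor z : R[i] := (1 - z) * cexp z.

(* Lindelof: the sums of [1/w] stay bounded, because the zero-free cofactor has a bounded
   logarithmic derivative at 0. *)
Lemma hadamard b L p N : cderiv f 0 (f 0 * b) -> cofactor_of f L p ->
  (forall w, cabs w <= 2 ^+ N -> p w != 0) ->
  (forall w, w \in L -> 0 < cabs w <= 2 ^+ N) ->
  cabs (b + \sum_(w <- L) w^-1) <= 4 * (K + 2 * C) /\
   forall z, cabs z <= 2 ^+ N / 4 ->
    cabs (f z) <= cabs (f 0) * expR (Re (b * z) + 16 * (K + 2 * C) / 2 ^+ N * cabs z ^+ 2) *
       \prod_(w <- L) cabs (efactor (z / w)).
Proof.
move=> fb hp pn Lr; have [c [c1 c2 c3]] := cofactor_bound hp pn Lr.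
have [pe fE] := hp.
have cE : c = b + \sum_(w <- L) w^-1.
  have := cderivM (cderiv_zprod0 L) c2.
  rewrite -(funext fE) zprod0 mul1r (cofactor0 hp) => h.
  have := cderiv_unique fb h; rewrite mulrC => /(congr1 (fun x => x / f 0)).
  rewrite mulfK// => ->; field; exact: f0.
rewrite -cE; split => // z zN; rewrite fE cabsM.
have h := c3 z zN.
apply: le_trans (ler_wpM2l (cabs_ge0 _) h) _.
rewrite cE mulrDl ReD -addrA [X in expR X]addrCA expRD.
suff -> : \prod_(w <- L) cabs (efactor (z / w)) =
    cabs (zprod L z) * expR (Re ((\sum_(w <- L) w^-1) * z)).
  by rewrite le_eqVlt; apply/orP; left; apply/eqP; ring.
rewrite /zprod cabs_prod mulr_suml Re_sum.
rewrite (big_morph expR (@expRD R) (@expR0 R)) -big_split; apply: eq_bigr => w _ /=.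
by rewrite /efactor cabsM cabs_cexp [z / w]mulrC.
Qed.

End zeros.

(** * What the growth of f and class A say about the zeros *)

Section zero_data.
Variable R : realType.
Implicit Types (f g p : R[i] -> R[i]) (z w : R[i]) (L : seq R[i]).

Lemma ent_zero_at D w : ent D -> (forall z, z != w -> D z = 0) -> D w = 0.
Proof.
move=> De Dz; apply/eqP; rewrite -cabs_eq0 eq_le cabs_ge0 andbT.
apply/ler_addgt0Pr => e e0; rewrite add0r.
have [r r0 hr] := cdiff_cont (De w) e0.
have := hr r%:C; rewrite cabs_real gtr0_norm// lexx Dz; last first.
  by rewrite addr_eq_self -cabs_eq0 cabs_real gt_eqF// gtr0_norm.
by rewrite sub0r cabsN; apply.
Qed.

Lemma zprod_count L w z : zprod L z = (1 - z / w) ^+ count_mem w L * zprod [seq u <- L | u != w] z.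
Proof.
rewrite /zprod (bigID (pred1 w))/= big_filter; congr (_ * _).
rewrite (eq_bigr (fun=> 1 - z / w)) => [|u /eqP->//].
by rewrite big_const_seq iter_mulr_1.
Qed.

(** If [w] were listed more often than its order k, cancelling (z - w)^k would leave a function that
    vanishes at [w] and, off [w], equals the cofactor [h'] of the order; by continuity
    [h' w = 0]. *)
Lemma count_le_zero_mult f L p w : ent f -> (exists z, f z != 0) -> cofactor_of f L p -> w != 0 ->
  (count_mem w L <= zero_mult f w)%N.
Proof.
move=> fe fn0 [pe fE] w0; have [n [h [he hw hE]]] := ent_order w fe fn0.
rewrite /zero_mult; case: xgetP => [k _ [h' [/entireP h'e h'w h'E]]|/(_ n)no]; last first.
  by exfalso; apply: no; exists h; split => //; apply/entireP.
set m := count_mem w L; rewrite leqNgt; apply/negP => km.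
pose D z := h' z - (z - w) ^+ (m - k) * ((- w^-1) ^+ m * zprod [seq u <- L | u != w] z * p z).
have De : ent D.
  move=> z; apply: cdiffB; first exact: h'e.
  apply: cdiffM; first by apply: cdiffX; apply: cdiffB; [exact: cdiff_id|exact: cdiff_const].
  apply: cdiffM; last exact: pe.
  by apply: cdiffM; [exact: cdiff_const|exact: ent_zprod].
have Dz z : z != w -> D z = 0.
  move=> zw; have zw0 : (z - w) ^+ k != 0 by rewrite expf_neq0// subr_eq0.
  apply: (mulfI zw0); rewrite mulr0 /D mulrBr -h'E mulrA -exprD subnKC ?(ltnW km)//.
  rewrite fE (zprod_count L w) -/m.
  have -> : 1 - z / w = (z - w) * - w^-1 by field.
  by rewrite exprMn; ring.
have := ent_zero_at De Dz; rewrite /D subrr expr0n subn_eq0 leqNgt km/= mul0r subr0.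
by move/eqP; rewrite (negPf h'w).
Qed.

(* Unlike [class_A], this passes at once to the quotient of [f] by a power of [z]. *)
Definition im_inv_bounded f := exists S : R, forall L p, cofactor_of f L p ->
  (forall w, w \in L -> w != 0) -> \sum_(w <- L) `|Im w^-1| <= S.

(** Without repetitions the list is a finite set of zeros, and [count_le_zero_mult] compares the
    number of repetitions with the weights of [class_A]. *)
Lemma class_A_im_inv_bounded f : ent f -> (exists z, f z != 0) -> class_A f ->
  im_inv_bounded f.
Proof.
move=> fe fn0; rewrite /class_A; set A := [set z | _].
pose F z := ((zero_mult f z)%:R * `|Im z^-1|)%:E; rewrite -/F => Af; exists (fine (\esum_(z in A) F z)) => L p hp Ln0.
have F0 z : (0 <= F z)%E by rewrite lee_fin mulr_ge0.
have e0 : (0 <= \esum_(z in A) F z)%E by apply: esum_ge0 => z _; exact: F0.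
rewrite -lee_fin fineK ?ge0_fin_numE//.
apply: (@le_trans _ _ (\sum_(w <- undup L) F w)%E).
  rewrite /F sumEFin lee_fin.
  rewrite -big_undup_iterop_count; apply: ler_sum => w _.
  have -> : iterop (count_mem w L) +%R `|Im w^-1| 0 = (count_mem w L)%:R * `|Im w^-1|.
    by rewrite Monoid.iteropE iter_addr_0 mulr_natl.
  have [wL|wL] := boolP (w \in L); last by rewrite (count_memPn wL) mul0r mulr_ge0.
  by rewrite ler_wpM2r// ler_nat (count_le_zero_mult fe fn0 hp)// Ln0.
rewrite fsbig_seq ?undup_uniq//; apply: esum_ge; exists [set` undup L] => //.
split; first exact: finite_seq.
move=> w /=; rewrite mem_undup => wL; split; last exact: Ln0.
have [_ fE] := hp; rewrite fE /zprod (big_rem w)//= divff ?subrr ?mul0r//.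
exact: Ln0.
Qed.

Definition zeros_upto (L : nat -> seq R[i]) N := flatten (mkseq L N).

Lemma sum_zeros_upto (V : nmodType) (L : nat -> seq R[i]) N (F : R[i] -> V) :
  \sum_(w <- zeros_upto L N) F w = \sum_(j < N) \sum_(w <- L j) F w.
Proof. by rewrite /zeros_upto big_flatten/= big_map -{1}[N]subn0 big_mkord. Qed.

Lemma prod_zeros_upto (L : nat -> seq R[i]) N (F : R[i] -> R) :
  \prod_(w <- zeros_upto L N) F w = \prod_(j < N) \prod_(w <- L j) F w.
Proof. by rewrite /zeros_upto big_flatten/= big_map -{1}[N]subn0 big_mkord. Qed.

Lemma size_zeros_upto (L : nat -> seq R[i]) N :
  (size (zeros_upto L N))%:R = \sum_(j < N) (size (L j))%:R :> R.
Proof.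
rewrite -natr_sum; congr (_%:R).
by rewrite /zeros_upto size_flatten /shape -map_comp sumnE big_map -{1}[N]subn0 big_mkord.
Qed.

(** A single [Q] serves for the linear count, Lindelof's bound on the sums of 1 / w, the imaginary
    parts and the quadratic error of the product formula. From here on [f] enters only through these
    data, its boundedness on discs and its value at 0. *)
Lemma zero_data f : ent f -> f 0 != 0 -> exponential_type f -> im_inv_bounded f ->
  exists (L : nat -> seq R[i]) (Q : R) (b : R[i]), 0 <= Q /\
  [/\ (forall j w, w \in L j -> 0 < cabs w <= 2 ^+ j) /\
      (forall j w, w \in L j.+1 -> 2 ^+ j < cabs w),
    forall N, \sum_(j < N.+1) (size (L j))%:R <= Q * 2 ^+ N,
    forall N, cabs (\sum_(j < N) \sum_(w <- L j) w^-1) <= Q,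
    forall N, \sum_(j < N) \sum_(w <- L j) `|Im w^-1| <= Q &
    forall N z, cabs z <= 2 ^+ N / 4 -> cabs (f z) <=
      cabs (f 0) * expR (Re (b * z) + Q / 2 ^+ N * cabs z ^+ 2) *
       \prod_(j < N.+1) \prod_(w <- L j) cabs (efactor (z / w))].
Proof.
move=> fe f0 [C' fC'] [S hS].
pose C := `|C'| + 1; have C0 : 0 < C by rewrite ltr_wpDl.
have fC z : cabs (f z) <= C * expR (C * cabs z).
  have CC : C' <= C by rewrite (le_trans (ler_norm _))// lerDl.
  rewrite (le_trans (fC' z))// (le_trans (ler_wpM2r (expR_ge0 _) CC))//.
  by rewrite ler_wpM2l ?(ltW C0)// ler_expR ler_wpM2r ?cabs_ge0.
have [f' _ hf'] := ent_deriv fe.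
have fb : cderiv f 0 (f 0 * (f' 0 / f 0)) by rewrite mulrC divfK//; exact: hf'.
set b := f' 0 / f 0 in fb.
have [L [p hL]] := zero_sequence fe f0 C0 fC.
set K := `|ln (2 * C / cabs (f 0))|.
have K0 : 0 <= K by exact: normr_ge0.
have ln3 : 0 < ln 3 :> R by rewrite ln_gt0// ltr1n.
pose Q0 := (K + 4 * C) / ln 3.
have Q00 : 0 <= Q0 by apply: divr_ge0; [lra|exact: ltW].
pose Q := Q0 + 16 * (K + 2 * C) + `|S| + cabs b.
have KC : 0 <= K + 2 * C by lra.
have Qs : [/\ Q0 <= Q, S <= Q, 16 * (K + 2 * C) <= Q & 4 * (K + 2 * C) + cabs b <= Q].
  by have := ler_norm S; have := normr_ge0 S; have := cabs_ge0 b; rewrite /Q; split; lra.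
have [Q1 Q2 Q3 Q4] := Qs.
have Q_ge0 : 0 <= Q by exact: le_trans Q1.
have Lb j w : w \in L j -> 0 < cabs w <= 2 ^+ j by have [_ _ h _] := hL j; exact: h.
have mem N w : w \in zeros_upto L N.+1 -> 0 < cabs w <= 2 ^+ N.
  move=> /flattenP[_ /mapP[j + ->]]; rewrite mem_iota add0n ltnS => /andP[_ jN] /Lb /andP[-> /le_trans->]//.
  by rewrite ler_eXn2l ?ltr1n.
have N1 N : 1 <= 2 ^+ N :> R by rewrite exprn_ege1// ler1n.
exists L, Q, b; split => //; split.
- by split=> [//|j w]; have [_ _ _ h] := hL j; exact: h.
- move=> N; rewrite -size_zeros_upto; have [h _ _ _] := hL N.
  rewrite (le_trans (zero_count f0 C0 fC h (N1 N) (mem N)))// -/K -/Q0.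
  by rewrite ler_wpM2r// exprn_ge0.
- case=> [|N]; first by rewrite big_ord0 cabs0.
  have [h1 h2 _ _] := hL N; have [h3 _] := hadamard f0 C0 fC fb h1 h2 (mem N).
  rewrite -sum_zeros_upto (le_trans _ Q4)//.
  have -> : \sum_(w <- zeros_upto L N.+1) w^-1 = (b + \sum_(w <- zeros_upto L N.+1) w^-1) - b by ring.
  by rewrite (le_trans (cabsB _ _))// lerD2r.
- case=> [|N]; first by rewrite big_ord0.
  have [h1 _ _ _] := hL N; rewrite -sum_zeros_upto (le_trans (hS _ _ h1 _))//.
  by move=> w /mem/andP[]; rewrite cabs_gt0.
- move=> N z zN; have [h1 h2 _ _] := hL N; have [_ h3] := hadamard f0 C0 fC fb h1 h2 (mem N).
  rewrite -prod_zeros_upto (le_trans (h3 z zN))// ler_wpM2r//.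
    by apply: prodr_ge0 => w _; exact: cabs_ge0.
  rewrite ler_wpM2l ?cabs_ge0// ler_expR lerD2l ler_wpM2r ?exprn_ge0 ?cabs_ge0//.
  by rewrite ler_wpM2r// invr_ge0 exprn_ge0.
Qed.

End zero_data.

(** * The real multiplier *)

Section dyadic_sums.
Variable R : realType.
Variables (c : nat -> R) (Q : R).
Hypothesis c0 : forall j, 0 <= c j.
Hypothesis cQ : forall N, \sum_(j < N.+1) c j <= Q * 2 ^+ N.

Let p2 j : 0 < 2 ^+ j :> R. Proof. by rewrite exprn_gt0. Qed.

Lemma dyadic_Q_ge0 : 0 <= Q.
Proof. by have := cQ 0; rewrite big_ord1 expr0 mulr1; apply: le_trans. Qed.

Lemma dyadic_term j : c j <= Q * 2 ^+ j.
Proof.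
by apply: le_trans (cQ j); rewrite big_ord_recr/= lerDr sumr_ge0// => i _.
Qed.

Lemma dyadic_below y J : 0 <= y -> \sum_(j < J | 2 ^+ j <= y) c j <= Q * y.
Proof.
move=> y0; elim: J => [|J ih]; first by rewrite big_ord0 mulr_ge0// dyadic_Q_ge0.
rewrite big_mkcond big_ord_recr -big_mkcond/=; case: ifPn => [Jy|_]; last by rewrite addr0.
apply: (@le_trans _ _ (Q * 2 ^+ J)); last by rewrite ler_wpM2l// dyadic_Q_ge0.
apply: le_trans (cQ J); rewrite big_ord_recr/= lerD2r big_mkcond/=.
by apply: ler_sum => i _; case: ifP.
Qed.

Lemma inv_dyadic_above y J : 0 < y -> \sum_(j < J | y < 2 ^+ j) (2 ^+ j)^-1 <= 2 / y :> R.
Proof.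
(* The correction 2 / 2^J makes the induction telescope; the maximum with 0 covers the stages at
   which no term has appeared yet. *)
move=> y0; suff : \sum_(j < J | y < 2 ^+ j) (2 ^+ j)^-1 <=
    Num.max 0 (2 / y - 2 / 2 ^+ J) :> R.
  move=> /le_trans; apply; rewrite ge_max divr_ge0 ?(ltW y0)//= lerBlDr lerDl.
  by rewrite divr_ge0// ltW.
elim: J => [|J ih]; first by rewrite big_ord0 le_max lexx.
rewrite big_mkcond big_ord_recr -big_mkcond/=.
have e : 2 / 2 ^+ J.+1 = (2 ^+ J)^-1 :> R by rewrite exprS invfM mulrA divff ?mul1r.
have s : 2 / 2 ^+ J = (2 ^+ J)^-1 + (2 ^+ J)^-1 :> R by ring.
rewrite e; rewrite s in ih; have i0 : 0 < (2 ^+ J)^-1 :> R by rewrite invr_gt0.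
case: ifPn => [yJ|_].
  rewrite le_max; apply/orP; right.
  have iy : (2 ^+ J)^-1 < y^-1 by rewrite ltf_pV2 ?posrE.
  have ty : 2 / y = y^-1 + y^-1 by ring.
  move: ih; rewrite le_max => /orP[]; lra.
rewrite addr0 (le_trans ih)// ge_max le_max lexx/= le_max; apply/orP; right; lra.
Qed.

Lemma dyadic_above y J : 0 < y -> \sum_(j < J | y < 2 ^+ j) c j / 4 ^+ j <= 2 * Q / y.
Proof.
move=> y0; apply: (@le_trans _ _ (\sum_(j < J | y < 2 ^+ j) Q * (2 ^+ j)^-1)).
  apply: ler_sum => j _; have -> : 4 = 2 * 2 :> R by ring.
  rewrite exprMn invfM mulrA ler_wpM2r ?invr_ge0 ?(ltW (p2 _))//.
  by rewrite ler_pdivrMr// dyadic_term.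
rewrite -mulr_sumr (le_trans (ler_wpM2l dyadic_Q_ge0 (inv_dyadic_above _ y0)))//.
by rewrite le_eqVlt; apply/orP; left; apply/eqP; ring.
Qed.

Lemma dyadic_quartic J : \sum_(j < J) c j / 4 ^+ j <= 4 * Q.
Proof.
have -> : 4 * Q = 2 * Q / 2^-1 by rewrite invrK; ring.
apply: le_trans (@dyadic_above 2^-1 J _); last by rewrite invr_gt0.
rewrite [leRHS]big_mkcond/=; apply: ler_sum => j _.
by rewrite ifT// (lt_le_trans (y := 1)) ?invf_lt1 ?ltr1n// exprn_ege1// ler1n.
Qed.

Let rt := Num.sqrt (2 : R).
Let rt0 : 0 < rt. Proof. by rewrite sqrtr_gt0. Qed.
(** Used twice: 4 + rt <= 4 rt keeps the geometric sum below four times its last term, and 1 / (1 -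
    1 / rt) <= 7 / 2 bounds the decreasing series. *)
Let rt75 : 7 / 5 <= rt.
Proof.
by rewrite -ler_sqr ?nnegrE ?(ltW rt0)// sqr_sqrtr//; lra.
Qed.
Let sqrt_pow j : Num.sqrt (2 ^+ j) = rt ^+ j.
Proof.
elim: j => [|j ih]; first by rewrite !expr0 sqrtr1.
by rewrite !exprS sqrtrM// ih.
Qed.

Lemma sqrt_dyadic_below y J : 0 <= y ->
  \sum_(j < J | 2 ^+ j <= y) Num.sqrt (2 ^+ j) <= 4 * Num.sqrt y :> R.
Proof.
move=> y0; have full K : \sum_(j < K.+1) Num.sqrt (2 ^+ j : R) <= 4 * rt ^+ K.
  elim: K => [|K ih]; first by rewrite big_ord1 !expr0 sqrtr1; lra.
  rewrite big_ord_recr/= sqrt_pow (le_trans (lerD ih (lexx _)))// exprS.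
  have : 0 < rt ^+ K by rewrite exprn_gt0.
  by have := rt75; nra.
elim: J => [|J ih]; first by rewrite big_ord0 mulr_ge0// sqrtr_ge0.
rewrite big_mkcond big_ord_recr -big_mkcond/=; case: ifPn => [Jy|_]; last by rewrite addr0.
apply: (@le_trans _ _ (4 * rt ^+ J)).
  apply: le_trans (full J); rewrite big_ord_recr/= lerD2r big_mkcond/=.
  by apply: ler_sum => i _; case: ifP => // _; rewrite sqrtr_ge0.
by rewrite -sqrt_pow ler_wpM2l// ler_sqrt.
Qed.

Lemma dyadic_sqrt_below y J : 0 <= y ->
  \sum_(j < J | 2 ^+ j <= y) c j * Num.sqrt (y / 2 ^+ j) <= 4 * Q * y.
Proof.
move=> y0; apply: (@le_trans _ _ (\sum_(j < J | 2 ^+ j <= y) Q * Num.sqrt y * Num.sqrt (2 ^+ j))).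
  apply: ler_sum => j _.
  have -> : Q * Num.sqrt y * Num.sqrt (2 ^+ j) = Q * 2 ^+ j * Num.sqrt (y / 2 ^+ j).
    rewrite sqrtrM// -mulrA -mulrA; congr (_ * _); rewrite mulrCA; congr (_ * _).
    have e : 2 ^+ j = Num.sqrt (2 ^+ j) * Num.sqrt (2 ^+ j) :> R by rewrite -expr2 sqr_sqrtr// ltW.
    by rewrite {2}e sqrtrV ?(ltW (p2 _))// mulfK// gt_eqF// sqrtr_gt0.
  by rewrite ler_wpM2r ?sqrtr_ge0// dyadic_term.
rewrite -mulr_sumr (le_trans (ler_wpM2l _ (sqrt_dyadic_below _ y0)))//.
  by rewrite mulr_ge0 ?dyadic_Q_ge0// sqrtr_ge0.
have e : y = Num.sqrt y * Num.sqrt y by rewrite -expr2 sqr_sqrtr.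
by rewrite [X in _ <= _ * X]e le_eqVlt; apply/orP; left; apply/eqP; ring.
Qed.

Lemma dyadic_three_halves J :
  \sum_(j < J) c j * (2 ^+ j * Num.sqrt (2 ^+ j))^-1 <= 4 * Q.
Proof.
apply: (@le_trans _ _ (\sum_(j < J) Q * (rt ^+ j)^-1)).
  apply: ler_sum => j _; rewrite invfM mulrA sqrt_pow ler_wpM2r ?invr_ge0 ?exprn_ge0 ?(ltW rt0)//.
  by rewrite ler_pdivrMr// dyadic_term.
rewrite -mulr_sumr mulrC ler_wpM2r ?dyadic_Q_ge0//.
under eq_bigr do rewrite -exprVn.
have r1 : rt^-1 <= 5 / 7.
  by rewrite -[leRHS]invrK lef_pV2 ?posrE ?invr_gt0 ?divr_gt0// invf_div.
have r0 : 0 <= rt^-1 by rewrite invr_ge0 ltW.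
have r2 : rt^-1 < 1 by lra.
rewrite (le_trans (geometric_sum_le J r0 r2))//.
by rewrite -[leRHS]invrK lef_pV2 ?posrE ?invr_gt0//; lra.
Qed.

End dyadic_sums.

(** * Products over the half-integers *)

Section lattice.
Variable R : realType.
Implicit Types (v : R) (z : R[i]).

Definition node (n : nat) : R := n%:R + 2^-1.

Lemma node_gt0 n : 0 < node n.
Proof. by rewrite /node ltr_wpDl. Qed.

Lemma nodeS n : node n.+1 = node n + 1.
Proof. by rewrite /node -addn1 natrD; ring. Qed.

Lemma ln1D_sqrt (a : R) : 0 <= a -> ln (1 + a) <= 2 * Num.sqrt a.
Proof.
move=> a0; have s0 : 0 <= Num.sqrt a by rewrite sqrtr_ge0.
have p : 0 < 1 + Num.sqrt a by rewrite ltr_wpDr.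
have -> : 2 * Num.sqrt a = Num.sqrt a + Num.sqrt a by ring.
apply: (@le_trans _ _ (ln ((1 + Num.sqrt a) * (1 + Num.sqrt a)))).
  rewrite ler_ln ?posrE ?mulr_gt0 ?ltr_wpDr//.
  have e : a = Num.sqrt a * Num.sqrt a by rewrite -expr2 sqr_sqrtr.
  lra.
by rewrite lnM ?posrE// lerD// le_ln1Dx// (lt_le_trans _ s0)// ltrN10.
Qed.

Lemma inv_sqrt_node n : (Num.sqrt (node n))^-1 <= 2 * (Num.sqrt n.+1%:R - Num.sqrt n%:R).
Proof.
set a := Num.sqrt n.+1%:R; set b := Num.sqrt n%:R; set s := Num.sqrt (node n).
have a0 : 0 < a by rewrite sqrtr_gt0 ltr0n.
have b0 : 0 <= b by rewrite sqrtr_ge0.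
have s0 : 0 < s by rewrite sqrtr_gt0 node_gt0.
have aa : a * a = n%:R + 1 by rewrite -expr2 sqr_sqrtr ?ler0n// -addn1 natrD.
have bb : b * b = n%:R by rewrite -expr2 sqr_sqrtr ?ler0n.
have ss : s * s = n%:R + 2^-1 by rewrite -expr2 sqr_sqrtr// ltW// node_gt0.
have ab : a + b <= 2 * s.
  rewrite -ler_sqr ?nnegrE; [|by lra|by lra].
  rewrite !expr2; have : 0 <= (a - b) ^+ 2 by rewrite sqr_ge0.
  rewrite expr2; lra.
rewrite -[leLHS]mul1r ler_pdivrMr//.
have : (a - b) * (a + b) = 1 by have := aa; have := bb; lra.
have : 0 < a - b.
  have : b < a by rewrite ltr_sqrt ?ltr0n// ltr_nat.
  lra.
nra.
Qed.

Lemma inv_sqr_node n : (0 < n)%N -> (node n ^+ 2)^-1 <= n%:R^-1 - n.+1%:R^-1.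
Proof.
move=> n0; have np : 0 < n%:R :> R by rewrite ltr0n.
have np1 : 0 < n.+1%:R :> R by rewrite ltr0n.
have -> : n%:R^-1 - n.+1%:R^-1 = (n%:R * n.+1%:R)^-1 :> R.
  by rewrite -addn1 natrD; field; rewrite -natr1 in np1 *; rewrite !gt_eqF.
rewrite lef_pV2 ?posrE ?mulr_gt0 ?exprn_gt0 ?node_gt0//.
by rewrite /node -addn1 natrD; lra.
Qed.

(** For n < k the logarithm is at most 4 sqrt(v / node n), and the inverse square roots telescope to
    8 k in all. For n >= k it is at most (v / node n)^2, and the inverse squares telescope to one
    more k. *)
Lemma node_log_sum v (k N : nat) : 0 <= v -> v <= k%:R -> (0 < k)%N ->
  \sum_(n < N) ln (1 + (v / node n) ^+ 2) <= 9 * k%:R.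
Proof.
move=> v0 vk k0; have kp : 0 < k%:R :> R by rewrite ltr0n.
have kk : Num.sqrt k%:R * Num.sqrt k%:R = k%:R :> R by rewrite -expr2 sqr_sqrtr ?ler0n.
have sk : 0 < Num.sqrt k%:R :> R by rewrite sqrtr_gt0.
suff : \sum_(n < N) ln (1 + (v / node n) ^+ 2) <=
   (if (N <= k)%N then 8 * Num.sqrt k%:R * Num.sqrt N%:R
    else 8 * k%:R + k%:R ^+ 2 * (k%:R^-1 - N%:R^-1)).
  move=> /le_trans; apply; case: ifP => Nk.
    have : Num.sqrt N%:R <= Num.sqrt k%:R :> R by rewrite ler_sqrt ?ler0n// ler_nat.
    by nra.
  rewrite mulrBr expr2 mulfK ?gt_eqF//.
  have : 0 <= k%:R * k%:R * N%:R^-1 :> R by rewrite !mulr_ge0 ?invr_ge0.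
  lra.
elim: N => [|N ih]; first by rewrite big_ord0 leq0n sqrtr0 mulr0.
rewrite big_ord_recr/=; set u := v / node N.
have u0 : 0 <= u by rewrite divr_ge0// ltW// node_gt0.
have l1 : ln (1 + u ^+ 2) <= 4 * Num.sqrt u.
  apply: (@le_trans _ _ (ln ((1 + u) * (1 + u)))).
    by rewrite ler_ln ?posrE ?mulr_gt0 ?ltr_wpDr ?sqr_ge0// expr2; nra.
  by rewrite lnM ?posrE ?ltr_wpDr//; have := ln1D_sqrt u0; lra.
have l2 : ln (1 + u ^+ 2) <= u ^+ 2.
  by rewrite le_ln1Dx// (lt_le_trans _ (sqr_ge0 _))// ltrN10.
have [Nk|kN] := ltnP N k.
  rewrite (ltnW Nk) in ih; apply: (le_trans (lerD ih l1)).
  have su : Num.sqrt u <= Num.sqrt k%:R * (2 * (Num.sqrt N.+1%:R - Num.sqrt N%:R)).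
    rewrite /u sqrtrM// ler_pM ?sqrtr_ge0//; first by rewrite ler_sqrt// ler0n.
    by rewrite sqrtrV ?inv_sqrt_node// ltW// node_gt0.
  by nra.
have N0 : (0 < N)%N by exact: leq_trans kN.
have uN : u ^+ 2 <= k%:R ^+ 2 * (N%:R^-1 - N.+1%:R^-1).
  rewrite /u expr_div_n ler_pM ?sqr_ge0 ?invr_ge0 ?sqr_ge0 ?inv_sqr_node//.
  by rewrite ler_sqr ?nnegrE ?ler0n.
move: ih; case: ifP => Nk ih.
  have kN' : k = N by apply/eqP; rewrite eqn_leq kN.
  subst N; apply: (le_trans (lerD ih (le_trans l2 uN))).
  by rewrite lerD2r -mulrA kk.
apply: (le_trans (lerD ih (le_trans l2 uN))).
by rewrite -addrA lerD2l -mulrDr addrA subrK.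
Qed.

Definition node_prod (m : nat -> nat) N z : R[i] :=
  \prod_(n < N) (1 - (z / (node n)%:C) ^+ 2) ^+ m n.

Lemma cabs_node_factor n z : cabs (1 - (z / (node n)%:C) ^+ 2) <= 1 + (cabs z / node n) ^+ 2.
Proof.
rewrite (le_trans (cabsB _ _))// cabs1 cabsX cabsM cabsV cabs_real ger0_norm//.
by rewrite ltW// node_gt0.
Qed.

Lemma node_prod_bound (m : nat -> nat) (M : R) N z : (forall n, (m n)%:R <= M) ->
  cabs (node_prod m N z) <= expR (9 * M * (cabs z + 1)).
Proof.
move=> mM; have M0 : 0 <= M by rewrite (le_trans _ (mM 0%N)).
pose k := (Num.truncn (cabs z)).+1.
have kz : cabs z <= k%:R by rewrite ltW// truncnS_gt.
have kz1 : k%:R <= cabs z + 1.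
  by rewrite /k -addn1 natrD lerD2r truncn_le ?cabs_ge0.
apply: (@le_trans _ _ (expR (\sum_(n < N) M * ln (1 + (cabs z / node n) ^+ 2)))).
  rewrite /node_prod cabs_prod (big_morph expR (@expRD R) (@expR0 R)).
  apply: ler_prod => n _; rewrite cabs_ge0/= cabsX.
  set a := (cabs z / node n) ^+ 2; have a0 : 0 <= a by rewrite sqr_ge0.
  have p : 0 < 1 + a by rewrite ltr_wpDr.
  apply: (@le_trans _ _ ((1 + a) ^+ m n)).
    by rewrite lerXn2r ?nnegrE ?cabs_ge0 ?(ltW p)// cabs_node_factor.
  rewrite -[X in X ^+ _](lnK p) -expRM_natl ler_expR ler_wpM2r//.
  by rewrite ln_ge0// lerDl.
rewrite ler_expR -mulr_sumr.
apply: (le_trans (ler_wpM2l M0 (node_log_sum N (cabs_ge0 z) kz (ltn0Sn _)))).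
by nra.
Qed.

Definition comb N z : R[i] := \prod_(n < N) (1 - (z / (node n)%:C) ^+ 2).

Lemma nat_complex n : (n%:R : R[i]) = (n%:R)%:C.
Proof. by rewrite rmorph_nat. Qed.

(** The truncated form of cos(pi (z + 1)) = - cos(pi z). *)
Lemma comb_shift N z : comb N (z + 1) * (N%:R - 2^-1 - z) = - comb N z * (N%:R + 2^-1 + z).
Proof.
elim: N => [|N ih]; first by rewrite /comb !big_ord0; field.
rewrite /comb !big_ord_recr/= -/(comb N _) -/(comb N z).
have n0 : (node N)%:C != 0 :> R[i] by rewrite -cabs_eq0 cabs_real normr_eq0 gt_eqF// node_gt0.
have NE : N%:R = (node N)%:C - 2^-1 :> R[i].
  by rewrite /node real_complexD rmorph_nat fmorphV rmorph_nat addrK.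
have NE1 : N.+1%:R = (node N)%:C + 2^-1 :> R[i] by rewrite -addn1 natrD NE; field.
rewrite NE in ih; rewrite NE1; set a := (node N)%:C in n0 ih *; clearbody a.
have -> : comb N (z + 1) * (1 - ((z + 1) / a) ^+ 2) * (a + 2^-1 - 2^-1 - z) =
  comb N (z + 1) * (a - 2^-1 - 2^-1 - z) * ((a + 2^-1 + 2^-1 + z) * (a - z) / a ^+ 2) by field.
rewrite ih; field; exact: n0.
Qed.

(* Shifting [z] by 1 only changes the end factors of the product, so for large [N] the size
   of [comb N z] is governed by the residue of [z] in the strip [0 <= Re z < 1]. *)
Lemma comb_bound z : 0 <= Re z -> exists N0, forall N, (N0 <= N)%N ->
  cabs (comb N z) <= expR (28 + 9 * `|Im z|).
Proof.
move=> x0; pose k := Num.truncn (Re z).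
have kz : k%:R <= Re z by rewrite truncn_le.
have zk : Re z < k%:R + 1 by rewrite natr1 truncnS_gt.
pose A := cabs z + 1.
have A0 : 0 <= A by rewrite addr_ge0 ?cabs_ge0.
(* For N beyond [y] a shift by 1 multiplies the modulus by at most 1 + 1 / (k + 1), so the k shifts
   together cost at most a factor e. *)
pose y := 1 + A + (2 + 2 * A) * (k%:R + 1).
exists (Num.truncn y).+1 => N yN'.
have k1 : 0 < k%:R + 1 :> R by rewrite ltr_wpDl.
have yN : y <= N%:R by rewrite (le_trans (ltW (truncnS_gt _)))// ler_nat.
set q := 1 + (k%:R + 1)^-1 : R.
pose z0 := z - k%:R.
have kR := nat_complex k.
have step i : (i < k)%N -> cabs (comb N (z0 + i.+1%:R)) <= cabs (comb N (z0 + i%:R)) * q.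
  move=> ik; have := comb_shift N (z0 + i%:R).
  have -> : z0 + i%:R + 1 = z0 + i.+1%:R by rewrite -addn1 natrD addrA.
  set u := z0 + i%:R => /(congr1 (@cabs R)); rewrite !cabsM cabsN.
  have uA : cabs u <= A.
    have Im_u : Im u = Im z.
      by rewrite /u /z0 !nat_complex !ImD ImN/= ?(oppr0, subr0, addr0).
    have Re_u : Re u = Re z - k%:R + i%:R.
      by rewrite /u /z0 !nat_complex !ReD ReN/=.
    have ik' : i%:R <= k%:R :> R by rewrite ler_nat ltnW.
    have ui : `|Re u| <= `|Re z|.
      by rewrite Re_u (ger0_norm x0) ger0_norm; have := ler0n R i; lra.
    rewrite /A (le_trans (y := cabs z)) ?lerDl// -ler_sqr ?nnegrE ?cabs_ge0//.
    rewrite !sqr_cabs Im_u lerD2r -[X in X <= _]real_normK ?num_real//.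
    by rewrite -[X in _ <= X]real_normK ?num_real// ler_sqr ?nnegrE.
  have NC := nat_complex N.
  have hC : (2^-1 : R[i]) = (2^-1)%:C by rewrite fmorphV rmorph_nat.
  have l1 : N%:R - 1 - A <= cabs (N%:R - 2^-1 - u).
    have := cabs_sub_ge (N%:R - 2^-1) u; rewrite NC hC -real_complexB cabs_real.
    have : N%:R - 2^-1 <= `|N%:R - 2^-1 : R| by exact: ler_norm.
    lra.
  have l2 : cabs (N%:R + 2^-1 + u) <= N%:R + 1 + A.
    apply: (le_trans (cabsD _ _)); rewrite NC hC -real_complexD cabs_real ger0_norm; last first.
      by rewrite addr_ge0.
    lra.
  have NA : 0 < N%:R - 1 - A.
    have : 0 < (2 + 2 * A) * (k%:R + 1) by rewrite mulr_gt0//; lra.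
    by move: yN; rewrite /y; lra.
  move=> E; rewrite -(ler_pM2r NA).
  have : (N%:R + 1 + A) <= q * (N%:R - 1 - A).
    have qk : (q - 1) * (k%:R + 1) = 1 by rewrite /q addrC addKr mulVf// gt_eqF.
    have q1 : 0 <= q - 1 by rewrite /q addrC addKr invr_ge0 ltW.
    move: yN; rewrite /y; nra.
  move=> l3; have c0 := cabs_ge0 (comb N u).
  apply: (le_trans (ler_wpM2l (cabs_ge0 _) l1)); rewrite E -mulrA ler_wpM2l//.
  exact: le_trans l3.
have iter i : (i <= k)%N -> cabs (comb N (z0 + i%:R)) <= cabs (comb N z0) * q ^+ i.
  have q0 : 0 <= q by rewrite addr_ge0// invr_ge0 ltW.
  elim: i => [|i ih] ik; first by rewrite addr0 expr0 mulr1.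
  rewrite (le_trans (step i ik))// exprSr mulrA ler_wpM2r//; exact: ih (ltnW ik).
have := iter k (leqnn k); rewrite /z0 subrK -/z0 => h.
have qk : q ^+ k <= expR 1.
  apply: (@le_trans _ _ (expR (k.+1%:R^-1) ^+ k)).
    rewrite lerXn2r ?nnegrE ?expR_ge0 ?addr_ge0 ?invr_ge0 ?(ltW k1)//.
    by rewrite /q natr1 expR_ge1Dx.
  rewrite -expRM_natl ler_expR -[leRHS](divff (x := k.+1%:R)) ?pnatr_eq0//.
  by rewrite ler_wpM2r ?invr_ge0// ler_nat.
have z0b : cabs z0 <= 1 + `|Im z|.
  rewrite (le_trans (cabs_le_sum _))// /z0 kR ReD ImD ReN ImN/= ?(oppr0, subr0, addr0) lerD2r.
  by rewrite ger0_norm; lra.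
have c0 : cabs (comb N z0) <= expR (9 * (cabs z0 + 1)).
  have := @node_prod_bound (fun=> 1%N) 1 N z0 (fun=> lexx 1); rewrite mulr1.
  by rewrite /node_prod /comb; under eq_bigr do rewrite expr1.
apply: (le_trans h); apply: (le_trans (ler_pM (cabs_ge0 _) _ c0 qk)).
  by rewrite exprn_ge0// addr_ge0// invr_ge0 ltW.
by rewrite -expRD ler_expR; lra.
Qed.

End lattice.

(** * The logarithm of one factor on the rotated ray *)

Section rotated_factor.
Variable R : realType.
Variables (x d : R).
Hypothesis x0 : 0 < x.
Hypothesis d0 : 0 < d.
Hypothesis d1 : d <= 1.

(* [hfactor s] is the logarithm of the modulus of [1 - (z / s)^2] at [z = x (1 + i d)]. *)
Definition ray_point : R[i] := x +i* (d * x).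
Definition qfactor (u : R) : R := cabs (1 - u%:C * (1 +i* d) ^+ 2).
Definition hfactor (s : R) : R := ln (qfactor ((x / s) ^+ 2)).

Lemma qfactorE (s : R) : s != 0 -> qfactor ((x / s) ^+ 2) = cabs (1 - (ray_point / s%:C) ^+ 2).
Proof.
move=> s0; congr (cabs (_ - _)).
have -> : ray_point = x%:C * (1 +i* d).
  by apply: complex_ext; rewrite /= !(mul0r, subr0, addr0, mulr1)// mulrC.
rewrite !expr_div_n exprMn rmorphM fmorphV !rmorphXn/=.
by rewrite mulrAC.
Qed.

Let sqE : ((1 : R) +i* d) ^+ 2 = (1 - d * d) +i* (2 * d).
Proof. by rewrite expr2; apply: complex_ext; rewrite /= ?mulr1 ?mul1r//; ring. Qed.

(** The real part 1 - u + u d^2 and the imaginary part - 2 d u are never small together. This is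
    what the rotation buys: the logarithm stays finite at u = 1. *)
Lemma qfactor_lower (u : R) : 0 <= u -> d / 2 * Num.max 1 u <= qfactor u.
Proof.
have [dpos dle] := conj d0 d1.
move=> u0.
have h1 : 2 * d * u <= qfactor u.
  apply: le_trans (Im_le_cabs _); rewrite sqE ImD ImN Im_realM/=.
  by rewrite sub0r normrN ger0_norm ?mulr_ge0// ?mulr_ge0 ?(ltW d0)//; lra.
have h2 : 1 - u <= qfactor u.
  apply: le_trans (Re_le_cabs _); rewrite sqE ReD ReN Re_realM/=.
  apply: le_trans (ler_norm _); have := mulr_ge0 u0 (sqr_ge0 d); rewrite expr2; lra.
have du := mulr_ge0 (ltW d0) u0.
have [u1|u1] := leP 1 u; first by lra.
have [u4|u4] := leP 4^-1 u; last by lra.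
have := ler_wpM2l (ltW d0) u4; lra.
Qed.

Lemma qfactor_gt0 (u : R) : 0 <= u -> 0 < qfactor u.
Proof.
move=> u0; apply: lt_le_trans (qfactor_lower u0).
by rewrite !mulr_gt0// lt_max ltr01.
Qed.

Lemma qfactor_lip (u v : R) : qfactor u - qfactor v <= 2 * `|u - v|.
Proof.
have [dpos dle] := conj d0 d1.
apply: le_trans (cabs_sub_ge _ _) _.
have -> : 1 - u%:C * (1 +i* d) ^+ 2 - (1 - v%:C * (1 +i* d) ^+ 2) = - ((u - v)%:C * (1 +i* d) ^+ 2).
  by rewrite real_complexB; ring.
rewrite cabsN cabsM cabs_real mulrC ler_wpM2r// cabsX sqr_cabs/= expr1n.
by rewrite expr2; nra.
Qed.

Lemma qfactor0 : qfactor 0 = 1.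
Proof. by rewrite /qfactor mul0r subr0 cabs1. Qed.

Lemma qfactor_upper (u : R) : 0 <= u -> qfactor u <= 1 + 2 * u.
Proof.
by move=> u0; have := qfactor_lip u 0; rewrite qfactor0 subr0 ger0_norm//; lra.
Qed.

Lemma ln_qfactor_lip (u v : R) : 0 <= u -> 0 <= v ->
  ln (qfactor u) - ln (qfactor v) <= 4 / d * (`|u - v| / Num.max 1 v).
Proof.
move=> u0 v0; have qu := qfactor_gt0 u0; have qv := qfactor_gt0 v0.
have m0 : 0 < Num.max 1 v by rewrite lt_max ltr01.
have E : qfactor u <= qfactor v * (1 + 2 * `|u - v| / qfactor v).
  by rewrite mulrDr mulr1 mulrC divfK ?gt_eqF//; have := qfactor_lip u v; lra.
have p : 0 <= 2 * `|u - v| / qfactor v by rewrite divr_ge0 ?mulr_ge0// ltW.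
have p1 : 0 < 1 + 2 * `|u - v| / qfactor v by rewrite ltr_wpDr.
rewrite lerBlDl; apply: (@le_trans _ _ (ln (qfactor v * (1 + 2 * `|u - v| / qfactor v)))).
  by rewrite ler_ln ?posrE ?mulr_gt0.
rewrite lnM ?posrE// lerD2l (le_trans (le_ln1Dx _))//; first by lra.
rewrite ler_pdivrMr//.
have l := qfactor_lower v0.
apply: (@le_trans _ _ (4 / d * (`|u - v| / Num.max 1 v) * (d / 2 * Num.max 1 v))).
  by rewrite le_eqVlt; apply/orP; left; apply/eqP; field; rewrite !gt_eqF.
by rewrite ler_wpM2l// !(mulr_ge0, divr_ge0, invr_ge0)// ltW.
Qed.

Lemma ln_qfactor_small (u : R) : 0 <= u -> u <= 4^-1 -> `|ln (qfactor u)| <= 4 * u.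
Proof.
move=> u0 u4; have qu := qfactor_gt0 u0.
have up : ln (qfactor u) <= 2 * u.
  apply: (@le_trans _ _ (ln (1 + 2 * u))); last by rewrite le_ln1Dx//; lra.
  by rewrite ler_ln ?posrE ?qfactor_upper//; lra.
have lo : 1 - 2 * u <= qfactor u.
  by have := qfactor_lip 0 u; rewrite qfactor0 sub0r normrN ger0_norm//; lra.
have p : 0 < 1 - 2 * u by lra.
have lo2 : - (4 * u) <= ln (qfactor u).
  rewrite lerNl -lnV ?posrE// (le_trans (y := ln (1 + 4 * u)))//; last by rewrite le_ln1Dx//; lra.
  rewrite ler_ln ?posrE ?invr_gt0//; last by lra.
  rewrite -[leLHS]mul1r ler_pdivrMr//; nra.
by rewrite ler_norml lo2/= (le_trans up)//; lra.
Qed.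

Lemma hfactor_small (s : R) : 0 < s -> (x / s) ^+ 2 <= 4^-1 -> `|hfactor s| <= 4 * (x / s) ^+ 2.
Proof. by move=> s0; apply: ln_qfactor_small; exact: sqr_ge0. Qed.

(** The cost of moving a point by at most 1. The exponent 3/2 of s makes the total over all
    half-integers O(sqrt x), which is negligible against x for fixed [d]. *)
Lemma hfactor_step (s t : R) : 0 < s -> 0 < t -> `|s - t| <= 1 -> t <= 3 * s -> s <= 4 * t ->
  hfactor s - hfactor t <= 32 / d * (Num.sqrt x / (s * Num.sqrt s)).
Proof.
move=> s0 t0 st t3 s4; have [xpos dpos] := conj x0 d0; apply: le_trans (ln_qfactor_lip (sqr_ge0 _) (sqr_ge0 _)) _.
have -> : 32 / d = 4 / d * 8 by ring.
rewrite -[leRHS]mulrA ler_wpM2l ?divr_ge0 ?(ltW d0)//.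
set p := Num.sqrt (x / t); have p0 : 0 < p by rewrite sqrtr_gt0 divr_gt0.
have pp : p ^+ 2 = x / t by rewrite sqr_sqrtr// divr_ge0// ltW.
set r := Num.sqrt s; have r0 : 0 < r by rewrite sqrtr_gt0.
have rr : r ^+ 2 = s by rewrite sqr_sqrtr// ltW.
(* The maximum of 1 and p^4 is weakened to p^3: this single bound is valid for small and large x /
   t, and it leaves the factor p = sqrt(x / t). *)
have m3 : p ^+ 3 <= Num.max 1 ((x / t) ^+ 2).
  rewrite -pp -exprM le_max; have [p1|p1] := leP p 1.
    by rewrite exprn_ile1// ltW.
  by rewrite [X in _ || X](_ : _ = true) ?orbT// ler_eXn2l.
have m0 : 0 < Num.max 1 ((x / t) ^+ 2) by rewrite lt_max ltr01.
have num : `|(x / s) ^+ 2 - (x / t) ^+ 2| <= 4 * p ^+ 4 / s.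
  have -> : (x / s) ^+ 2 - (x / t) ^+ 2 = (x / t) ^+ 2 / s ^+ 2 * ((t - s) * (t + s)).
    by field; rewrite !gt_eqF.
  rewrite normrM ger0_norm ?divr_ge0 ?sqr_ge0// normrM distrC [`|t + s|]ger0_norm; last by lra.
  have -> : 4 * p ^+ 4 / s = (x / t) ^+ 2 / s ^+ 2 * (4 * s).
    by rewrite -pp; field; rewrite gt_eqF.
  rewrite ler_wpM2l ?divr_ge0 ?sqr_ge0//.
  by have := normr_ge0 (s - t); nra.
have ps : p <= 2 * (Num.sqrt x / r).
  have e : 2 * (Num.sqrt x / r) = Num.sqrt (4 * x / s).
    rewrite sqrtrM ?mulr_ge0 ?(ltW x0)// sqrtrM// sqrtrV ?(ltW s0)//.
    have -> : 4 = 2 ^+ 2 :> R by ring.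
    by rewrite sqrtr_sqr ger0_norm// mulrA.
  rewrite e ler_sqrt; last by rewrite !mulr_ge0 ?invr_ge0 ?ltW.
  by rewrite ler_pdivrMr// mulrAC ler_pdivlMr//; nra.
apply: (@le_trans _ _ (4 * p ^+ 4 / s / p ^+ 3)).
  rewrite ler_pM ?invr_ge0 ?(ltW m0)// lef_pV2 ?posrE ?exprn_gt0//.
have -> : 4 * p ^+ 4 / s / p ^+ 3 = 4 / s * p by field; rewrite !gt_eqF.
have -> : 8 * (Num.sqrt x / (s * r)) = 4 / s * (2 * (Num.sqrt x / r)).
  by field; rewrite !gt_eqF.
by rewrite ler_wpM2l// divr_ge0// ltW.
Qed.

Lemma hfactor_split (s : R) : 0 < s -> hfactor s =
  ln (cabs (s%:C - ray_point)) + ln (cabs (s%:C + ray_point)) - 2 * ln s.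
Proof.
move=> s0; have s0c : s%:C != 0 :> R[i] by rewrite -cabs_eq0 cabs_real normr_eq0 gt_eqF.
have nz (w : R[i]) : Im w != 0 -> 0 < cabs w.
  by rewrite cabs_gt0; apply: contraNneq => ->.
have dx : d * x != 0 by rewrite mulf_neq0// gt_eqF.
have n1 : 0 < cabs (s%:C - ray_point) by apply: nz; rewrite ImD ImN/= sub0r oppr_eq0.
have n2 : 0 < cabs (s%:C + ray_point) by apply: nz; rewrite ImD/= add0r.
rewrite /hfactor qfactorE ?gt_eqF//.
have -> : 1 - (ray_point / s%:C) ^+ 2 = (s%:C - ray_point) * (s%:C + ray_point) * (s%:C ^+ 2)^-1.
  by field.
rewrite !cabsM cabsV cabsX cabs_real gtr0_norm//.
rewrite lnM ?posrE ?mulr_gt0 ?invr_gt0 ?exprn_gt0// lnM ?posrE// lnV ?posrE ?exprn_gt0//.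
by rewrite lnXn// mulr_natl.
Qed.

End rotated_factor.

(** * Replacing a point by a spread of points around it *)

Section smearing.
Variable R : realType.
Implicit Types (w : R[i]) (m y : R).

(** The negative of a symmetric second difference of the logarithmic potential. It is positive
    essentially only while m is of size at most |w|. *)
Definition ell w m := 2 * ln (cabs w) - ln (cabs (w + m%:C)) - ln (cabs (w - m%:C)).

Lemma ellN w m : ell (- w) m = ell w m.
Proof.
rewrite /ell cabsN; have -> : - w + m%:C = - (w - m%:C) by ring.
have -> : - w - m%:C = - (w + m%:C) by ring.
by rewrite !cabsN; ring.
Qed.

Lemma Im_cabs_pos w m : 1 <= `|Im w| -> [/\ 1 <= cabs w, 1 <= cabs (w + m%:C) & 1 <= cabs (w - m%:C)].
Proof.
move=> w1; have h u : Im u = Im w -> 1 <= cabs u.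
  by move=> e; apply: le_trans (Im_le_cabs u); rewrite e.
by split; apply: h; rewrite ?ImD ?ImN/= ?oppr0 ?addr0.
Qed.

Lemma ell_large w m : 1 <= `|Im w| -> 2 * cabs w <= m -> ell w m <= 0.
Proof.
move=> w1 wm; have [h1 h2 h3] := Im_cabs_pos m w1.
have m0 : 0 <= m by apply: le_trans wm; rewrite mulr_ge0// cabs_ge0.
have y0 : 0 < cabs w by exact: lt_le_trans h1.
have a1 : cabs w <= cabs (w + m%:C).
  have := cabs_sub_ge m%:C (- w); rewrite cabsN cabs_real ger0_norm// opprK [m%:C + w]addrC; lra.
have a2 : cabs w <= cabs (w - m%:C).
  have := cabs_sub_ge m%:C w; rewrite cabs_real ger0_norm// cabsBC; lra.
have b1 : ln (cabs w) <= ln (cabs (w + m%:C)) by rewrite ler_ln ?posrE// (lt_le_trans y0).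
have b2 : ln (cabs w) <= ln (cabs (w - m%:C)) by rewrite ler_ln ?posrE// (lt_le_trans y0).
by rewrite /ell; lra.
Qed.

Lemma ell_small w m : 1 <= `|Im w| -> 0 <= m -> 2 * m <= cabs w -> ell w m <= 2 * (m / cabs w) ^+ 2.
Proof.
move=> w1 m0 wm; have [h1 h2 h3] := Im_cabs_pos m w1.
have y0 : 0 < cabs w by exact: lt_le_trans h1.
have p1 : 0 < cabs (w + m%:C) by exact: lt_le_trans h2.
have p2 : 0 < cabs (w - m%:C) by exact: lt_le_trans h3.
set v := (m / cabs w) ^+ 2.
have v0 : 0 <= v by exact: sqr_ge0.
have v4 : v <= 4^-1.
  have -> : 4^-1 = 2^-1 ^+ 2 :> R by field.
  by rewrite ler_sqr ?nnegrE ?invr_ge0 ?divr_ge0 ?(ltW y0)// ler_pdivrMr// mulrC ler_pdivlMr// mulrC.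
have prod : (1 - v) * cabs w ^+ 2 <= cabs (w + m%:C) * cabs (w - m%:C).
  have -> : (1 - v) * cabs w ^+ 2 = cabs (w ^+ 2) - cabs (m%:C ^+ 2).
    rewrite !cabsX cabs_real real_normK ?num_real//.
    by rewrite /v; field; rewrite gt_eqF.
  rewrite -cabsM (le_trans (cabs_sub_ge _ _))//.
  by have -> : w ^+ 2 - m%:C ^+ 2 = (w + m%:C) * (w - m%:C) by ring.
have q0 : 0 < 1 - v by lra.
have : ln ((1 - v) * cabs w ^+ 2) <= ln (cabs (w + m%:C) * cabs (w - m%:C)).
  by rewrite ler_ln ?posrE ?mulr_gt0 ?exprn_gt0.
rewrite expr2 !lnM ?posrE ?mulr_gt0// => h.
have : - ln (1 - v) <= 2 * v.
  rewrite -lnV ?posrE// (le_trans (y := ln (1 + 2 * v)))//; last by rewrite le_ln1Dx//; lra.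
  rewrite ler_ln ?posrE ?invr_gt0//; last by lra.
  by rewrite -[leLHS]mul1r ler_pdivrMr//; nra.
by rewrite /ell; lra.
Qed.

(** An antiderivative of 1 / sqrt |t| across the singularity at 0; sums of that function over unit
    steps are compared with its increments. *)
Definition sgnsqrt (t : R) := if 0 <= t then 2 * Num.sqrt t else - (2 * Num.sqrt (- t)).

Let sqrtE (t : R) : 0 <= t -> 0 <= Num.sqrt t /\ Num.sqrt t * Num.sqrt t = t.
Proof. by move=> t0; rewrite sqrtr_ge0 -expr2 sqr_sqrtr. Qed.

Lemma sgnsqrt_incr (t : R) :
  (Num.sqrt (Num.max 1 `|t|))^-1 <= 2 * (sgnsqrt (t + 1) - sgnsqrt t).
Proof.
set M := Num.max 1 `|t|.
have M1 : 1 <= M by rewrite le_max lexx.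
have tM : `|t| <= M by rewrite le_max lexx orbT.
have M0 : 0 <= M by lra.
have [r0 rr] := sqrtE M0; set r := Num.sqrt M in r0 rr *.
have r1 : 1 <= r by nra.
have rp : 0 < r by lra.
rewrite -[leLHS]mul1r ler_pdivrMr// /sgnsqrt.
have [t0|t0] := leP 0 t.
  have t1 : 0 <= t + 1 by lra.
  rewrite t1; have [a0 aa] := sqrtE t1; have [b0 bb] := sqrtE t0.
  rewrite ger0_norm// in tM.
  set a := Num.sqrt (t + 1) in a0 aa *; set b := Num.sqrt t in b0 bb *.
  have ar : a <= 2 * r by nra.
  have ba : b <= a by nra.
  have ab : (a - b) * (a + b) = 1 by lra.
  nra.
have nt : 0 <= - t by lra.
have [b0 bb] := sqrtE nt; set b := Num.sqrt (- t) in b0 bb *.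
have [t1|t1] := leP 0 (t + 1).
  have [a0 aa] := sqrtE t1; set a := Num.sqrt (t + 1) in a0 aa *.
  have ab : 1 <= a + b by nra.
  nra.
have nt1 : 0 <= - (t + 1) by lra.
have [a0 aa] := sqrtE nt1; set a := Num.sqrt (- (t + 1)) in a0 aa *.
rewrite ltr0_norm// in tM.
have br : b <= r by nra.
have ba : a <= b by nra.
have ab : (b - a) * (a + b) = 1 by lra.
nra.
Qed.

Lemma sgnsqrt_total (t b : R) : 0 <= b -> sgnsqrt (t + b) - sgnsqrt t <= 4 * Num.sqrt b.
Proof.
move=> b0; have [r0 rr] := sqrtE b0; set r := Num.sqrt b in r0 rr *.
rewrite /sgnsqrt; have [t0|t0] := leP 0 t.
  have t1 : 0 <= t + b by lra.
  rewrite t1; have [a0 aa] := sqrtE t1; have [c0 cc] := sqrtE t0.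
  set a := Num.sqrt (t + b) in a0 aa *; set c := Num.sqrt t in c0 cc *.
  have : a <= c + r by nra.
  lra.
have nt : 0 <= - t by lra.
have [c0 cc] := sqrtE nt; set c := Num.sqrt (- t) in c0 cc *.
have [t1|t1] := leP 0 (t + b).
  have [a0 aa] := sqrtE t1; set a := Num.sqrt (t + b) in a0 aa *.
  have : a <= r by nra.
  have : c <= r by nra.
  lra.
have nt1 : 0 <= - (t + b) by lra.
have [a0 aa] := sqrtE nt1; set a := Num.sqrt (- (t + b)) in a0 aa *.
have : c <= a + r by nra.
lra.
Qed.

(** Since |w + m| >= |w|, only ln(|w| / |w - m|) remains. The bound ln q <= 2 sqrt q trades it for
    an inverse square root, whose sum over m telescopes. *)
Lemma ell_mid w m : 1 <= `|Im w| -> 0 <= Re w -> 0 <= m ->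
  ell w m <= 2 * Num.sqrt (cabs w) / Num.sqrt (Num.max 1 `|m - Re w|).
Proof.
move=> w1 wr m0; have [h1 h2 h3] := Im_cabs_pos m w1.
have y0 : 0 < cabs w by exact: lt_le_trans h1.
have a1 : cabs w <= cabs (w + m%:C).
  rewrite -ler_sqr ?nnegrE ?cabs_ge0// !sqr_cabs ReD ImD/= addr0 lerD2r.
  by rewrite ler_sqr ?nnegrE//; lra.
have b1 : ln (cabs w) <= ln (cabs (w + m%:C)) by rewrite ler_ln ?posrE// (lt_le_trans y0).
set v := Num.max 1 `|m - Re w|.
have v0 : 0 < v by rewrite lt_max ltr01.
have a2 : v <= cabs (w - m%:C).
  by rewrite ge_max h3/= (le_trans _ (Re_le_cabs _))// ReD ReN/= distrC.
have b2 : ln v <= ln (cabs (w - m%:C)) by rewrite ler_ln ?posrE// (lt_le_trans v0).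
have -> : 2 * Num.sqrt (cabs w) / Num.sqrt v = 2 * Num.sqrt (cabs w / v).
  by rewrite sqrtrM ?cabs_ge0// sqrtrV ?(ltW v0)// mulrA.
set q := cabs w / v; have q0 : 0 < q by rewrite divr_gt0.
have : ln q <= 2 * Num.sqrt q.
  have s0 : 0 < Num.sqrt q by rewrite sqrtr_gt0.
  have -> : ln q = 2 * ln (Num.sqrt q).
    by rewrite -[in LHS](sqr_sqrtr (ltW q0)) lnXn// mulr_natl.
  by rewrite ler_wpM2l// ltW// ln_sublinear.
rewrite lnM ?posrE ?invr_gt0// lnV ?posrE// /ell; lra.
Qed.

(** Blocks far beyond |w| contribute nothing positive, and blocks well below |w| are controlled by
    [ell_small]. A block of size comparable to |w| costs at most 32 B, and there (B / |w|)^2 > 1/16,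
    whence 512. *)
Lemma ell_block w (B : nat) : 1 <= `|Im w| -> (0 < B)%N ->
  \sum_(k < B) ell w (B + k)%:R <=
  if B%:R < 2 * cabs w then B%:R * (512 * (B%:R / cabs w) ^+ 2) else 0.
Proof.
move=> w1 B0; wlog wr : w w1 / 0 <= Re w.
  move=> h; have [/h->//|wr] := leP 0 (Re w).
  have := h (- w); rewrite ImN normrN ReN cabsN oppr_ge0 => /(_ w1 (ltW wr)).
  by under eq_bigr do rewrite ellN.
have [h1 _ _] := Im_cabs_pos 0 w1; set y := cabs w in h1 *.
have y0 : 0 < y by exact: lt_le_trans h1.
have BR : 0 < B%:R :> R by rewrite ltr0n.
case: ifPn => [By|]; last first.
  rewrite -leNgt => yB; apply: sumr_le0 => k _; apply: ell_large => //.
  by rewrite (le_trans yB)// ler_nat leq_addr.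
have [By4|By4] := leP (4 * B%:R) y.
  apply: (@le_trans _ _ (\sum_(k < B) 8 * (B%:R / y) ^+ 2)).
    apply: ler_sum => k _; have kB : (B + k)%:R <= 2 * B%:R :> R.
      by rewrite mulr2n mulrDl mul1r -natrD ler_nat leq_add2l ltnW.
    apply: (le_trans (ell_small w1 (ler0n _ _) _)); first by lra.
    have -> : 8 * (B%:R / y) ^+ 2 = 2 * (2 * B%:R / y) ^+ 2 by rewrite !expr_div_n; field; rewrite gt_eqF.
    rewrite ler_wpM2l// ler_sqr ?nnegrE ?divr_ge0 ?mulr_ge0 ?(ltW y0)//.
    by rewrite ler_wpM2r// invr_ge0 ltW.
  rewrite sumr_const card_ord -[X in X <= _]mulr_natl ler_wpM2l ?ler0n//.
  by rewrite ler_wpM2r ?sqr_ge0//; lra.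
have tel : \sum_(k < B) (Num.sqrt (Num.max 1 `|(B + k)%:R - Re w|))^-1 <= 8 * Num.sqrt B%:R.
  apply: (@le_trans _ _ (\sum_(k < B) 2 * (sgnsqrt (B%:R - Re w + k.+1%:R) - sgnsqrt (B%:R - Re w + k%:R)))).
    apply: ler_sum => k _.
    have -> : (B + k)%:R - Re w = B%:R - Re w + k%:R by rewrite natrD; ring.
    have -> : B%:R - Re w + k.+1%:R = B%:R - Re w + k%:R + 1 by rewrite -[k.+1%:R]natr1; ring.
    exact: sgnsqrt_incr.
  rewrite -mulr_sumr -(big_mkord xpredT (fun k => sgnsqrt (B%:R - Re w + k.+1%:R) - sgnsqrt (B%:R - Re w + k%:R))).
  rewrite telescope_sumr// addr0.
  have := @sgnsqrt_total (B%:R - Re w) B%:R (ltW BR); lra.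
apply: (@le_trans _ _ (2 * Num.sqrt y * (8 * Num.sqrt B%:R))).
  apply: le_trans (ler_wpM2l _ tel); last by rewrite mulr_ge0// sqrtr_ge0.
  by rewrite mulr_sumr; apply: ler_sum => k _; apply: ell_mid.
have s1 : Num.sqrt y * Num.sqrt B%:R <= 2 * B%:R.
  have e : 2 * B%:R = Num.sqrt (4 * B%:R) * Num.sqrt B%:R :> R.
    have -> : 4 = 2 ^+ 2 :> R by ring.
    by rewrite sqrtrM ?sqr_ge0// sqrtr_sqr ger0_norm// -mulrA -expr2 sqr_sqrtr// ltW.
  by rewrite e ler_wpM2r ?sqrtr_ge0// ler_sqrt ?ltW// mulr_gt0.
have s2 : 1 <= 16 * (B%:R / y) ^+ 2.
  have : 1 <= 4 * (B%:R / y) by rewrite mulrA ler_pdivlMr// mul1r ltW.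
  by rewrite expr2; nra.
have : B%:R * 32 <= B%:R * (512 * (B%:R / y) ^+ 2) by rewrite ler_wpM2l ?ler0n//; lra.
lra.
Qed.

(** The quantities 512 (B / |w|)^2 with B doubling and B < 2 |w| add up to at most 16 * 512 / 3,
    just below 2731. *)
Definition level_const : R := 2731.

Lemma ell_levels w (E h : nat) : 1 <= `|Im w| -> (0 < h)%N ->
  \sum_(i < E) (2 ^ i * h)%:R^-1 * \sum_(k < 2 ^ i * h) ell w (2 ^ i * h + k)%:R <= level_const.
Proof.
move=> w1 h0; have [h1 _ _] := Im_cabs_pos 0 w1; set y := cabs w in h1 *.
have y0 : 0 < y by exact: lt_le_trans h1.
have [c cE] : exists c : R, c * 3 = 512 by exists (512 / 3); field.
have c0 : 0 <= c by lra.
(* With [c * 3 = 512] the increment from b to 2 b of c b^2 is exactly the cost 512 b^2 of a level;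
   the cap at 4 stops the growth once b >= 2. *)
suff : \sum_(i < E) (2 ^ i * h)%:R^-1 * \sum_(k < 2 ^ i * h) ell w (2 ^ i * h + k)%:R <=
    c * Num.min ((2 ^ E * h)%:R / y) 4 ^+ 2.
  move=> /le_trans; apply.
  set mm := Num.min _ _; have m0 : 0 <= mm by rewrite le_min divr_ge0//= ltW.
  have m4 : mm <= 4 by rewrite ge_min lexx orbT.
  by rewrite /level_const expr2; nra.
elim: E => [|E ih]; first by rewrite big_ord0 mulr_ge0 ?sqr_ge0.
rewrite big_ord_recr/=; set B := (2 ^ E * h)%N in ih *.
have B0 : (0 < B)%N by rewrite muln_gt0 expn_gt0.
have BR : 0 < B%:R :> R by rewrite ltr0n.
have -> : (2 ^ E.+1 * h)%:R / y = 2 * (B%:R / y) by rewrite expnS -mulnA natrM mulrA.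
set b := B%:R / y in ih *; have b0 : 0 < b by rewrite divr_gt0.
have blk : B%:R^-1 * \sum_(k < B) ell w (B + k)%:R <= if b < 2 then 512 * b ^+ 2 else 0.
  rewrite mulrC ler_pdivrMr//; have := ell_block w1 B0; rewrite -/y -/b.
  by rewrite /b ltr_pdivrMr//; case: ifP => _; rewrite ?mul0r// mulrC.
apply: (le_trans (lerD ih blk)).
case: ifPn => [b2|]; last rewrite -leNgt => b2.
  by rewrite (min_l (x := b)) ?(min_l (x := 2 * b)) -?cE ?expr2; lra.
rewrite addr0 (min_r (x := 2 * b)); last by lra.
have m0 : 0 <= Num.min b 4 by rewrite le_min (ltW b0)/=.
have m1 : Num.min b 4 <= 4 by rewrite ge_min lexx orbT.
by apply: ler_wpM2l => //; rewrite !expr2; nra.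
Qed.

(* Averages [G] over points around [T] at [E] dyadic distances of equal weight. A logarithmic
   singularity costs a bounded amount summed over all levels, hence [O(1/E)] in the average. *)
Definition smear (E h T : nat) (G : nat -> R) : R :=
  \sum_(i < E) (2 * E%:R * (2 ^ i * h)%:R)^-1 *
     \sum_(k < 2 ^ i * h) (G (T + (2 ^ i * h + k))%N + G (T - (2 ^ i * h + k))%N).

Lemma smear_near (x d : R) (E h T : nat) : 0 < x -> 0 < d -> d <= 1 -> 1 <= d * x ->
  (0 < E)%N -> (0 < h)%N -> (2 ^ E * h <= T)%N ->
  hfactor x d (node R T) - smear E h T (fun n => hfactor x d (node R n)) <= level_const / E%:R.
Proof.
move=> x0 d0 d1 dx E0 h0 hT.
have ER : 0 < E%:R :> R by rewrite ltr0n.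
pose z := ray_point x d; pose s := node R T; pose H n := hfactor x d (node R n).
have s0 : 0 < s by exact: node_gt0.
pose w1 := s%:C - z; pose w2 := s%:C + z.
have i1 : 1 <= `|Im w1| by rewrite /w1 ImD ImN/= sub0r normrN ger0_norm// (le_trans _ dx).
have i2 : 1 <= `|Im w2| by rewrite /w2 ImD/= add0r ger0_norm// (le_trans _ dx).
have second (m : nat) : (m < T)%N -> 2 * H T - (H (T + m)%N + H (T - m)%N) <= ell w1 m%:R + ell w2 m%:R.
  move=> mT; have nD : node R (T + m) = s + m%:R by rewrite /s /node natrD; ring.
  have nB : node R (T - m) = s - m%:R by rewrite /s /node natrB ?(ltnW mT)//; ring.
  have p1 : 0 < s + m%:R by rewrite -nD node_gt0.
  have p2 : 0 < s - m%:R by rewrite -nB node_gt0.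
  rewrite /H nD nB !hfactor_split ?node_gt0//.
  rewrite -/s -/z /ell.
  have -> : (s + m%:R)%:C - z = w1 + (m%:R)%:C by rewrite /w1 real_complexD; ring.
  have -> : (s + m%:R)%:C + z = w2 + (m%:R)%:C by rewrite /w2 real_complexD; ring.
  have -> : (s - m%:R)%:C - z = w1 - (m%:R)%:C by rewrite /w1 real_complexB; ring.
  have -> : (s - m%:R)%:C + z = w2 - (m%:R)%:C by rewrite /w2 real_complexB; ring.
  have : ln (s + m%:R) + ln (s - m%:R) <= ln s + ln s.
    rewrite -!lnM ?posrE// ler_ln ?posrE ?mulr_gt0//.
    have : 0 <= (m%:R : R) ^+ 2 by exact: sqr_ge0.
    by rewrite expr2; lra.
  rewrite -/w1 -/w2; lra.
have -> : hfactor x d (node R T) - smear E h T H = \sum_(i < E) (2 * E%:R * (2 ^ i * h)%:R)^-1 *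
     \sum_(k < 2 ^ i * h) (2 * H T - (H (T + (2 ^ i * h + k))%N + H (T - (2 ^ i * h + k))%N)).
  under [RHS]eq_bigr do rewrite sumrB mulrBr.
  rewrite sumrB; congr (_ - _).
  transitivity (\sum_(i < E) E%:R^-1 * H T).
    by rewrite sumr_const card_ord -[RHS]mulr_natl mulrA divff ?mul1r// gt_eqF.
  apply: eq_bigr => i _; rewrite sumr_const card_ord -[X in _ = _ * X]mulr_natl.
  have : ((2 ^ i * h)%:R : R) != 0 by rewrite pnatr_eq0 -lt0n muln_gt0 expn_gt0.
  move: ((2 ^ i * h)%:R : R) (gt_eqF ER) => b + b0; move: (E%:R : R) (H T) => e a /negbT e0.
  by field; rewrite b0 e0.
apply: (@le_trans _ _ (\sum_(i < E) (2 * E%:R)^-1 * ((2 ^ i * h)%:R^-1 * \sum_(k < 2 ^ i * h) ell w1 (2 ^ i * h + k)%:R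
   + (2 ^ i * h)%:R^-1 * \sum_(k < 2 ^ i * h) ell w2 (2 ^ i * h + k)%:R))).
  apply: ler_sum => i _; rewrite -mulrDr -big_split/= [leRHS]mulrA -invfM.
  rewrite ler_wpM2l ?invr_ge0 ?mulr_ge0 ?ler0n//; apply: ler_sum => k _; apply: second.
  rewrite (leq_trans _ hT)// (@leq_trans (2 ^ i * h + 2 ^ i * h))// ?ltn_add2l//.
  by rewrite addnn -mul2n mulnA -expnS leq_mul2r leq_exp2l// ltn_ord orbT.
rewrite -mulr_sumr big_split/=.
have := lerD (ell_levels E i1 h0) (ell_levels E i2 h0) => L.
apply: (le_trans (ler_wpM2l _ L)); first by rewrite invr_ge0 mulr_ge0 ?ler0n.
by rewrite le_eqVlt; apply/orP; left; apply/eqP; field; rewrite gt_eqF.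
Qed.

End smearing.

(** * The weights of the smearing and summation by parts *)

Section smear_weights.
Variable R : realType.
Implicit Types (G : nat -> R).

Lemma smear_le E h T (G G' : nat -> R) : (2 ^ E * h <= T)%N ->
  (forall p, (T <= p + 2 ^ E * h)%N -> (p <= T + 2 ^ E * h)%N -> G p <= G' p) ->
  smear E h T G <= smear E h T G'.
Proof.
move=> hT GG; apply: ler_sum => i _; apply: ler_wpM2l.
  by rewrite invr_ge0 !mulr_ge0 ?ler0n.
apply: ler_sum => k _.
have kB : (2 ^ i * h + k <= 2 ^ E * h)%N.
  rewrite (@leq_trans (2 ^ i * h + 2 ^ i * h))// ?leq_add2l ?(ltnW (ltn_ord k))//.
  by rewrite addnn -mul2n mulnA -expnS leq_mul2r leq_exp2l// ltn_ord orbT.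
move: kB; set q := (2 ^ i * h + k)%N; set W := (2 ^ E * h)%N in hT GG * => kB.
by rewrite lerD// GG//; lia.
Qed.

Lemma smear_eq E h T (G G' : nat -> R) : (2 ^ E * h <= T)%N ->
  (forall p, (T <= p + 2 ^ E * h)%N -> (p <= T + 2 ^ E * h)%N -> G p = G' p) ->
  smear E h T G = smear E h T G'.
Proof.
by move=> hT GG; apply/eqP; rewrite eq_le !smear_le// => p p1 p2; rewrite GG.
Qed.

Lemma smear_cst E h T (c : R) : (0 < E)%N -> (0 < h)%N -> smear E h T (fun=> c) = c.
Proof.
move=> E0 h0; transitivity (\sum_(i < E) E%:R^-1 * c); last first.
  by rewrite sumr_const card_ord -[LHS]mulr_natl mulrA divff ?mul1r// pnatr_eq0 -lt0n.
apply: eq_bigr => i _; rewrite sumr_const card_ord -[X in _ * X]mulr_natl.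
have : ((2 ^ i * h)%:R : R) != 0 by rewrite pnatr_eq0 -lt0n muln_gt0 expn_gt0.
have : (E%:R : R) != 0 by rewrite pnatr_eq0 -lt0n.
move: ((2 ^ i * h)%:R : R) (E%:R : R) => b e e0 b0.
by field; rewrite b0 e0.
Qed.

Lemma smear0 E h T : smear E h T (fun=> 0 : R) = 0.
Proof.
by rewrite /smear big1// => i _; rewrite big1 ?mulr0// => k _; rewrite addr0.
Qed.

Lemma smearD E h T G G' : smear E h T (fun p => G p + G' p) = smear E h T G + smear E h T G'.
Proof.
rewrite /smear -big_split; apply: eq_bigr => i _ /=.
by rewrite -mulrDr -big_split/=; congr (_ * _); apply: eq_bigr => k _; ring.
Qed.

Lemma smearZ E h T G c : smear E h T (fun p => G p * c) = smear E h T G * c.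
Proof.
rewrite /smear mulr_suml; apply: eq_bigr => i _ /=.
by rewrite -[RHS]mulrA; congr (_ * _); rewrite mulr_suml; apply: eq_bigr => k _; rewrite mulrDl.
Qed.

Definition weight E h T n : R := smear E h T (fun p => (p == n)%:R).

Lemma smear_weight E h T G N : (2 ^ E * h <= T)%N -> (T + 2 ^ E * h < N)%N ->
  smear E h T G = \sum_(n < N) weight E h T n * G n.
Proof.
move=> hT TN; transitivity (smear E h T (fun p => \sum_(n < N) (p == n)%:R * G n)).
  apply: smear_eq => // p _ pN; have pN' : (p < N)%N by exact: leq_ltn_trans TN.
  rewrite (bigD1 (Ordinal pN'))//= eqxx mul1r big1 ?addr0// => n np.
  by rewrite (_ : (p == n) = false) ?mul0r//; apply: contraNF np => /eqP e; apply/eqP/val_inj.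
elim: N {TN} => [|N ih].
  rewrite big_ord0; under eq_fun do rewrite big_ord0; exact: smear0.
rewrite big_ord_recr/= -ih /weight -smearZ -smearD.
by congr (smear _ _ _ _); apply: funext => p; rewrite big_ord_recr.
Qed.

Lemma weight_ge0 E h T n : (2 ^ E * h <= T)%N -> 0 <= weight E h T n.
Proof.
by move=> hT; rewrite -(smear0 E h T); apply: smear_le => // p _ _; rewrite ler0n.
Qed.

Lemma weight_out E h T n : (2 ^ E * h <= T)%N ->
  (n + 2 ^ E * h < T)%N \/ (T + 2 ^ E * h < n)%N -> weight E h T n = 0.
Proof.
move=> hT nout; rewrite -(smear0 E h T); apply: smear_eq => // p p1 p2.
by case: eqP => // pn; subst p; case: nout; lia.
Qed.

Lemma count_inj_le1 (B n : nat) (f : nat -> nat) :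
  (forall i j, (i < B)%N -> (j < B)%N -> f i = f j -> i = j) ->
  \sum_(k < B) (f k == n)%:R <= 1 :> R.
Proof.
move=> fi; have [[k kn]|no] := pselect (exists k : 'I_B, f k = n); last first.
  by rewrite big1 ?ler01// => k _; case: eqP => // kn; exfalso; apply: no; exists k.
rewrite (bigD1 k)//= kn eqxx big1 ?addr0// => j jk.
case: eqP => // jn; move: jk; rewrite (_ : j = k) ?eqxx//.
by apply: val_inj; apply: fi (ltn_ord _) (ltn_ord _) (etrans jn (esym kn)).
Qed.

(** On each level a point is hit at most once from either side, which contributes at most 1 / (E
    h). *)
Lemma weight_le E h T n : (0 < E)%N -> (0 < h)%N -> (2 ^ E * h <= T)%N -> weight E h T n <= h%:R^-1.
Proof.
move=> E0 h0 hT; have hR : 0 < h%:R :> R by rewrite ltr0n.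
have ER : 0 < E%:R :> R by rewrite ltr0n.
apply: (@le_trans _ _ (\sum_(i < E) E%:R^-1 * h%:R^-1)); last first.
  by rewrite sumr_const card_ord -[leLHS]mulr_natl mulrA divff ?mul1r// gt_eqF.
apply: ler_sum => i _; rewrite big_split/=.
have B0 : (0 < 2 ^ i * h)%N by rewrite muln_gt0 expn_gt0.
have iE : (2 ^ i * h + 2 ^ i * h <= 2 ^ E * h)%N.
  by rewrite addnn -mul2n mulnA -expnS leq_mul2r leq_exp2l// ltn_ord orbT.
have hB : h%:R <= (2 ^ i * h)%:R :> R by rewrite ler_nat leq_pmull// expn_gt0.
move: B0 iE hB; set B := (2 ^ i * h)%N; set W := (2 ^ E * h)%N in hT * => B0 iE hB.
have BR : 0 < B%:R :> R by rewrite ltr0n.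
have c1 := @count_inj_le1 B n (fun k => T + (B + k))%N ltac:(by move=> a b _ _; lia).
have c2 := @count_inj_le1 B n (fun k => T - (B + k))%N ltac:(by move=> a b; lia).
apply: (@le_trans _ _ ((2 * E%:R * B%:R)^-1 * 2)).
  by apply: ler_wpM2l; [rewrite invr_ge0 !mulr_ge0 ?ler0n|lra].
have -> : (2 * E%:R * B%:R)^-1 * 2 = E%:R^-1 * B%:R^-1 :> R.
  by move: (gt_eqF BR) (gt_eqF ER); move: (B%:R : R) (E%:R : R) => b e /negbT b0 /negbT e0; field; rewrite b0 e0.
by rewrite ler_wpM2l ?invr_ge0 ?ler0n// lef_pV2.
Qed.

Lemma node_three_halves_sum N :
  \sum_(n < N) (node R n * Num.sqrt (node R n))^-1 <= 9.
Proof.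
pose g n := (Num.sqrt (node R n))^-1.
have g0 n : 0 < g n by rewrite invr_gt0 sqrtr_gt0 node_gt0.
have step n : (node R n * Num.sqrt (node R n))^-1 <= 6 * (g n - g n.+1).
  rewrite /g; set s := node R n; have s0 : 0 < s by exact: node_gt0.
  have s2 : 2^-1 <= s by rewrite /s /node lerDr.
  rewrite nodeS -/s; set a := Num.sqrt s; set b := Num.sqrt (s + 1).
  have a0 : 0 < a by rewrite sqrtr_gt0.
  have b0 : 0 < b by rewrite sqrtr_gt0; lra.
  have aa : a * a = s by rewrite -expr2 sqr_sqrtr// ltW.
  have bb : b * b = s + 1 by rewrite -expr2 sqr_sqrtr; lra.
  have ab : a <= b by nra.
  have -> : 6 * (a^-1 - b^-1) = 6 * (b - a) / (a * b) by field; rewrite !gt_eqF.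
  rewrite -[leLHS]mul1r ler_pdivrMr ?mulr_gt0//.
  have -> : 6 * (b - a) / (a * b) * (s * a) = 6 * (b - a) * s / b by field; rewrite !gt_eqF.
  rewrite ler_pdivlMr// mul1r.
  have d1 : (b - a) * (a + b) = 1 by lra.
  have d2 : 1 <= (b - a) * (2 * b) by nra.
  have d3 : b * b <= 3 * s by lra.
  have d4 : 0 <= b - a by lra.
  have d5 : b <= (b - a) * (2 * (b * b)) by nra.
  have d6 : (b - a) * (2 * (b * b)) <= (b - a) * (2 * (3 * s)) by rewrite ler_wpM2l//; lra.
  lra.
apply: (@le_trans _ _ (\sum_(n < N) 6 * (g n - g n.+1))); first by apply: ler_sum.
rewrite -mulr_sumr; have -> : \sum_(n < N) (g n - g n.+1) = g 0%N - g N.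
  elim: N => [|N ih]; first by rewrite big_ord0 subrr.
  by rewrite big_ord_recr/= ih; ring.
have : g 0%N <= 3 / 2.
  rewrite /g /node add0r sqrtrV// invrK -[leRHS]ger0_norm; last by lra.
  rewrite -sqrtr_sqr ler_sqrt; last by rewrite sqr_ge0.
  by rewrite expr2; lra.
by have := g0 N; lra.
Qed.

(** Summation by parts, meant for the rounding errors of the multiplicities: they cost the total
    variation of [H], not its size. *)
Lemma abel_bound (e H : nat -> R) N : (forall n, `|\sum_(i < n) e i| <= 1) ->
  \sum_(n < N) e n * H n <= `|H N| + \sum_(n < N) `|H n - H n.+1|.
Proof.
move=> eb; have -> : \sum_(n < N) e n * H n =
    (\sum_(i < N) e i) * H N + \sum_(n < N) (\sum_(i < n.+1) e i) * (H n - H n.+1).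
  elim: N => [|N ih]; first by rewrite !big_ord0 mul0r addr0.
  by rewrite big_ord_recr/= ih [X in _ = _ + X]big_ord_recr/= !(big_ord_recr N)/=; ring.
apply: lerD.
  by rewrite (le_trans (ler_norm _))// normrM ler_piMl.
apply: ler_sum => n _.
by rewrite (le_trans (ler_norm _))// normrM ler_piMl.
Qed.

End smear_weights.

(** * The multiplicities of the half-integers *)

Section multiplier.
Variable R : realType.
Implicit Types (I J j T n p : nat).

(** The product of the 512 of a distant point in [smeared_excess] and the 2 of [dyadic_above]. *)
Definition far_const : R := 1024.

Lemma level_const_ge0 : 0 <= level_const R. Proof. exact: ler0n. Qed.
Lemma far_const_ge0 : 0 <= far_const. Proof. exact: ler0n. Qed.

Lemma node_ratio n : [/\ node R n + 1 <= 3 * node R n, node R n <= 4 * (node R n + 1),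
  node R n <= 3 * (node R n + 1) & node R n + 1 <= 4 * node R n].
Proof. by have : 2^-1 <= node R n by [rewrite /node lerDr]; split; lra. Qed.

Section fixed_level.
Variables (E : nat) (Q : R) (NL : nat -> seq nat).
Hypothesis E0 : (0 < E)%N.
Hypothesis NLb : forall j T, T \in NL j -> [/\ (2 ^ E.+3 <= T)%N, (T <= 2 ^ j.+1)%N & (2 ^ j <= 4 * T)%N].
Hypothesis NLQ : forall N, \sum_(j < N.+1) (size (NL j))%:R <= Q * 2 ^+ N.

(** The base scale of the smearing of [T]. Its largest scale 2^E h is at most T / 8, so the mass
    stays near [T], and 1 / h is of size 2^E / T, so no point receives much. *)
Let hh T := (T %/ 2 ^ E.+3)%N.

Let hhP j T : T \in NL j -> [/\ (0 < hh T)%N, (8 * (2 ^ E * hh T) <= T)%N & (T <= 2 ^ E.+4 * hh T)%N].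
Proof.
move=> /NLb[T1 _ _]; have p : (0 < 2 ^ E.+3)%N by rewrite expn_gt0.
have h0 : (0 < hh T)%N by rewrite divn_gt0.
have e1 : (8 * (2 ^ E * hh T) = 2 ^ E.+3 * hh T)%N by rewrite !expnS; lia.
split => //; first by rewrite e1 mulnC leq_divM.
rewrite expnS; have := divn_eq T (2 ^ E.+3); have := ltn_pmod T p.
rewrite -/(hh T); move: (2 ^ E.+3)%N (hh T) h0 => a b; nia.
Qed.

Let hhT j T : T \in NL j -> (2 ^ E * hh T <= T)%N.
Proof. by move=> /hhP[_ h8 _]; rewrite (leq_trans _ h8)// leq_pmull. Qed.

Let wt T n := weight R E (hh T) T n.
Let dn J n := \sum_(j < J) \sum_(T <- NL j) wt T n.
(** Levels with 2^j > 5 n do not reach [n], and 5 n < 2^(5 n + 1); hence this finite sum is the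
    density of all levels at [n]. *)
Let D n := dn (5 * n).+1 n.

Let wt_ge0 j T n : T \in NL j -> 0 <= wt T n.
Proof. by move=> /hhT; apply: weight_ge0. Qed.

Let wt_out j T n : T \in NL j -> (5 * n < 2 ^ j)%N -> wt T n = 0.
Proof.
move=> TN nj; have [h0 h8 _] := hhP TN; have [_ _ T4] := NLb TN.
apply: weight_out; first exact: hhT TN.
left; move: h8 T4 nj; move: (2 ^ E * hh T)%N (2 ^ j)%N => a b; lia.
Qed.

Let wt_le j T n : T \in NL j -> wt T n <= 2 ^+ (E + 5) / n%:R.
Proof.
move=> TN; have [h0 h8 hT] := hhP TN.
have W := hhT TN.
have [n0|n0] := posnP n.
  have : (0 < 2 ^ E * hh T)%N by rewrite muln_gt0 expn_gt0 h0.
  by rewrite n0 invr0 mulr0 /wt weight_out// add0n; left; lia.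
have [nT|nT] := leqP n (T + 2 ^ E * hh T); last first.
  by rewrite /wt weight_out ?divr_ge0 ?exprn_ge0 ?ler0n//; right.
apply: (le_trans (@weight_le R E (hh T) T n E0 h0 W)).
have nR : 0 < n%:R :> R by rewrite ltr0n.
rewrite ler_pdivlMr// mulrC ler_pdivrMr ?ltr0n// -natrX -natrM ler_nat.
rewrite addnS expnS addnC -/(4 + E)%N -mulnA.
by move: nT h8 hT; rewrite (_ : (2 ^ (4 + E)) = 2 ^ E.+4)%N//; move: (2 ^ E * hh T)%N (2 ^ E.+4 * hh T)%N; lia.
Qed.

Let c0 j : 0 <= (size (NL j))%:R :> R. Proof. by rewrite ler0n. Qed.
Let Q0 : 0 <= Q. Proof. exact: (dyadic_Q_ge0 c0 NLQ). Qed.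
(** At most 5 Q n points lie on levels that reach [n], and each gives [n] a mass of at most 2^(E +
    5) / n. *)
Let M0 := 5 * Q * 2 ^+ (E + 5).

Let dn_ge0 J n : 0 <= dn J n.
Proof. by apply: sumr_ge0 => j _; rewrite big_seq sumr_ge0// => T TN; apply: wt_ge0 TN. Qed.

Let dn_mono I J n : (I <= J)%N -> dn I n <= dn J n.
Proof.
move=> IJ; rewrite /dn -!(big_mkord xpredT (fun j => \sum_(T <- NL j) wt T n)).
rewrite (big_cat_nat _ IJ)//= lerDl sumr_ge0// => j _.
by rewrite big_seq sumr_ge0// => T TN; apply: wt_ge0 TN.
Qed.

Let dn_stable I J n : (5 * n < 2 ^ I)%N -> (I <= J)%N -> dn J n = dn I n.
Proof.
move=> nI IJ; rewrite /dn -!(big_mkord xpredT (fun j => \sum_(T <- NL j) wt T n)).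
rewrite (big_cat_nat _ IJ)//= [X in _ + X]big1_seq ?addr0// => j /andP[_].
rewrite mem_index_iota => /andP[Ij _]; rewrite big1_seq// => T /andP[_ TN].
by apply: (wt_out TN); rewrite (leq_trans nI)// leq_exp2l.
Qed.

Let dn_le J n : dn J n <= D n.
Proof.
have n5 : (5 * n < 2 ^ (5 * n).+1)%N by rewrite expnS; have := @ltn_expl 2 (5 * n) isT; lia.
have [JD|DJ] := leqP J (5 * n).+1; first exact: dn_mono.
by rewrite (dn_stable n5 (ltnW DJ)).
Qed.

Let dn_eq J n : (5 * n < 2 ^ J)%N -> dn J n = D n.
Proof.
move=> nJ; apply/eqP; rewrite eq_le dn_le/= /D.
rewrite -(dn_stable nJ (leq_maxl J (5 * n).+1)).
by apply: dn_mono; rewrite leq_maxr.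
Qed.

Let D_le n : D n <= M0.
Proof.
have p5 : 0 < 2 ^+ (E + 5) :> R by rewrite exprn_gt0.
apply: (@le_trans _ _ (\sum_(j < (5 * n).+1 | 2 ^+ j <= (5 * n)%:R :> R) (size (NL j))%:R * (2 ^+ (E + 5) / n%:R))).
  rewrite /D /dn [leRHS]big_mkcond/=; apply: ler_sum => j _; case: ifPn => [_|].
    rewrite -sum1_size natr_sum mulr_suml big_seq [leRHS]big_seq; apply: ler_sum => T TN.
    by rewrite mul1r; apply: wt_le TN.
  rewrite -ltNge -natrX ltr_nat => nj; rewrite big1_seq// => T /andP[_ TN].
  exact: wt_out TN nj.
rewrite -mulr_suml.
have := dyadic_below c0 NLQ (5 * n).+1 (ler0n R (5 * n)) => h.
have k0 : 0 <= 2 ^+ (E + 5) / n%:R :> R by rewrite divr_ge0// ltW.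
apply: (le_trans (ler_wpM2r k0 h)).
have [->|n0] := posnP n.
  by rewrite invr0 !mulr0 /M0 !mulr_ge0// ltW.
by rewrite natrM /M0 le_eqVlt; apply/orP; left; apply/eqP; field; rewrite pnatr_eq0 -lt0n.
Qed.

Let P n := \sum_(i < n) (M0 - D i).
Let P_ge0 n : 0 <= P n. Proof. by apply: sumr_ge0 => i _; rewrite subr_ge0. Qed.
(* Rounding the partial sums, not the terms, keeps all partial sums of the error below 1. *)
Let mult n := (Num.truncn (P n.+1) - Num.truncn (P n))%N.

Let PS n : P n.+1 = P n + (M0 - D n).
Proof. by rewrite /P big_ord_recr. Qed.

Let mult_nat n : (mult n)%:R = (Num.truncn (P n.+1))%:R - (Num.truncn (P n))%:R :> R.
Proof. by rewrite /mult natrB// le_truncn// PS lerDl subr_ge0. Qed.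

Lemma multiplicity_le n : (mult n)%:R <= M0 + 1.
Proof.
rewrite mult_nat PS; have h1 : (Num.truncn (P n + (M0 - D n)))%:R <= P n + (M0 - D n).
  by rewrite truncn_le addr_ge0 ?subr_ge0.
have h2 := truncnS_gt (P n); rewrite -natr1 in h2.
have D0 : 0 <= D n by exact: dn_ge0.
lra.
Qed.

Let rounding n : `|\sum_(i < n) ((mult i)%:R - (M0 - D i))| <= 1.
Proof.
have -> : \sum_(i < n) ((mult i)%:R - (M0 - D i)) = (Num.truncn (P n))%:R - P n.
  elim: n => [|n ih]; first by rewrite /P !big_ord0 truncn0 subrr.
  by rewrite big_ord_recr/= ih mult_nat PS; ring.
have h1 : (Num.truncn (P n))%:R <= P n by rewrite truncn_le.
have h2 := truncnS_gt (P n); rewrite -natr1 in h2.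
by rewrite ler_norml; apply/andP; split; lra.
Qed.

(** Levels with 2^j <= B x hold at most Q B x points, each at the price of [smear_near]. On higher
    levels both logarithms are O((x / T)^2), and the dyadic tail gains the factor 1 / B. *)
Lemma smeared_excess (x d B : R) J : 0 < x -> 0 < d -> d <= 1 -> 1 <= d * x -> 32 <= B ->
  \sum_(j < J) \sum_(T <- NL j) (hfactor x d (node R T) -
     smear E (hh T) T (fun n => hfactor x d (node R n))) <=
  Q * B * level_const R / E%:R * x + far_const * Q / B * x.
Proof.
move=> x0 d0 d1 dx B32; have ER : 0 < E%:R :> R by rewrite ltr0n.
have B0 : 0 < B by lra.
have Bx : 0 < B * x by rewrite mulr_gt0.
pose V T := hfactor x d (node R T) - smear E (hh T) T (fun n => hfactor x d (node R n)).
have V1 j T : T \in NL j -> V T <= level_const R / E%:R.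
  by move=> TN; have [h0 h8 _] := hhP TN; apply: smear_near => //; exact: hhT TN.
have V2 j T : T \in NL j -> B * x < 2 ^+ j -> V T <= 512 * x ^+ 2 * (4 ^+ j)^-1.
  move=> TN jB; have [h0 h8 _] := hhP TN; have [_ _ T4] := NLb TN.
  have hT := hhT TN.
  have TR : 2 ^+ j <= 4 * T%:R :> R by rewrite -natrX -natrM ler_nat.
  have Bx32 : 32 * x <= B * x by rewrite ler_wpM2r// ltW.
  have T0 : 0 < T%:R :> R by lra.
  have xT : 8 * x <= T%:R by lra.
  have near p : T%:R <= 2 * node R p -> `|hfactor x d (node R p)| <= 16 * (x / T%:R) ^+ 2.
    move=> pT; have p0 := node_gt0 R p.
    have r1 : x / node R p <= 2 * (x / T%:R).
      by rewrite mulrA ler_pdivrMr// mulrAC ler_pdivlMr//; nra.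
    have r2 : 2 * (x / T%:R) <= 4^-1 by rewrite mulrA ler_pdivrMr//; lra.
    have r0 : 0 <= x / node R p by rewrite divr_ge0 ?ltW.
    have sq : (x / node R p) ^+ 2 <= (2 * (x / T%:R)) ^+ 2.
      by rewrite ler_sqr ?nnegrE ?mulr_ge0 ?invr_ge0// ltW.
    apply: (le_trans (hfactor_small d0 d1 p0 _)); first by rewrite (le_trans sq)// expr2; nra.
    by rewrite (le_trans (ler_wpM2l _ sq))// exprMn expr2; lra.
  have nT : T%:R <= 2 * node R T by rewrite /node; lra.
  have h1 := near T nT.
  have h2 : - (16 * (x / T%:R) ^+ 2) <= smear E (hh T) T (fun n => hfactor x d (node R n)).
    rewrite -[leLHS](@smear_cst R E (hh T) T _ E0 h0); apply: smear_le => // p p1 _.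
    have pT : T%:R <= 2 * node R p.
      rewrite /node mulrDr divff// -natrM (le_trans (y := (2 * p)%:R))//; last by rewrite natrM; lra.
      by rewrite ler_nat; move: p1 h8; move: (2 ^ E * hh T)%N; clear; lia.
    by have := near p pT; rewrite ler_norml => /andP[].
  have h3 : V T <= 32 * (x / T%:R) ^+ 2.
    by rewrite /V; move: h1; rewrite ler_norml => /andP[]; lra.
  apply: (le_trans h3); rewrite expr_div_n.
  have -> : 4 = 2 * 2 :> R by ring.
  rewrite exprMn.
  move: (2 ^+ j : R) TR jB => a TR jB.
  have a0 : 0 < a by lra.
  have q2 : (T%:R ^+ 2)^-1 <= 16 * (a * a)^-1.
    rewrite -[leLHS]mul1r ler_pdivrMr ?exprn_gt0// mulrAC ler_pdivlMr ?mulr_gt0// expr2.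
    by nra.
  by have := ler_wpM2l (sqr_ge0 x) q2; lra.
rewrite (bigID (fun j : 'I_J => 2 ^+ j <= B * x))/=; apply: lerD.
  apply: (@le_trans _ _ (\sum_(j < J | 2 ^+ j <= B * x) (size (NL j))%:R * (level_const R / E%:R))).
    apply: ler_sum => j _; rewrite -sum1_size natr_sum mulr_suml big_seq [leRHS]big_seq.
    by apply: ler_sum => T TN; rewrite mul1r; exact: V1 TN.
  rewrite -mulr_suml; have h := dyadic_below c0 NLQ J (ltW Bx).
  apply: (le_trans (ler_wpM2r _ h)); first by rewrite divr_ge0 ?ler0n ?level_const_ge0.
  by rewrite le_eqVlt; apply/orP; left; apply/eqP; ring.
apply: (@le_trans _ _ (\sum_(j < J | B * x < 2 ^+ j) 512 * x ^+ 2 * ((size (NL j))%:R / 4 ^+ j))).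
  rewrite (eq_bigl (fun j : 'I_J => B * x < 2 ^+ j)) => [|j]; last by rewrite ltNge.
  apply: ler_sum => j Bj; rewrite mulrCA -sum1_size natr_sum mulr_suml big_seq [leRHS]big_seq.
  by apply: ler_sum => T TN; rewrite mul1r; apply: V2 TN Bj.
rewrite -mulr_sumr /far_const; have h := dyadic_above c0 NLQ J Bx.
apply: (le_trans (ler_wpM2l _ h)); first by rewrite mulr_ge0 ?ler0n ?sqr_ge0.
by rewrite le_eqVlt; apply/orP; left; apply/eqP; field; rewrite !gt_eqF.
Qed.

Let smeared_sum (H : nat -> R) J :
  \sum_(j < J) \sum_(T <- NL j) smear E (hh T) T H = \sum_(n < 2 ^ J.+1) dn J n * H n.
Proof.
under [RHS]eq_bigr do rewrite /dn mulr_suml; rewrite [RHS]exchange_big/=.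
apply: eq_bigr => j _; under [RHS]eq_bigr do rewrite mulr_suml; rewrite [RHS]exchange_big/=.
apply: eq_big_seq => T TN.
have [h0 h8 _] := hhP TN; have [_ T2 _] := NLb TN.
apply: smear_weight; first exact: hhT TN.
have W0 : (0 < 2 ^ E * hh T)%N by rewrite muln_gt0 expn_gt0.
have TJ : (T <= 2 ^ J)%N by rewrite (leq_trans T2)// leq_exp2l.
by rewrite expnS; move: h8 TJ W0; move: (2 ^ E * hh T)%N (2 ^ J)%N; clear; lia.
Qed.

(** Writing the multiplicity as M0 - D plus a rounding error leaves four terms: the smearing error,
    M0 times the logarithm of the comb, the rounding errors, and the masses of the levels cut off at
    J. *)
Lemma balanced_sum (x d B : R) : 0 < x -> 0 < d -> d <= 1 -> 1 <= d * x -> 32 <= B ->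
  exists J0, forall J, (J0 <= J)%N ->
    \sum_(j < J) \sum_(T <- NL j) hfactor x d (node R T) +
    \sum_(n < 2 ^ J.+1) (mult n)%:R * hfactor x d (node R n) <=
    Q * B * level_const R / E%:R * x + far_const * Q / B * x + M0 * (28 + 9 * (d * x)) + 2 + 288 / d * Num.sqrt x.
Proof.
move=> x0 d0 d1 dx B32; pose H n := hfactor x d (node R n).
have M00 : 0 <= M0 by apply: mulr_ge0; [apply: mulr_ge0|exact: exprn_ge0].
have [N0 hN0] := @comb_bound R (ray_point x d) (ltW x0).
(* For 2^J >= K the logarithms at the nodes beyond 2^J / 5 are quadratically small, and the cut-off
   masses on them cost at most 200 M0 x^2 / 2^J <= 1. *)
pose K := 10 * x + 200 * M0 * x ^+ 2.
have K0 : 0 <= 200 * M0 * x ^+ 2 by apply: mulr_ge0; [apply: mulr_ge0|exact: sqr_ge0].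
exists ((Num.truncn K).+1 + N0)%N => J JJ0.
have J2 : (J < 2 ^ J)%N by rewrite ltn_expl.
have KJ : K <= 2 ^+ J.
  rewrite (le_trans (ltW (truncnS_gt _)))// -natrX ler_nat.
  by rewrite (leq_trans _ (ltnW J2))// (leq_trans _ JJ0)// leq_addr.
set p : R := 2 ^+ J in KJ; have p0 : 0 < p by rewrite exprn_gt0.
set N := (2 ^ J.+1)%N.
have NR : N%:R = 2 * p :> R by rewrite /N natrX exprS.
have N0N : (N0 <= N)%N.
  rewrite /N expnS (leq_trans _ (leq_pmull _ _))// (leq_trans _ (ltnW J2))//.
  by rewrite (leq_trans _ JJ0)// leq_addl.
have xp : 10 * x <= p by rewrite /K in KJ; lra.
have Mp : 200 * M0 * x ^+ 2 <= p by rewrite /K in KJ; lra.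
have q0 n : 0 < qfactor d ((x / node R n) ^+ 2) by apply: qfactor_gt0 => //; exact: sqr_ge0.
have small n : p <= 5 * node R n -> `|H n| <= 100 * x ^+ 2 / p ^+ 2.
  move=> pn; have s0 := node_gt0 R n.
  have r1 : x / node R n <= 5 * x / p.
    by rewrite ler_pdivrMr// mulrAC ler_pdivlMr//; nra.
  have r2 : 5 * x / p <= 2^-1 by rewrite ler_pdivrMr//; lra.
  have r0 : 0 <= x / node R n by rewrite divr_ge0 ?ltW.
  have sq : (x / node R n) ^+ 2 <= (5 * x / p) ^+ 2.
    by rewrite ler_sqr ?nnegrE// (le_trans r0).
  apply: (le_trans (hfactor_small d0 d1 s0 _)); first by rewrite expr2; nra.
  have -> : 100 * x ^+ 2 / p ^+ 2 = 4 * (5 * x / p) ^+ 2.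
    by rewrite expr_div_n exprMn; field; rewrite gt_eqF.
  by rewrite ler_wpM2l.
have -> : \sum_(j < J) \sum_(T <- NL j) hfactor x d (node R T) +
    \sum_(n < N) (mult n)%:R * hfactor x d (node R n) =
   \sum_(j < J) \sum_(T <- NL j) (hfactor x d (node R T) - smear E (hh T) T H)
   + M0 * \sum_(n < N) H n + \sum_(n < N) ((mult n)%:R - (M0 - D n)) * H n
   + \sum_(n < N) (dn J n - D n) * H n.
  have -> : \sum_(j < J) \sum_(T <- NL j) (hfactor x d (node R T) - smear E (hh T) T H) =
     \sum_(j < J) \sum_(T <- NL j) hfactor x d (node R T) - \sum_(n < N) dn J n * H n.
    by rewrite -smeared_sum -sumrB; apply: eq_bigr => j _; rewrite sumrB.
  rewrite mulr_sumr -!addrA; congr (_ + _); rewrite -sumrN -!big_split; apply: eq_bigr => n _ /=.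
  by rewrite -/(H n); ring.
have e1 := smeared_excess J x0 d0 d1 dx B32; rewrite -/H in e1.
have e2 : M0 * \sum_(n < N) H n <= M0 * (28 + 9 * (d * x)).
  rewrite ler_wpM2l//; have -> : \sum_(n < N) H n = ln (cabs (comb N (ray_point x d))).
    rewrite /comb cabs_prod; elim: (N) => [|k ih]; first by rewrite !big_ord0 ln1.
    rewrite !big_ord_recr/= ih -qfactorE ?gt_eqF ?node_gt0// lnM ?posrE ?q0//.
    by apply: prodr_gt0 => i _; rewrite -qfactorE ?gt_eqF ?node_gt0.
  rewrite -[leRHS]expRK ler_ln ?posrE ?expR_gt0//.
    by have := hN0 N N0N; rewrite [Im _]/= ger0_norm // (le_trans _ dx).
  by rewrite /comb cabs_prod; apply: prodr_gt0 => i _; rewrite -qfactorE ?gt_eqF ?node_gt0.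
(* The total variation of [H] comes from [hfactor_step]: 32 / d at each node times the sum 9 of the
   powers - 3/2 of the nodes. *)
have e3 : \sum_(n < N) ((mult n)%:R - (M0 - D n)) * H n <= 1 + 288 / d * Num.sqrt x.
  apply: (le_trans (@abel_bound R (fun n => (mult n)%:R - (M0 - D n)) H N rounding)); apply: lerD.
    apply: (le_trans (small N _)); first by rewrite /node NR; lra.
    by rewrite ler_pdivrMr ?exprn_gt0// mul1r !expr2; nra.
  have k0 : 0 <= 32 / d * Num.sqrt x by rewrite mulr_ge0 ?sqrtr_ge0// divr_ge0 ?ltW.
  apply: (@le_trans _ _ (\sum_(n < N) 32 / d * Num.sqrt x * (node R n * Num.sqrt (node R n))^-1)).
    apply: ler_sum => n _; have s0 := node_gt0 R n; have s1 := node_gt0 R n.+1.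
    have sh : 2^-1 <= node R n by rewrite /node lerDr.
    have nS := nodeS R n. have [n3 n4 n5 n6] := node_ratio n.
    have h1 : H n - H n.+1 <= 32 / d * (Num.sqrt x / (node R n * Num.sqrt (node R n))).
      apply: hfactor_step => //; rewrite nS; [|exact: n3|exact: n4].
      by rewrite opprD addrA subrr sub0r normrN normr1.
    have h2 : H n.+1 - H n <= 32 / d * (Num.sqrt x / (node R n.+1 * Num.sqrt (node R n.+1))).
      apply: hfactor_step => //; rewrite nS; [|exact: n5|exact: n6].
      by rewrite addrAC subrr add0r normr1.
    have h3 : (node R n.+1 * Num.sqrt (node R n.+1))^-1 <= (node R n * Num.sqrt (node R n))^-1.
      rewrite lef_pV2 ?posrE ?mulr_gt0 ?sqrtr_gt0//.
      have l : node R n <= node R n.+1 by rewrite nS lerDl.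
      by apply: ler_pM; rewrite ?(ltW s0) ?sqrtr_ge0// ler_sqrt// ltW.
    have h4 := ler_wpM2l k0 h3.
    rewrite ler_norml; apply/andP; split.
      by rewrite lerNl opprB (le_trans h2)// [leLHS]mulrA.
    by rewrite (le_trans h1)// [leLHS]mulrA.
  rewrite -mulr_sumr (le_trans (ler_wpM2l k0 (node_three_halves_sum _ _)))//.
  by rewrite le_eqVlt; apply/orP; left; apply/eqP; ring.
(* The densities differ only at nodes with 5 n >= 2^J, where [H] is small. *)
have e4 : \sum_(n < N) (dn J n - D n) * H n <= 1.
  apply: (@le_trans _ _ (\sum_(n < N) M0 * (100 * x ^+ 2 / p ^+ 2))).
    apply: ler_sum => n _; have g0 : 0 <= 100 * x ^+ 2 / p ^+ 2.
      by rewrite divr_ge0 ?sqr_ge0// mulr_ge0 ?ler0n ?sqr_ge0.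
    have [nJ|Jn] := ltnP (5 * n) (2 ^ J).
      by rewrite (dn_eq nJ) subrr mul0r mulr_ge0.
    have pn : p <= 5 * node R n.
      have : (2 ^ J)%:R <= (5 * n)%:R :> R by rewrite ler_nat.
      by rewrite natrX -/p natrM => /le_trans; apply; rewrite ler_wpM2l// lerDl.
    have := small n pn => hs.
    have b1 : 0 <= D n - dn J n by rewrite subr_ge0.
    have b2 : D n - dn J n <= M0 by rewrite lerBlDr (le_trans (D_le n))// lerDl dn_ge0.
    have : (D n - dn J n) * `|H n| <= M0 * (100 * x ^+ 2 / p ^+ 2) by apply: ler_pM.
    have : - ((D n - dn J n) * H n) <= (D n - dn J n) * `|H n|.
      by rewrite -mulrN ler_wpM2l// -normrN ler_norm.
    move=> h1 h2; rewrite -[dn J n - D n]opprB mulNr; exact: le_trans h1 h2.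
  rewrite sumr_const card_ord -[leLHS]mulr_natl NR.
  have -> : 2 * p * (M0 * (100 * x ^+ 2 / p ^+ 2)) = 200 * M0 * x ^+ 2 / p by field; rewrite gt_eqF.
  by rewrite ler_pdivrMr// mul1r.
apply: (le_trans (lerD (lerD (lerD e1 e2) e3) e4)).
by rewrite le_eqVlt; apply/orP; left; apply/eqP; ring.
Qed.

End fixed_level.

(** Each of the four linear error terms receives eps / 4. The constants [T0], [M] and [d] precede
    the points [NL], because [d] and [T0] decide which zeros of f are passed on as points; T0 = 2^(E
    + 3) makes the base scales positive. *)
Theorem multiplier (Q eps : R) : 0 <= Q -> 0 < eps -> exists (T0 : nat) (M d : R),
  [/\ 0 < d, d <= 1, (0 < T0)%N & forall NL : nat -> seq nat,
    (forall j T, T \in NL j -> [/\ (T0 <= T)%N, (T <= 2 ^ j.+1)%N & (2 ^ j <= 4 * T)%N]) ->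
    (forall N, \sum_(j < N.+1) (size (NL j))%:R <= Q * 2 ^+ N) ->
    exists m : nat -> nat, (forall n, (m n)%:R <= M) /\
      exists A : R, forall x : R, 0 < x -> 1 <= d * x -> exists J0, forall J, (J0 <= J)%N ->
       \sum_(j < J) \sum_(T <- NL j) hfactor x d (node R T) +
       \sum_(n < 2 ^ J.+1) (m n)%:R * hfactor x d (node R n) <= eps * x + A].
Proof.
move=> Q0 e0; have fc0 := far_const_ge0; have lc0 := level_const_ge0.
pose B := 32 + 4 * far_const * Q / eps.
have Qe : 0 <= 4 * far_const * Q / eps by apply: divr_ge0; [apply: mulr_ge0 => //; apply: mulr_ge0 => //; exact: far_const_ge0|exact: ltW].
have B32 : 32 <= B by rewrite lerDl.
have B0 : 0 < B by lra.
pose y := 4 * Q * B * level_const R / eps; pose E := (Num.truncn y).+1.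
have yE : y <= E%:R by rewrite ltW// truncnS_gt.
have E0 : (0 < E)%N by [].
have ER : 0 < E%:R :> R by rewrite ltr0n.
pose M0 := 5 * Q * 2 ^+ (E + 5).
have M00 : 0 <= M0 by apply: mulr_ge0; [apply: mulr_ge0|exact: exprn_ge0].
pose d := Num.min 1 (eps / (36 * (M0 + 1))).
have k0 : 0 < 36 * (M0 + 1) by rewrite mulr_gt0// ltr_wpDl.
have d0 : 0 < d by rewrite lt_min ltr01 divr_gt0.
have d1 : d <= 1 by rewrite ge_min lexx.
have dk : 36 * (M0 + 1) * d <= eps.
  by rewrite mulrC -ler_pdivlMr// ge_min lexx orbT.
exists (2 ^ E.+3)%N, (M0 + 1), d; split => //; first by rewrite expn_gt0.
move=> NL NLb NLQ; eexists; split; first by move=> n; apply: (multiplicity_le E0 NLb NLQ).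
exists (28 * M0 + 2 + (288 / d) ^+ 2 / eps) => x x0 dx.
have [J0 hJ0] := balanced_sum E0 NLb NLQ x0 d0 d1 dx B32.
exists J0 => J /hJ0 h; apply: (le_trans h); rewrite -/M0.
have h1 : Q * B * level_const R / E%:R <= eps / 4.
  by rewrite ler_pdivrMr//; move: yE; rewrite /y ler_pdivrMr//; clear; lra.
have h2 : far_const * Q / B <= eps / 4.
  rewrite ler_pdivrMr// /B mulrDr.
  have -> : eps / 4 * (4 * far_const * Q / eps) = far_const * Q by field; rewrite gt_eqF.
  by rewrite lerDr mulr_ge0// divr_ge0// ltW.
have h3 : M0 * (28 + 9 * (d * x)) <= 28 * M0 + eps / 4 * x.
  have : M0 * (d * x) * 36 <= eps * x.
    have -> : M0 * (d * x) * 36 = 36 * M0 * d * x by ring.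
    rewrite ler_wpM2r ?(ltW x0)//; apply: le_trans dk.
    by rewrite ler_wpM2r ?(ltW d0)// ler_wpM2l// lerDl.
  by clear; lra.
have h4 : 288 / d * Num.sqrt x <= eps / 4 * x + (288 / d) ^+ 2 / eps.
  move: (288 / d) => a; set r := Num.sqrt x.
  have rr : x = r * r by rewrite -expr2 sqr_sqrtr// ltW.
  rewrite rr -(ler_pM2r e0) mulrDl divfK ?gt_eqF//.
  have : 0 <= (eps * r / 2 - a) ^+ 2 by exact: sqr_ge0.
  by rewrite !expr2; clear; lra.
move: (ler_wpM2r (ltW x0) h1) (ler_wpM2r (ltW x0) h2) h3 h4; clear; lra.
Qed.

End multiplier.

(** * Bounds on the real axis *)

Section infinite_products.
Variable R : realType.
Implicit Types (z w : R[i]).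

Lemma bounded_tail (a : nat -> R) (B : R) : (forall j, 0 <= a j) ->
  (forall J, \sum_(j < J) a j <= B) -> forall e : R, 0 < e ->
  exists I, forall J, (I <= J)%N -> \sum_(j < J) a j - \sum_(j < I) a j <= e.
Proof.
move=> a0 aB e e0; pose S := [set \sum_(j < J) a j | J in [set: nat]].
have Ss : has_sup S.
  by split; [exists (\sum_(j < 0) a j), 0%N|exists B => _ [J _ <-]].
have [_ [I _ <-] hI] := sup_adherent e0 Ss.
exists I => J _; have : \sum_(j < J) a j <= sup S by apply: ub_le_sup; [exact: Ss.2|exists J].
lra.
Qed.

Lemma expR_sub1_le (s : R) : expR s - 1 <= s * expR s.
Proof.
have := expR_ge1Dx (- s); rewrite expRN => h; have e0 := expR_gt0 s.
have := ler_wpM2r (ltW e0) h; rewrite mulVf ?gt_eqF//; lra.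
Qed.

Lemma cabs_prod1D (I : Type) (s : seq I) (v : I -> R[i]) :
  cabs (\prod_(i <- s) (1 + v i)) <= expR (\sum_(i <- s) cabs (v i)).
Proof.
rewrite cabs_prod (big_morph expR (@expRD R) (@expR0 R)).
apply: ler_prod => i _; rewrite cabs_ge0/= (le_trans (cabsD _ _))// cabs1.
exact: expR_ge1Dx.
Qed.

Lemma cabs_prod1D_sub1 (I : Type) (s : seq I) (v : I -> R[i]) :
  cabs (\prod_(i <- s) (1 + v i) - 1) <= expR (\sum_(i <- s) cabs (v i)) - 1.
Proof.
elim: s => [|i s ih]; first by rewrite !big_nil subrr cabs0 expR0 subrr.
rewrite !big_cons; set P := \prod_(j <- s) _ in ih *; set S := \sum_(j <- s) _ in ih *.
have -> : (1 + v i) * P - 1 = (1 + v i) * (P - 1) + v i by ring.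
have S0 : 0 <= S by apply: sumr_ge0 => j _; exact: cabs_ge0.
have e1 : 0 <= expR S - 1 by rewrite subr_ge0 -expR0 ler_expR.
have e2 := expR_ge1Dx (cabs (v i)); have c0 := cabs_ge0 (v i).
have t : cabs (1 + v i) <= 1 + cabs (v i) by rewrite (le_trans (cabsD _ _))// cabs1.
rewrite (le_trans (cabsD _ _))// cabsM expRD.
have : cabs (1 + v i) * cabs (P - 1) <= (1 + cabs (v i)) * (expR S - 1).
  by apply: ler_pM => //; exact: cabs_ge0.
have : 0 <= (expR (cabs (v i)) - 1 - cabs (v i)) * (expR S - 1 + 1).
  by apply: mulr_ge0; lra.
lra.
Qed.

(** The partial products are bounded on discs, so pointwise convergence already gives an entire
    limit by [ent_limit]. *)
Lemma infinite_product (u : nat -> R[i] -> R[i]) : (forall j, ent (u j)) ->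
  (forall r : R, exists B : R, forall J z, cabs z <= r -> \sum_(j < J) cabs (u j z - 1) <= B) ->
  exists p, [/\ ent p, forall z, ccvg (fun J => \prod_(j < J) u j z) (p z) &
    forall z, p z = 0 -> exists j, u j z = 0].
Proof.
move=> ue uB.
have uE j z : u j z = 1 + (u j z - 1) by ring.
have PB r (B : R) : (forall J z, cabs z <= r -> \sum_(j < J) cabs (u j z - 1) <= B) ->
    forall J z, cabs z <= r -> cabs (\prod_(j < J) u j z) <= expR B.
  move=> hB J z zr; under eq_bigr do rewrite uE.
  by rewrite (le_trans (cabs_prod1D _ _))// ler_expR hB.
have tail z I J (s : R) : (I <= J)%N -> s <= 2^-1 ->
    \sum_(j < J) cabs (u j z - 1) - \sum_(j < I) cabs (u j z - 1) <= s ->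
    exists2 t, \prod_(j < J) u j z = (\prod_(j < I) u j z) * (1 + t) & cabs t <= 2 * s.
  move=> IJ s2; rewrite -!(big_mkord xpredT (fun j => cabs (u j z - 1))).
  rewrite (big_cat_nat _ IJ)//= [X in X - _]addrC addrK => hs.
  exists (\prod_(I <= j < J) u j z - 1).
    rewrite -!(big_mkord xpredT (fun j => u j z)) (big_cat_nat _ IJ)//=.
    by rewrite [1 + _]addrC subrK.
  under eq_bigr do rewrite uE.
  have s0 : 0 <= \sum_(I <= j < J) cabs (u j z - 1) by apply: sumr_ge0 => j _; exact: cabs_ge0.
  apply: (le_trans (cabs_prod1D_sub1 _ _)).
  set S := \sum_(I <= j < J) _ in hs s0 *.
  have := expR_ge1Dx (- S); rewrite expRN => h; have e0 := expR_gt0 S.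
  have := ler_wpM2r (ltW e0) h; rewrite mulVf ?gt_eqF// => h2.
  have e2 : expR S <= 2 by nra.
  nra.
have lim z : exists l, ccvg (fun J => \prod_(j < J) u j z) l.
  have [B hB] := uB (cabs z); have hB' J := hB J z (lexx _).
  apply: ccvg_complete => e e0.
  have eB : 0 < expR B by exact: expR_gt0.
  pose s := Num.min 2^-1 (e / (4 * expR B)).
  have s0 : 0 < s by rewrite lt_min invr_gt0 ltr0n divr_gt0// mulr_gt0.
  have s2 : s <= 2^-1 by rewrite ge_min lexx.
  have sB : s * (4 * expR B) <= e by rewrite -ler_pdivlMr ?mulr_gt0// ge_min lexx orbT.
  have [I hI] := bounded_tail (fun j => cabs_ge0 (u j z - 1)) hB' s0.
  exists I => m n mI nI.
  have [t1 -> c1] := tail z I m s mI s2 (hI m mI).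
  have [t2 -> c2] := tail z I n s nI s2 (hI n nI).
  have := PB _ _ hB I z (lexx _); set P := \prod_(j < I) _ => PI.
  have -> : P * (1 + t1) - P * (1 + t2) = P * (t1 - t2) by ring.
  rewrite cabsM; have := cabsB t1 t2 => ct; have p0 := cabs_ge0 P.
  have : cabs P * cabs (t1 - t2) <= expR B * (4 * s).
    by apply: ler_pM => //; [exact: cabs_ge0|lra].
  lra.
have [p hp] := choice lim; exists p; split => //.
- apply: (@ent_limit R (fun J z => \prod_(j < J) u j z)) => //.
    by move=> J z; apply: (@cdiff_prod R _ _ (fun j : 'I_J => u j)) => j; exact: ue.
  by move=> r; have [B hB] := uB r; exists (expR B) => J z zr; exact: PB hB _ _ zr.
- move=> z pz; apply: contrapT => no.
  have un j : u j z != 0 by apply/eqP => uj; apply: no; exists j.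
  have [B hB] := uB (cabs z); have hB' J := hB J z (lexx _).
  have q0 : 0 < 4^-1 :> R by rewrite invr_gt0.
  (* The factors after [I] multiply to modulus at least 1/2, so the limit can vanish only if the
     product of the first [I] factors does. *)
  have [I hI] := bounded_tail (fun j => cabs_ge0 (u j z - 1)) hB' q0.
  have P0 : 0 < cabs (\prod_(j < I) u j z).
    by rewrite cabs_prod; apply: prodr_gt0 => j _; rewrite cabs_gt0.
  have [N hN] := hp z _ (divr_gt0 P0 (ltr0n R 4)).
  have q2 : 4^-1 <= 2^-1 :> R by lra.
  have [t E ct] := tail z I _ _ (leq_maxl I N) q2 (hI _ (leq_maxl I N)).
  have := hN _ (leq_maxr I N); rewrite pz subr0 E cabsM.
  have := cabs_sub_ge 1 (- t); rewrite opprK cabsN cabs1; nra.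
Qed.

End infinite_products.

(** * The canonical product of the points - 1 / b *)

Section real_multiplier.
Variable R : realType.
Implicit Types (z w : R[i]).

Lemma ent_efactor : ent (@efactor R).
Proof.
by move=> z; apply: cdiffM; [apply: cdiffB; [exact: cdiff_const|exact: cdiff_id]|exact: cdiff_cexp].
Qed.

Lemma efactor_quadratic : exists2 q, ent q & forall v : R[i], efactor v - 1 = v ^+ 2 * q v.
Proof.
have de : cderiv (fun v : R[i] => efactor v - 1) 0 0.
  have := cderivB (cderivM (cderivB (cderiv_const 1 0) (cderiv_id 0)) (cderiv_cexp (0 : R[i]))) (cderiv_const 1 0).
  by have -> : (0 - 1) * cexp 0 + (1 - 0) * cexp 0 - 0 = 0 :> R[i] by rewrite cexp0; ring.
have ee : ent (fun v : R[i] => efactor v - 1).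
  by move=> z; apply: cdiffB; [exact: ent_efactor|exact: cdiff_const].
have [|q1 q1e q1E] := ent_division (w := 0) ee.
  by rewrite /efactor cexp0 subr0 mulr1 subrr.
have q10 : q1 0 = 0.
  have [a q1d] := q1e 0; have := cderivM (cderiv_id 0) q1d.
  have -> : (fun w => w * q1 w) = (fun v => efactor v - 1).
    by apply: funext => v; rewrite q1E subr0.
  by rewrite mul1r mul0r addr0 => /(cderiv_unique de).
have [q qe qE] := ent_division q1e q10; exists q => // v.
by rewrite q1E qE !subr0 expr2 mulrA.
Qed.

Definition re_inv w : R := Re w^-1.

Variables (L : nat -> seq R[i]) (Q : R).
Hypothesis Q0 : 0 <= Q.
Hypothesis Lb : forall j w, w \in L j -> 0 < cabs w <= 2 ^+ j.
Hypothesis Lb' : forall j w, w \in L j.+1 -> 2 ^+ j < cabs w.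
Hypothesis LQ : forall N, \sum_(j < N.+1) (size (L j))%:R <= Q * 2 ^+ N.
Hypothesis Lsum : forall N, cabs (\sum_(j < N) \sum_(w <- L j) w^-1) <= Q.

Let c0 j : 0 <= (size (L j))%:R :> R. Proof. by rewrite ler0n. Qed.
Let p2 j : 0 < 2 ^+ j :> R. Proof. by rewrite exprn_gt0. Qed.

(** From level 1 on the constant 2 would do; [k] also absorbs the finite list [L 0], whose zeros may
    be close to 0. *)
Lemma inv_zero_bound : exists2 k : R, 2 <= k & forall j w, w \in L j -> cabs w^-1 <= k / 2 ^+ j.
Proof.
have fin (s : seq R[i]) : exists2 k : R, 2 <= k & forall w, w \in s -> cabs w^-1 <= k.
  elim: s => [|w s [k k2 hk]]; first by exists 2.
  exists (Num.max k (cabs w^-1)); first by rewrite le_max k2.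
  by move=> u; rewrite inE le_max => /predU1P[->|/hk->//]; rewrite lexx orbT.
have [k k2 hk] := fin (L 0%N); exists k => // -[|j] w wL.
  by rewrite expr0 divr1 hk.
have w2 := Lb' wL; have k0 : 0 < k by lra.
rewrite cabsV exprS invfM mulrA; apply: (@le_trans _ _ (2 ^+ j)^-1).
  by rewrite lef_pV2 ?posrE ?p2 ?(lt_trans (p2 j) w2)// ltW.
by rewrite ler_peMl ?invr_ge0 ?(ltW (p2 j))// ler_pdivlMr// mul1r.
Qed.

(** The zeros are opposite to 1 / b so that the exponentials cancel those of the product of f on the
    real axis. For b = 0 the factor is 1. *)
Definition hblock j z : R[i] := \prod_(w <- L j) efactor (- z * (re_inv w)%:C).

Lemma re_inv_le w : cabs (re_inv w)%:C <= cabs w^-1.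
Proof. by rewrite cabs_real; exact: Re_le_cabs. Qed.

Lemma hblock_tail (k K : R) (q : R[i] -> R[i]) j z : 
  (forall w, w \in L j -> cabs w^-1 <= k / 2 ^+ j) ->
  (forall v, efactor v - 1 = v ^+ 2 * q v) ->
  (forall v : R[i], cabs v <= k * cabs z / 2 ^+ j -> cabs (q v) <= K) -> 0 <= K ->
  \sum_(w <- L j) cabs (efactor (- z * (re_inv w)%:C) - 1) <=
    K * (k * cabs z) ^+ 2 * ((size (L j))%:R / 4 ^+ j).
Proof.
move=> kb qE qK K0.
have -> : K * (k * cabs z) ^+ 2 * ((size (L j))%:R / 4 ^+ j) =
   \sum_(w <- L j) K * (k * cabs z / 2 ^+ j) ^+ 2.
  have -> : 4 = 2 * 2 :> R by ring.
  rewrite big_const_seq count_predT iter_addr_0 -[RHS]mulr_natl exprMn.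
  by rewrite expr_div_n exprMn; field; rewrite expf_neq0.
rewrite big_seq [leRHS]big_seq; apply: ler_sum => w wL.
have vb : cabs (- z * (re_inv w)%:C) <= k * cabs z / 2 ^+ j.
  rewrite cabsM cabsN mulrC [k * _]mulrC -mulrA [leRHS]mulrC ler_wpM2r ?cabs_ge0//.
  exact: le_trans (re_inv_le w) (kb w wL).
rewrite qE cabsM cabsX mulrC ler_pM ?cabs_ge0 ?exprn_ge0 ?cabs_ge0 ?qK//.
by rewrite lerXn2r ?nnegrE ?cabs_ge0// (le_trans (cabs_ge0 _) vb).
Qed.

Lemma ent_hblock j : ent (hblock j).
Proof.
move=> z; apply: (@cdiff_prod R _ (L j) (fun w z => efactor (- z * (re_inv w)%:C))) => w.
apply: (@cdiff_comp R (fun z => - z * (re_inv w)%:C) (@efactor R)); last exact: ent_efactor.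
by apply: cdiffM; [apply: cdiffN; exact: cdiff_id|exact: cdiff_const].
Qed.

(** Since (1 - v) exp(v) - 1 = O(v^2), level j contributes in proportion to [size (L j) / 4 ^ j],
    and these sum to at most 4 Q. *)
Lemma hblock_sum (r : R) : exists B : R, forall J z, cabs z <= r ->
  \sum_(j < J) cabs (hblock j z - 1) <= B.
Proof.
have [k k2 kb] := inv_zero_bound; have k0 : 0 <= k by lra.
have [q qe qE] := efactor_quadratic.
have [K K0 hK] := ent_bounded (k * `|r|) qe.
pose S := K * (k * `|r|) ^+ 2 * (4 * Q).
have S0 : 0 <= S by rewrite !mulr_ge0 ?sqr_ge0// ltW.
exists (S * expR S) => J z zr.
have zr' : cabs z <= `|r| by rewrite (le_trans zr)// ler_norm.
pose s j := \sum_(w <- L j) cabs (efactor (- z * (re_inv w)%:C) - 1).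
have s0 j : 0 <= s j by apply: sumr_ge0 => w _; exact: cabs_ge0.
have sb j : s j <= K * (k * `|r|) ^+ 2 * ((size (L j))%:R / 4 ^+ j).
  apply: (@le_trans _ _ (K * (k * cabs z) ^+ 2 * ((size (L j))%:R / 4 ^+ j))).
    apply: hblock_tail qE _ (ltW K0) => [w|v vb]; first exact: kb.
    apply: hK; apply: (le_trans vb); rewrite ler_pdivrMr//.
    have a1 : 1 <= 2 ^+ j :> R by rewrite exprn_ege1// ler1n.
    have a2 : k * cabs z <= k * `|r| by rewrite ler_wpM2l.
    by rewrite (le_trans a2)// ler_peMr// mulr_ge0.
  rewrite ler_wpM2r ?divr_ge0 ?exprn_ge0// ler_wpM2l ?(ltW K0)//.
  by rewrite ler_sqr ?nnegrE ?mulr_ge0 ?cabs_ge0// ler_wpM2l.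
have ss : \sum_(j < J) s j <= S.
  apply: (@le_trans _ _ (\sum_(j < J) K * (k * `|r|) ^+ 2 * ((size (L j))%:R / 4 ^+ j))).
    by apply: ler_sum => j _; exact: sb.
  rewrite -mulr_sumr ler_wpM2l ?mulr_ge0 ?sqr_ge0 ?(ltW K0)//.
  exact: dyadic_quartic c0 LQ J.
apply: (@le_trans _ _ (\sum_(j < J) s j * expR S)); last first.
  by rewrite -mulr_suml ler_wpM2r// expR_ge0.
apply: ler_sum => j _; have sS : s j <= S.
  apply: (le_trans (sb j)); rewrite ler_wpM2l ?mulr_ge0 ?sqr_ge0 ?(ltW K0)//.
  apply: le_trans (dyadic_quartic c0 LQ j.+1); rewrite big_ord_recr/= lerDr.
  by apply: sumr_ge0 => i _; rewrite divr_ge0 ?exprn_ge0.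
rewrite /hblock; have -> : \prod_(w <- L j) efactor (- z * (re_inv w)%:C) =
    \prod_(w <- L j) (1 + (efactor (- z * (re_inv w)%:C) - 1)).
  by apply: eq_bigr => w _; ring.
apply: (le_trans (cabs_prod1D_sub1 _ _)); apply: (le_trans (expR_sub1_le _)).
by apply: ler_wpM2l; [exact: s0|rewrite ler_expR].
Qed.

(* For [2 ^ j <= k |z|] the exponentials are controlled by the bounded sums of [1/w]
   and the factors [1 + z b] by counting; the remaining factors are close to 1. *)
Lemma hblock_growth : exists2 A : R, 0 <= A & forall z, exists J0, forall J, (J0 <= J)%N ->
  cabs (\prod_(j < J) hblock j z) <= A * expR (A * cabs z).
Proof.
have [k k2 kb] := inv_zero_bound; have k0 : 0 < k by lra.
have [q qe qE] := efactor_quadratic.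
have [K K0 hK] := ent_bounded 1 qe.
pose A := 8 * Q * k + Q + 2 * K * k * Q.
have A0 : 0 <= A.
  have a1 : 0 <= 8 * Q * k by rewrite !mulr_ge0 ?(ltW k0) ?(ltW K0).
  have a2 : 0 <= 2 * K * k * Q by rewrite !mulr_ge0 ?(ltW k0) ?(ltW K0).
  by rewrite /A !addr_ge0.
exists (expR (8 * Q) + A); first by rewrite addr_ge0// expR_ge0.
move=> z; set Y := k * cabs z; have Y0 : 0 <= Y by rewrite mulr_ge0 ?cabs_ge0 ?(ltW k0).
pose y := Y + 1; have y0 : 0 < y by rewrite ltr_wpDl.
have [n0 hn0] : exists n0, forall j, (2 ^+ j <= y) = (j < n0)%N.
  have ex : exists n, y < 2 ^+ n.
    exists (Num.truncn y).+1; rewrite (lt_trans (truncnS_gt _))// -natrX ltr_nat.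
    by rewrite ltn_expl.
  case: (ex_minnP ex) => n0 yn hmin; exists n0 => j; apply/idP/idP => [jy|jn].
    by rewrite ltnNge; apply/negP => nj; move: (lt_le_trans yn (ler_weXn2l (ler1n R 2) nj)); rewrite ltNge jy.
  by rewrite leNgt; apply/negP => /hmin; rewrite leqNgt jn.
exists n0 => J nJ.
rewrite -(big_mkord xpredT (fun j => hblock j z)) (big_cat_nat _ nJ)//= cabsM.
have first : cabs (\prod_(0 <= j < n0) hblock j z) <= expR (8 * Q * y + Q * cabs z).
  rewrite big_mkord /hblock cabs_prod; under eq_bigr do rewrite cabs_prod.
  apply: (@le_trans _ _ (\prod_(j < n0) \prod_(w <- L j) (expR (2 * Num.sqrt (y / 2 ^+ j)) * expR (Re (- z * (re_inv w)%:C))))).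
    apply: ler_prod => j _; apply/andP; split.
      by apply: prodr_ge0 => w _; exact: cabs_ge0.
    rewrite big_seq [leRHS]big_seq; apply: ler_prod => w wL; rewrite cabs_ge0/=.
    rewrite /efactor cabsM cabs_cexp ler_wpM2r ?expR_ge0//.
    have vb : cabs (- z * (re_inv w)%:C) <= y / 2 ^+ j.
      rewrite cabsM cabsN (le_trans (ler_wpM2l (cabs_ge0 z) (le_trans (re_inv_le w) (kb j w wL))))//.
      by rewrite mulrA ler_wpM2r ?invr_ge0 ?(ltW (p2 j))// mulrC lerDl.
    have v0 : 0 <= y / 2 ^+ j by rewrite divr_ge0 ?(ltW y0) ?(ltW (p2 j)).
    apply: (@le_trans _ _ (1 + y / 2 ^+ j)).
      by rewrite (le_trans (cabsB _ _))// cabs1 lerD2l.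
    have p : 0 < 1 + y / 2 ^+ j by rewrite ltr_wpDr.
    by rewrite -{1}(lnK p) ler_expR; exact: ln1D_sqrt.
  under eq_bigr do rewrite big_split/=; rewrite big_split/= expRD ler_pM//.
  - by apply: prodr_ge0 => j _; apply: prodr_ge0 => w _; exact: expR_ge0.
  - by apply: prodr_ge0 => j _; apply: prodr_ge0 => w _; exact: expR_ge0.
  - have -> : \prod_(j < n0) \prod_(w <- L j) expR (2 * Num.sqrt (y / 2 ^+ j)) =
       expR (2 * \sum_(j < n0) (size (L j))%:R * Num.sqrt (y / 2 ^+ j)).
      rewrite mulr_sumr (big_morph expR (@expRD R) (@expR0 R)); apply: eq_bigr => j _.
      rewrite -(big_morph expR (@expRD R) (@expR0 R)); congr expR.
      by rewrite big_const_seq count_predT iter_addr_0 -[LHS]mulr_natl mulrCA.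
    rewrite ler_expR; have := dyadic_sqrt_below c0 LQ n0 (ltW y0).
    rewrite (eq_bigl xpredT) => [h|j]; last by rewrite hn0 ltn_ord.
    by have := ler_wpM2l (ler0n R 2) h; lra.
  - under eq_bigr do rewrite -(big_morph expR (@expRD R) (@expR0 R)).
    rewrite -(big_morph expR (@expRD R) (@expR0 R)) ler_expR.
    have -> : \sum_(j < n0) \sum_(w <- L j) Re (- z * (re_inv w)%:C) =
       - (Re z * Re (\sum_(j < n0) \sum_(w <- L j) w^-1)).
      rewrite -mulNr Re_sum mulr_sumr; apply: eq_bigr => j _; rewrite Re_sum mulr_sumr.
      by apply: eq_bigr => w _; rewrite ReM ReN/= mulr0 subr0.
    apply: (le_trans (ler_norm _)); rewrite normrN normrM mulrC ler_pM//.
      by rewrite (le_trans (Re_le_cabs _)).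
    exact: Re_le_cabs.
have second : cabs (\prod_(n0 <= j < J) hblock j z) <= expR (2 * K * k * Q * cabs z).
  rewrite /hblock; have -> : \prod_(n0 <= j < J) \prod_(w <- L j) efactor (- z * (re_inv w)%:C) =
    \prod_(n0 <= j < J) \prod_(w <- L j) (1 + (efactor (- z * (re_inv w)%:C) - 1)).
    by apply: eq_bigr => j _; apply: eq_bigr => w _; ring.
  rewrite cabs_prod; apply: (@le_trans _ _ (\prod_(n0 <= j < J) expR (K * Y ^+ 2 * ((size (L j))%:R / 4 ^+ j)))).
    rewrite big_nat_cond [leRHS]big_nat_cond; apply: ler_prod => j /andP[/andP[nj _] _]; rewrite cabs_ge0/=.
    apply: (le_trans (cabs_prod1D _ _)); rewrite ler_expR.
    apply: hblock_tail qE _ (ltW K0) => [w|v vb]; first exact: kb.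
    apply: hK; apply: (le_trans vb); rewrite ler_pdivrMr// mul1r -/Y.
    have : y < 2 ^+ j by rewrite ltNge hn0 -leqNgt.
    by rewrite /y; lra.
  rewrite -(big_morph expR (@expRD R) (@expR0 R)) ler_expR -mulr_sumr.
  have h := dyadic_above c0 LQ J y0.
  have h2 : \sum_(n0 <= j < J) (size (L j))%:R / 4 ^+ j <= 2 * Q / y.
    apply: le_trans h; rewrite -(big_mkord (fun j => y < 2 ^+ j) (fun j => (size (L j))%:R / 4 ^+ j)).
    rewrite (big_cat_nat (leq0n n0) nJ)//= -[leLHS]add0r lerD//.
      by apply: sumr_ge0 => j _; rewrite divr_ge0 ?exprn_ge0.
    rewrite big_nat_cond [leRHS]big_nat_cond le_eqVlt; apply/orP; left; apply/eqP.
    by apply: eq_bigl => j; rewrite ltNge hn0 -leqNgt; case: (n0 <= j)%N; rewrite /= ?andbT ?andbF.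
  apply: (@le_trans _ _ (K * Y ^+ 2 * (2 * Q / y))).
    by apply: ler_wpM2l h2; apply: mulr_ge0; [exact: ltW|exact: sqr_ge0].
  have Yy : Y ^+ 2 / y <= Y.
    by rewrite ler_pdivrMr// expr2 ler_wpM2l// /y lerDl.
  have KQ : 0 <= 2 * K * Q by rewrite !mulr_ge0 ?(ltW k0) ?(ltW K0).
  have := ler_wpM2l KQ Yy; rewrite /Y; lra.
have Q8 : 0 <= 8 * Q by rewrite mulr_ge0.
apply: (@le_trans _ _ (expR (8 * Q) * expR (A * cabs z))).
  apply: (le_trans (ler_pM (cabs_ge0 _) (cabs_ge0 _) first second)).
  rewrite -!expRD ler_expR /y /A /Y; lra.
have e1 := expR_ge0 (8 * Q).
apply: ler_pM; rewrite ?expR_ge0 ?lerDl// ler_expR ler_wpM2r ?cabs_ge0//.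
by rewrite lerDr.
Qed.

End real_multiplier.

Section multiplier_products.
Variable R : realType.
Implicit Types (z w : R[i]).

Lemma inv_sqr_node_sum N : \sum_(n < N) (node R n ^+ 2)^-1 <= 5.
Proof.
suff : \sum_(n < N.+1) (node R n ^+ 2)^-1 <= 5 - N.+1%:R^-1.
  rewrite big_ord_recr/=; have h1 : 0 <= N.+1%:R^-1 :> R by rewrite invr_ge0.
  have h2 : 0 <= (node R N ^+ 2)^-1 by rewrite invr_ge0 sqr_ge0.
  by move: h1 h2; move: (N.+1%:R^-1) (node R N ^- 2) (\sum_(i < N) _) => a b c; lra.
elim: N => [|N ih].
  by rewrite big_ord_recr big_ord0/= /node !add0r exprVn invrK invr1; lra.
rewrite big_ord_recr/=; have := inv_sqr_node R (ltn0Sn N); move: ih.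
move: (N.+1%:R^-1) (N.+2%:R^-1) (node R N.+1 ^- 2) (\sum_(i < N.+1) _) => a b c e; lra.
Qed.

Lemma node_product (m : nat -> nat) (M : R) : (forall n, (m n)%:R <= M) -> exists g,
  [/\ ent g, forall z, ccvg (fun N => node_prod m N z) (g z),
      forall z, cabs (g z) <= expR (9 * M * (cabs z + 1)) &
      forall z, g z = 0 -> Im z = 0].
Proof.
move=> mM; have M0 : 0 <= M by rewrite (le_trans _ (mM 0%N)).
pose u n z : R[i] := (1 - (z / (node R n)%:C) ^+ 2) ^+ m n.
have ue n : ent (u n).
  move=> z; apply: cdiffX; apply: cdiffB; first exact: cdiff_const.
  by apply: cdiffX; apply: cdiffM; [exact: cdiff_id|exact: cdiff_const].
have [|g [ge gc g0]] := infinite_product ue.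
  move=> r; pose v := M * `|r| ^+ 2.
  have v0 : 0 <= v by apply: mulr_ge0 => //; exact: sqr_ge0.
  exists (v * expR (4 * v) * 5) => J z zr.
  apply: (@le_trans _ _ (\sum_(n < J) v * expR (4 * v) * (node R n ^+ 2)^-1)); last first.
    by rewrite -mulr_sumr ler_wpM2l ?inv_sqr_node_sum// mulr_ge0// expR_ge0.
  apply: ler_sum => n _; set s := (node R n ^+ 2)^-1.
  have s0 : 0 <= s by rewrite invr_ge0 sqr_ge0.
  have s4 : s <= 4.
    rewrite /s -[leRHS]invrK lef_pV2 ?posrE ?invr_gt0 ?exprn_gt0 ?node_gt0//.
    have := ler0n R n; rewrite /node expr2; nra.
  have -> : u n z = \prod_(i <- nseq (m n) tt) (1 + - (z / (node R n)%:C) ^+ 2).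
    by rewrite big_const_seq count_predT size_nseq /u; elim: (m n) => //= k ih; rewrite exprS ih.
  apply: (le_trans (cabs_prod1D_sub1 _ _)).
  set t := \sum_(i <- _) _; have t0 : 0 <= t by apply: sumr_ge0 => i _; exact: cabs_ge0.
  have ts : t <= v * s.
    rewrite /t big_const_seq count_predT size_nseq iter_addr_0 -[leLHS]mulr_natl /v -mulrA.
    apply: ler_pM => //; first exact: cabs_ge0.
    rewrite cabsN cabsX cabsM cabsV cabs_real ger0_norm ?(ltW (node_gt0 R n))// expr_div_n.
    rewrite ler_wpM2r// ler_sqr ?nnegrE ?cabs_ge0//.
    by rewrite (le_trans zr)// ler_norm.
  apply: (le_trans (expR_sub1_le _)); rewrite -mulrA [expR _ * _]mulrC mulrA.
  apply: ler_pM => //; rewrite ?expR_ge0//.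
  by rewrite ler_expR (le_trans ts)// mulrC ler_wpM2r.
exists g; split => // z.
  apply: (ccvg_cabs_le (gc z)) => N0; exists N0 => //.
  exact: (node_prod_bound N0 z mM).
move=> /g0[n /eqP]; rewrite expf_eq0 => /andP[_].
rewrite subr_eq0 eq_sym sqrf_eq1 => h.
have n0 : (node R n)%:C != 0 :> R[i] by rewrite -cabs_eq0 cabs_real normr_eq0 gt_eqF// node_gt0.
case/orP: h => /eqP e.
  by have -> : z = (node R n)%:C by rewrite -[z](divfK n0) e mul1r.
by have -> : z = (- node R n)%:C by rewrite -[z](divfK n0) e mulN1r real_complexN.
Qed.

Variables (L : nat -> seq R[i]) (Q : R).
Hypothesis Q0 : 0 <= Q.
Hypothesis Lb : forall j w, w \in L j -> 0 < cabs w <= 2 ^+ j.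
Hypothesis Lb' : forall j w, w \in L j.+1 -> 2 ^+ j < cabs w.
Hypothesis LQ : forall N, \sum_(j < N.+1) (size (L j))%:R <= Q * 2 ^+ N.
Hypothesis Lsum : forall N, cabs (\sum_(j < N) \sum_(w <- L j) w^-1) <= Q.

Lemma hblock_product : exists h,
  [/\ ent h, forall z, ccvg (fun N => \prod_(j < N) hblock L j z) (h z),
      exists2 A : R, 0 <= A & forall z, cabs (h z) <= A * expR (A * cabs z) &
      forall z, h z = 0 -> Im z = 0].
Proof.
have [h [he hc h0]] := infinite_product (@ent_hblock R L) (hblock_sum Q0 Lb' LQ).
have [A A0 hA] := hblock_growth Q0 Lb' LQ Lsum.
exists h; split => //.
  exists A => // z; apply: (ccvg_cabs_le (hc z)) => N0.
  by have [J0 hJ] := hA z; exists (maxn N0 J0); [exact: leq_maxl|apply: hJ; exact: leq_maxr].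
move=> z /h0[j /eqP]; rewrite /hblock prodf_seq_eq0 => /hasP[w _ /=].
rewrite /efactor mulf_eq0 (negPf (cexp_neq0 _)) orbF subr_eq0 eq_sym => /eqP e.
have b0 : re_inv w != 0.
  by apply/negP => /eqP b0; move: e; rewrite b0 mulr0 => /eqP; rewrite eq_sym oner_eq0.
have := congr1 (fun u => Im u) e; rewrite ImM ImN/= mulr0 add0r => /eqP.
by rewrite mulf_eq0 (negPf b0) orbF oppr_eq0 => /eqP.
Qed.

End multiplier_products.

(** * Pairs of factors on the real axis *)

Section real_axis_factors.
Variable R : realType.
Implicit Types (x d : R) (w : R[i]).

Lemma efactor_pair x w :
  cabs (efactor (x%:C / w)) * cabs (efactor (- x%:C * (re_inv w)%:C)) =
  cabs (1 - x%:C * w^-1) * cabs (1 + x%:C * (re_inv w)%:C).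
Proof.
have E (u : R[i]) : cabs (efactor u) = cabs (1 - u) * expR (Re u).
  by rewrite /efactor cabsM cabs_cexp.
rewrite !E mulrACA -expRD Re_realM ReM ReN/= mulr0 subr0.
by rewrite mulNr opprK mulNr subrr expR0 mulr1.
Qed.

(** Multiplying x b by 1 + i d leaves the real parts of 1 - x b and 1 + x b unchanged and adds
    imaginary parts of modulus d |x b|, which dominate x Im a. So the rotated point gives a majorant
    for both factors. *)
Lemma near_pair x d w : `|Im w^-1| <= d * `|Re w^-1| ->
  cabs (1 - x%:C * w^-1) * cabs (1 + x%:C * (re_inv w)%:C) <=
  qfactor d ((`|x| * `|Re w^-1|) ^+ 2).
Proof.
rewrite /re_inv; set a := w^-1 => h.
have d0 : 0 <= d * `|Re a| by exact: le_trans h.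
have -> : qfactor d ((`|x| * `|Re a|) ^+ 2) =
   cabs (1 - (x * Re a)%:C * (1 +i* d)) * cabs (1 + (x * Re a)%:C * (1 +i* d)).
  rewrite /qfactor -cabsM; congr cabs; rewrite -normrM real_normK ?num_real//.
  by rewrite rmorphXn/=; ring.
have c2 : Im a ^+ 2 <= (d * Re a) ^+ 2.
  rewrite -[Im a ^+ 2]real_normK ?num_real// -[leRHS]real_normK ?num_real//.
  rewrite ler_sqr ?nnegrE// normrM; apply: (le_trans h).
  by rewrite ler_wpM2r// ler_norm.
have x2 : x ^+ 2 * Im a ^+ 2 <= x ^+ 2 * (d * Re a) ^+ 2 by rewrite ler_wpM2l// sqr_ge0.
apply: ler_pM; rewrite ?cabs_ge0// -ler_sqr ?nnegrE ?cabs_ge0// !sqr_cabs.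
  rewrite ReD ReN ImD ImN !Re_realM !Im_realM /= mulr1 !mul0r subr0 !addr0 !add0r !sqrrN.
  by rewrite lerD2l; rewrite !exprMn in x2 *; lra.
rewrite !ReD !ImD !Re_realM !Im_realM /= ?(mulr1, mul0r, subr0, mulr0, addr0, add0r) lerD2l.
by rewrite expr0n/= sqr_ge0.
Qed.

Lemma far_pair x w : cabs (1 - x%:C * w^-1) * cabs (1 + x%:C * (re_inv w)%:C) <=
  expR (2 * ln (1 + `|x| * cabs w^-1)).
Proof.
have p : 0 < 1 + `|x| * cabs w^-1 by rewrite ltr_wpDr// mulr_ge0 ?cabs_ge0.
rewrite expRM_natl lnK// expr2 ler_pM ?cabs_ge0//.
  by rewrite (le_trans (cabsB _ _))// cabs1 lerD2l cabsM cabs_real.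
rewrite (le_trans (cabsD _ _))// cabs1 lerD2l cabsM cabs_real ler_wpM2l//.
exact: re_inv_le.
Qed.

(** The case of a real zero in [near_pair]: the factors of the multiplier are majorized at the same
    rotated point as those of f h, so that their logarithms may be added. *)
Lemma node_factor_exp x d n m : x != 0 -> 0 < d -> d <= 1 ->
  cabs ((1 - (x%:C / (node R n)%:C) ^+ 2) ^+ m) <= expR (m%:R * hfactor `|x| d (node R n)).
Proof.
move=> x0 d0 d1; have n0 := node_gt0 R n; have u0 := sqr_ge0 (`|x| / node R n).
have q0 : 0 < qfactor d ((`|x| / node R n) ^+ 2) by apply: qfactor_gt0.
rewrite cabsX expRM_natl /hfactor lnK// lerXn2r ?nnegrE ?cabs_ge0 ?(ltW q0)//.
have E : (`|x| / node R n) ^+ 2 = (`|x| * `|Re ((node R n)%:C)^-1|) ^+ 2.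
  by rewrite -fmorphV/= [`|_^-1|]ger0_norm// invr_ge0 ltW.
have h := @near_pair x d (node R n)%:C; rewrite -E in h; apply: le_trans (h _).
  rewrite -cabsM le_eqVlt; apply/orP; left; apply/eqP; congr cabs.
  by rewrite /re_inv -fmorphV/=; ring.
by rewrite -fmorphV/= normr0 mulr_ge0// ltW.
Qed.

Lemma sqrt_le_linear (D e X : R) : 0 < e -> 0 <= X -> D * Num.sqrt X <= e * X + D ^+ 2 / e.
Proof.
move=> e0 X0; have s := sqr_sqrtr X0; set r := Num.sqrt X in s *.
have -> : e * X + D ^+ 2 / e = D * r + (e * r - D / 2) ^+ 2 / e + 3 / 4 * (D ^+ 2 / e).
  by rewrite -s; field; rewrite gt_eqF.
have h1 : 0 <= (e * r - D / 2) ^+ 2 / e by rewrite divr_ge0 ?sqr_ge0// ltW.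
have h2 : 0 <= D ^+ 2 / e by rewrite divr_ge0 ?sqr_ge0// ltW.
lra.
Qed.

End real_axis_factors.

Section real_axis.
Variable R : realType.
Implicit Types (z w : R[i]).

Lemma ccvgZ (s : nat -> R[i]) c l : ccvg s l -> ccvg (fun N => c * s N) (c * l).
Proof.
move=> sl e e0; have c0 := cabs_ge0 c; have c1 : 0 < cabs c + 1 by lra.
have [N0 hN] := sl _ (divr_gt0 e0 c1); exists N0 => N /hN h.
rewrite -mulrBr cabsM; apply: (@le_trans _ _ (cabs c * (e / (cabs c + 1)))).
  by rewrite ler_wpM2l.
by rewrite mulrA ler_pdivrMr// mulrC ler_wpM2l ?(ltW e0)//; lra.
Qed.

(** The two indices are independent because N + 1 levels of zeros are balanced by 2^(N + 2)
    nodes. *)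
Lemma ccvg_cabs_mul_le (s t : nat -> R[i]) a b (B : R) : ccvg s a -> ccvg t b ->
  (forall N0, exists N N', [/\ (N0 <= N)%N, (N0 <= N')%N & cabs (s N) * cabs (t N') <= B]) ->
  cabs a * cabs b <= B.
Proof.
move=> sa tb hB; apply/ler_addgt0Pr => e e0.
have a0 := cabs_ge0 a; have b0 := cabs_ge0 b.
have p : 0 < cabs a + cabs b + 3 by lra.
pose r := Num.min 1 (e / (cabs a + cabs b + 3)).
have r0 : 0 < r by rewrite lt_min ltr01 divr_gt0.
have r1 : r <= 1 by rewrite ge_min lexx.
have re : r * (cabs a + cabs b + 3) <= e by rewrite -ler_pdivlMr// ge_min lexx orbT.
have [N1 h1] := sa r r0; have [N2 h2] := tb r r0.
have [N [N' [n1 n2 h]]] := hB (maxn N1 N2).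
have := h1 N (leq_trans (leq_maxl _ _) n1); have := h2 N' (leq_trans (leq_maxr _ _) n2).
rewrite [cabs (t N' - b)]cabsBC [cabs (s N - a)]cabsBC => u v.
have u2 := cabs_sub_ge b (t N'); have v2 := cabs_sub_ge a (s N).
have s0 := cabs_ge0 (s N); have t0 := cabs_ge0 (t N').
have [ab|ab] := leP (cabs a) r.
  have : cabs a * cabs b <= r * cabs b by rewrite ler_wpM2r.
  have : 0 <= cabs (s N) * cabs (t N') by rewrite mulr_ge0.
  have : 0 <= r * (cabs a + 3) by rewrite mulr_ge0 ?(ltW r0)//; lra.
  lra.
have [bb|bb] := leP (cabs b) r.
  have : cabs a * cabs b <= cabs a * r by rewrite ler_wpM2l.
  have : 0 <= cabs (s N) * cabs (t N') by rewrite mulr_ge0.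
  have : 0 <= r * (cabs b + 3) by rewrite mulr_ge0 ?(ltW r0)//; lra.
  lra.
have : (cabs a - r) * (cabs b - r) <= cabs (s N) * cabs (t N') by apply: ler_pM; lra.
have : 0 <= r * r by rewrite mulr_ge0 ?(ltW r0).
lra.
Qed.

(** A zero is [near] if 1 / w is almost real and 1 / |b| is at least [T0]. Near zeros become points
    for [multiplier]. For the others the sum of 1 / |w| converges, so they contribute o(x). *)
Theorem real_axis_bound (f : R[i] -> R[i]) (eps : R) :
  ent f -> f 0 != 0 -> exponential_type f -> im_inv_bounded f -> 0 < eps ->
  exists g, [/\ ent g, g 0 != 0, (exists C : R, forall z, cabs (g z) <= C * expR (C * cabs z)),
    (forall z, g z = 0 -> Im z = 0) &
    exists b A : R, forall x : R, cabs (f x%:C * g x%:C) <= A * expR (b * x + eps * `|x|)].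
Proof.
move=> fe f0 fexp fA eps0.
have [L [Q [b [Q0 [[Lb Lb'] LQ Lsum LIm fb]]]]] := zero_data fe f0 fexp fA.
have [h [he hc [Ah Ah0 hA] h0]] := hblock_product Q0 Lb' LQ Lsum.
have e4 : 0 < eps / 4 by rewrite divr_gt0.
have [T0 [M [d [d0 d1 T00 hm]]]] := multiplier Q0 e4.
pose nb w := `|Re w^-1|.
pose near w := (`|Im w^-1| <= d * nb w) && (T0%:R <= (nb w)^-1).
(* The node of [T w] is within 1/2 of 1 / |b|, so [hfactor_step] pays for the move to it. *)
pose T w := Num.truncn (nb w)^-1.
pose NL j := [seq T w | w <- L j & near w].
have c0 j : 0 <= (size (L j))%:R :> R by rewrite ler0n.
have p2 j : 0 < 2 ^+ j :> R by rewrite exprn_gt0.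
have T01 : 1 <= T0%:R :> R by rewrite ler1n.
have nearE w : near w -> [/\ 0 < nb w, (T0 <= T w)%N, (T w)%:R <= (nb w)^-1,
    (nb w)^-1 < (T w)%:R + 1 & (nb w)^-1 <= 2 * (T w)%:R].
  move=> /andP[_ tT]; have t0 : 0 <= (nb w)^-1 by lra.
  have t1 : (nb w)^-1 < (T w)%:R + 1 by rewrite natr1 truncnS_gt.
  have TT : (T0 <= T w)%N by rewrite truncn_ge_nat.
  have T1 : 1 <= (T w)%:R :> R by rewrite ler1n (leq_trans T00).
  split=> //; first by rewrite -invr_gt0; lra.
    by rewrite /T truncn_le.
  by lra.
have [k k2 kb] := inv_zero_bound Lb'.
have k0 : 0 <= k by exact: le_trans k2.
have [m [mM [A1 hA1]]] : exists m : nat -> nat, (forall n, (m n)%:R <= M) /\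
      exists A : R, forall x : R, 0 < x -> 1 <= d * x -> exists J0, forall J, (J0 <= J)%N ->
       \sum_(j < J) \sum_(T <- NL j) hfactor x d (node R T) +
       \sum_(n < 2 ^ J.+1) (m n)%:R * hfactor x d (node R n) <= eps / 4 * x + A.
  apply: hm => [j T' /mapP[w]|N].
    rewrite mem_filter => /andP[nw wL] ->; have [b0 TT Tt tT tT2] := nearE w nw.
    have /andP[w0 wj] := Lb _ _ wL; split => //.
      rewrite -(ler_nat R) natrX; apply: (le_trans Tt).
      have ha : cabs w^-1 <= 2 * nb w.
        apply: (le_trans (cabs_le_sum _)); case/andP: nw => hi _.
        have := ler_wpM2r (normr_ge0 (Re w^-1)) d1; rewrite -/(nb w); lra.
      rewrite exprS -ler_pdivrMl// -invfM -[leRHS]invrK lef_pV2 ?posrE ?invr_gt0 ?mulr_gt0//.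
      by apply: le_trans ha; rewrite cabsV lef_pV2 ?posrE.
    rewrite -(ler_nat R) natrX natrM.
    have wt : cabs w <= (nb w)^-1.
      by rewrite -[leLHS]invrK lef_pV2 ?posrE ?invr_gt0// -cabsV; exact: Re_le_cabs.
    case: j wL wj => [|j] wL wj; last by rewrite exprS; have := Lb' _ _ wL; lra.
    have : 1 <= (T w)%:R :> R by rewrite ler1n (leq_trans T00).
    by rewrite expr0; lra.
  apply: le_trans (LQ N); apply: ler_sum => j _.
  by rewrite ler_nat /NL size_map size_filter count_size.
have [g2 [g2e g2c g2b g20]] := node_product mM.
pose S J := \sum_(j < J) \sum_(w <- L j | ~~ near w) cabs w^-1.
(* With a = 1 / w: if |Im a| > d |b|, then |a| <= (1 / d + 1) |Im a|, and class A sums this. If 1 /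
   |b| < T0, then |a| <= T0 |a|^2, and the linear count sums the squares. *)
pose B := (d^-1 + 1) * Q + T0%:R * k ^+ 2 * (4 * Q).
have SB J : S J <= B.
  apply: (@le_trans _ _ (\sum_(j < J) \sum_(w <- L j) ((d^-1 + 1) * `|Im w^-1| + T0%:R * (k / 2 ^+ j) ^+ 2))).
    apply: ler_sum => j _; rewrite big_mkcond/= big_seq [leRHS]big_seq; apply: ler_sum => w wL.
    have q1 : 0 <= (d^-1 + 1) * `|Im w^-1|.
      by apply: mulr_ge0 => //; have := invr_ge0 d; lra.
    have q2 : 0 <= T0%:R * (k / 2 ^+ j) ^+ 2 by apply: mulr_ge0; [exact: ler0n|exact: sqr_ge0].
    case: ifP => [|_]; last exact: addr_ge0.
    have a2 : cabs w^-1 ^+ 2 <= (k / 2 ^+ j) ^+ 2.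
      by rewrite ler_sqr ?nnegrE ?cabs_ge0 ?(le_trans (cabs_ge0 _) (kb _ _ wL))// kb.
    have := cabs_le_sum w^-1; rewrite -/(nb w) => ca.
    rewrite negb_and -!ltNge => /orP[hi|ht].
      have : nb w <= d^-1 * `|Im w^-1| by rewrite mulrC ler_pdivlMr// mulrC ltW.
      by rewrite mulrDl mul1r; lra.
    (* As the inverse of 0 is 0, a purely imaginary 1 / w fails the test against [T0] and is counted
       here. *)
    have [nb0|nb0] := eqVneq (nb w) 0.
      by move: ca; rewrite nb0 add0r; move: q1; rewrite mulrDl mul1r; have := mulr_ge0 (ltW (divr_gt0 ltr01 d0)) (normr_ge0 (Im w^-1)); rewrite div1r; lra.
    have nbp : 0 < nb w by rewrite lt_neqAle eq_sym nb0 normr_ge0.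
    have : 1 <= T0%:R * nb w by rewrite -ler_pdivrMr// div1r ltW.
    move=> h1; have h2 : cabs w^-1 <= T0%:R * cabs w^-1 ^+ 2.
      rewrite expr2 mulrA -[leLHS]mul1r ler_wpM2r ?cabs_ge0//; apply: (le_trans h1).
      by rewrite ler_wpM2l ?ler0n//; exact: Re_le_cabs.
    by move: h2 (ler_wpM2l (ler0n R T0) a2) q1; clear => h2 h3; lra.
  under eq_bigr do rewrite big_split/= -mulr_sumr; rewrite big_split/= -mulr_sumr.
  apply: lerD.
    by rewrite ler_wpM2l ?LIm// addr_ge0// invr_ge0 ltW.
  apply: le_trans (ler_wpM2l _ (dyadic_quartic c0 LQ J)); last first.
    by apply: mulr_ge0; [exact: ler0n|exact: sqr_ge0].
  rewrite mulr_sumr le_eqVlt; apply/orP; left; apply/eqP; apply: eq_bigr => j _.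
  rewrite big_const_seq count_predT iter_addr_0 -[LHS]mulr_natl.
  have -> : 4 = 2 * 2 :> R by ring.
  by rewrite expr_div_n exprMn; field; rewrite expf_neq0.
have far0 j : 0 <= \sum_(w <- L j | ~~ near w) cabs w^-1.
  by apply: sumr_ge0 => w _; exact: cabs_ge0.
(* Past level [I] the pairs cost 2 ln(1 + X |a|) <= 2 X |a|, in total at most eps X / 8; the
   finitely many earlier ones cost O(sqrt X), recorded in [D1]. [D2] records the moves of the near
   zeros to their nodes. *)
have [I hI] := bounded_tail far0 SB (divr_gt0 eps0 (ltr0n R 16)).
pose D1 : R := \sum_(j < I) \sum_(w <- L j | ~~ near w) 4 * Num.sqrt (cabs w^-1).
pose D2 := 32 / d * (k * Num.sqrt k) * (4 * Q).
have Dd : 0 <= 32 / d * (k * Num.sqrt k).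
  by rewrite !mulr_ge0 ?invr_ge0 ?sqrtr_ge0// ?(ltW d0).
pose Eo := A1 + (D1 + D2) ^+ 2 / (eps / 4) + 1.
have fge : ent (fun z => f z * (h z * g2 z)).
  by move=> z; apply: cdiffM; [exact: fe|apply: cdiffM; [exact: he|exact: g2e]].
(* The multiplier needs d |x| >= 1; the remaining bounded part of the real axis is covered by this
   constant. *)
have [M1 M10 hM1] := ent_bounded d^-1 fge.
exists (fun z => h z * g2 z); split.
- by move=> z; apply: cdiffM; [exact: he|exact: g2e].
- apply/eqP => /eqP; rewrite mulf_eq0 => /orP[/eqP e|/eqP e].
    have := hc 0; rewrite e => /ccvg_unique-/(_ 1) E.
    have /eqP : 0 = 1 :> R[i]; last by rewrite eq_sym oner_eq0.
    apply: E => r r0; exists 0%N => N _; rewrite /hblock.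
    rewrite big1 ?subrr ?cabs0 ?ltW// => j _; rewrite big1// => w _.
    by rewrite oppr0 mul0r /efactor cexp0 subr0 mulr1.
  have := g2c 0; rewrite e => /ccvg_unique-/(_ 1) E.
  have /eqP : 0 = 1 :> R[i]; last by rewrite eq_sym oner_eq0.
  apply: E => r r0; exists 0%N => N _; rewrite /node_prod.
  by rewrite big1 ?subrr ?cabs0 ?ltW// => j _; rewrite mul0r expr0n/= subr0 expr1n.
- have M0 : 0 <= M by rewrite (le_trans _ (mM 0%N)).
  exists (Ah * expR (9 * M) + (Ah + 9 * M)) => z; rewrite cabsM.
  have P0 : 0 <= Ah * expR (9 * M) by rewrite mulr_ge0// expR_ge0.
  apply: (le_trans (ler_pM (cabs_ge0 _) (cabs_ge0 _) (hA z) (g2b z))).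
  have -> : Ah * expR (Ah * cabs z) * expR (9 * M * (cabs z + 1)) =
     Ah * expR (9 * M) * expR ((Ah + 9 * M) * cabs z).
    by rewrite -!mulrA -!expRD; congr (_ * expR _); ring.
  apply: ler_pM; rewrite ?expR_ge0 ?lerDl//; first by rewrite addr_ge0// mulr_ge0.
  by rewrite ler_expR ler_wpM2r ?cabs_ge0// lerDr.
- by move=> z /eqP; rewrite mulf_eq0 => /orP[/eqP/h0|/eqP/g20].
(* The linear coefficient [b] of the product formula of f shifts the strip horizontally without
   widening it. *)
exists (Re b), (cabs (f 0) * expR Eo + M1 * expR (`|Re b| / d)) => x.
have Reb : - `|Re b| * `|x| <= Re b * x.
  by have := ler_norm (- (Re b * x)); rewrite normrN normrM; lra.
have [small|large] := ltP (d * `|x|) 1.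
  have xd : `|x| <= d^-1 by rewrite -[d^-1]mul1r ler_pdivlMr// mulrC ltW.
  apply: (@le_trans _ _ (M1 * expR (`|Re b| / d) * expR (Re b * x + eps * `|x|))).
    rewrite -mulrA -expRD; apply: (@le_trans _ _ M1).
      by apply: hM1; rewrite cabs_real.
    rewrite ler_peMr ?(ltW M10)// -expR0 ler_expR.
    have : `|Re b| * `|x| <= `|Re b| / d by rewrite ler_wpM2l.
    have : 0 <= eps * `|x| by rewrite mulr_ge0// ltW.
    by move: Reb; clear; lra.
  rewrite ler_wpM2r ?expR_ge0// lerDr mulr_ge0 ?cabs_ge0//; exact: expR_ge0.
set X : R := `|x| in Reb large *.
have X0 : 0 < X by rewrite normr_gt0; apply/eqP => x0; move: large; rewrite /X x0 normr0 mulr0; lra.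
have x0 : x != 0 by rewrite -normr_gt0.
have sX : 0 <= Num.sqrt X by rewrite sqrtr_ge0.
have [J0 hJ0] := hA1 X X0 large.
(* The first summand brings x into the range of the product formula; the second makes its quadratic
   error at most 1. *)
have [n1 hn1] : exists n1, forall n, (n1 <= n)%N -> 4 * X + Q * X ^+ 2 <= 2 ^+ n.
  exists (Num.truncn (4 * X + Q * X ^+ 2)).+1 => n nn; rewrite ltW// (lt_trans (truncnS_gt _))//.
  by rewrite -natrX ltr_nat (leq_ltn_trans nn)// ltn_expl.
have Fx : cabs (f x%:C * (h x%:C * g2 x%:C)) <= cabs (f 0) * expR Eo * expR (Re b * x + eps * X).
  rewrite mulrA cabsM; apply: (@ccvg_cabs_mul_le (fun N => f x%:C * \prod_(j < N) hblock L j x%:C) (fun N => node_prod m N x%:C)); last 2 first.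
  - exact: g2c.
  - move=> N0; pose N := maxn (maxn N0 n1) (maxn I J0).
    have NN0 : (N0 <= N)%N by rewrite /N leq_max leq_max leqnn.
    have Nn1 : (n1 <= N)%N by rewrite /N leq_max leq_max leqnn orbT.
    have NI : (I <= N)%N by rewrite /N !leq_max leqnn !orbT.
    have NJ0 : (J0 <= N)%N by rewrite /N !leq_max leqnn !orbT.
    clearbody N; exists N.+1, (2 ^ N.+2)%N; split; first exact: leqW.
      apply: (leq_trans NN0); apply: (@leq_trans (2 ^ N)); last by rewrite leq_exp2l// !leqW.
      by rewrite ltnW// ltn_expl.
    have p2N : 4 * X + Q * X ^+ 2 <= 2 ^+ N by exact: hn1.
    have QX : 0 <= Q * X ^+ 2 by apply: mulr_ge0 => //; exact: sqr_ge0.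
    pose nu : R := \sum_(n < 2 ^ N.+2) (m n)%:R * hfactor X d (node R n).
    pose ew j w : R := if near w then hfactor X d (node R (T w)) +
       32 / d * (k * Num.sqrt k) * Num.sqrt X * (2 ^+ j * Num.sqrt (2 ^+ j))^-1
       else 2 * ln (1 + X * cabs w^-1).
    have pw j w : w \in L j -> cabs (efactor (x%:C / w)) * cabs (efactor (- x%:C * (re_inv w)%:C)) <= expR (ew j w).
      move=> wL; rewrite efactor_pair /ew; case: ifP => nw; last exact: far_pair.
      have [b0 TT Tt tT tT2] := nearE w nw.
      have t0 : 0 < (nb w)^-1 by rewrite invr_gt0.
      have T1 : 1 <= (T w)%:R :> R by rewrite ler1n (leq_trans T00).
      case/andP: (nw) => hi _; apply: (le_trans (near_pair x hi)); rewrite -/(nb w) -/X.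
      have q0 : 0 < qfactor d ((X * nb w) ^+ 2) by apply: qfactor_gt0 => //; exact: sqr_ge0.
      rewrite -[leLHS](lnK q0) ler_expR.
      have -> : ln (qfactor d ((X * nb w) ^+ 2)) = hfactor X d (nb w)^-1 by rewrite /hfactor invrK.
      have st : hfactor X d (nb w)^-1 - hfactor X d (node R (T w)) <=
         32 / d * (Num.sqrt X / ((nb w)^-1 * Num.sqrt (nb w)^-1)).
        apply: hfactor_step => //; rewrite ?node_gt0// /node; move: Tt tT tT2 T1 t0;
          move: (nb w)^-1 ((T w)%:R) => s t; clear; rewrite ?ler_norml; lra.
      have kt : 2 ^+ j <= k * (nb w)^-1.
        rewrite ler_pdivlMr// mulrC -ler_pdivlMr//.
        by apply: le_trans (kb _ _ wL); exact: Re_le_cabs.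
      have u0 : 0 < 2 ^+ j * Num.sqrt (2 ^+ j) :> R by rewrite mulr_gt0// sqrtr_gt0.
      have v0 : 0 < (nb w)^-1 * Num.sqrt (nb w)^-1 by rewrite mulr_gt0// sqrtr_gt0.
      have kt2 : 2 ^+ j * Num.sqrt (2 ^+ j) <= k * Num.sqrt k * ((nb w)^-1 * Num.sqrt (nb w)^-1).
        rewrite mulrACA -sqrtrM// ler_pM ?sqrtr_ge0 ?(ltW (p2 j))//.
        by rewrite ler_sqrt// mulr_ge0// ltW.
      have iv : ((nb w)^-1 * Num.sqrt (nb w)^-1)^-1 <= k * Num.sqrt k * (2 ^+ j * Num.sqrt (2 ^+ j))^-1.
        by rewrite ler_pdivlMr// mulrC ler_pdivrMr.
      have c1 : 0 <= 32 / d * Num.sqrt X by rewrite !mulr_ge0 ?invr_ge0// ltW.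
      by move: st (ler_wpM2l c1 iv); clear => st; lra.
    have far_sum : \sum_(j < N.+1) \sum_(w <- L j | ~~ near w) 2 * ln (1 + X * cabs w^-1) <=
       D1 * Num.sqrt X + eps / 8 * X.
      rewrite -(big_mkord xpredT (fun j => \sum_(w <- L j | ~~ near w) 2 * ln (1 + X * cabs w^-1))).
      rewrite (big_cat_nat (leq0n I) (leqW NI))//=; apply: lerD.
        rewrite big_mkord /D1 mulr_suml; apply: ler_sum => j _; rewrite mulr_suml; apply: ler_sum => w _.
        move: (ln1D_sqrt (mulr_ge0 (ltW X0) (cabs_ge0 w^-1))).
        by rewrite sqrtrM ?(ltW X0)//; clear; lra.
      have := hI N.+1 (leqW NI).
      rewrite -!(big_mkord xpredT (fun j => \sum_(w <- L j | ~~ near w) cabs w^-1)).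
      rewrite (big_cat_nat (leq0n I) (leqW NI))//= [X in X - _]addrC addrK => hI'.
      apply: (@le_trans _ _ (2 * X * \sum_(I <= j < N.+1) \sum_(w <- L j | ~~ near w) cabs w^-1)); last first.
        by move: (ler_wpM2l (ltW X0) hI'); clear; lra.
      rewrite mulr_sumr; apply: ler_sum => j _; rewrite mulr_sumr; apply: ler_sum => w _.
      rewrite -mulrA ler_wpM2l// le_ln1Dx// (lt_le_trans (ltrN10 R))//.
      by rewrite mulr_ge0 ?cabs_ge0 ?(ltW X0).
    have near_sum : \sum_(j < N.+1) \sum_(w <- L j | near w) ew j w <=
       \sum_(j < N.+1) \sum_(T <- NL j) hfactor X d (node R T) + D2 * Num.sqrt X.
      apply: (@le_trans _ _ (\sum_(j < N.+1) \sum_(T <- NL j) hfactor X d (node R T) +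
         \sum_(j < N.+1) 32 / d * (k * Num.sqrt k) * Num.sqrt X * ((size (L j))%:R * (2 ^+ j * Num.sqrt (2 ^+ j))^-1))).
        rewrite -big_split/=; apply: ler_sum => j _.
        rewrite /NL big_map big_filter.
        have -> : \sum_(w <- L j | near w) ew j w = \sum_(w <- L j | near w) (hfactor X d (node R (T w)) +
           32 / d * (k * Num.sqrt k) * Num.sqrt X * (2 ^+ j * Num.sqrt (2 ^+ j))^-1).
          by apply: eq_bigr => w nw; rewrite /ew nw.
        rewrite big_split/= lerD2l big_const_seq iter_addr_0 -[leLHS]mulr_natl.
        rewrite mulrCA ler_wpM2l//; first by rewrite mulr_ge0.
        rewrite ler_wpM2r ?invr_ge0 ?mulr_ge0 ?sqrtr_ge0 ?(ltW (p2 j))//.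
        by rewrite ler_nat count_size.
      rewrite lerD2l -mulr_sumr /D2 [leRHS]mulrAC; apply: ler_wpM2l; first by rewrite mulr_ge0.
      exact: dyadic_three_halves c0 LQ _.
    have total : \sum_(j < N.+1) \sum_(w <- L j) ew j w + nu + 1 <= Eo + eps * X.
      have -> : \sum_(j < N.+1) \sum_(w <- L j) ew j w = \sum_(j < N.+1) \sum_(w <- L j | near w) ew j w +
         \sum_(j < N.+1) \sum_(w <- L j | ~~ near w) 2 * ln (1 + X * cabs w^-1).
        rewrite -big_split/=; apply: eq_bigr => j _; rewrite (bigID near)/=; congr (_ + _).
        by apply: eq_bigr => w /negPf nw; rewrite /ew nw.
      have := hJ0 N.+1 (leqW NJ0); rewrite -/nu; have := sqrt_le_linear (D1 + D2) e4 (ltW X0).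
      move: near_sum far_sum; rewrite /Eo mulrDl; clear -X0 eps0.
      move: (\sum_(j < N.+1) _) (\sum_(j < N.+1) _) (\sum_(j < N.+1) _) => s1 s2 s3.
      move: (D1 * _) (D2 * _) ((D1 + D2) ^+ 2 / _) => u1 u2 u3.
      by have := mulr_gt0 eps0 X0; lra.
    have fN : cabs (f x%:C) <= cabs (f 0) * expR (Re b * x + 1) * \prod_(j < N.+1) \prod_(w <- L j) cabs (efactor (x%:C / w)).
      have : cabs x%:C <= 2 ^+ N / 4 by rewrite cabs_real -/X ler_pdivlMr// mulrC (le_trans _ p2N)// lerDl.
      move=> /fb/le_trans; apply; rewrite ler_wpM2r//.
        by apply: prodr_ge0 => j _; apply: prodr_ge0 => w _; exact: cabs_ge0.
      rewrite ler_wpM2l ?cabs_ge0// ler_expR cabs_real -/X mulrC Re_realM mulrC lerD2l.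
      by rewrite mulrAC ler_pdivrMr// mul1r (le_trans _ p2N)// lerDr mulr_ge0// ltW.
    have hN : \prod_(j < N.+1) \prod_(w <- L j) cabs (efactor (x%:C / w)) * cabs (\prod_(j < N.+1) hblock L j x%:C) <=
       expR (\sum_(j < N.+1) \sum_(w <- L j) ew j w).
      rewrite cabs_prod -big_split/= (big_morph expR (@expRD R) (@expR0 R)).
      apply: ler_prod => j _; rewrite /hblock cabs_prod -big_split/= (big_morph expR (@expRD R) (@expR0 R)).
      apply/andP; split; first by apply: prodr_ge0 => w _; rewrite mulr_ge0 ?cabs_ge0.
      rewrite big_seq [leRHS]big_seq; apply: ler_prod => w wL; rewrite mulr_ge0 ?cabs_ge0//=.
      exact: pw.
    have nN : cabs (node_prod m (2 ^ N.+2) x%:C) <= expR nu.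
      rewrite /node_prod cabs_prod /nu (big_morph expR (@expRD R) (@expR0 R)).
      by apply: ler_prod => n _; rewrite cabs_ge0/=; exact: node_factor_exp.
    rewrite cabsM; set V := \prod_(j < N.+1) \prod_(w <- L j) _ in fN hN.
    have V0 : 0 <= V by apply: prodr_ge0 => j _; apply: prodr_ge0 => w _; exact: cabs_ge0.
    have f00 := cabs_ge0 (f 0).
    apply: (@le_trans _ _ (cabs (f 0) * expR (Re b * x + 1) * expR (\sum_(j < N.+1) \sum_(w <- L j) ew j w) * expR nu)).
      apply: ler_pM; rewrite ?mulr_ge0 ?cabs_ge0//.
      apply: (le_trans (ler_wpM2r (cabs_ge0 _) fN)); rewrite -[leLHS]mulrA; apply: ler_wpM2l => //.
      by rewrite mulr_ge0// expR_ge0.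
    rewrite -!mulrA -!expRD ler_wpM2l// ler_expR.
    by move: total; clear; move: (\sum_(j < N.+1) _) => s1; lra.
  exact/ccvgZ/hc.
apply: (le_trans Fx); rewrite ler_wpM2r ?expR_ge0// lerDl mulr_ge0 ?(ltW M10)//; exact: expR_ge0.
Qed.

End real_axis.

(** * The Phragmen-Lindelof principle *)

Section maximum_principle.
Variable R : realType.
Implicit Types (z w p : R[i]) (F G : R[i] -> R[i]) (a b c d : R).

Definition rect a b c d : set R[i] := [set z | (a <= Re z <= b) /\ (c <= Im z <= d)].

Lemma rect_max G a b c d : a <= b -> c <= d -> (forall z, ccont G z) ->
  exists2 p, rect a b c d p & forall z, rect a b c d z -> Re (G z) <= Re (G p).
Proof.
move=> ab cd Gc; pose A : set (R * R) := `[a, b] `*` `[c, d].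
have A0 : A !=set0 by exists (a, c); split; rewrite /= in_itv/= lexx ?ab ?cd.
have Ac : compact A by apply: compact_setX; exact: segment_compact.
have fc : {within A, continuous (fun q : R * R => Re (G (q.1 +i* q.2)))}.
  apply: continuous_subspaceT => q; apply/cvgrPdist_le => /= e e0.
  have [r r0 hr] := Gc (q.1 +i* q.2) _ e0; have r2 : 0 < r / 2 by rewrite divr_gt0.
  exists (ball q.1 (r / 2), ball q.2 (r / 2)); first by split; apply: nbhsx_ballx.
  case=> x y [/=]; rewrite -!ball_normE/= => h1 h2.
  have := hr ((x - q.1) +i* (y - q.2)); have -> : q.1 +i* q.2 + (x - q.1) +i* (y - q.2) = x +i* y.
    by apply: complex_ext => /=; ring.
  move=> h; rewrite distrC; have := Re_le_cabs (G (x +i* y) - G (q.1 +i* q.2)).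
  rewrite ReD ReN => /le_trans; apply; apply: h; apply: (le_trans (cabs_le_sum _)) => /=.
  by rewrite distrC [`|y - _|]distrC; move: h1 h2; clear; lra.
have [q /set_mem[q1 q2] qmax] := compact_EVT_max A0 Ac fc.
exists (q.1 +i* q.2) => [|z [z1 z2]]; first by move: q1 q2; rewrite /= !in_itv.
have := qmax (Re z, Im z); case: z z1 z2 => x y /= z1 z2; apply.
by apply/mem_set; split; rewrite /= in_itv.
Qed.

(* Adding a small multiple of [|w - z|^2], whose mean over circles exceeds its central
   value, makes the maximum unattainable in the interior. *)
Lemma rect_Re_bound F a b c d B : ent F ->
  (forall z, rect a b c d z -> Re z = a \/ Re z = b \/ Im z = c \/ Im z = d -> Re (F z) <= B) ->
  forall z, rect a b c d z -> Re (F z) <= B.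
Proof.
move=> Fe FB z [/andP[za zb] /andP[zc zd]].
rewrite leNgt; apply/negP => zB.
pose D := (b - a) + (d - c) + 1; have D1 : 1 <= D by rewrite /D; lra.
(* On the rectangle the added term is then at most half of the assumed excess over [B], so the
   maximum point still exceeds [B] and must be interior. *)
pose e := (Re (F z) - B) / (2 * D ^+ 2).
have D2 : 0 < 2 * D ^+ 2 by rewrite mulr_gt0// exprn_gt0//; lra.
have e0 : 0 < e by rewrite divr_gt0// subr_gt0.
have eD : e * D ^+ 2 = (Re (F z) - B) / 2 by rewrite /e; field; lra.
pose G w := F w + e%:C * ((w - z) * (w - z)^*%C).
have GRe w : Re (G w) = Re (F w) + e * cabs (w - z) ^+ 2.
  by rewrite /G ReD Re_realM sqr_cabs ReM; case: (w - z) => x y /=; ring.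
have Gc w : ccont G w.
  apply: ccontD; first exact: cdiff_cont.
  apply: ccontM; first exact: ccont_const.
  have wz : ccont (fun u => u - z) w by apply: ccontD; [exact: ccont_id|exact: ccont_const].
  apply: ccontM => //; apply: (@ccont_comp R _ (fun u : R[i] => u^*%C)) => // r r0.
  by exists r => // h hh; rewrite -conjcB addrAC subrr add0r cabsJ.
have [p pr pmax] := rect_max (le_trans za zb) (le_trans zc zd) Gc.
have zr : rect a b c d z by split; apply/andP.
have pz := pmax _ zr; rewrite !GRe subrr cabs0 expr0n/= mulr0 addr0 in pz.
have [/andP[pa pb] /andP[pc pd]] := pr.
have pD : cabs (p - z) <= D.
  apply: (le_trans (cabs_le_sum _)); rewrite ReD ReN ImD ImN.
  have r1 : `|Re p - Re z| <= b - a by rewrite ler_norml; lra.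
  have r2 : `|Im p - Im z| <= d - c by rewrite ler_norml; lra.
  by rewrite /D; lra.
have eD2 : e * cabs (p - z) ^+ 2 <= (Re (F z) - B) / 2.
  by rewrite -eD ler_wpM2l ?(ltW e0)// lerXn2r ?nnegrE ?cabs_ge0//; lra.
have pB : B < Re (F p) by lra.
have pin : [/\ a < Re p, Re p < b, c < Im p & Im p < d].
  have nob : ~ (Re p = a \/ Re p = b \/ Im p = c \/ Im p = d).
    by move=> /(FB p pr) h; move: (le_lt_trans h pB); rewrite ltxx.
  split; rewrite lt_neqAle ?pa ?pb ?pc ?pd andbT; apply/eqP => h; apply: nob; first by left.
  - by right; left.
  - by right; right; left.
  - by right; right; right.
have [p1 p2 p3 p4] := pin.
pose s := Num.min (Num.min (Re p - a) (b - Re p)) (Num.min (Im p - c) (d - Im p)).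
have s0 : 0 < s by rewrite !lt_min !subr_gt0 p1 p2 p3 p4.
have [s1 s2 s3 s4] : [/\ s <= Re p - a, s <= b - Re p, s <= Im p - c & s <= d - Im p].
  by split; rewrite !ge_min lexx ?orbT.
(* In the expansion of |p + u - z|^2 the cross term is the real part of a linear function of u.
   Absorbing it keeps the function entire, and the gain e s^2 contradicts the mean value
   property. *)
pose H u := F (p + u) + (2 * e)%:C * ((p - z)^*%C * u).
have He : ent H.
  move=> u; apply: cdiffD; first exact: (ent_shift p Fe).
  apply: cdiffM; first exact: cdiff_const.
  by apply: cdiffM; [exact: cdiff_const|exact: cdiff_id].
have mean : circ H s = F p.
  rewrite (@circ_mean R H s 0) ?lexx//; first by rewrite /H addr0 !mulr0 addr0.
    by move=> u _; exact: cdiff_cont.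
have bd : Re (circ H s) <= Re (F p) - e * s ^+ 2.
  apply: avg_Re_bound.
    by apply: rc_circ => u _; exact: cdiff_cont.
  move=> t _; set u := s%:C * cis t.
  have cu : cabs u = s by rewrite cabs_circle// ltW.
  have ur : rect a b c d (p + u).
    have := Re_le_cabs u; have := Im_le_cabs u; rewrite cu !ler_norml => /andP[i1 i2] /andP[i3 i4].
    by split; rewrite ?ReD ?ImD; apply/andP; split; move: s1 s2 s3 s4 i1 i2 i3 i4; clear; lra.
  have := pmax _ ur; rewrite !GRe.
  have -> : cabs (p + u - z) ^+ 2 = cabs (p - z) ^+ 2 + s ^+ 2 + 2 * Re ((p - z)^*%C * u).
    rewrite -cu [p + u - z]addrAC !sqr_cabs ReM.
    by move: (p - z) u {cu ur} => [x y] [x' y'] /=; ring.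
  by rewrite /H ReD Re_realM; lra.
rewrite mean in bd; have : 0 < e * s ^+ 2 by rewrite mulr_gt0// exprn_gt0.
lra.
Qed.

(** A unimodular factor makes the value at the given point real and nonnegative, which reduces the
    modulus to the real part. *)
Lemma rect_cabs_bound F a b c d B : ent F ->
  (forall z, rect a b c d z -> Re z = a \/ Re z = b \/ Im z = c \/ Im z = d -> cabs (F z) <= B) ->
  forall z, rect a b c d z -> cabs (F z) <= B.
Proof.
move=> Fe FB z zr; have [c' c1 cE] := unimodular_multiplier (F z).
have -> : cabs (F z) = Re (c' * F z) by rewrite cE.
apply: (@rect_Re_bound (fun w => c' * F w) a b c d) => // [w|w wr wb].
  by apply: cdiffM; [exact: cdiff_const|exact: Fe].
apply: le_trans (FB w wr wb); rewrite -[leRHS]mul1r -c1 -cabsM.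
by rewrite (le_trans (ler_norm _))// Re_le_cabs.
Qed.

End maximum_principle.

Section phragmen_lindelof.
Variable R : realType.
Implicit Types (z w : R[i]) (F : R[i] -> R[i]).

Lemma cos_ge (x m : R) : `|x| <= m -> m < pi -> cos m <= cos x.
Proof.
rewrite ler_norml => /andP[x1 x2] mp.
have s0 (p : R) : 0 <= p -> p <= m -> 0 <= sin p.
  rewrite le_eqVlt => /predU1P[<- _|p0 pm]; first by rewrite sin0.
  by apply/ltW/sin_gt0_pi; rewrite p0 (le_lt_trans pm).
have -> : cos m = cos ((m + x) / 2 + (m - x) / 2) by congr cos; field.
have -> : cos x = cos ((m + x) / 2 - (m - x) / 2) by congr cos; field.
have h := mulr_ge0 (s0 ((m + x) / 2) ltac:(lra) ltac:(lra)) (s0 ((m - x) / 2) ltac:(lra) ltac:(lra)).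
by rewrite cosD cosB; lra.
Qed.

(* In the coordinate [tau = log z] the sector is a strip, on which [exp (- e exp (rho tau))]
   with [1 < rho] beats the exponential growth of [F (exp tau)]. *)
Theorem sector_bound F (C A a b : R) : ent F -> (forall z, cabs (F z) <= C * expR (C * cabs z)) ->
  a < b -> b - a < pi -> (forall r, 0 <= r -> cabs (F (r%:C * cis a)) <= A) ->
  (forall r, 0 <= r -> cabs (F (r%:C * cis b)) <= A) ->
  forall r t, 0 <= r -> a <= t <= b -> cabs (F (r%:C * cis t)) <= A + 1.
Proof.
move=> Fe FC' ab bp Fa Fb r t r0 /andP[ta tb].
have A0 : 0 <= A by exact: le_trans (cabs_ge0 _) (Fa 0 (lexx _)).
have F0A : cabs (F 0) <= A by rewrite -(mul0r (cis a)); exact: (Fa 0).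
have := r0; rewrite le_eqVlt => /predU1P[<-|rp]; first by rewrite mul0r (le_trans F0A)// lerDl.
pose C1 := `|C| + 1; have C10 : 1 <= C1 by rewrite lerDr.
have FC z : cabs (F z) <= expR (2 * C1 * (cabs z + 1)).
  have C1p : 0 <= C1 by exact: le_trans C10.
  have CC : C <= C1 by rewrite (le_trans (ler_norm _))// lerDl.
  have z0 := cabs_ge0 z; have e0 := expR_ge0 (C * cabs z).
  apply: (le_trans (FC' z)); apply: (@le_trans _ _ (C1 * expR (C1 * cabs z))).
    apply: (@le_trans _ _ (C1 * expR (C * cabs z))); first by rewrite ler_wpM2r.
    by rewrite ler_wpM2l// ler_expR ler_wpM2r.
  apply: (@le_trans _ _ (expR C1 * expR (C1 * cabs z))).
    by rewrite ler_wpM2r ?expR_ge0// (le_trans _ (expR_ge1Dx C1))// lerDr.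
  by rewrite -expRD ler_expR; have := mulr_ge0 (le_trans ler01 C10) z0; lra.
pose al := b - a; have al0 : 0 < al by rewrite subr_gt0.
(* The exponent must exceed 1 to beat exponential type, and rho (b - a) must stay below pi to keep
   cos(rho (u - mid)) positive on the sector. *)
pose rho := (pi / al + 1) / 2.
have pal : 1 < pi / al by rewrite ltr_pdivlMr// mul1r.
have rho1 : 1 < rho by rewrite /rho; lra.
have rhob : rho * al < pi.
  have : rho * al = (pi + al) / 2 by rewrite /rho; field; rewrite gt_eqF.
  by move=> ->; move: bp; rewrite -/al; lra.
pose mid := (a + b) / 2; pose m := rho * al / 2.
have m0 : 0 < m by rewrite /m divr_gt0// mulr_gt0//; lra.
have m2 : m < pi / 2 by rewrite /m ltr_pM2r.
pose kap := cos m; have kap0 : 0 < kap by apply: cos_gt0_pihalf; rewrite m2 andbT; lra.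
have kapc u : a <= u -> u <= b -> kap <= cos (rho * (u - mid)).
  move=> au ub; apply: cos_ge; last by have := pi_gt0 R; lra.
  rewrite normrM gtr0_norm; last lra.
  rewrite /m -mulrA ler_wpM2l; first by []; first lra.
  by rewrite ler_norml /mid /al; lra.
pose Phi (e : R) tau := F (cexp tau) * cexp (- (e%:C * cexp (rho%:C * (tau - (0 +i* mid))))).
have Phie e : ent (Phi e).
  move=> z; apply: cdiffM; first exact: cdiff_comp (cdiff_cexp _) (Fe _).
  apply: (@cdiff_comp R (fun tau => - (e%:C * cexp (rho%:C * (tau - (0 +i* mid))))) (@cexp R)); last exact: cdiff_cexp.
  apply: cdiffN; apply: cdiffM; first exact: cdiff_const.
  apply: (@cdiff_comp R (fun tau => rho%:C * (tau - (0 +i* mid))) (@cexp R)); last exact: cdiff_cexp.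
  by apply: cdiffM; [exact: cdiff_const|apply: cdiffB; [exact: cdiff_id|exact: cdiff_const]].
have PhiE e (s u : R) : cabs (Phi e (s +i* u)) =
    cabs (F ((expR s)%:C * cis u)) * expR (- (e * (expR (rho * s) * cos (rho * (u - mid))))).
  rewrite /Phi cabsM cabs_cexp cexpE; congr (_ * expR _).
  by rewrite ReN Re_realM /cexp Re_realM Re_realM Im_realM ReD ImD ReN ImN/= subr0.
have [d d0 hd] := cdiff_cont (Fe 0) ltr01.
pose s0 := ln r; have rE : r = expR s0 by rewrite lnK.
have key (e : R) : 0 < e -> cabs (Phi e (s0 +i* t)) <= A + 1.
  move=> e0; pose ek := e * kap * (rho - 1).
  have ek0 : 0 < ek by rewrite /ek !mulr_gt0//; lra.
  (* On the left edge |z| <= d, so F is within 1 of F(0), the origin of the 1 in [A + 1]. On the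
     right edge the damping outweighs the bound [FC]. *)
  pose s1 := Num.min s0 (ln d); pose s2 := Num.max 0 (Num.max s0 (4 * C1 / ek)).
  apply: (@rect_cabs_bound R _ s1 s2 a b); first exact: Phie.
    move=> [s u] [/= /andP[ss1 ss2] /andP[ua ub]] bd; rewrite PhiE.
    have c0 := kapc u ua ub; have q0 := expR_gt0 (rho * s).
    have q1 : 0 <= expR (rho * s) * cos (rho * (u - mid)).
      by rewrite mulr_ge0 ?(ltW q0)// (le_trans (ltW kap0)).
    have E1 : expR (- (e * (expR (rho * s) * cos (rho * (u - mid))))) <= 1.
      by rewrite -expR0 ler_expR oppr_le0 mulr_ge0// ltW.
    have triv : cabs (F ((expR s)%:C * cis u)) <= A + 1 ->
        cabs (F ((expR s)%:C * cis u)) * expR (- (e * (expR (rho * s) * cos (rho * (u - mid))))) <= A + 1.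
      by move=> h; rewrite -[A + 1]mulr1 ler_pM ?cabs_ge0 ?expR_ge0.
    case: bd => [sE|[sE|[uE|uE]]].
    - apply: triv; have sd : expR s <= d.
        by rewrite sE -[leRHS]lnK// ler_expR /s1 ge_min lexx orbT.
      have := hd ((expR s)%:C * cis u); rewrite cabs_circle ?expR_ge0// sd add0r => /(_ isT) h.
      have := cabsD (F ((expR s)%:C * cis u) - F 0) (F 0); rewrite subrK.
      by move: F0A h; clear; lra.
    - have sp : 0 <= s by rewrite sE /s2 le_max lexx.
      have s4 : 4 * C1 / ek <= s by rewrite sE /s2 !le_max lexx !orbT.
      have s4' : 4 * C1 <= s * ek by rewrite -ler_pdivrMr.
      apply: (le_trans (ler_wpM2r (expR_ge0 _) (FC _))); rewrite cabs_circle ?expR_ge0//.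
      rewrite -expRD; apply: (@le_trans _ _ 1); last by rewrite lerDr.
      rewrite -[leRHS]expR0 ler_expR.
      have E2 : expR (rho * s) = expR s * expR ((rho - 1) * s) by rewrite -expRD; congr expR; ring.
      have y1 : 1 <= expR s by rewrite -expR0 ler_expR.
      have y2 := expR_ge1Dx ((rho - 1) * s).
      have h1 : e * kap * ((rho - 1) * s) <= e * kap * expR ((rho - 1) * s).
        by rewrite ler_wpM2l ?mulr_ge0 ?(ltW e0) ?(ltW kap0)//; lra.
      have h2 : e * kap * expR ((rho - 1) * s) <= e * cos (rho * (u - mid)) * expR ((rho - 1) * s).
        by rewrite ler_wpM2r ?expR_ge0// ler_wpM2l// ltW.
      have h3 : 4 * C1 <= e * cos (rho * (u - mid)) * expR ((rho - 1) * s).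
        apply: le_trans h2; apply: le_trans h1; apply: (le_trans s4').
        by rewrite /ek le_eqVlt; apply/orP; left; apply/eqP; ring.
      have h4 := ler_wpM2l (expR_ge0 s) h3.
      have h5 : C1 * 1 <= C1 * expR s by rewrite ler_wpM2l//; lra.
      by move: h4 h5; rewrite E2; clear; lra.
    - by apply: triv; rewrite uE (le_trans (Fa _ (expR_ge0 _)))// lerDl.
    - by apply: triv; rewrite uE (le_trans (Fb _ (expR_ge0 _)))// lerDl.
  by split; rewrite /= ?ta ?tb// /s1 /s2 ge_min !le_max lexx !orbT.
(* Instead of a limit e -> 0, one explicit [e] is small enough that the damping factor at the given
   point cannot make up for the assumed excess. *)
rewrite leNgt; apply/negP => big.
set v := cabs _ in big; have A1 : 0 < A + 1 by rewrite ltr_wpDl.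
have q1 : 1 < v / (A + 1) by rewrite ltr_pdivlMr// mul1r.
have l0 : 0 < ln (v / (A + 1)) by rewrite ln_gt0.
pose Y := expR (rho * s0) + 1; have Y0 : 0 < Y by rewrite ltr_wpDl// expR_ge0.
have e0 : 0 < ln (v / (A + 1)) / (2 * Y) by rewrite divr_gt0// mulr_gt0.
have := key _ e0; rewrite PhiE -rE -/v leNgt => /negP; apply.
have v0 : 0 < v by exact: lt_trans big.
rewrite -ltr_pdivrMl// mulrC -invf_div -[X in X^-1]lnK ?posrE ?divr_gt0//.
rewrite -expRN ltr_expR ltrN2.
have cY : expR (rho * s0) * cos (rho * (t - mid)) <= Y.
  by apply: (@le_trans _ _ (expR (rho * s0) * 1)); [rewrite ler_wpM2l ?expR_ge0// cos_le1|rewrite mulr1 lerDl].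
apply: (le_lt_trans (ler_wpM2l (ltW e0) cY)).
have -> : ln (v / (A + 1)) / (2 * Y) * Y = ln (v / (A + 1)) / 2 by field; rewrite gt_eqF.
lra.
Qed.

End phragmen_lindelof.

(** * The indicator diagram *)

Section growth.
Variable R : realType.
Implicit Types (z w : R[i]) (F : R[i] -> R[i]).

Lemma cis_exists w : cabs w = 1 -> exists2 x : R, - pi <= x <= pi & w = cis x.
Proof.
move=> w1; have s1 : Re w ^+ 2 + Im w ^+ 2 = 1 by rewrite -sqr_cabs w1 expr1n.
have r1 : -1 <= Re w <= 1 by rewrite -ler_norml -w1 Re_le_cabs.
have [/andP[a0 a1] ca] := acos_def r1; have p0 := pi_ge0 R.
have sa : sin (acos (Re w)) = `|Im w| by rewrite sin_acos// -s1 addrAC subrr add0r sqrtr_sqr.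
have [i0|i0] := leP 0 (Im w).
  exists (acos (Re w)); first by rewrite a1 andbT; lra.
  by apply: complex_ext; rewrite /= ?ca ?sa ?ger0_norm.
exists (- acos (Re w)); first by apply/andP; split; lra.
by apply: complex_ext; rewrite /= ?cosN ?sinN ?ca ?sa ?ltr0_norm ?opprK.
Qed.

Lemma polar z (th : R) : exists2 x : R, - pi <= x <= pi & z = (cabs z)%:C * cis (th + x).
Proof.
have [->|z0] := eqVneq z 0.
  by exists 0; rewrite ?cabs0 ?mul0r// oppr_le0 pi_ge0.
have c0 : (cabs z)%:C != 0 :> R[i] by rewrite -cabs_eq0 cabs_real normr_eq0 cabs_eq0.
have [|x xp xE] := @cis_exists (z / (cabs z)%:C / cis th).
  rewrite !cabsM !cabsV cabs_cis invr1 mulr1 cabs_real ger0_norm ?cabs_ge0// divff//.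
  by rewrite cabs_eq0.
by exists x => //; rewrite cisD -xE; field; rewrite c0 cis_neq0.
Qed.

Lemma liouville F (M : R) : ent F -> (forall z, cabs (F z) <= M) -> forall z, F z = F 0.
Proof.
move=> Fe FM z; apply: (@disc_constant R F (cabs z + 1)); last by rewrite ltrDl.
move=> w _; have [d Fd] := Fe w; suff <- : d = 0 by [].
have M0 : 0 <= M by exact: le_trans (cabs_ge0 _) (FM 0).
apply/eqP; rewrite -cabs_eq0 eq_le cabs_ge0 andbT; apply/ler_addgt0Pr => e e0; rewrite add0r.
have r0 : 0 < (M + 1) / e by rewrite divr_gt0//; lra.
have [d' [Fd' b _]] := @taylor1 R F w _ M r0 (fun w _ => Fe _) (fun w _ => FM _).
rewrite (cderiv_unique Fd Fd') (le_trans b)// invf_div mulrA ler_pdivrMr; last lra.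
by rewrite mulrC ler_wpM2l ?(ltW e0)//; lra.
Qed.

(** Bounds valid on the whole ray are the form that the sector theorem consumes and returns; the
    infimum of these exponents is the indicator, by [indicator_fun_growth_inf]. *)
Definition growth F (th : R) : set R :=
  [set c | exists A : R, forall r, 0 <= r -> cabs (F (r%:C * cis th)) <= A * expR (c * r)].

Lemma growth_cis F (th th' : R) : cis th = cis th' :> R[i] -> growth F th = growth F th'.
Proof. by rewrite /growth => ->. Qed.

Lemma growth_le F th c c' : growth F th c -> c <= c' -> growth F th c'.
Proof.
move=> [A hA] cc; exists A => r r0; apply: (le_trans (hA r r0)).
have A0 : 0 <= A.
  by have := hA 0 (lexx _); rewrite mulr0 expR0 mulr1; apply: le_trans; exact: cabs_ge0.
by rewrite ler_wpM2l// ler_expR ler_wpM2r.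
Qed.

(** The coefficient of the exponential exp(al z) whose growth rate at the angle th + x is the
    sinusoid p cos x + q sin x. *)
Definition dual_point (p q th : R) : R[i] := (p +i* (- q)) * cis (- th).

Lemma dual_pointE (p q th x : R) :
  Re (dual_point p q th * cis (th + x)) = p * cos x + q * sin x.
Proof. by rewrite /dual_point -mulrA -cisD addKr ReM/=; ring. Qed.

Variables (F : R[i] -> R[i]) (C : R).
Hypothesis Fe : ent F.
Hypothesis FC : forall z, cabs (F z) <= C * expR (C * cabs z).

Lemma growth_all (c : R) th : C <= c -> growth F th c.
Proof.
move=> Cc; apply: growth_le Cc; exists C => r r0.
by rewrite (le_trans (FC _))// cabs_circle.
Qed.

(** After division by exp(al z) the function is bounded on both sides of the sector, and
    [sector_bound] applies. *)
Lemma growth_sector al (a b : R) : a < b -> b - a < pi ->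
  growth F a (Re (al * cis a)) -> growth F b (Re (al * cis b)) ->
  exists A : R, forall r t, 0 <= r -> a <= t <= b ->
    cabs (F (r%:C * cis t)) <= A * expR (r * Re (al * cis t)).
Proof.
move=> ab bp [A1 h1] [A2 h2].
pose G z := F z * cexp (- (al * z)).
have GE z : cabs (G z) = cabs (F z) * expR (- Re (al * z)) by rewrite /G cabsM cabs_cexp ReN.
have rE r t : Re (al * (r%:C * cis t)) = r * Re (al * cis t) by rewrite mulrCA Re_realM.
have Ge : ent G.
  move=> z; apply: cdiffM; first exact: Fe.
  apply: (@cdiff_comp R (fun z => - (al * z)) (@cexp R)); last exact: cdiff_cexp.
  by apply: cdiffN; apply: cdiffM; [exact: cdiff_const|exact: cdiff_id].
pose C2 := `|C| + cabs al.
have GC z : cabs (G z) <= C2 * expR (C2 * cabs z).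
  have e0 : expR (- Re (al * z)) <= expR (cabs al * cabs z).
    by rewrite ler_expR -cabsM (le_trans (ler_norm _))// normrN Re_le_cabs.
  have cC := ler_norm C; have al0 := cabs_ge0 al.
  rewrite GE; apply: (@le_trans _ _ (C2 * expR (C * cabs z) * expR (cabs al * cabs z))).
    apply: ler_pM; rewrite ?cabs_ge0 ?expR_ge0//; apply: (le_trans (FC z)).
    by rewrite ler_wpM2r ?expR_ge0// /C2; lra.
  have C20 : 0 <= C2 by rewrite addr_ge0.
  rewrite -mulrA -expRD -mulrDl ler_wpM2l// ler_expR ler_wpM2r ?cabs_ge0//.
  by rewrite lerD2r.
have bnd t A : (forall r, 0 <= r -> cabs (F (r%:C * cis t)) <= A * expR (Re (al * cis t) * r)) ->
    forall r, 0 <= r -> cabs (G (r%:C * cis t)) <= A.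
  move=> h r r0; rewrite GE rE; apply: (le_trans (ler_wpM2r (expR_ge0 _) (h r r0))).
  by rewrite -mulrA -expRD [_ * r]mulrC subrr expR0 mulr1.
exists (Num.max A1 A2 + 1) => r t r0 tab.
have := @sector_bound R G C2 (Num.max A1 A2) a b Ge GC ab bp _ _ r t r0 tab.
rewrite GE rE => h.
have /h {}h : forall r, 0 <= r -> cabs (G (r%:C * cis a)) <= Num.max A1 A2.
  by move=> s s0; rewrite le_max (bnd _ _ h1).
have {h}: cabs (F (r%:C * cis t)) * expR (- (r * Re (al * cis t))) <= Num.max A1 A2 + 1.
  by apply: h => s s0; rewrite le_max (bnd _ _ h2)// orbT.
by rewrite expRN ler_pdivrMr// expR_gt0.
Qed.

(** Trigonometric convexity: p and q determine the sinusoid with value c1 at - t1 and c2 at t2; p is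
    its value at 0. *)
Lemma growth_convex (th t1 t2 c1 c2 : R) : 0 < t1 -> 0 < t2 -> t1 + t2 < pi ->
  growth F (th - t1) c1 -> growth F (th + t2) c2 ->
  growth F th ((sin t2 * c1 + sin t1 * c2) / sin (t1 + t2)).
Proof.
move=> t10 t20 tp g1 g2; set S := sin (t1 + t2).
have S0 : 0 < S by apply: sin_gt0_pi; rewrite tp andbT addr_gt0.
set p := _ / S; pose q := (cos t1 * c2 - cos t2 * c1) / S.
have SE : S = sin t1 * cos t2 + cos t1 * sin t2 by rewrite /S sinD.
have e1 : p * cos (- t1) + q * sin (- t1) = c1.
  rewrite cosN sinN; have : S * (p * cos t1 + q * - sin t1) = S * c1.
    rewrite {2}SE /p /q; field; rewrite gt_eqF//.
  by move/mulfI; apply; rewrite gt_eqF.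
have e2 : p * cos t2 + q * sin t2 = c2.
  have : S * (p * cos t2 + q * sin t2) = S * c2 by rewrite {2}SE /p /q; field; rewrite gt_eqF.
  by move/mulfI; apply; rewrite gt_eqF.
have [||||A hA] := @growth_sector (dual_point p q th) (th - t1) (th + t2).
- lra.
- by move: tp; lra.
- by rewrite dual_pointE e1.
- by rewrite dual_pointE e2.
have e0 := dual_pointE p q th 0; rewrite addr0 cos0 sin0 mulr0 addr0 mulr1 in e0.
exists A => r r0; have := hA r th r0; rewrite e0 [r * p]mulrC; apply.
by apply/andP; split; lra.
Qed.

(* Otherwise [F] times some exponential is bounded on three rays that cut the plane into
   sectors of opening less than [pi]; it is then constant, although it decays on one ray. *)
Lemma growth_opposite (th c c' : R) : (exists z, F z != 0) ->
  growth F th c -> growth F (th + pi) c' -> 0 <= c + c'.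
Proof.
move=> [z0 Fz0] gc gc'; rewrite leNgt; apply/negP => neg.
have pi0 := pi_gt0 R.
(* The sinusoid a cos x - k sin x exceeds [c] at 0 and [c'] at pi by the same margin, and equals k
   >= C at - pi / 2. *)
pose a := (c - c') / 2; pose k := `|C| + 1.
have k0 : 0 < k by rewrite ltr_wpDl.
have Ck : C <= k by rewrite (le_trans (ler_norm _))// lerDl.
have ac : 0 < a - c by rewrite /a; lra.
(* At this angle the bound interpolated between [c] at 0 and [k] at pi / 2 just meets the sinusoid:
   2 k sin t = (a - c) cos t. *)
pose t := atan ((a - c) / (2 * k)).
have tt : tan t = (a - c) / (2 * k) by rewrite atanK.
have t2 : t < pi / 2 by exact: atan_ltpi2.
have tN : - (pi / 2) < t by exact: atan_gtNpi2.
have ct : 0 < cos t by apply: cos_gt0_pihalf; rewrite tN.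
have st : sin t = (a - c) / (2 * k) * cos t by rewrite -tt /tan divfK// gt_eqF.
have st0 : 0 < sin t by rewrite st mulr_gt0// divr_gt0// mulr_gt0.
have t0 : 0 < t.
  rewrite ltNge; apply/negP => tle; move: st0; rewrite ltNge => /negP; apply.
  rewrite -[t]opprK sinN oppr_le0; move: tle; rewrite -oppr_ge0 le_eqVlt => /predU1P[<-|h].
    by rewrite sin0.
  by apply/ltW/sin_gt0_pi; rewrite h/=; lra.
have gt : growth F (th + t) (a * cos t + (- k) * sin t).
  have := @growth_convex (th + t) t (pi / 2 - t) c k t0.
  have -> : th + t + (pi / 2 - t) = th + pi / 2 by ring.
  have -> : t + (pi / 2 - t) = pi / 2 by ring.
  rewrite addrK sin_pihalf divr1 sinB cos_pihalf sin_pihalf !mul0r subr0 mul1r => h; apply: growth_le.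
    by apply: h => //; [lra|lra|exact: growth_all].
  have : 2 * k * sin t = (a - c) * cos t by rewrite st; field; rewrite gt_eqF.
  by lra.
have gpi : growth F (th + pi) (a * cos pi + (- k) * sin pi).
  by rewrite cospi sinpi; apply: (growth_le gc'); rewrite /a; lra.
have gNpi : growth F (th - pi) (a * cos (- pi) + (- k) * sin (- pi)).
  rewrite cosN sinN (@growth_cis F (th - pi) (th + pi)) ?cospi ?sinpi; last first.
    have -> : th + pi = (th - pi) + pi *+ 2 by rewrite -mulr_natl; ring.
    by rewrite [RHS]cisD cis2pi mulr1.
  by apply: (growth_le gc'); rewrite /a; lra.
have gN2 : growth F (th - pi / 2) (a * cos (- (pi / 2)) + (- k) * sin (- (pi / 2))).
  by rewrite cosN sinN cos_pihalf sin_pihalf mulr0 add0r mulrNN mulr1; exact: growth_all.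
set al := dual_point a (- k) th.
have sec (x y : R) : x < y -> y - x < pi -> growth F (th + x) (a * cos x + (- k) * sin x) ->
   growth F (th + y) (a * cos y + (- k) * sin y) ->
   exists A : R, forall z r u, z = r%:C * cis (th + u) -> 0 <= r -> x <= u <= y ->
   cabs (F z) <= A * expR (Re (al * z)).
  move=> xy yx gx gy; have [||||A hA] := @growth_sector al (th + x) (th + y).
  - by rewrite ltrD2l.
  - by lra.
  - by rewrite dual_pointE.
  - by rewrite dual_pointE.
  exists A => z r u -> r0 /andP[xu uy]; rewrite mulrCA Re_realM; apply: hA => //.
  by rewrite !lerD2l xu.
have [||||A1 h1] := sec t pi => //; [lra|lra|].
have [||||A2 h2] := sec (- pi) (- (pi / 2)) => //; [lra|lra|].
have [||||A3 h3] := sec (- (pi / 2)) t => //; [lra|].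
pose G z := F z * cexp (- (al * z)).
have GE z : cabs (G z) = cabs (F z) * expR (- Re (al * z)) by rewrite /G cabsM cabs_cexp ReN.
pose M := Num.max (Num.max A1 A2) A3.
have GM z : cabs (G z) <= M.
  have [x /andP[x1 x2] zE] := polar z th; have z1 := cabs_ge0 z.
  rewrite GE expRN ler_pdivrMr ?expR_gt0//.
  have e0 := expR_ge0 (Re (al * z)).
  have [tx|xt] := leP t x.
    apply: (le_trans (h1 _ _ _ zE z1 _)); first by rewrite tx.
    by rewrite ler_wpM2r// !le_max lexx.
  have [px|xp] := leP x (- (pi / 2)).
    apply: (le_trans (h2 _ _ _ zE z1 _)); first by rewrite x1.
    by rewrite ler_wpM2r// !le_max lexx !orbT.
  apply: (le_trans (h3 _ _ _ zE z1 _)); first by rewrite !ltW.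
  by rewrite ler_wpM2r// !le_max lexx !orbT.
have Ge : ent G.
  move=> z; apply: cdiffM; first exact: Fe.
  apply: (@cdiff_comp R (fun z => - (al * z)) (@cexp R)); last exact: cdiff_cexp.
  by apply: cdiffN; apply: cdiffM; [exact: cdiff_const|exact: cdiff_id].
have Gc := liouville Ge GM.
have G0 : G 0 != 0 by rewrite -(Gc z0) mulf_neq0// cexp_neq0.
have g0 : 0 < cabs (G 0) by rewrite cabs_gt0.
have [A hA] := gc'.
pose d := - a - c'; have d0 : 0 < d by rewrite /d /a; lra.
have bd (r : R) : 0 <= r -> cabs (G 0) * (d * r) <= A.
  move=> r0; have := hA r r0; have := Gc (r%:C * cis (th + pi)).
  move=> /(congr1 (@cabs R)); rewrite GE mulrCA Re_realM dual_pointE cospi sinpi => E h.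
  have h4 : cabs (G 0) <= A * expR (- (d * r)).
    rewrite -E; apply: (le_trans (ler_wpM2r (expR_ge0 _) h)); rewrite -mulrA -expRD.
    by rewrite le_eqVlt; apply/orP; left; apply/eqP; congr (_ * expR _); rewrite /d; ring.
  rewrite expRN ler_pdivlMr ?expR_gt0// in h4; apply: le_trans h4.
  by rewrite ler_wpM2l ?(ltW g0)// (le_trans _ (expR_ge1Dx _))// lerDr.
have r0 : 0 <= (`|A| + 1) / (cabs (G 0) * d) by apply: divr_ge0; [exact: addr_ge0|apply: mulr_ge0; exact: ltW].
have := bd _ r0; rewrite mulrA mulrC divfK ?mulf_neq0 ?gt_eqF//.
by have := ler_norm A; lra.
Qed.

End growth.

(** * The indicator as a support function *)

Section indicator.
Variable R : realType.
Variables (F : R[i] -> R[i]) (C : R).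
Hypothesis Fe : ent F.
Hypothesis FC : forall z, cabs (F z) <= C * expR (C * cabs z).
Hypothesis Fn0 : exists z, F z != 0.

Definition growth_inf (th : R) : R := inf (growth F th).

Lemma growth_has_inf th : has_inf (growth F th).
Proof.
split; first by exists C; exact: growth_all.
exists (- C) => c gc; have := growth_opposite Fe FC Fn0 gc (growth_all FC (th + pi) (lexx C)).
lra.
Qed.

Lemma growth_inf_le th c : growth F th c -> growth_inf th <= c.
Proof. by apply: ge_inf; case: (growth_has_inf th). Qed.

Lemma growth_inf_adherent th (e : R) : 0 < e -> growth F th (growth_inf th + e).
Proof.
by move=> e0; have [c gc /ltW] := inf_adherent e0 (growth_has_inf th); exact: growth_le.
Qed.

Lemma growth_inf_cis (th th' : R) : cis th = cis th' :> R[i] -> growth_inf th = growth_inf th'.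
Proof. by rewrite /growth_inf => /(growth_cis F) ->. Qed.

Lemma growth_inf_opposite th : 0 <= growth_inf th + growth_inf (th + pi).
Proof.
apply/ler_addgt0Pr => e e0; have e2 : 0 < e / 2 by rewrite divr_gt0.
have := growth_opposite Fe FC Fn0 (growth_inf_adherent th e2) (growth_inf_adherent (th + pi) e2).
lra.
Qed.

Lemma growth_inf_convex (th t1 t2 : R) : 0 < t1 -> 0 < t2 -> t1 + t2 < pi ->
  sin (t1 + t2) * growth_inf th <=
  sin t2 * growth_inf (th - t1) + sin t1 * growth_inf (th + t2).
Proof.
move=> t10 t20 tp; have S0 : 0 < sin (t1 + t2) by apply: sin_gt0_pi; rewrite tp andbT addr_gt0.
apply/ler_addgt0Pr => e e0; have e2 : 0 < e / 2 by rewrite divr_gt0.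
have := growth_convex Fe FC t10 t20 tp (growth_inf_adherent (th - t1) e2) (growth_inf_adherent (th + t2) e2).
move=> /growth_inf_le; rewrite ler_pdivlMr// mulrC.
have s1 := sin_le1 t1; have s2 := sin_le1 t2.
have := ler_wpM2r (ltW e2) s1; have := ler_wpM2r (ltW e2) s2; lra.
Qed.

(** The analogue of a supporting line of a convex function, with sinusoids for lines: slopes
    obtained from angles below [th] never exceed those from angles above, and [s] is the supremum of
    the former. *)
Lemma supporting_slope th : exists s : R, forall t : R, 0 < t -> t < pi ->
  growth_inf th * cos t + s * sin t <= growth_inf (th + t) /\
  growth_inf th * cos t - s * sin t <= growth_inf (th - t).
Proof.
set h := growth_inf th; have pi0 := pi_gt0 R.
pose lower := [set (h * cos t - growth_inf (th - t)) / sin t | t in [set t | 0 < t < pi]].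
have sp (t : R) : 0 < t -> t < pi -> 0 < sin t by move=> t0 tp; apply: sin_gt0_pi; rewrite t0.
have cross (t t' : R) : 0 < t -> t < pi -> 0 < t' -> t' < pi ->
    (h * cos t' - growth_inf (th - t')) / sin t' <= (growth_inf (th + t) - h * cos t) / sin t.
  move=> t0 tp t'0 t'p; rewrite ler_pdivrMr ?sp// mulrAC ler_pdivlMr ?sp//.
  suff : sin (t' + t) * h <= sin t * growth_inf (th - t') + sin t' * growth_inf (th + t).
    by rewrite sinD; lra.
  (* If the two angles span more than pi, convexity is used around the opposite direction th + pi,
     and [growth_inf_opposite] returns to th. At exactly pi the latter alone suffices. *)
  have [tt|tt|tt] := ltgtP (t' + t) pi.
  - exact: growth_inf_convex.
  - have := @growth_inf_convex (th + pi) (pi - t) (pi - t').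
    rewrite !subr_gt0 => /(_ tp t'p) /(_ ltac:(lra)).
    have -> : th + pi - (pi - t) = th + t by ring.
    have -> : sin (pi - t + (pi - t')) = - sin (t' + t).
      have -> : pi - t + (pi - t') = - (t' + t) + pi *+ 2 by rewrite -mulr_natl; ring.
      by rewrite [LHS]sinD cos2pi sin2pi mulr1 mulr0 addr0 sinN.
    have s1 (u : R) : sin (pi - u) = sin u by rewrite sinB sinpi cospi; ring.
    rewrite !s1 (@growth_inf_cis (th + pi + (pi - t')) (th - t')); last first.
      have -> : th + pi + (pi - t') = (th - t') + pi *+ 2 by rewrite -mulr_natl; ring.
      by rewrite cisD cis2pi mulr1.
    have sn : sin (t' + t) <= 0.
      have -> : sin (t' + t) = - sin (t' + t - pi) by rewrite sinB sinpi cospi; ring.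
      by rewrite oppr_le0 ltW// sp//; lra.
    have := growth_inf_opposite th; rewrite -/h => o.
    have : 0 <= - sin (t' + t) * (h + growth_inf (th + pi)) by rewrite mulr_ge0// oppr_ge0.
    lra.
  - have -> : t = pi - t' by rewrite -tt addrAC subrr add0r.
    have -> : sin (t' + (pi - t')) = 0 by rewrite addrC subrK sinpi.
    have -> : sin (pi - t') = sin t' by rewrite sinB sinpi cospi; ring.
    rewrite mul0r -mulrDr mulr_ge0 ?(ltW (sp _ t'0 t'p))//.
    by have := growth_inf_opposite (th - t'); rewrite addrAC -addrA.
have p1 : 0 < pi / 2 :> R by lra.
have p2 : pi / 2 < pi :> R by lra.
have Ls : has_sup lower.
  split; first by exists ((h * cos (pi / 2) - growth_inf (th - pi / 2)) / sin (pi / 2)), (pi / 2) => //; rewrite /= p1.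
  exists ((growth_inf (th + pi / 2) - h * cos (pi / 2)) / sin (pi / 2)) => _ [t /andP[t0 tp] <-].
  exact: cross.
exists (sup lower) => t t0 tp; have s0 := sp t t0 tp; split.
  have : sup lower <= (growth_inf (th + t) - h * cos t) / sin t.
    by apply: ge_sup; [exact: Ls.1|move=> _ [t' /andP[? ?] <-]; exact: cross].
  by rewrite ler_pdivlMr//; lra.
have : (h * cos t - growth_inf (th - t)) / sin t <= sup lower.
  by apply: ub_le_sup; [exact: Ls.2|exists t; [rewrite /= t0|]].
by rewrite ler_pdivrMr//; lra.
Qed.

Definition support_set : set R[i] := [set z | forall th, Re (z * cis (- th)) <= growth_inf th].

(** The supporting sinusoid at [th] is the support function of a single point, which touches the
    bound in the direction [th]. *)
Lemma support_point th : exists2 z, support_set z & Re (z * cis (- th)) = growth_inf th.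
Proof.
have [s hs] := supporting_slope th; have pi0 := pi_gt0 R.
pose z := (growth_inf th +i* s) * cis th.
have zE x : Re (z * cis (- (th + x))) = growth_inf th * cos x + s * sin x.
  by rewrite /z -mulrA -cisD opprD addrA subrr add0r ReM/= cosN sinN; ring.
exists z; last by rewrite -{1}(addr0 th) zE cos0 sin0; ring.
move=> ph; have [x /andP[x1 x2] xE] := @cis_exists R (cis (ph - th)) (cabs_cis _).
have pE : cis ph = cis (th + x) :> R[i] by rewrite cisD -xE -cisD addrC subrK.
rewrite (growth_inf_cis pE) cisN pE -cisN zE.
have op : growth_inf th * cos pi + s * sin pi <= growth_inf (th + pi).
  by rewrite cospi sinpi; have := growth_inf_opposite th; lra.
have [x0|x0|<-] := ltgtP 0 x; last by rewrite cos0 sin0 addr0; lra.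
  move: x2; rewrite le_eqVlt => /predU1P[->//|xp].
  by have [] := hs x x0 xp.
move: x1; rewrite le_eqVlt => /predU1P[<-|xp].
  rewrite cosN sinN sinpi oppr0 -sinpi (@growth_inf_cis (th - pi) (th + pi))//.
  have -> : th + pi = (th - pi) + pi *+ 2 by rewrite -mulr_natl; ring.
  by rewrite [RHS]cisD cis2pi mulr1.
have [] := hs (- x); [by rewrite oppr_gt0|lra|].
by rewrite cosN sinN !opprK mulrN opprK.
Qed.

(** The constant factor of a growth bound disappears after division by a large r. Conversely an
    upper bound beyond some radius extends to the whole ray, at the price of a constant, because F
    is bounded on discs. *)
Lemma indicator_fun_growth_inf th : indicator_fun F th = (growth_inf th)%:E.
Proof.
rewrite /indicator_fun; apply/eqP; rewrite eq_le; apply/andP; split.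
  apply/lee_addgt0Pr => e e0; have e2 : 0 < e / 2 by rewrite divr_gt0.
  have [A hA] := growth_inf_adherent th e2.
  pose A' := `|A| + 1; have A0 : 0 < A' by rewrite ltr_wpDl.
  pose M := Num.max 1 (`|ln A'| / (e / 2)).
  apply: (@le_trans _ _ (ereal_sup [set (lne (cabs (F (r%:C * cis th)))%:E * (r^-1)%:E)%E | r in [set r | M < r]])).
    apply: ereal_inf_lbound; exists [set r | M < r] => //.
    by exists M; split => //; exact: num_real.
  apply: ge_ereal_sup => _ [r /= Mr <-].
  have [r1 rA] : 1 <= r /\ `|ln A'| / (e / 2) <= r.
    by move: (ltW Mr); rewrite /M ge_max => /andP[].
  have r0 : 0 < r by lra.
  have [F0|F0] := leP (cabs (F (r%:C * cis th))) 0.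
    by rewrite gt0_mulNye ?lte_fin ?invr_gt0// leNye.
  rewrite -EFinM -EFinD lee_fin ler_pdivrMr//.
  have := hA r (ltW r0) => h.
  have {}h : cabs (F (r%:C * cis th)) <= A' * expR ((growth_inf th + e / 2) * r).
    by rewrite (le_trans h)// ler_wpM2r ?expR_ge0// (le_trans (ler_norm A))// lerDl.
  apply: (@le_trans _ _ (ln (A' * expR ((growth_inf th + e / 2) * r)))).
    by rewrite ler_ln ?posrE// mulr_gt0// expR_gt0.
  rewrite lnM ?posrE ?expR_gt0// expRK.
  move: rA; rewrite ler_pdivrMr// => rA; have := ler_norm (ln A'); lra.
apply: le_ereal_inf_tmp => _ [V [M [_ hV]] <-].
apply/lee_subgt0Pr => e e0; rewrite -EFinB leNgt; apply/negP => hsup.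
set c := growth_inf th - e in hsup; pose M1 := Num.max M 1.
have [B B0 hB] := ent_bounded M1 Fe.
have M10 : 0 < M1 by rewrite lt_max ltr01 orbT.
suff /growth_inf_le : growth F th c by rewrite /c; lra.
exists (B * expR (`|c| * M1) + 1) => r r0.
have BB : 0 <= B * expR (`|c| * M1) by rewrite mulr_ge0 ?expR_ge0// ltW.
have [rM|rM] := leP r M1.
  apply: (@le_trans _ _ (B * expR (`|c| * M1) * expR (c * r))); last first.
    by rewrite ler_wpM2r ?expR_ge0// lerDl.
  rewrite -mulrA -expRD (le_trans (hB _ _)) ?cabs_circle// ler_peMr ?(ltW B0)//.
  rewrite -expR0 ler_expR; have := ler_norm (- c); rewrite normrN => nc.
  have := ler_wpM2r r0 nc; have := ler_wpM2l (normr_ge0 c) rM; lra.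
apply: (@le_trans _ _ (1 * expR (c * r))); last by rewrite ler_wpM2r ?expR_ge0// lerDr.
have rp : 0 < r by exact: lt_trans rM.
rewrite mul1r; have [F0|F0] := leP (cabs (F (r%:C * cis th))) 0.
  by rewrite (le_trans F0)// expR_ge0.
have Vr : V r by apply: hV; apply: le_lt_trans rM; rewrite le_max lexx.
have : ((lne (cabs (F (r%:C * cis th)))%:E * (r^-1)%:E)%E <= c%:E)%E.
  by apply: le_trans (ltW hsup); apply: ereal_sup_ubound; exists r.
rewrite lne_EFin// -EFinM lee_fin ler_pdivrMr// => h.
by rewrite -[leLHS]lnK ?posrE// ler_expR.
Qed.

Lemma convex_support_set : convex_set (support_set : set (convex_lmodType R[i]^o)).
Proof.
move=> z w l /set_mem hz /set_mem hw; apply/mem_set => th.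
change (Re ((l%:num * (z : R[i]) + (1 - l%:num) * (w : R[i])) * cis (- th)) <= growth_inf th).
have : 0 <= l%:num :> R[i] by exact: ge0.
have : l%:num <= 1 :> R[i] by exact: le1.
(* Comparability with 1 in the order of [R[i]] forces the coefficient to be real. *)
case: (l%:num) => x y; rewrite !lecE/= => /andP[/eqP y0 x1] /andP[_ x0].
have -> : (x +i* y : R[i]) = x%:C by rewrite -y0.
rewrite -(rmorphB (real_complex R) 1 x) mulrDl -!mulrA ReD !Re_realM.
have := ler_wpM2l x0 (hz th); have : 0 <= 1 - x by rewrite subr_ge0.
by move=> /ler_wpM2l/(_ _ _ (hw th)); lra.
Qed.

Lemma compact_support_set : compact (support_set : set R[i]^o).
Proof.
pose f (q : R * R) : R[i]^o := q.1 +i* q.2.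
have fc : continuous f.
  move=> q; apply/cvgrPdist_le => /= e e0.
  have eE : e = (Re e)%:C by rewrite RRe_real// gtr0_real.
  have e1 : 0 < Re e by move: e0; rewrite eE ltcR.
  exists (ball q.1 (Re e / 2), ball q.2 (Re e / 2)).
    by split; apply: nbhsx_ballx; rewrite divr_gt0.
  case=> x y [/=]; rewrite -!ball_normE/= => h1 h2.
  rewrite eE normcE' lecR; apply: (le_trans (cabs_le_sum _)) => /=.
  by move: h1 h2; clear; lra.
(* The four axis directions enclose the set in a square. *)
pose r := Num.max (Num.max (growth_inf 0) (growth_inf pi)) (Num.max (growth_inf (pi / 2)) (growth_inf (- (pi / 2)))).
have cI : compact (f @` (`[- r, r] `*` `[- r, r])).
  apply: continuous_compact; first exact: continuous_subspaceT.
  by apply: compact_setX; exact: segment_compact.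
apply: (subclosed_compact _ cI).
  move=> z hz th; rewrite leNgt; apply/negP => h.
  set d := Re (z * cis (- th)) - growth_inf th.
  have d0 : 0 < d by rewrite subr_gt0.
  have d0' : 0 < d%:C by rewrite ltcR.
  have [w [hw]] := hz _ (nbhsx_ballx z _ d0'); rewrite -ball_normE/= normcE' ltcR => wz.
  have := hw th; have := Re_le_cabs ((z - w) * cis (- th)); rewrite cabsM cabs_cis mulr1.
  rewrite mulrBl ReD ReN => h1; have := ler_norm (Re (z * cis (- th)) - Re (w * cis (- th))).
  by rewrite /d in wz; lra.
move=> z hz; exists (Re z, Im z); last by case: (z).
have h0 := hz 0; have h1 := hz pi; have h2 := hz (pi / 2); have h3 := hz (- (pi / 2)).
rewrite ReM /= ?(oppr0, cosN, sinN, cos0, sin0, cospi, sinpi, cos_pihalf, sin_pihalf, opprK) in h0.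
rewrite ReM /= ?(oppr0, cosN, sinN, cos0, sin0, cospi, sinpi, cos_pihalf, sin_pihalf, opprK) in h1.
rewrite ReM /= ?(oppr0, cosN, sinN, cos0, sin0, cospi, sinpi, cos_pihalf, sin_pihalf, opprK) in h2.
rewrite ReM /= ?(oppr0, cosN, sinN, cos0, sin0, cospi, sinpi, cos_pihalf, sin_pihalf, opprK) in h3.
have [r1 r2 r3 r4] : [/\ growth_inf 0 <= r, growth_inf pi <= r, growth_inf (pi / 2) <= r & growth_inf (- (pi / 2)) <= r].
  by rewrite /r; split; rewrite !le_max lexx ?orbT.
by split; rewrite /= in_itv/=; apply/andP; split; lra.
Qed.

Theorem indicator_diagram : is_indicator_diagram F support_set.
Proof.
split; [exact: convex_support_set|exact: compact_support_set|] => th.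
rewrite indicator_fun_growth_inf; split; last by move=> z hz; rewrite lee_fin.
by have [z hz zE] := support_point th; exists z => //; rewrite zE.
Qed.

End indicator.

Section exponential_type.
Variable R : realType.
Implicit Types (f g : R[i] -> R[i]).

Lemma exponential_typeP f : exponential_type f ->
  exists2 C : R, 0 <= C & forall z, cabs (f z) <= C * expR (C * cabs z).
Proof.
move=> [C hC]; exists `|C| => // z; apply: (le_trans (hC z)).
apply: (@le_trans _ _ (`|C| * expR (C * cabs z))).
  by rewrite ler_wpM2r ?expR_ge0// ler_norm.
by rewrite ler_wpM2l// ler_expR ler_wpM2r ?cabs_ge0// ler_norm.
Qed.

Lemma exponential_typeM f g : exponential_type f -> exponential_type g -> exponential_type (f \* g).
Proof.
move=> /exponential_typeP[C C0 hC] /exponential_typeP[D D0 hD]; exists (C * D + (C + D)) => z /=.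
have CD : 0 <= C * D by rewrite mulr_ge0.
rewrite cabsM; apply: (le_trans (ler_pM (cabs_ge0 _) (cabs_ge0 _) (hC z) (hD z))).
rewrite mulrACA -expRD -mulrDl; apply: ler_pM; rewrite ?expR_ge0//.
  by rewrite lerDl addr_ge0.
by rewrite ler_expR ler_wpM2r ?cabs_ge0// lerDr.
Qed.

Lemma exponential_type_divX f f1 n : ent f1 -> (forall z, f z = z ^+ n * f1 z) ->
  exponential_type f -> exponential_type f1.
Proof.
move=> f1e fE /exponential_typeP[C C0 hC]; have [M M0 hM] := ent_bounded 1 f1e.
exists (C + M) => z; have z0 := cabs_ge0 z; have CM : 0 <= C + M by rewrite addr_ge0// ltW.
have [z1|z1] := leP (cabs z) 1.
  rewrite (le_trans (hM z z1))//; apply: (@le_trans _ _ (C + M)); first by rewrite lerDr.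
  by rewrite ler_peMr// -[leLHS]expR0 ler_expR mulr_ge0.
have : cabs (f1 z) <= cabs (f z).
  by rewrite fE cabsM cabsX ler_peMl ?cabs_ge0// exprn_ege1// ltW.
move=> /le_trans; apply; apply: (le_trans (hC z)); apply: ler_pM; rewrite ?expR_ge0//.
  by rewrite lerDl ltW.
by rewrite ler_expR ler_wpM2r// lerDl ltW.
Qed.

(** The n-th power of r <= (n + 1) / e * exp(e r / (n + 1)); using n + 1 includes n = 0. *)
Lemma power_le_exp (n : nat) (e : R) : 0 < e ->
  exists2 K : R, 0 <= K & forall r, 0 <= r -> r ^+ n <= K * expR (e * r).
Proof.
move=> e0; have m0 : 0 < n.+1%:R :> R by rewrite ltr0n.
have k0 : 0 <= n.+1%:R / e by rewrite divr_ge0// ltW.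
exists ((n.+1%:R / e) ^+ n) => [|r r0]; first exact: exprn_ge0.
have h : r <= n.+1%:R / e * expR (e * r / n.+1%:R).
  rewrite -ler_pdivrMl ?divr_gt0// invf_div mulrAC.
  by rewrite (le_trans _ (expR_ge1Dx _))// lerDr.
apply: (@le_trans _ _ ((n.+1%:R / e * expR (e * r / n.+1%:R)) ^+ n)).
  by rewrite lerXn2r ?nnegrE ?(le_trans r0).
rewrite exprMn ler_wpM2l ?exprn_ge0// -expRM_natl ler_expR mulrCA ler_piMr ?mulr_ge0 ?(ltW e0)//.
by rewrite ler_pdivrMr// mul1r ler_nat.
Qed.

End exponential_type.

Theorem mainTheorem6 (R : realType) (f : R[i] -> R[i]) :
  entire f -> not_identically_zero f -> exponential_type f -> class_A f ->
  forall eps : R, 0 < eps ->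
  exists g : R[i] -> R[i],
    [/\ entire g, not_identically_zero g, exponential_type g
      & only_real_zeros g] /\
    [/\ entire (f \* g), exponential_type (f \* g)
      & exists K : set R[i], is_indicator_diagram (f \* g) K /\
          exists c w : R, 0 <= w <= eps /\ K `<=` vertical_strip c w].
Proof.
move=> /entireP fe fn0 fexp fA eps eps0.
(* The product formula needs a nonzero value at 0; the factor z^n costs only a power of |x| on the
   real axis. *)
have [n [f1 [f1e f10 fE']]] := ent_order 0 fe fn0.
have fE z : f z = z ^+ n * f1 z by rewrite fE' subr0.
have fI : im_inv_bounded f1.
  (* A list of zeros of [f1] is one of [f] with z^n moved into the cofactor, so the bound carries
     over without comparing multiplicities. *)
  have [S hS] := class_A_im_inv_bounded fe fn0 fA; exists S => L p [pe pE] L0.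
  apply: (hS L (fun z => z ^+ n * p z)) => //; split=> [z|z]; last by rewrite fE pE mulrCA.
  by apply: cdiffM; [apply: cdiffX; exact: cdiff_id|exact: pe].
(* One quarter for the bound on the real axis and one for the power z^n: the excess is eps / 2 in
   each of the two real directions. *)
have e4 : 0 < eps / 4 by rewrite divr_gt0.
have [g [ge g0 gexp gr [b [A hA]]]] :=
  real_axis_bound f1e f10 (exponential_type_divX f1e fE fexp) fI e4.
have Fexp := exponential_typeM fexp gexp.
have Fe : ent (f \* g) by move=> z; exact: cdiffM (fe z) (ge z).
have Fn0 : exists z, (f \* g) z != 0.
  apply: contrapT => no; have /eqP := f10; apply.
  suff : f1 0 * g 0 = 0 by move/eqP; rewrite mulf_eq0 (negPf g0) orbF => /eqP.
  apply: (@ent_zero_at R (fun z => f1 z * g z)) => z.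
    exact: cdiffM (f1e z) (ge z).
  move=> z0; apply/eqP/negPn/negP => h; apply: no; exists z.
  by rewrite /= fE -mulrA mulf_neq0// expf_neq0.
have [K K0 hK] := power_le_exp n e4.
have Fx (x : R) : cabs ((f \* g) x%:C) <= K * A * expR (b * x + eps / 2 * `|x|).
  rewrite /= fE -mulrA cabsM cabsX cabs_real.
  apply: (le_trans (ler_pM (exprn_ge0 _ (normr_ge0 x)) (cabs_ge0 _) (hK _ (normr_ge0 x)) (hA x))).
  rewrite mulrACA -expRD le_eqVlt; apply/orP; left; apply/eqP; congr (_ * expR _).
  by field.
have grow0 : growth (f \* g) 0 (b + eps / 2).
  by exists (K * A) => r r0; rewrite cis0 mulr1 (le_trans (Fx r))// ger0_norm// mulrDl.
have growpi : growth (f \* g) pi (- b + eps / 2).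
  exists (K * A) => r r0; have -> : r%:C * cis pi = (- r)%:C.
    by apply: complex_ext; rewrite /= cospi sinpi; ring.
  by rewrite (le_trans (Fx _))// normrN ger0_norm// mulrN mulrDl mulNr.
have [C FC] := Fexp.
exists g; split; first by split=> //; [exact/entireP|exists 0].
split=> //; first exact/entireP.
exists (support_set (f \* g)); split; first exact: indicator_diagram Fe FC Fn0.
(* The directions 0 and pi give Re z <= b + eps / 2 and - Re z <= - b + eps / 2 on the diagram. *)
exists (b - eps / 2), eps; split; first by rewrite lexx ltW.
move=> z hz; have := hz 0; have := hz pi.
rewrite !ReM /= oppr0 cosN sinN cos0 sin0 cospi sinpi => h1 h2.
have := growth_inf_le Fe FC Fn0 grow0; have := growth_inf_le Fe FC Fn0 growpi.
by rewrite /vertical_strip/= => h3 h4; apply/andP; split; lra.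
Qed.
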